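(* Let $\Omega\subset\mathbb{R}^2$ be a convex polygonal domain, let $(\mathcal{T}_h)_{0<h\le h_0}$ be a regular family of admissible triangulations of $\Omega$, and let $A\in L^\infty(\Omega;\mathcal{M}_2(\mathbb{R}))$ be uniformly elliptic, i.e. there is $c>0$ with $A(x)\xi\cdot\xi\ge c|\xi|^2$ for a.e. $x\in\Omega$ and all $\xi\in\mathbb{R}^2$. Then there exist $\varepsilon>0$ and $C>0$ such that for all $p\in(2,2+\varepsilon)$ and all $f\in W^{-1,p}(\Omega)$ the following hold. Let $u\in W^{1,2}_0(\Omega)$ be the unique weak solution of $\mathrm{div}(A\nabla u)=f$, and for each $h$ let $u_h\in V^1_0(\mathcal{T}_h)$ be the Galerkin solution, i.e. the unique element of $V^1_0(\mathcal{T}_h)$ with $$\int_\Omega A(x)\nabla u_h(x)\cdot\nabla v(x)\,dx=-\langle f,v\rangle\qquad\text{for all } v\in V^1_0(\mathcal{T}_h).$$ Then $u_h\in W^{1,p}(\Omega)$ and, for all $h$, $$\|u_h\|_{W^{1,p}(\Omega)}\le C\|f\|_{W^{-1,p}(\Omega)}.$$ Moreover, $$\lim_{h\to0}\|u_h-u\|_{W^{1,p}(\Omega)}=0.$$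
   Context: A triangulation of the polygonal domain $\Omega$ is a finite family $\mathcal{T}$ of closed triangles with $\overline\Omega=\bigcup_{T\in\mathcal{T}}T$. It is admissible if for all distinct $T,T'\in\mathcal{T}$ the set $T\cap T'$ is empty, or a vertex, or a common side. For a triangle $T$, $h_T$ is its diameter and $\rho_T$ is the diameter of the largest ball included in $T$. The family $(\mathcal{T}_h)_{0<h\le h_0}$ consists of admissible triangulations of $\Omega$ with $\sup_{T\in\mathcal{T}_h}h_T=h$; it is regular if there exists $\sigma>0$ with $h_T/\rho_T\le\sigma$ for all $T\in\mathcal{T}_h$ and all $h$. $V^1(\mathcal{T})$ is the space of continuous functions on $\overline\Omega$ whose restriction to each $T\in\mathcal{T}$ is a polynomial of degree at most $1$, and $V^1_0(\mathcal{T})$ is the subspace of those vanishing on $\partial\Omega$; $V^1_0(\mathcal{T})\subset W^{1,2}_0(\Omega)$. $W^{-1,p}(\Omega)$ is the dual of $W^{1,p'}_0(\Omega)$, $\frac1p+\frac1{p'}=1$. The weak solution $u\in W^{1,2}_0(\Omega)$ of $\mathrm{div}(A\nabla u)=f$ is characterised by $\int_\Omega A\nabla u\cdot\nabla\varphi\,dx=-\langle f,\varphi\rangle$ for all $\varphi\in C_c^\infty(\Omega)$. *)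

(* Defs.v *)
(* The plane is R * R with R : realType, carrying the
   product of the library's Lebesgue measure with itself (on Borel sets). *)
From HB Require Import structures.
From mathcomp Require Import all_boot all_order all_algebra.
From mathcomp Require Import all_classical all_reals all_analysis.

Set Implicit Arguments.
Unset Strict Implicit.
Unset Printing Implicit Defensive.
Import Order.TTheory GRing.Theory Num.Theory numFieldNormedType.Exports.

Local Open Scope classical_set_scope.
Local Open Scope ring_scope.

Notation leb2 R := (@lebesgue_measure R \x @lebesgue_measure R)%E.

Section geometry.
Context {R : realType}.
Implicit Types (a b c x y : R * R) (Om S T : set (R * R)).

(* The norm that the library puts on R * R is the maximum norm; lengths below
   are Euclidean. *)
Definition edist x y : R :=
  Num.sqrt ((x.1 - y.1) ^+ 2 + (x.2 - y.2) ^+ 2).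

Definition segment a b : set (R * R) :=
  [set x | exists t : R, [/\ 0 <= t, t <= 1 & x = (1 - t) *: a + t *: b]].

Definition triangle a b c : set (R * R) :=
  [set x | exists r s t : R, [/\ 0 <= r, 0 <= s, 0 <= t, r + s + t = 1 &
    x = r *: a + s *: b + t *: c]].

Definition nondegenerate a b c : bool :=
  (b.1 - a.1) * (c.2 - a.2) != (b.2 - a.2) * (c.1 - a.1).

(* Triangles are point sets; vertices and sides are recovered from the set,
   which determines them. *)
Definition is_triangle T :=
  exists a b c, nondegenerate a b c /\ T = triangle a b c.

Definition is_vertex T a :=
  exists b c, nondegenerate a b c /\ T = triangle a b c.

Definition is_side T S :=
  exists a b c, [/\ nondegenerate a b c, T = triangle a b c & S = segment a b].

Definition diam T : R := sup [set edist x y | x in T & y in T].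

Definition inball_diam T : R :=
  sup [set 2 * r | r in [set r | 0 <= r /\
    exists x, [set y | edist x y <= r] `<=` T]].

Definition boundary Om : set (R * R) := closure Om `\` Om°.

Definition polygonal_domain Om :=
  [/\ open Om, Om !=set0, connected Om, bounded_set Om &
      exists s : seq ((R * R) * (R * R)),
        boundary Om = \bigcup_(ab in [set` s]) segment ab.1 ab.2].

Definition triangulation Om (Th : set (set (R * R))) :=
  [/\ finite_set Th, forall T, Th T -> is_triangle T &
      closure Om = \bigcup_(T in Th) T].

Definition admissible (Th : set (set (R * R))) :=
  forall T T', Th T -> Th T' -> T <> T' ->
    [\/ T `&` T' = set0,
        exists x, [/\ is_vertex T x, is_vertex T' x & T `&` T' = [set x]] |
        is_side T (T `&` T') /\ is_side T' (T `&` T')].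

Definition regular_family Om (h0 : R) (Th : R -> set (set (R * R))) :=
  (forall h, 0 < h <= h0 ->
     [/\ triangulation Om (Th h), admissible (Th h) &
         sup [set diam T | T in Th h] = h]) /\
  (exists2 sigma : R, 0 < sigma &
     forall h, 0 < h <= h0 -> forall T, Th h T ->
       diam T / inball_diam T <= sigma).

End geometry.

(* Elements of function spaces on Om are functions on the plane of which only
   the values on Om matter; they are not quotiented by equality a.e. *)
Section sobolev.
Context {R : realType}.
Local Notation mu := (leb2 R).
Implicit Types (Om : set (R * R)) (u v w g phi : R * R -> R) (p q : \bar R).

Definition Lp Om p u := (u \_ Om) \in Lfun mu p.

Definition Lp_norm Om p u : \bar R := ('N[mu]_p[EFin \o (u \_ Om)])%E.

Definition basis (i : 'I_2) : R * R := if i == 0 then (1, 0) else (0, 1).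

Definition partial (i : 'I_2) phi : R * R -> R := 'D_(basis i) phi.

(* Differentiability of all iterated directional derivatives is C^infinity
   regularity: it makes each of them continuous. *)
Definition smooth phi :=
  forall (s : seq (R * R)) (x : R * R),
    differentiable (foldr (fun e psi => 'D_e psi) phi s) x.

Definition test_function Om phi :=
  [/\ smooth phi, compact (closure [set x | phi x != 0]) &
      closure [set x | phi x != 0] `<=` Om].

Definition loc_integrable Om u :=
  measurable_fun Om u /\
  forall K, compact K -> K `<=` Om -> mu.-integrable K (EFin \o u).

Definition weak_partial_of Om (i : 'I_2) u g :=
  [/\ loc_integrable Om u, loc_integrable Om g &
      forall phi, test_function Om phi ->
        \int[mu]_(x in Om) (u x * partial i phi x) =
        - \int[mu]_(x in Om) (g x * phi x)].

(* Any choice will do, as two weak derivatives of u agree a.e. on Om; the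
   default 0 is used only when u has none. *)
Definition weak_partial Om (i : 'I_2) u : R * R -> R :=
  xget (cst 0) [set g | weak_partial_of Om i u g].

Definition W1 Om p u :=
  Lp Om p u /\ forall i, exists2 g, weak_partial_of Om i u g & Lp Om p g.

Definition W1_norm Om p u : \bar R :=
  (Lp_norm Om p u + \sum_(i < 2) Lp_norm Om p (weak_partial Om i u))%E.

Definition W1_0 Om p u :=
  W1 Om p u /\
  forall e : R, 0 < e -> exists2 phi, test_function Om phi &
    (W1_norm Om p (u \- phi)%R < e%:E)%E.

(* Norm of a functional on W^{1,q}_0, where q is the exponent conjugate
   to p. *)
Definition dual_norm Om p (f : (R * R -> R) -> R) : \bar R :=
  let q := hoelder_conjugate p in
  ereal_sup [set (`|f v|)%:E | v in
    [set v | W1_0 Om q v /\ (W1_norm Om q v <= 1)%E]].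

(* Linearity and boundedness make f insensitive to changes of its argument on
   a null set and outside Om. *)
Definition Wm1 Om p (f : (R * R -> R) -> R) :=
  let q := hoelder_conjugate p in
  (forall (k : R) v w, W1_0 Om q v -> W1_0 Om q w ->
     f (fun x => k * v x + w x) = k * f v + f w) /\
  (dual_norm Om p f < +oo)%E.

End sobolev.

Section elliptic.
Context {R : realType}.
Local Notation mu := (leb2 R).
Implicit Types (Om : set (R * R)) (A : R * R -> 'M[R]_2)
  (u v phi : R * R -> R) (f : (R * R -> R) -> R).

Definition dot (xi eta : 'cV[R]_2) : R := \sum_(i < 2) xi i 0 * eta i 0.

Definition grad phi (x : R * R) : 'cV[R]_2 := \col_i partial i phi x.

Definition weak_grad Om u (x : R * R) : 'cV[R]_2 :=
  \col_i weak_partial Om i u x.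

Definition Linfty_mx Om A := forall i j, Lp Om +oo%E (fun x => A x i j).

Definition uniformly_elliptic Om A :=
  exists2 c : R, 0 < c &
    {ae mu, forall x, Om x ->
      forall xi : 'cV[R]_2, c * dot xi xi <= dot (A x *m xi) xi}.

Definition weak_solution Om A f u :=
  W1_0 Om 2%:E u /\
  forall phi, test_function Om phi ->
    \int[mu]_(x in Om) dot (A x *m weak_grad Om u x) (grad phi x) = - f phi.

Definition V1 Om (Th : set (set (R * R))) v :=
  {within closure Om, continuous v} /\
  forall T, Th T -> exists a b c : R,
    forall x, T x -> v x = a + b * x.1 + c * x.2.

Definition V1_0 Om (Th : set (set (R * R))) v :=
  V1 Om Th v /\ forall x, boundary Om x -> v x = 0.

Definition galerkin_solution Om (Th : set (set (R * R))) A f u :=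
  V1_0 Om Th u /\
  forall v, V1_0 Om Th v ->
    \int[mu]_(x in Om) dot (A x *m weak_grad Om u x) (weak_grad Om v x) = - f v.

End elliptic.

(* Main.v *)
(* A discrete Meyers estimate, by Lipschitz truncation instead of elliptic regularity.

   Let [w] be the Galerkin solution, extended by 0 outside the convex domain,
   and let [M] be the sum of its horizontal and vertical maximal difference
   quotients; the one-dimensional maximal inequality and Tonelli bound the
   L^p norm of [M] by that of [grad w]. Given a level [l], keep [w] at the nodes
   all of whose triangles carry [M <= l] and at the boundary nodes, extend it by
   McShane's formula and interpolate: this gives a discrete function [w_l] with
   gradient at most [C l], equal to [w] on the triangles where the maximum [Ma]
   of [M] over neighbouring triangles is at most [l]. Here regularity enters: it
   bounds the number and the size ratios of the triangles around a node.
   With [p = 2 + d] and levels [l_k = 2^-k L], the test function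
   [beta w + sum_k (2^d - 1) l_k^d (w - w_{l_k})] has a gradient that is
   comparable to [|Ma|^d grad w] up to [O(d) Ma^(1+d)] and is bounded by
   [C Ma^(1+d)]. For small [d], testing with it bounds [grad w] in L^p by [f].

   Any functions of W^{1,p}_0 bounded in this way and asymptotically solving
   the equation produce a solution [u] in W^{1,p}_0, by convexity and Clarkson's
   inequality. The estimate, applied to [u_h] minus the nodal interpolant of a
   test function close to [u], is Cea's lemma in W^{1,p} and gives convergence.
   Discrete functions lie in W^{1,q}_0 because, once dilated towards an interior
   point, they are limits of smooth quasi-interpolants that reproduce affine
   functions. *)

Require Import Defs.
From HB Require Import structures.
From mathcomp Require Import all_boot all_order all_algebra.
From mathcomp Require Import all_classical all_reals all_analysis.
From mathcomp Require Import measurable_realfun.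
From mathcomp Require Import ring lra.
Import Order.TTheory GRing.Theory Num.Theory numFieldNormedType.Exports.
Local Open Scope classical_set_scope.
Local Open Scope ring_scope.

Set Implicit Arguments.
Unset Strict Implicit.
Unset Printing Implicit Defensive.

(** * The plane and its Lebesgue measure *)

(** Meyers' estimate amounts to testing the equation with a field of size [|grad w|^(1+d)] directed
    along [grad w]. In general no discrete function has such a gradient, whereas differences of [w]
    and its truncations are discrete. The gradient of the test function lies in L^q with
    [q = (2 + d) / (1 + d)], conjugate to [p = 2 + d], so that a functional in W^{-1,p} may act on
    it. The levels carry the weights [2^d - 1 <= 2 d], so the terms without a sign are of order [d];
    ellipticity absorbs them once [d] is below a bound that involves only the ellipticity constant,
    the bound of [A] and the regularity of the meshes. This fixes [eps]. Convexity enters whenever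
    two points are joined by a segment: bounds on the gradients of the triangles become Lipschitz
    bounds, the triangles at a node are linked through edges, and a point close to the complement
    leaves the domain along an axis. Sobolev functions are carried together with a representative of
    their gradient, since [weak_partial] is an arbitrary choice and does not commute with sums. *)

Notation plane R := (measurableTypeR R * measurableTypeR R)%type.

(* An opaque copy of [leb2 R]: unification must not unfold the product measure. *)
Definition lam {R : realType} : {measure set (plane R) -> \bar R} :=
  (@lebesgue_measure R \x @lebesgue_measure R)%E.

Section plane_measure.
Context {R : realType}.
Notation mu := (leb2 R).
Implicit Types (x y z : R * R) (f g : R * R -> R).
Notation measurable2 := (@measurable _ (plane R)).
Notation measurable_fun2 := (@measurable_fun _ _ (plane R) R).

Lemma ball_prodE x (e : R) : ball x e = ball x.1 e `*` ball x.2 e.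
Proof. by []. Qed.

(** The sigma-algebra of the product is generated by rectangles. Balls of the maximum norm are
    rectangles, and those with rational centre and radius [1 / (n + 1)] that fit into [U] are
    countably many and cover it. *)
Lemma open_measurable2 (U : set (R * R)) : open U -> measurable2 U.
Proof.
move=> oU.
pose F (q : (rat * rat) * nat) : set (R * R) :=
  let B := ball (ratr q.1.1 : R, ratr q.1.2 : R) (q.2.+1%:R^-1 : R) in
  if `[< B `<=` U >] then B else set0.
have -> : U = \bigcup_q F q.
  apply/seteqP; split => [x Ux|x [q _]]; last first.
    by rewrite /F; case: asboolP => // BU /BU.
  have /nbhs_ballP [e /= e0 eU] := open_nbhs_nbhs (conj oU Ux).
  have [n _ ne] : exists2 n, True & n.+1%:R^-1 < e / 2.
    have [n] := near_infty_natSinv_lt (PosNum (divr_gt0 e0 (ltr0n R 2))).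
    by move=> _ /(_ n (leqnn n)) ?; exists n.
  have d0 : 0 < n.+1%:R^-1 :> R by rewrite invr_gt0.
  have rat_ball (a : R) : exists q : rat, ball a (n.+1%:R^-1) (ratr q : R).
    have := @dense_rat R (ball a (n.+1%:R^-1)) .
    case; [by exists a; exact: ballxx|exact: ball_open|].
    by move=> ? [? [q _ ?]]; exists q; subst.
  have [q1 h1] := rat_ball x.1; have [q2 h2] := rat_ball x.2.
  exists ((q1, q2), n) => //; rewrite /F /=; case: asboolP => [_|].
    by split => /=; apply: ball_sym.
  case=> y [/= y1 y2]; apply: eU; rewrite [e]splitr; split => /=.
  - apply: (le_ball (e1 := n.+1%:R^-1 + n.+1%:R^-1)); first by rewrite lerD// ltW.
    exact: ball_triangle h1 y1.
  - apply: (le_ball (e1 := n.+1%:R^-1 + n.+1%:R^-1)); first by rewrite lerD// ltW.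
    exact: ball_triangle h2 y2.
apply: countable_bigcupT_measurable => // q; rewrite /F; case: ifP => // _.
by rewrite ball_prodE; apply: measurableX; exact: measurable_ball.
Qed.

Lemma closed_measurable2 (U : set (R * R)) : closed U -> measurable2 U.
Proof.
by move=> cU; rewrite -[U]setCK; apply: measurableC; apply: open_measurable2; exact: closed_openC.
Qed.

Lemma continuous_measurable2 f : continuous f -> measurable_fun2 setT f.
Proof.
move=> cf; apply: (measurability _ (measurable_realfun.RGenOpens.measurableE R)).
move=> _ [_ [a [b ->] <-]]; rewrite setTI; apply: open_measurable2.
by apply: open_comp; [move=> + _; exact: cf|exact: interval_open].
Qed.

Lemma mu_rect (A B : set R) : measurable A -> measurable B ->
  mu (A `*` B) = (lebesgue_measure A * lebesgue_measure B)%E.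
Proof. by move=> mA mB; rewrite product_measure1E. Qed.

Lemma mu_ball x (r : R) : 0 <= r -> mu (ball x r) = ((2 * r) ^+ 2)%:E.
Proof.
move=> r0; rewrite ball_prodE mu_rect; [|exact: measurable_ball..].
rewrite !lebesgue_measure_ball// -EFinM; congr EFin; rewrite expr2 mulr_natl.
by rewrite mulr2n.
Qed.

Lemma lebesgue_measure_shift (a : R) (A : set R) : measurable A ->
  pushforward lebesgue_measure (fun x : R => x + a : measurableTypeR R) A
    = lebesgue_measure A.
Proof.
move=> mA.
have mf : measurable_fun setT (fun x : R => x + a : measurableTypeR R).
  exact: measurable_funD.
apply/esym.
apply: (@lebesgue_measure_unique R (pushforward lebesgue_measure (fun x : R => x + a : measurableTypeR R))) => //.
move=> X [[x y] _ <-] /=.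
rewrite /pushforward.
have -> : (fun z : R => z + a) @^-1` `]x, y] = `]x - a, y - a]%classic.
  by apply/seteqP; split => z /=; rewrite !in_itv/= ltrBlDr lerBrDr.
rewrite !lebesgue_measure_itv/= !lte_fin ltrD2r; case: ifP => // _.
by rewrite -!EFinB; congr EFin; ring.
Qed.

Lemma mu_shift (v : R * R) (A : set (R * R)) : measurable2 A ->
  pushforward mu (fun x : R * R => x + v : measurableTypeR R * measurableTypeR R) A = mu A.
Proof.
move=> mA.
have mf : measurable_fun setT (fun x : R * R => x + v : measurableTypeR R * measurableTypeR R).
  apply/measurable_fun_pairP; split => /=.
    by apply: measurable_funD => //; exact: measurable_fst.
  by apply: measurable_funD => //; exact: measurable_snd.
apply/esym.
apply: (@product_measure_unique _ _ _ _ R lebesgue_measure lebesgue_measure (pushforward mu (fun x : R * R => x + v : measurableTypeR R * measurableTypeR R))) => //.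
move=> C D mC mD; rewrite /= /pushforward.
have -> : (fun x : R * R => x + v) @^-1` (C `*` D) =
  ((fun z : R => z + v.1) @^-1` C) `*` ((fun z : R => z + v.2) @^-1` D).
  by apply/seteqP; split => z.
rewrite mu_rect.
- by congr (_ * _)%E; [exact: (lebesgue_measure_shift v.1)|exact: (lebesgue_measure_shift v.2)].
- by rewrite -[X in measurable X]setTI; exact: measurable_funD.
- by rewrite -[X in measurable X]setTI; exact: measurable_funD.
Qed.

(** For [b = 0] the line is a product with a singleton factor; otherwise its sections at fixed first
    coordinate are single points. *)
Lemma negligible_line (a b c : R) : (a != 0) || (b != 0) ->
  mu.-negligible [set x : R * R | a * x.1 + b * x.2 = c].
Proof.
move=> ab; set L := [set x | _].
have mL : measurable2 L.
  have cf : continuous (fun x : R * R => a * x.1 + b * x.2).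
    move=> x; apply: cvgD; apply: cvgM; try exact: cvg_cst.
      exact: cvg_fst.
    exact: cvg_snd.
  by apply: closed_measurable2; apply: (closed_comp (f := fun x : R * R => a * x.1 + b * x.2) (D := [set c])) => [x _|]; [exact: cf|exact: closed_eq].
apply/negligibleP => //.
have [b0|b0] := eqVneq b 0.
  have a0 : a != 0 by move: ab; rewrite b0 eqxx orbF.
  have -> : L = [set c / a] `*` setT.
    apply/seteqP; split => [x|[x1 x2] [/= -> _]]; rewrite /L /= b0 mul0r addr0; last by rewrite mulrC divfK.
    by move=> <-; split => //=; rewrite mulrC mulKf.
  apply: (eq_trans (mu_rect (A := [set c / a]) (B := setT) _ _)) => //.
  by rewrite lebesgue_measure_set1 mul0e.
rewrite /= /product_measure1 integral0_eq// => x _ /=.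
have -> : xsection L x = [set (c - a * x) / b].
  apply/seteqP; split => y; rewrite /xsection /= inE /L /=.
    by move=> <-; rewrite addrC addKr mulrC mulKf.
  by move=> ->; rewrite [b * _]mulrC divfK// addrC subrK.
exact: lebesgue_measure_set1.
Qed.

(** The restatements from here on, proved while [lam] still unfolds, carry facts from [leb2 R] to
    its opaque copy. *)
Lemma lam_integral (D : set (plane R)) (f : plane R -> \bar R) :
  (\int[mu]_(x in D) f x = \int[lam]_(x in D) f x)%E.
Proof. by []. Qed.

Lemma lam_integrable (D : set (plane R)) (f : plane R -> \bar R) :
  mu.-integrable D f = lam.-integrable D f.
Proof. by []. Qed.

Lemma lam_ae (P : set (plane R)) : {ae mu, forall x, P x} = {ae lam, forall x, P x}.
Proof. by []. Qed.

Lemma lam_Lp_norm (Om : set (R * R)) (p : \bar R) f :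
  Lp_norm Om p f = ('N[lam]_p[EFin \o (f \_ Om)])%E.
Proof. by []. Qed.

Lemma lam_Lp (Om : set (R * R)) (p : \bar R) f :
  Lp Om p f = ((f \_ Om) \in Lfun lam p).
Proof. by []. Qed.

Lemma lam_ball x (r : R) : 0 <= r -> lam (ball x r) = ((2 * r) ^+ 2)%:E.
Proof. exact: mu_ball. Qed.

Lemma lam_shift (v : R * R) (A : set (plane R)) : measurable A ->
  pushforward lam (fun x : plane R => (x + v : R * R) : plane R) A = lam A.
Proof. exact: mu_shift. Qed.

Lemma lam_line (a b c : R) : (a != 0) || (b != 0) ->
  lam.-negligible ([set x : R * R | a * x.1 + b * x.2 = c] : set (plane R)).
Proof. exact: negligible_line. Qed.

Lemma lam_tonelli1 (f : plane R -> \bar R) : measurable_fun setT f ->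
  (forall x, 0 <= f x)%E ->
  (\int[lam]_x f x =
   \int[lebesgue_measure]_x \int[lebesgue_measure]_y f (x, y))%E.
Proof. exact: fubini_tonelli1. Qed.

Lemma lam_tonelli2 (f : plane R -> \bar R) : measurable_fun setT f ->
  (forall x, 0 <= f x)%E ->
  (\int[lam]_x f x =
   \int[lebesgue_measure]_y \int[lebesgue_measure]_x f (x, y))%E.
Proof. exact: fubini_tonelli2. Qed.

End plane_measure.
#[global] Opaque lam.

(** * Lebesgue norms *)

Section lebesgue_norms.
Context {R : realType}.
Context d (T : measurableType d) (mu : {measure set T -> \bar R}).
Implicit Types (Om : set T) (u v w : T -> R) (p q : R).

Definition Lnr Om p u : \bar R := ('N[mu]_(p%:E)[EFin \o (u \_ Om)])%E.

(** The p-th power of the norm [Lnr]; unlike the norm it is additive over triangles. *)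
Definition Ip Om p u : \bar R := (\int[mu]_(x in Om) (`|u x| `^ p)%:E)%E.

Lemma measurable_powR_norm Om p u : measurable_fun Om u ->
  measurable_fun Om (fun x => (`|u x| `^ p)%:E).
Proof.
move=> mu_; apply/measurable_EFinP.
by apply: (measurableT_comp (measurable_powR p)); exact: measurableT_comp.
Qed.

Lemma Ip_ge0 Om p u : (0 <= Ip Om p u)%E.
Proof. by apply: integral_ge0 => x _; rewrite lee_fin powR_ge0. Qed.

Lemma LnrE Om p u : 0 < p -> Lnr Om p u = (Ip Om p u `^ p^-1)%E.
Proof.
move=> p0; rewrite /Lnr unlock /Lnorm.
suff -> : (\int[mu]_x (`|(EFin \o (u \_ Om)) x| `^ p))%E = Ip Om p u by [].
rewrite /Ip [RHS]integral_mkcond; apply: eq_integral => x _.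
rewrite /= !patchE; case: ifP => // _.
by rewrite normr0 powR0// gt_eqF.
Qed.

Lemma poweR_ltyP (x : \bar R) p : 0 < p -> (0 <= x)%E ->
  (x `^ p < +oo)%E = (x < +oo)%E.
Proof.
move=> p0; case: x => [r| |] //= r0; first by rewrite !ltry.
by rewrite gt_eqF.
Qed.

Lemma Lnr_le Om p u (K : R) : 0 < p -> 0 <= K ->
  (Lnr Om p u <= K%:E)%E = (Ip Om p u <= (K `^ p)%:E)%E.
Proof.
move=> p0 K0; rewrite LnrE//.
case: (Ip Om p u) (Ip_ge0 Om p u) => [r| |] //= r0; last first.
  by rewrite gt_eqF ?invr_gt0.
rewrite lee_fin in r0.
rewrite !lee_fin; apply/idP/idP => h.
  have := ge0_ler_powR (ltW p0) _ _ h; rewrite !nnegrE powR_ge0 => /(_ isT K0).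
  by rewrite -powRrM mulVf ?gt_eqF// powRr1.
have pV : 0 <= p^-1 by rewrite invr_ge0 ltW.
have := ge0_ler_powR pV _ _ h; rewrite !nnegrE powR_ge0 => /(_ r0 isT).
by rewrite -[leRHS]powRrM mulfV ?gt_eqF// powRr1.
Qed.

Lemma Ip_Lnr Om p u : 0 < p -> Ip Om p u = (Lnr Om p u `^ p)%E.
Proof.
move=> p0; rewrite LnrE//; case: (Ip Om p u) (Ip_ge0 Om p u) => [r| |]//=.
  by rewrite lee_fin => r0; rewrite -powRrM mulVf ?gt_eqF// powRr1.
by move=> _; rewrite gt_eqF ?invr_gt0//= gt_eqF.
Qed.

Lemma le_Ip Om p u v : measurable Om -> measurable_fun Om u -> measurable_fun Om v ->
  0 <= p -> {ae mu, forall x, Om x -> `|u x| <= `|v x|} -> (Ip Om p u <= Ip Om p v)%E.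
Proof.
move=> mOm mu_ mv p0 uv; apply: ae_ge0_le_integral => //=.
- exact: measurable_powR_norm.
- exact: measurable_powR_norm.
- apply: filterS uv => x h /h uvx; rewrite lee_fin.
  by apply: ge0_ler_powR => //; rewrite nnegrE.
Qed.

Lemma eq_Ip Om p u v : measurable Om -> measurable_fun Om u -> measurable_fun Om v ->
  {ae mu, forall x, Om x -> u x = v x} -> Ip Om p u = Ip Om p v.
Proof.
move=> mOm mu_ mv uv; apply: ge0_ae_eq_integral => //=.
- exact: measurable_powR_norm.
- exact: measurable_powR_norm.
- by apply: filterS uv => x h /h /= ->.
Qed.

Lemma eq_Lnr Om p u v : measurable Om -> measurable_fun Om u -> measurable_fun Om v ->
  0 < p -> {ae mu, forall x, Om x -> u x = v x} ->
  Lnr Om p u = Lnr Om p v.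
Proof.
move=> mOm mu_ mv p0 uv; rewrite (LnrE _ _ p0) (LnrE _ _ p0).
by have -> := eq_Ip p mOm mu_ mv uv.
Qed.

Lemma Lnr_ge0 Om p u : (0 <= Lnr Om p u)%E.
Proof. exact: Lnorm_ge0. Qed.

Lemma le_Lnr Om p u v : measurable Om -> measurable_fun Om u -> measurable_fun Om v ->
  0 < p -> {ae mu, forall x, Om x -> `|u x| <= `|v x|} ->
  (Lnr Om p u <= Lnr Om p v)%E.
Proof.
move=> mOm mu_ mv p0 h; rewrite (LnrE _ _ p0) (LnrE _ _ p0).
have pV : 0 <= p^-1 by rewrite invr_ge0 ltW.
apply: (gt0_ler_poweR pV).
- by rewrite in_itv/= Ip_ge0 leey.
- by rewrite in_itv/= Ip_ge0 leey.
- exact: (le_Ip mOm mu_ mv (ltW p0) h).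
Qed.

Lemma LnrD Om p u v : measurable Om -> measurable_fun Om u -> measurable_fun Om v ->
  1 <= p -> (Lnr Om p (fun x => (u x + v x)%R) <= Lnr Om p u + Lnr Om p v)%E.
Proof.
move=> mOm mu_ mv p1; rewrite /Lnr.
have -> : (fun x => u x + v x) \_ Om = (u \_ Om) \+ (v \_ Om).
  by apply/funext => x; rewrite /= !patchE; case: ifP => // _; rewrite addr0.
by apply: minkowski_EFin => //; apply/(measurable_restrictT _ mOm).
Qed.

Lemma IpZ Om p (k : R) u : measurable Om -> measurable_fun Om u ->
  Ip Om p (fun x => k * u x) = ((`|k| `^ p)%:E * Ip Om p u)%E.
Proof.
move=> mOm mu_; rewrite /Ip -ge0_integralZl//=.
- by apply: eq_integral => x _; rewrite normrM powRM// EFinM.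
- exact: measurable_powR_norm.
Qed.

Lemma LnrZ Om p (k : R) u : measurable Om -> measurable_fun Om u -> 0 < p ->
  Lnr Om p (fun x => k * u x) = (`|k|%:E * Lnr Om p u)%E.
Proof.
move=> mOm mu_ p0; rewrite !LnrE// IpZ// poweRM ?Ip_ge0 ?lee_fin ?powR_ge0//=.
by rewrite -powRrM mulfV ?gt_eqF// powRr1.
Qed.

Lemma Ip_cst Om p (k : R) : measurable Om ->
  Ip Om p (cst k) = ((`|k| `^ p)%:E * mu Om)%E.
Proof. by move=> mOm; rewrite /Ip /= integral_cst. Qed.

Lemma Ip_bounded Om p u (K : R) : measurable Om -> measurable_fun Om u ->
  0 <= p -> 0 <= K -> {ae mu, forall x, Om x -> `|u x| <= K} ->
  (Ip Om p u <= (K `^ p)%:E * mu Om)%E.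
Proof.
move=> mOm mu_ p0 K0 h; rewrite -{1}(ger0_norm K0) -(Ip_cst _ _ mOm).
apply: (le_Ip mOm mu_ _ p0); first exact: measurable_cst.
by apply: filterS h => x /[apply]; rewrite /= (ger0_norm K0).
Qed.

End lebesgue_norms.

Section completeness.
Context {R : realType} d (T : measurableType d) (mu : {measure set T -> \bar R}).
Implicit Types (Om : set T) (u v w : T -> R).

Lemma Ip2E Om u : Ip mu Om 2 u = (\int[mu]_(x in Om) (u x ^+ 2)%:E)%E.
Proof.
by apply: eq_integral => x _; rewrite powR_mulrn// real_normK// num_real.
Qed.

Lemma increments_cvg (a : nat -> R) (C : R) :
  (forall k, `|a k.+1 - a k| <= C * 2^-1 ^+ k) -> cvgn a.
Proof.
move=> h.
have -> : a = (fun n => a 0%N + series (fun k => a k.+1 - a k) n).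
  apply/funext => n; rewrite /series /=.
  by rewrite telescope_sumr//; ring.
apply: is_cvgD; first exact: is_cvg_cst.
apply: normed_cvg.
apply: (series_le_cvg (v_ := geometric C (2^-1))) => //=.
- by move=> k; apply: le_trans (h k).
- by apply: is_cvg_geometric_series; rewrite ger0_norm ?invr_ge0// invf_lt1// ltr1n.
Qed.

End completeness.

(** * Smooth bump functions *)

Section smooth1.
Context {R : realType}.
Implicit Types (f g : R -> R).

Fixpoint Cn n f : Prop :=
  if n is m.+1 then (forall x, derivable f x 1) /\ Cn m (derive1 f) else True.

Definition smooth1 f := forall n, Cn n f.

Lemma CnW n f : Cn n.+1 f -> Cn n f.
Proof. by elim: n f => // n IH f [df /IH]. Qed.

Lemma is_derive_Cn n f (df : R -> R) : (forall x : R, is_derive x 1 f (df x)) -> Cn n df -> Cn n.+1 f.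
Proof.
move=> fdf cdf; split; first by move=> x; apply: ex_derive.
suff -> : (derive1 f) = df by [].
by apply/funext => x; rewrite derive1E derive_val.
Qed.

Lemma smooth1_der f : smooth1 f -> smooth1 (derive1 f).
Proof. by move=> sf n; have [] := sf n.+1. Qed.

Lemma smooth1_is_derive f (x : R) : smooth1 f -> is_derive x 1 f ((derive1 f) x).
Proof. by move=> /(_ 1%N) [df _]; rewrite derive1E; exact/derivableP. Qed.

Lemma smooth1_continuous f : smooth1 f -> continuous f.
Proof.
by move=> /(_ 1%N) [df _] x; apply: differentiable_continuous; exact/derivable1_diffP.
Qed.

Lemma Cn_cst n (c : R) : Cn n (cst c).
Proof.
elim: n c => // n IH c; apply: (@is_derive_Cn _ _ (cst 0)).
exact: IH.
Qed.

Lemma Cn_id n : Cn n (@id R).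
Proof.
by case: n => // n; apply: (@is_derive_Cn _ _ (cst 1)); exact: Cn_cst.
Qed.

Lemma CnD n f g : Cn n f -> Cn n g -> Cn n (fun x => f x + g x).
Proof.
elim: n f g => // n IH f g [df cf] [dg cg].
apply: (@is_derive_Cn _ _ (fun x => (derive1 f) x + (derive1 g) x)); last exact: IH.
by move=> x; apply: is_deriveD; rewrite derive1E; exact/derivableP.
Qed.

Lemma CnM n f g : Cn n f -> Cn n g -> Cn n (fun x => f x * g x).
Proof.
elim: n f g => // n IH f g Cf Cg; have [df cf] := Cf; have [dg cg] := Cg.
apply: (@is_derive_Cn _ _ (fun x => f x * (derive1 g) x + g x * (derive1 f) x)).
  by move=> x; apply: is_deriveM; rewrite derive1E; exact/derivableP.
by apply: CnD; apply: IH => //; exact: CnW.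
Qed.

Lemma Cn_affine n f (a b : R) : Cn n f -> Cn n (fun x => f (a * x + b)).
Proof.
elim: n f => // n IH f [df cf].
apply: (@is_derive_Cn _ _ (fun x => a * (derive1 f) (a * x + b))); last first.
  by apply: CnM; [exact: Cn_cst|exact: IH].
move=> x.
have h : is_derive x 1 (fun x => a * x + b) a.
  by apply: is_derive_eq; rewrite /GRing.scale /= mulr1 addr0.
have := @is_derive1_comp _ f (fun x => a * x + b) x ((derive1 f) (a * x + b)) a.
rewrite [a * _ in X in _ -> X]mulrC; apply => //.
by rewrite derive1E; exact/derivableP.
Qed.

Lemma CnV n f : (forall x, f x != 0) -> Cn n f -> Cn n (fun x => (f x)^-1).
Proof.
move=> f0; elim: n => // n IH Cf; have [df cf] := Cf.
apply: (@is_derive_Cn _ _ (fun x => - ((f x)^-1 * (f x)^-1 * (derive1 f) x))).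
  move=> x; rewrite derive1E.
  have h : is_derive x 1 f ('D_1 f x) by exact/derivableP.
  have := is_deriveV (f0 x) h; rewrite /GRing.scale /= => h2.
  rewrite (_ : - _ = - f x ^- 2 * 'D_1 f x)//.
  by rewrite expr2 invfM mulNr.
have -> : (fun x => - ((f x)^-1 * (f x)^-1 * (derive1 f) x)) =
    (fun x => cst (-1) x * ((f x)^-1 * (f x)^-1 * (derive1 f) x)).
  by apply/funext => x; rewrite /= mulN1r.
apply: CnM; first exact: Cn_cst.
by do ![apply: CnM] => //; apply: IH; exact: CnW.
Qed.

(** The family [x^-k exp(-1/x)], extended by 0, is closed under differentiation up to linear
    combinations, which permits induction on the order of smoothness. *)
Definition flat (k : nat) (x : R) : R :=
  if 0 < x then x ^- k * expR (- x^-1) else 0.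

Lemma flat_ge0 k x : 0 <= flat k x.
Proof. by rewrite /flat; case: ifP => // x0; rewrite mulr_ge0 ?expR_ge0// invr_ge0 exprn_ge0// ltW. Qed.

Lemma flat_gt0 k x : 0 < x -> 0 < flat k x.
Proof. by move=> x0; rewrite /flat x0 mulr_gt0 ?expR_gt0// invr_gt0 exprn_gt0. Qed.

Lemma flat_le0 k x : x <= 0 -> flat k x = 0.
Proof. by move=> x0; rewrite /flat ltNge x0. Qed.

(** From [exp y >= y^(k+1) / (k+1)!] at [y = 1/x]. *)
Lemma flat_le k x : 0 < x -> flat k x <= k.+1`!%:R * x.
Proof.
move=> x0; rewrite /flat x0 expRN.
have y0 : 0 <= x^-1 by rewrite invr_ge0 ltW.
rewrite ler_pdivrMr ?expR_gt0//.
have := expR_ge1Dxn k y0.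
have f0 : 0 < (k.+1)`!%:R :> R by rewrite ltr0n fact_gt0.
move=> h; have {h} : x^-1 ^+ k.+1 / (k.+1)`!%:R <= expR x^-1 by apply: le_trans h; rewrite lerDr.
rewrite ler_pdivrMr// => h.
have : x ^- k = x * x^-1 ^+ k.+1 by rewrite exprS mulrA mulfV ?gt_eqF// mul1r exprVn.
move=> ->; rewrite -mulrA mulrCA ler_wpM2l ?(ltW x0)//.
by rewrite mulrC.
Qed.

Lemma flat_div k x : x^-1 * flat k x = flat k.+1 x.
Proof.
rewrite /flat; case: ifPn => [x0|_]; last by rewrite mulr0.
by rewrite mulrA exprS invfM.
Qed.

Lemma flat_norm_le k x : `|flat k x| <= k.+1`!%:R * `|x|.
Proof.
have [x0|x0] := ltP 0 x.
  by rewrite !ger0_norm ?flat_ge0 ?(ltW x0)// flat_le.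
by rewrite flat_le0// normr0 mulr_ge0.
Qed.

Lemma is_derive_flat k (x : R) :
  is_derive x 1 (flat k) (flat k.+2 x - k%:R * flat k.+1 x).
Proof.
have [x0|x0|->] := ltgtP x 0.
- rewrite !flat_le0 ?(ltW x0)// mulr0 subr0.
  apply: (@near_eq_is_derive _ _ _ (cst 0)).
  near=> y; rewrite /= flat_le0// ltW//; near: y; exact: lt_nbhsl.
- apply: (@near_eq_is_derive _ _ _ (fun y : R => y^-1 ^+ k * expR (- y^-1))).
    near=> y; rewrite /= /flat ifT ?exprVn//; near: y; exact: lt_nbhsr.
  have xn0 : x != 0 by rewrite gt_eqF.
  have d1 : is_derive x 1 (fun y : R => y^-1) (- x ^- 2).
    by have := is_deriveV xn0 (is_derive_id x 1); rewrite /GRing.scale /= mulr1.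
  have d2 : is_derive x 1 (fun y : R => y^-1 ^+ k) (k%:R * x^-1 ^+ k.-1 * - x ^- 2).
    rewrite (_ : (fun y : R => y^-1 ^+ k) = (fun y : R => y^-1) ^+ k).
      exact: (is_deriveX k d1).
    by apply/funext => y; rewrite exprfctE.
  have d3 : is_derive x 1 (fun y : R => expR (- y^-1)) (expR (- x^-1) * x ^- 2).
    have d : is_derive x 1 (fun y : R => - y^-1) (- (- x ^- 2)) by exact: is_deriveN.
    have := (@is_derive1_comp _ expR (fun y : R => - y^-1) x _ _ (is_derive_expR _) d).
    by rewrite opprK.
  have := is_deriveM d2 d3; rewrite /GRing.scale /= => d4.
  rewrite (_ : _ - _ = x^-1 ^+ k * (expR (- x^-1) * x ^- 2) +
    expR (- x^-1) * (k%:R * x^-1 ^+ k.-1 * - x ^- 2))//.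
  rewrite /flat x0 -!exprVn !exprS; case: (k) => [|m] /=; rewrite ?exprS; ring.
rewrite !flat_le0 ?lexx// mulr0 subr0.
(* At the origin the difference quotient of [flat k] is [flat k.+1], which tends to 0 by
   [flat_norm_le]. *)
have h : (fun h : R => h^-1 *: ((flat k \o shift 0) (h *: 1) - flat k 0)) @ 0^' --> (0 : R).
  rewrite (_ : (fun h => _) = flat k.+1); last first.
    apply/funext => h; rewrite /= [flat k 0]flat_le0// subr0 addr0 -flat_div.
    by rewrite /GRing.scale /= mulr1.
  apply: (@cvg_within_filter R R (flat k.+1)).
  apply/cvgr0Pnorm_le => e e0; near=> y.
  apply: le_trans (flat_norm_le _ _) _.
  rewrite -ler_pdivlMl ?ltr0n ?fact_gt0//.
  near: y; apply: cvgr0_norm_le; first exact: cvg_id.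
  by rewrite mulr_gt0// invr_gt0 ltr0n fact_gt0.
apply: DeriveDef; first by apply/cvg_ex; exists 0.
exact/cvg_lim.
Unshelve. all: by end_near. Qed.

Lemma Cn_flat n k : Cn n (flat k).
Proof.
elim: n k => // n IH k.
apply: (is_derive_Cn (is_derive_flat k)).
have -> : (fun x => flat k.+2 x - k%:R * flat k.+1 x) =
  (fun x => flat k.+2 x + cst (- k%:R) x * flat k.+1 x).
  by apply/funext => x; rewrite /= mulNr.
apply: CnD => //; apply: CnM => //; exact: Cn_cst.
Qed.

(** A smooth transition from 0 to 1 on [[0, 1]]; the denominator is positive because [x] and [1 - x]
    are never both nonpositive. *)
Definition step (x : R) : R := flat 0 x / (flat 0 x + flat 0 (1 - x)).

Lemma step_den x : flat 0 x + flat 0 (1 - x) != 0.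
Proof.
have [x0|x0] := ltP 0 x; rewrite gt_eqF//.
  by rewrite ltr_pwDl ?flat_ge0// flat_gt0.
by rewrite ltr_pwDr ?flat_ge0// flat_gt0// subr_gt0 (le_lt_trans x0).
Qed.

Lemma smooth1_step : smooth1 step.
Proof.
move=> n; apply: CnM; first exact: Cn_flat.
apply: CnV; first exact: step_den.
apply: CnD; first exact: Cn_flat.
have -> : (fun x => flat 0 (1 - x)) = (fun x => flat 0 ((-1) * x + 1)).
  by apply/funext => x; rewrite mulN1r addrC.
exact/Cn_affine/Cn_flat.
Qed.

Lemma step_le0 x : x <= 0 -> step x = 0.
Proof. by move=> x0; rewrite /step flat_le0// mul0r. Qed.

Lemma step_ge1 x : 1 <= x -> step x = 1.
Proof.
move=> x1; rewrite /step [flat 0 (1 - x)]flat_le0 ?subr_le0// addr0 divff//.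
by rewrite gt_eqF// flat_gt0// (lt_le_trans ltr01).
Qed.

(** A smooth substitute for the positive part. *)
Definition ramp (x : R) : R := x * step x.

Lemma smooth1_ramp : smooth1 ramp.
Proof. by move=> n; apply: CnM; [exact: Cn_id|exact: smooth1_step]. Qed.

Lemma ramp_le0 x : x <= 0 -> ramp x = 0.
Proof. by move=> x0; rewrite /ramp step_le0// mulr0. Qed.

Lemma ramp_ge1 x : 1 <= x -> ramp x = x.
Proof. by move=> x0; rewrite /ramp step_ge1// mulr1. Qed.

Lemma smooth1D f g : smooth1 f -> smooth1 g -> smooth1 (fun x => f x + g x).
Proof. by move=> sf sg n; apply: CnD. Qed.

Lemma smooth1M f g : smooth1 f -> smooth1 g -> smooth1 (fun x => f x * g x).
Proof. by move=> sf sg n; apply: CnM. Qed.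

Lemma smooth1Z (c : R) f : smooth1 f -> smooth1 (fun x => c * f x).
Proof. by move=> sf n; apply: (@CnM n (cst c)) => //; exact: Cn_cst. Qed.

Lemma smooth1_affine f (a b : R) : smooth1 f -> smooth1 (fun x => f (a * x + b)).
Proof. by move=> sf n; apply: Cn_affine. Qed.

(* The second difference of [ramp]: its integer translates reproduce affine
   functions, because both sums over translates telescope. *)
Definition rho (x : R) : R := ramp (x + 1) - 2 * ramp x + ramp (x - 1).

Lemma smooth1_rho : smooth1 rho.
Proof.
have h (c : R) : smooth1 (fun x => ramp (x + c)).
  have -> : (fun x => ramp (x + c)) = (fun x => ramp (1 * x + c)).
    by apply/funext => x; rewrite mul1r.
  exact/smooth1_affine/smooth1_ramp.
rewrite /rho; apply: smooth1D; last exact: h.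
apply: smooth1D; first exact: h.
have -> : (fun x => - (2 * ramp x)) = (fun x => - 2 * ramp x).
  by apply/funext => x; rewrite mulNr.
exact/smooth1Z/smooth1_ramp.
Qed.

Lemma rho_out x : (x <= -1) || (2 <= x) -> rho x = 0.
Proof.
move=> /orP[x1|x1]; rewrite /rho.
  rewrite !ramp_le0; lra.
rewrite !ramp_ge1; lra.
Qed.

(** [rho y = dramp (y + 1) - dramp y], so sums over integer translates telescope; [dramp] is 0 for
    negative arguments and 1 beyond 2. *)
Definition dramp (x : R) : R := ramp x - ramp (x - 1).

Lemma sum_rho (M : nat) (y : R) : M%:R >= y + 1 -> 1 <= y ->
  \sum_(i < M) rho (y - i%:R) = 1.
Proof.
move=> My y1.
have -> : \sum_(i < M) rho (y - i%:R) = dramp (y + 1) - dramp (y + 1 - M%:R).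
  elim: (M) => [|m IH]; first by rewrite big_ord0 subr0 subrr.
  rewrite big_ord_recr /= IH /rho /dramp -(natr1 m).
  rewrite (_ : y + 1 - (m%:R + 1) = y - m%:R); last by ring.
  rewrite (_ : y - m%:R + 1 = y + 1 - m%:R); last by ring.
  rewrite (_ : y + 1 - m%:R - 1 = y - m%:R); last by ring.
  ring.
have e1 : ramp (y + 1) = y + 1 by rewrite ramp_ge1; lra.
have e2 : ramp (y + 1 - 1) = y by rewrite ramp_ge1; lra.
have e3 : ramp (y + 1 - M%:R) = 0 by rewrite ramp_le0; lra.
have e4 : ramp (y + 1 - M%:R - 1) = 0 by rewrite ramp_le0; lra.
rewrite /dramp e1 e2 e3 e4; ring.
Qed.

Lemma sum_id_rho (M : nat) (y : R) : M%:R >= y + 1 -> 1 <= y ->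
  \sum_(i < M) i%:R * rho (y - i%:R) = y.
Proof.
move=> My y1.
(* Summation by parts: [E (t + 1) - E t = t * rho t], and [E] vanishes at both ends of the sum. *)
pose E t := t * dramp t - ramp t.
have h : \sum_(i < M) (y - i%:R) * rho (y - i%:R) = E (y + 1) - E (y + 1 - M%:R).
  elim: (M) => [|m IH]; first by rewrite big_ord0 subr0 subrr.
  rewrite big_ord_recr /= IH /rho /E /dramp -(natr1 m).
  rewrite (_ : y + 1 - (m%:R + 1) = y - m%:R); last by ring.
  rewrite (_ : y - m%:R + 1 = y + 1 - m%:R); last by ring.
  rewrite (_ : y + 1 - m%:R - 1 = y - m%:R); last by ring.
  ring.
have e1 : ramp (y + 1) = y + 1 by rewrite ramp_ge1; lra.
have e2 : ramp (y + 1 - 1) = y by rewrite ramp_ge1; lra.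
have e3 : ramp (y + 1 - M%:R) = 0 by rewrite ramp_le0; lra.
have e4 : ramp (y + 1 - M%:R - 1) = 0 by rewrite ramp_le0; lra.
have h0 : E (y + 1) - E (y + 1 - M%:R) = 0.
  by rewrite /E /dramp e1 e2 e3 e4; ring.
have : \sum_(i < M) (y - i%:R) * rho (y - i%:R) =
    y * \sum_(i < M) rho (y - i%:R) - \sum_(i < M) i%:R * rho (y - i%:R).
  by rewrite mulr_sumr -sumrB; apply: eq_bigr => i _; rewrite mulrBl.
rewrite h h0 (sum_rho My y1) mulr1 => /esym/eqP; rewrite subr_eq0 => /eqP <-.
by [].
Qed.

End smooth1.

(** * Smooth functions of two variables *)

Section smooth2.
Context {R : realType}.
Implicit Types (f g : R * R -> R) (a b : R -> R) (e x : R * R).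

(** Finite sums of products of smooth functions of one variable: the class is closed under all
    directional derivatives, which reduces smoothness in the plane to the line. *)
Inductive tensor : (R * R -> R) -> Prop :=
| tensor0 : tensor (fun _ => 0)
| tensorD a b f : smooth1 a -> smooth1 b -> tensor f ->
    tensor (fun x => a x.1 * b x.2 + f x).

Lemma differentiable_fst x : differentiable (fst : R * R -> R) x.
Proof. by apply: (@linear_differentiable _ _ _ (fst : R * R -> R)) => y; exact: cvg_fst. Qed.

Lemma differentiable_snd x : differentiable (snd : R * R -> R) x.
Proof. by apply: (@linear_differentiable _ _ _ (snd : R * R -> R)) => y; exact: cvg_snd. Qed.

Lemma diff_fst x e : 'd (fst : R * R -> R) x e = e.1.
Proof. by rewrite diff_lin// => y; exact: cvg_fst. Qed.

Lemma diff_snd x e : 'd (snd : R * R -> R) x e = e.2.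
Proof. by rewrite diff_lin// => y; exact: cvg_snd. Qed.

Lemma tensor_prod a b : smooth1 a -> smooth1 b -> tensor (fun x => a x.1 * b x.2).
Proof.
move=> sa sb; have -> : (fun x : R * R => a x.1 * b x.2) = (fun x => a x.1 * b x.2 + 0).
  by apply/funext => x; rewrite addr0.
by apply: tensorD => //; exact: tensor0.
Qed.

Lemma tensor_add f g : tensor f -> tensor g -> tensor (fun x => f x + g x).
Proof.
move=> tf tg; elim: tf => [|a b h sa sb th IH].
  by rewrite (_ : (fun x => 0 + g x) = g)//; apply/funext => x; rewrite add0r.
rewrite (_ : (fun x => _) = (fun x => a x.1 * b x.2 + (h x + g x))).
  exact: tensorD.
by apply/funext => x; rewrite addrA.
Qed.

Lemma tensor_scale (c : R) f : tensor f -> tensor (fun x => c * f x).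
Proof.
elim=> [|a b h sa sb th IH].
  rewrite (_ : (fun x => c * 0) = (fun _ => 0)); first exact: tensor0.
  by apply/funext => x; rewrite mulr0.
rewrite (_ : (fun x => _) = (fun x => (c * a x.1) * b x.2 + c * h x)).
  by apply: (@tensorD (fun y => c * a y)) => //; exact: smooth1Z.
by apply/funext => x; rewrite mulrDr mulrA.
Qed.

Lemma tensor_sum n (F : 'I_n -> R * R -> R) : (forall i, tensor (F i)) ->
  tensor (fun x => \sum_i F i x).
Proof.
elim: n F => [|n IH] F tF.
  rewrite (_ : (fun x => _) = (fun _ => 0)); first exact: tensor0.
  by apply/funext => x; rewrite big_ord0.
rewrite (_ : (fun x => _) = (fun x => F ord0 x + \sum_i F (lift ord0 i) x)).
  by apply: tensor_add => //; exact: IH.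
by apply/funext => x; rewrite big_ord_recl.
Qed.

Lemma is_diff_prod a b x : smooth1 a -> smooth1 b ->
  differentiable (fun x : R * R => a x.1 * b x.2) x /\
  forall e, 'D_e (fun x : R * R => a x.1 * b x.2) x =
    e.1 * ((derive1 a x.1) * b x.2) + e.2 * (a x.1 * (derive1 b x.2)).
Proof.
move=> sa sb.
have da y : differentiable a y by apply/derivable1_diffP; have [] := sa 1%N.
have db y : differentiable b y by apply/derivable1_diffP; have [] := sb 1%N.
have d1 : differentiable (a \o (fst : R * R -> R)) x.
  by apply: differentiable_comp => //; exact: differentiable_fst.
have d2 : differentiable (b \o (snd : R * R -> R)) x.
  by apply: differentiable_comp => //; exact: differentiable_snd.
split; first exact: (differentiableM d1 d2).
move=> e.
rewrite (@deriveM _ _ (a \o (fst : R * R -> R)) (b \o (snd : R * R -> R))); last 2 first.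
- exact: diff_derivable.
- exact: diff_derivable.
have -> : 'D_e (a \o (fst : R * R -> R)) x = e.1 * derive1 a x.1.
  by rewrite (deriveE _ d1) (diff_comp (differentiable_fst x) (da _)) /= diff_fst diff1E.
have -> : 'D_e (b \o (snd : R * R -> R)) x = e.2 * derive1 b x.2.
  by rewrite (deriveE _ d2) (diff_comp (differentiable_snd x) (db _)) /= diff_snd diff1E.
rewrite /GRing.scale /=; ring.
Qed.

Lemma tensor_diff f : tensor f -> forall x, differentiable f x.
Proof.
elim=> [|a b h sa sb th IH] x; first exact: differentiable_cst.
by apply: (@differentiableD _ _ _ (fun x : R * R => a x.1 * b x.2) h) => //; case: (is_diff_prod x sa sb).
Qed.

Lemma tensor_derive f e : tensor f -> tensor ('D_e f).
Proof.
elim=> [|a b h sa sb th IH].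
  rewrite (_ : 'D_e _ = (fun _ => 0)); first exact: tensor0.
  by apply/funext => x; rewrite derive_cst.
rewrite (_ : 'D_e _ = (fun x => (e.1 * derive1 a x.1) * b x.2 + ((e.2 * a x.1) * derive1 b x.2 + 'D_e h x))).
  apply: (@tensorD (fun y => e.1 * derive1 a y)) => //; first exact/smooth1Z/smooth1_der.
  apply: (@tensorD (fun y => e.2 * a y)) => //; [exact/smooth1Z|exact/smooth1_der].
apply/funext => x; have [d1 d2] := is_diff_prod x sa sb.
rewrite (@deriveD _ _ _ (fun x : R * R => a x.1 * b x.2) h); last 2 first.
- exact: diff_derivable.
- exact/diff_derivable/tensor_diff.
by rewrite d2 !mulrA addrA.
Qed.

Lemma tensor_smooth f : tensor f -> smooth f.
Proof.
move=> tf s; elim: s => [|e s IH] /= x; first exact: tensor_diff.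
suff : tensor (foldr (fun (e : R * R) (psi : R * R -> R) => 'D_e psi) f (e :: s)) by move/tensor_diff; exact.
by elim: {IH} (e :: s) => //= e' s' IH; exact: tensor_derive.
Qed.

End smooth2.

(** * Triangles and barycentric coordinates *)

Definition o0 : 'I_3 := @Ordinal 3 0 isT.
Definition o1 : 'I_3 := @Ordinal 3 1 isT.
Definition o2 : 'I_3 := @Ordinal 3 2 isT.

Lemma ord3P (P : 'I_3 -> Prop) : P o0 -> P o1 -> P o2 -> forall i, P i.
Proof.
move=> h0 h1 h2 [[|[|[|//]]] hi].
- by rewrite (_ : Ordinal hi = o0)//; apply: val_inj.
- by rewrite (_ : Ordinal hi = o1)//; apply: val_inj.
- by rewrite (_ : Ordinal hi = o2)//; apply: val_inj.
Qed.

Lemma sum3 (V : nmodType) (F : 'I_3 -> V) : \sum_i F i = F o0 + F o1 + F o2.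
Proof.
rewrite !big_ord_recl big_ord0 addr0 addrA.
by congr (F _ + F _ + F _); apply: val_inj.
Qed.

Section creep.
Context {R : realType}.

(** Continuous induction: the supremum of the parameters up to which the comparison holds is itself
    one of them and cannot lie before [b]. Neither [w] nor [Phi] has to be continuous. For constant
    [Phi] this says that a locally constant function on an interval is constant. *)
Lemma creep (w Phi : R -> R) (a b : R) : a <= b ->
  (forall t, a <= t <= b -> exists2 d, 0 < d & forall t', a <= t' <= b ->
     `|t' - t| < d -> `|w t' - w t| <= `|Phi t' - Phi t|) ->
  (forall t t', a <= t -> t <= t' -> t' <= b -> Phi t <= Phi t') ->
  `|w b - w a| <= Phi b - Phi a.
Proof.
move=> ab loc mono.
pose S := [set t | a <= t <= b /\ `|w t - w a| <= Phi t - Phi a].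
have Sa : S a by split; rewrite ?lexx ?ab// !subrr normr0.
have hS : has_sup S.
  by split; [exists a|exists b => t [/andP[]]].
pose c := sup S.
have ac : a <= c by apply: ub_le_sup => //; case: hS.
have cb : c <= b by apply: ge_sup; [exists a|move=> t [/andP[]]].
have [d d0 hd] := loc c (introT andP (conj ac cb)).
have [t [/andP[a_t tb] St] tc] : exists2 t, S t & c - d < t.
  by apply: sup_adherent.
have t_c : t <= c by apply: ub_le_sup; [case: hS|split => //; apply/andP].
have Sc : `|w c - w a| <= Phi c - Phi a.
  have := hd t (introT andP (conj a_t tb)).
  rewrite distrC ger0_norm ?subr_ge0// ltrBlDr -ltrBlDl => /(_ tc).
  rewrite distrC [X in _ <= X]distrC [X in _ <= X]ger0_norm ?subr_ge0 ?mono// => h.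
  have := ler_normD (w c - w t) (w t - w a).
  by rewrite (_ : w c - w t + (w t - w a) = w c - w a); [lra|ring].
have [cltb|bc] := ltP c b; last by rewrite (_ : b = c)//; apply/eqP; rewrite eq_le bc cb.
pose t' := Num.min (c + d / 2) b.
have ct' : c < t' by rewrite lt_min cltb andbT ltrDl divr_gt0.
have t'b : t' <= b by rewrite ge_min lexx orbT.
have t'd : t' - c < d.
  have : t' <= c + d / 2 by rewrite ge_min lexx.
  lra.
have at' : a <= t' by rewrite (le_trans ac)// ltW.
have := hd t' (introT andP (conj at' t'b)).
rewrite ger0_norm ?subr_ge0 ?(ltW ct')// => /(_ t'd).
rewrite [X in _ <= X]ger0_norm ?subr_ge0 ?mono// ?(ltW ct')// => h.
suff : t' <= c by rewrite leNgt ct'.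
apply: ub_le_sup; first by case: hS.
split; first by rewrite at'.
have := ler_normD (w t' - w c) (w c - w a).
by rewrite (_ : w t' - w c + (w c - w a) = w t' - w a); [lra|ring].
Qed.

End creep.

Section triangles.
Context {R : realType}.
Implicit Types (x y z g : R * R) (p : 'I_3 -> R * R) (w : R * R -> R) (i : 'I_3).

Definition cross x y : R := x.1 * y.2 - x.2 * y.1.
Definition dotp g x : R := g.1 * x.1 + g.2 * x.2.
(** The norm dual to the maximum norm of the plane, hence the right size for gradients, see
    [dotp_le]. *)
Definition n1 g : R := `|g.1| + `|g.2|.

Lemma norm_pair x : `|x| = Num.max `|x.1| `|x.2|.
Proof. by []. Qed.

Lemma norm1_le x : `|x.1| <= `|x|.
Proof. by rewrite norm_pair le_max lexx. Qed.

Lemma norm2_le x : `|x.2| <= `|x|.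
Proof. by rewrite norm_pair le_max lexx orbT. Qed.

Lemma n1_ge0 g : 0 <= n1 g.
Proof. by rewrite addr_ge0. Qed.

Lemma dotp_le g x : `|dotp g x| <= n1 g * `|x|.
Proof.
apply: le_trans (ler_normD _ _) _; rewrite !normrM mulrDl.
by rewrite lerD// ler_wpM2l// ?norm1_le ?norm2_le.
Qed.

Lemma dotpB g x y : dotp g (x - y) = dotp g x - dotp g y.
Proof. by rewrite /dotp /=; ring. Qed.

Lemma dotpD g x y : dotp g (x + y) = dotp g x + dotp g y.
Proof. by rewrite /dotp /=; ring. Qed.

Lemma dotpZ g (k : R) x : dotp g (k *: x) = k * dotp g x.
Proof. by rewrite /dotp /= /GRing.scale /=; ring. Qed.

(** A sign that is never 0, so that [(sg g.1, sg g.2)] has maximum norm 1 for every [g]. *)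
Definition sg (t : R) : R := if 0 <= t then 1 else -1.

Lemma norm_sg t : `|sg t| = 1.
Proof. by rewrite /sg; case: ifP; rewrite ?normrN normr1. Qed.

Lemma mulr_sg t : t * sg t = `|t|.
Proof.
rewrite /sg; case: ifPn => [t0|]; first by rewrite mulr1 ger0_norm.
by rewrite -ltNge => t0; rewrite mulrN1 ltr0_norm.
Qed.

(** The dual norm is attained: at the two opposite corners of the square in the direction of the
    signs of [g], the values of [dotp g] differ by [n1 g * (2 * r)]. *)
Lemma n1_osc g x (r m : R) : 0 <= r ->
  (forall y, `|y - x| <= r -> forall y', `|y' - x| <= r -> dotp g (y - y') <= m) ->
  n1 g * (2 * r) <= m.
Proof.
move=> r0 h; pose e : R * R := (sg g.1, sg g.2).
have ne : `|e| = 1 by rewrite norm_pair /= !norm_sg maxxx.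
have h1 : `|(x + r *: e) - x| <= r by rewrite addrC addKr normrZ ne mulr1 ger0_norm.
have h2 : `|(x - r *: e) - x| <= r by rewrite addrC addKr normrN normrZ ne mulr1 ger0_norm.
have := h _ h1 _ h2.
rewrite (_ : dotp _ _ = n1 g * (2 * r))// /dotp /n1 -!mulr_sg /= /GRing.scale /=; ring.
Qed.

Definition nxt (i : 'I_3) : 'I_3 :=
  match val i with 0%N => o1 | 1%N => o2 | _ => o0 end.

(** Twice the signed area. *)
Definition area2 p : R := cross (p o1 - p o0) (p o2 - p o0).

(** A ratio of signed areas, by Cramer's rule; the cyclic successor [nxt] turns the three formulas
    into one. *)
Definition bary p i x : R :=
  cross (p (nxt i) - x) (p (nxt (nxt i)) - x) / area2 p.

Definition bgrad p i : R * R :=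
  (((p (nxt i)).2 - (p (nxt (nxt i))).2) / area2 p,
   ((p (nxt (nxt i))).1 - (p (nxt i)).1) / area2 p).

Definition tri p : set (R * R) := [set x | forall i, 0 <= bary p i x].

Lemma baryB p i x y : bary p i x - bary p i y = dotp (bgrad p i) (x - y).
Proof. by rewrite /bary /cross /dotp /bgrad /=; ring. Qed.

Lemma baryE p i x y : bary p i x = bary p i y + dotp (bgrad p i) (x - y).
Proof. by rewrite -baryB addrC subrK. Qed.

Section nondeg.
Variable p : 'I_3 -> R * R.
Hypothesis pn : area2 p != 0.

Lemma sum_bary x : \sum_i bary p i x = 1.
Proof.
rewrite sum3 /bary /=; apply: (mulIf pn); rewrite !mulrDl !divfK// mul1r.
by rewrite /area2 /cross /=; ring.
Qed.

Lemma sum_bary_vertex x : \sum_i bary p i x *: p i = x.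
Proof.
have E a b : a / area2 p * b * area2 p = a * b by rewrite mulrAC divfK.
rewrite sum3 /bary /=; case: x => x1 x2; congr pair; rewrite /= /GRing.scale /=;
  apply: (mulIf pn); rewrite !mulrDl !E /area2 /cross /=; ring.
Qed.

Lemma bary_vertex i j : bary p i (p j) = (i == j)%:R.
Proof.
have h : forall i j, bary p i (p j) * area2 p = (i == j)%:R * area2 p.
  move=> {}i {}j; rewrite /bary divfK//; elim/ord3P: i; elim/ord3P: j => /=;
  rewrite /area2 /cross /=; ring.
exact: (mulIf pn (h i j)).
Qed.

Lemma bary_affine i (n : nat) (r : 'I_n -> R) (q : 'I_n -> R * R) : \sum_k r k = 1 ->
  bary p i (\sum_k r k *: q k) = \sum_k r k * bary p i (q k).
Proof.
move=> r1; rewrite (baryE p i _ 0).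
under [RHS]eq_bigr => k _ do rewrite (baryE p i (q k) 0) mulrDr.
rewrite big_split /= -mulr_suml r1 mul1r; congr +%R.
rewrite !subr0; under [RHS]eq_bigr => k _ do rewrite subr0 -dotpZ.
elim/big_rec2: _ => [|k y1 y2 _ <-]; first by rewrite /dotp /= !mulr0 addr0.
by rewrite dotpD.
Qed.

Lemma tri_vertex i : tri p (p i).
Proof. by move=> j; rewrite bary_vertex. Qed.

Lemma vertex_inj : injective p.
Proof.
move=> i j pij; have := bary_vertex i j; rewrite -pij bary_vertex eqxx.
by case: eqP => // _ /eqP; rewrite oner_eq0.
Qed.

Lemma tri_conv n (r : 'I_n -> R) (q : 'I_n -> R * R) : \sum_k r k = 1 ->
  (forall k, 0 <= r k) -> (forall k, tri p (q k)) -> tri p (\sum_k r k *: q k).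
Proof.
by move=> r1 r0 hq i; rewrite bary_affine// sumr_ge0// => k _; rewrite mulr_ge0// hq.
Qed.

Lemma tri_segment x y (t : R) : 0 <= t <= 1 -> tri p x -> tri p y ->
  tri p (x + t *: (y - x)).
Proof.
move=> /andP[t0 t1] hx hy i.
rewrite (baryE p i _ x) (_ : x + t *: (y - x) - x = t *: (y - x)); last first.
  by rewrite addrC addKr.
rewrite dotpZ -baryB.
have := hx i; have := hy i; move: (bary p i x) (bary p i y) => u v; nra.
Qed.

(** The affine function taking the values of [w] at the vertices; [igrad] is its constant
    gradient. *)
Definition ival w x : R := \sum_i bary p i x * w (p i).
Definition igrad w : R * R := \sum_i w (p i) *: bgrad p i.

Lemma dotp_suml n (r : 'I_n -> R) (q : 'I_n -> R * R) x :
  dotp (\sum_k r k *: q k) x = \sum_k r k * dotp (q k) x.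
Proof.
elim/big_rec2: _ => [|k y1 y2 _ <-]; first by rewrite /dotp /= !mul0r addr0.
by rewrite /dotp /= /GRing.scale /=; ring.
Qed.

Lemma ivalB w x y : ival w x - ival w y = dotp (igrad w) (x - y).
Proof.
rewrite /ival -sumrB dotp_suml; apply: eq_bigr => i _.
by rewrite -mulrBl baryB mulrC.
Qed.

Lemma ival_vertex w i : ival w (p i) = w (p i).
Proof.
rewrite /ival (bigD1 i)//= bary_vertex eqxx mul1r big1 ?addr0// => j /negbTE ji.
by rewrite bary_vertex ji mul0r.
Qed.

Lemma ival_affine w n (r : 'I_n -> R) (q : 'I_n -> R * R) : \sum_k r k = 1 ->
  ival w (\sum_k r k *: q k) = \sum_k r k * ival w (q k).
Proof.
move=> r1; rewrite /ival.
under eq_bigr => i _ do rewrite bary_affine// mulr_suml.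
rewrite exchange_big /=; apply: eq_bigr => k _; rewrite mulr_sumr.
by apply: eq_bigr => i _; rewrite mulrA.
Qed.

Lemma ival_range w (m M : R) x : (forall i, m <= w (p i) <= M) -> tri p x ->
  m <= ival w x <= M.
Proof.
move=> h hx; rewrite /ival; apply/andP; split.
  rewrite -[leLHS]mul1r -(sum_bary x) mulr_suml; apply: ler_sum => i _.
  by apply: ler_wpM2l; [exact: hx|case/andP: (h i)].
rewrite -[leRHS]mul1r -(sum_bary x) mulr_suml; apply: ler_sum => i _.
by apply: ler_wpM2l; [exact: hx|case/andP: (h i)].
Qed.

Lemma tri_closed : closed (tri p).
Proof.
have -> : tri p = \bigcap_(i in [set: 'I_3]) [set x | 0 <= bary p i x].
  by apply/seteqP; split => x h; [move=> i _; exact: h|move=> i; exact: h].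
apply: closed_bigI => i _.
apply: (closed_comp (f := bary p i) (D := [set y : R | 0 <= y])); last exact: closed_ge.
move=> x _.
rewrite (_ : bary p i = fun x => bary p i 0 + dotp (bgrad p i) x); last first.
  by apply/funext => y; rewrite (baryE p i y 0) subr0.
apply: cvgD; first exact: cvg_cst.
apply: cvgD; apply: cvgM; try exact: cvg_cst; [exact: cvg_fst|exact: cvg_snd].
Qed.

(* Regularity in terms of sup-norm squares: the triangle has diameter at most
   [h] and contains a square of radius [h / s]. *)
Definition shape (s h : R) := [/\ 0 < h, forall x y, tri p x -> tri p y -> `|x - y| <= h &
  exists x, forall y, `|y - x| <= h / s -> tri p y].

Variables (s h : R).
Hypothesis s0 : 0 < s.
Hypothesis sh : shape s h.

Lemma igrad_le w (m : R) : (forall i j, w (p i) - w (p j) <= m) ->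
  n1 (igrad w) * (2 * (h / s)) <= m.
Proof.
move=> hw; have [h0 _ [x hx]] := sh.
apply: (@n1_osc _ x); first by rewrite divr_ge0// ltW.
move=> y hy y' hy'; rewrite -ivalB.
have hM : exists M, (forall i, w (p i) <= M) /\ forall i, M - m <= w (p i).
  exists (Num.max (w (p o0)) (Num.max (w (p o1)) (w (p o2)))); split.
    by elim/ord3P; rewrite !le_max lexx ?orbT.
  by move=> i; rewrite lerBlDr !ge_max -!lerBlDl !hw.
have [M [M1 M2]] := hM.
have hh i : M - m <= w (p i) <= M by rewrite M1 M2.
have /andP[_ e1] := ival_range hh (hx _ hy).
have /andP[e2 _] := ival_range hh (hx _ hy').
lra.
Qed.

Lemma igrad_le_norm w (K : R) : (forall i j, w (p i) - w (p j) <= K * `|p i - p j|) ->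
  0 <= K -> n1 (igrad w) <= K * s / 2.
Proof.
move=> hw K0; have [h0 hd _] := sh.
have : n1 (igrad w) * (2 * (h / s)) <= K * h.
  apply: igrad_le => i j; apply: le_trans (hw i j) _.
  by rewrite ler_wpM2l// hd//; exact: tri_vertex.
rewrite [2 * _]mulrA -ler_pdivlMr; last by rewrite divr_gt0// mulr_gt0.
move=> /le_trans; apply; rewrite le_eqVlt; apply/orP; left; apply/eqP.
field; by rewrite !gt_eqF.
Qed.

Lemma igrad_delta i : igrad (fun x => (x == p i)%:R) = bgrad p i.
Proof.
rewrite /igrad (bigD1 i)//= eqxx scale1r big1 ?addr0// => j ji.
by rewrite (inj_eq vertex_inj) (negbTE ji) scale0r.
Qed.

Lemma bgrad_le i : n1 (bgrad p i) <= s / (2 * h).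
Proof.
have [h0 hd _] := sh.
rewrite -igrad_delta.
have := @igrad_le (fun x => (x == p i)%:R) 1.
move=> /(_ _)/wrap[].
  by move=> j k; case: eqP; case: eqP => _ _; rewrite ?subrr ?subr0 ?sub0r ?lerN10 ?ler01//=; lra.
rewrite mulrA -ler_pdivlMr; last by rewrite divr_gt0// mulr_gt0.
have -> : s / (2 * h) = 1 / (h / s) / 2 by field; rewrite !gt_eqF.
by move=> H; rewrite ler_pdivlMr.
Qed.

(** Along the edge the coordinate [bary p i] drops from 1 to 0, while its gradient is at most
    [s / (2 * h)]. *)
Lemma edge_ge i j : i != j -> 2 * h / s <= `|p i - p j|.
Proof.
move=> ij; have [h0 _ _] := sh.
have := dotp_le (bgrad p i) (p i - p j).
rewrite -baryB !bary_vertex eqxx (negbTE ij) subr0 normr1 => e.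
have e2 : 1 <= s / (2 * h) * `|p i - p j|.
  by apply: le_trans e _; rewrite ler_wpM2r// bgrad_le.
have c0 : 0 <= 2 * h / s by rewrite divr_ge0 ?mulr_ge0// ltW.
rewrite -[leLHS]mulr1; apply: le_trans (ler_wpM2l c0 e2) _.
have -> : 2 * h / s * (s / (2 * h) * `|p i - p j|) = `|p i - p j|; last by [].
by field; rewrite !gt_eqF.
Qed.

End nondeg.
End triangles.

(** * Meshes and interpolation *)

Section convex_open.
Context {R : realType}.
Implicit Types (x y z : R * R) (Om : set (R * R)).

Definition cvx Om := forall x y (t : R), Om x -> Om y -> 0 <= t <= 1 -> Om (x + t *: (y - x)).

Lemma segmentB x y (a b : R) : (x + a *: (y - x)) - (x + b *: (y - x)) = (a - b) *: (y - x).
Proof. by rewrite opprD addrACA subrr add0r scalerBl. Qed.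

Lemma closure_ex Om x (e : R) : closure Om x -> 0 < e -> exists2 y, Om y & `|y - x| < e.
Proof.
move=> cx e0; have [y [Oy xy]] := cx (ball x e) (nbhsx_ballx x e e0).
by exists y => //; rewrite distrC; move: xy; rewrite -ball_normE.
Qed.

Lemma in_closure Om x : (forall e : R, 0 < e -> exists2 y, Om y & `|y - x| < e) -> closure Om x.
Proof.
move=> h B /nbhs_ballP[e /= e0 eB]; have [y Oy xy] := h e e0.
by exists y; split => //; apply: eB; rewrite -ball_normE /= distrC.
Qed.

Lemma open_ex Om x : open Om -> Om x -> exists2 e : R, 0 < e & forall y, `|y - x| < e -> Om y.
Proof.
move=> oO Ox; have /nbhs_ballP[e /= e0 eO] := open_nbhs_nbhs (conj oO Ox).
by exists e => // y xy; apply: eO; rewrite -ball_normE /= distrC.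
Qed.

Lemma cvx_closure Om x y (t : R) : cvx Om -> closure Om x -> closure Om y -> 0 <= t <= 1 ->
  closure Om (x + t *: (y - x)).
Proof.
move=> cO cx cy t01; apply: in_closure => e e0.
have e2 : 0 < e / 2 by rewrite divr_gt0.
have [x' Ox' xx'] := closure_ex cx e2.
have [y' Oy' yy'] := closure_ex cy e2.
exists (x' + t *: (y' - x')); first exact: cO.
rewrite (_ : _ - _ = (1 - t) *: (x' - x) + t *: (y' - y)); last first.
  by rewrite !scalerBr !scalerBl !scale1r; case: x x' y y' {cx cy xx' yy' Ox' Oy'} => ? ? [? ?] [? ?] [? ?]; congr pair; rewrite /= /GRing.scale /=; ring.
apply: le_lt_trans (ler_normD _ _) _; rewrite !normrZ.
case/andP: t01 => t0 t1; rewrite !ger0_norm ?subr_ge0//.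
move: xx' yy'; move: (`|x' - x|) (`|y' - y|) => u v ? ?; nra.
Qed.

(** Replacing [y] by a close point [y'] of the set moves the other end to a point [x'] whose
    distance from [x] is only [t / (1 - t)] times the error, so that [x'] stays in a ball around [x]
    inside the set. *)
Lemma cvx_open_closure Om x y (t : R) : open Om -> cvx Om -> Om x -> closure Om y -> 0 <= t < 1 ->
  Om (x + t *: (y - x)).
Proof.
move=> oO cO Ox cy /andP[t0 t1].
have [r r0 hr] := open_ex oO Ox.
have d0 : 0 < r * (1 - t) by rewrite mulr_gt0// subr_gt0.
have [y' Oy' yy'] := closure_ex cy d0.
have t1' : 1 - t != 0 by rewrite gt_eqF// subr_gt0.
pose x' := x + (t / (1 - t)) *: (y - y').
have -> : x + t *: (y - x) = x' + t *: (y' - x').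
  rewrite /x'; case: x y y' {x' Ox cy yy' Oy' hr} => ? ? [? ?] [? ?]; congr pair;
  by rewrite /= /GRing.scale /=; field.
apply: cO => //; last by rewrite t0 ltW.
apply: hr; rewrite /x' addrC addKr normrZ distrC ger0_norm; last first.
  by rewrite divr_ge0// subr_ge0 ltW.
rewrite mulrAC ltr_pdivrMr ?subr_gt0//.
have := normr_ge0 (y' - y); move: yy'; move: (`|y' - y|) => u ? ?; nra.
Qed.

End convex_open.

Record is_mesh (R : realType) (Om : set (R * R)) (n : nat) (p : 'I_n -> 'I_3 -> R * R)
    (s : R) (h : 'I_n -> R) : Prop := IsMesh {
  mesh_open : open Om;
  mesh_cvx : cvx Om;
  mesh_s : 0 < s;
  mesh_nondeg : forall j, area2 (p j) != 0;
  mesh_cover : closure Om = \bigcup_(j in [set: 'I_n]) tri (p j);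
  mesh_inj : forall j k, tri (p j) = tri (p k) -> j = k;
  (* a point common to two triangles is a convex combination of common vertices *)
  mesh_conform : forall j k x, tri (p j) x -> tri (p k) x ->
    forall i, bary (p j) i x != 0 -> exists l, p k l = p j i;
  mesh_shape : forall j, shape (p j) s (h j)
}.

Section mesh.
Context {R : realType} (Om : set (R * R)) (n : nat) (p : 'I_n -> 'I_3 -> R * R)
    (s : R) (h : 'I_n -> R).
Hypothesis M : is_mesh Om p s h.
Implicit Types (x y z g : R * R) (w : R * R -> R) (i : 'I_3) (j k : 'I_n).

Let pn := mesh_nondeg M.
Let s0 := mesh_s M.

Lemma h_gt0 j : 0 < h j.
Proof. by case: (mesh_shape M j). Qed.

Lemma tri_diam j x y : tri (p j) x -> tri (p j) y -> `|x - y| <= h j.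
Proof. by case: (mesh_shape M j) => _ + _; exact. Qed.

Lemma tri_sub j : tri (p j) `<=` closure Om.
Proof. by move=> x hx; rewrite (mesh_cover M); exists j. Qed.

(** The triangles are finitely many closed sets, so those that miss [x] stay away from a
    neighbourhood of it. *)
Lemma near_tri x : exists2 d : R, 0 < d & forall y, `|y - x| < d -> forall j, tri (p j) y -> tri (p j) x.
Proof.
have : \forall y \near x, forall j, tri (p j) y -> tri (p j) x.
  apply: (@filter_forall _ _ (fun j y => tri (p j) y -> tri (p j) x) (nbhs x)) => j.
  have [hx|hx] := pselect (tri (p j) x).
    by apply: filterE.
  have : open (~` tri (p j)) by apply: closed_openC; exact: tri_closed.
  move=> oT; have := open_nbhs_nbhs (conj oT hx).
  by apply: filterS => y.
move=> /nbhs_ballP[d /= d0 hd]; exists d => // y xy; apply: hd.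
by rewrite -ball_normE /= distrC.
Qed.

(** Conformity makes [x] a convex combination of vertices shared by both triangles, and both affine
    functions take the values of [w] there. *)
Lemma ival_consistent j k w x : tri (p j) x -> tri (p k) x ->
  ival (p j) w x = ival (p k) w x.
Proof.
move=> xj xk.
rewrite -{2}(sum_bary_vertex (pn j) x) ival_affine ?(sum_bary (pn j))//.
rewrite {1}/ival; apply: eq_bigr => i _.
have [->|/(mesh_conform M xj xk) [l <-]] := eqVneq (bary (p j) i x) 0; first by rewrite !mul0r.
by rewrite ival_vertex.
Qed.

Lemma vertex_mem j k i : tri (p k) (p j i) -> exists l, p k l = p j i.
Proof.
move=> hk; have hj := tri_vertex (pn j) i.
by apply: (mesh_conform M hj hk); rewrite bary_vertex// eqxx oner_eq0.
Qed.

(** Otherwise the ray from [p j i] through [x] could be prolonged inside the triangle, placing [x]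
    on a half-open segment from a point of the open convex set to a point of its closure, hence in
    the set. So boundary points involve boundary vertices only. *)
Lemma vertex_notin j i x : tri (p j) x -> ~ Om x -> bary (p j) i x != 0 -> ~ Om (p j i).
Proof.
move=> xj nx r0 Oi; set r := bary (p j) i x in r0.
have rpos : 0 < r by rewrite lt_neqAle eq_sym r0 /r xj.
have [r1|r1] := eqVneq r 1.
  apply: nx; suff -> : x = p j i by [].
  have hz (k : 'I_3) : k != i -> bary (p j) k x = 0.
    have := sum_bary (pn j) x; rewrite (bigD1 i)//= -/r r1 => /eqP.
    rewrite -[X in _ == X]addr0 (inj_eq (addrI _)) psumr_eq0; last by move=> l _; exact: xj.
    by move=> /allP H ki; apply/eqP; have := H k (mem_index_enum _); rewrite ki.
  rewrite -[x](sum_bary_vertex (pn j)) (bigD1 i)//= -/r r1 scale1r big1 ?addr0// => k ki.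
  by rewrite hz// scale0r.
have rlt1 : r < 1.
  have q0 : 0 <= \sum_(k | k != i) bary (p j) k x by apply: sumr_ge0 => k _; exact: xj.
  by have := sum_bary (pn j) x; rewrite (bigD1 i)//= -/r => q1; rewrite lt_neqAle r1 /=; lra.
have r1n : 1 - r != 0 by rewrite gt_eqF// subr_gt0.
(* The prolongation up to the opposite side, where the coordinate [i] is 0. *)
pose y := x + (r / (1 - r)) *: (x - p j i).
have yj : tri (p j) y.
  move=> k; rewrite (baryE (p j) k y x) /y (_ : x + _ - x = (r / (1 - r)) *: (x - p j i)); last first.
    by rewrite addrC addKr.
  rewrite dotpZ -baryB bary_vertex//.
  have [->|ki] := eqVneq k i.
    rewrite -[bary (p j) i x]/r (_ : true%:R = 1 :> R)//.
    by rewrite (_ : r + _ = 0)//; field.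
  apply: addr_ge0; first exact: xj.
  by apply: mulr_ge0; [rewrite divr_ge0 ?subr_ge0 ?ltW|rewrite subr0; exact: xj].
apply: nx; have -> : x = p j i + (1 - r) *: (y - p j i).
  rewrite /y; case: (x) (p j i) => ? ? [? ?]; congr pair; rewrite /= /GRing.scale /=; field; exact: r1n.
apply: cvx_open_closure (mesh_open M) (mesh_cvx M) Oi (tri_sub yj) _.
by rewrite subr_ge0 (ltW rlt1) /= ltrBlDr ltrDl.
Qed.

(** Discrete functions are represented by arbitrary functions on the plane of which only the values
    at the vertices count; this is the Dirichlet condition at that level. *)
Definition bdry0 w := forall j i, ~ Om (p j i) -> w (p j i) = 0.

Lemma ival_out j w x : bdry0 w -> tri (p j) x -> ~ Om x -> ival (p j) w x = 0.
Proof.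
move=> w0 xj nx; rewrite /ival big1// => i _.
have [->|hi] := eqVneq (bary (p j) i x) 0; first by rewrite mul0r.
by rewrite (w0 _ _ (vertex_notin xj nx hi)) mulr0.
Qed.

(** The choice of the triangle is immaterial by [ival_consistent]; off the closure the function is
    extended by 0. *)
Definition interp w x : R :=
  if [pick j | `[< tri (p j) x >]] is Some j then ival (p j) w x else 0.

Lemma interpE j w x : tri (p j) x -> interp w x = ival (p j) w x.
Proof.
move=> xj; rewrite /interp; case: pickP => [k /asboolP xk|/(_ j)].
  exact: ival_consistent.
by rewrite asboolT.
Qed.

Lemma interp_notin w x : ~ closure Om x -> interp w x = 0.
Proof.
move=> nx; rewrite /interp; case: pickP => // k /asboolP xk.
by exfalso; apply: nx; exact: tri_sub xk.
Qed.

Lemma interp_out w x : bdry0 w -> ~ Om x -> interp w x = 0.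
Proof.
move=> w0 nx; have [|] := pselect (closure Om x); last exact: interp_notin.
by rewrite (mesh_cover M) => -[j _ xj]; rewrite (interpE w xj) (ival_out w0 xj nx).
Qed.

Lemma interp_vertex w j i : interp w (p j i) = w (p j i).
Proof. by rewrite (interpE w (tri_vertex (pn j) i)) ival_vertex. Qed.

Lemma interpB j w x y : tri (p j) x -> tri (p j) y ->
  interp w x - interp w y = dotp (igrad (p j) w) (x - y).
Proof. by move=> xj yj; rewrite (interpE w xj) (interpE w yj) ivalB. Qed.

(** By [creep]: near a parameter the segment meets only triangles containing the current point, and
    on each of them the interpolant is affine. Outside the domain it vanishes if [bdry0] holds; if
    both ends lie in the closure, convexity keeps the segment there. *)
Lemma interp_segment w x y (Phi : R -> R) :
  bdry0 w \/ (closure Om x /\ closure Om y) ->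
  (forall t t', 0 <= t -> t <= t' -> t' <= 1 -> Phi t <= Phi t') ->
  (forall j t t', 0 <= t -> t <= t' -> t' <= 1 ->
    tri (p j) (x + t *: (y - x)) -> tri (p j) (x + t' *: (y - x)) ->
    n1 (igrad (p j) w) * ((t' - t) * `|y - x|) <= Phi t' - Phi t) ->
  `|interp w y - interp w x| <= Phi 1 - Phi 0.
Proof.
move=> alt mono H; pose u t := x + t *: (y - x).
have -> : y = u 1 by rewrite /u scale1r addrC subrK.
have -> : interp w x = interp w (u 0) by rewrite /u scale0r addr0.
apply: (@creep _ (fun t => interp w (u t)) Phi 0 1) => // t /andP[t0 t1].
have uB a b : u a - u b = (a - b) *: (y - x) by exact: segmentB.
have inj j a b : 0 <= a <= 1 -> 0 <= b <= 1 -> tri (p j) (u a) -> tri (p j) (u b) ->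
    `|interp w (u a) - interp w (u b)| <= `|Phi a - Phi b|.
  wlog : a b / a <= b.
    move=> W a01 b01 ha hb; have [ab|ba] := leP a b; first exact: W.
    by rewrite distrC [leRHS]distrC; apply: W => //; exact: ltW.
  move=> ab /andP[a0 a1] /andP[b0 b1] ha hb.
  rewrite (interpB w ha hb) [leRHS]distrC [leRHS]ger0_norm; last by rewrite subr_ge0 mono.
  apply: le_trans (dotp_le _ _) _; rewrite uB normrZ distrC ger0_norm ?subr_ge0//.
  exact: H.
have [d1 d10 hd1] := near_tri (u t).
have [d2 d20 hd2] : exists2 d, 0 < d & forall z, `|z - u t| < d -> Om (u t) -> Om z.
  have [Ot|nOt] := pselect (Om (u t)).
    by have [d d0 hd] := open_ex (mesh_open M) Ot; exists d => // z zd _; exact: hd.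
  by exists 1.
have L0 : 0 < `|y - x| + 1 by rewrite ltr_wpDl.
exists (Num.min d1 d2 / (`|y - x| + 1)); first by rewrite divr_gt0// lt_min d10.
move=> t' /andP[t'0 t'1]; rewrite ltr_pdivlMr// => tt'.
have : `|u t' - u t| < Num.min d1 d2.
  apply: le_lt_trans tt'; rewrite uB normrZ ler_wpM2l//; lra.
rewrite lt_min => /andP[td1 td2].
have [|nc] := pselect (closure Om (u t')).
  rewrite (mesh_cover M) => -[j _ ht'].
  have ht := hd1 _ td1 j ht'.
  by apply: (inj j) => //; apply/andP.
case: alt => [w0|[cx cy]]; last first.
  by exfalso; apply: nc; apply: (cvx_closure (mesh_cvx M)) => //; apply/andP.
have nt' : ~ Om (u t') by move=> /subset_closure.
have nt : ~ Om (u t) by move=> /(hd2 _ td2).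
by rewrite !interp_out// subrr normr0.
Qed.

Lemma interp_lip w (K : R) x y : bdry0 w \/ (closure Om x /\ closure Om y) ->
  (forall j, n1 (igrad (p j) w) <= K) -> 0 <= K ->
  `|interp w y - interp w x| <= K * `|y - x|.
Proof.
move=> alt hK K0.
have := @interp_segment w x y (fun t => K * (t * `|y - x|)) alt.
rewrite mul1r mul0r mulr0 subr0; apply.
  by move=> t t' t0 tt' t1; rewrite ler_wpM2l// ler_wpM2r.
move=> j t t' t0 tt' t1 _ _; rewrite -mulrBr -mulrBl ler_wpM2r//.
by rewrite mulr_ge0// subr_ge0.
Qed.

(** A square of side [2 * h j / s] fits into a triangle of diameter at most [h j]. *)
Lemma s_ge2 (j : 'I_n) : 2 <= s.
Proof.
have h0 := h_gt0 j; have [_ hd [x hx]] := mesh_shape M j.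
have r0 : 0 < h j / s by rewrite divr_gt0.
pose e : R * R := (h j / s, h j / s).
have ne : `|e| = h j / s by rewrite norm_pair /= maxxx gtr0_norm.
have := hd _ _ (hx (x + e) _) (hx (x - e) _).
rewrite ![x + _]addrC !addrK normrN ne => /(_ (lexx _) (lexx _)).
rewrite (_ : e + x - (- e + x) = 2 *: e); last by rewrite opprD opprK addrACA subrr addr0 scaler_nat mulr2n.
rewrite normrZ ne ger0_norm// mulrA ler_pdivrMr//.
by rewrite mulrC ler_pM2l.
Qed.

Lemma bgrad_neq0 j i : ((bgrad (p j) i).1 != 0) || ((bgrad (p j) i).2 != 0).
Proof.
rewrite -negb_and; apply/negP => /andP[/eqP g1 /eqP g2].
have := baryB (p j) i (p j i) (p j (nxt i)).
rewrite !bary_vertex// eqxx /dotp g1 g2 !mul0r addr0 => /eqP.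
by move: i g1 g2; apply: ord3P => _ _; rewrite /= subr0 oner_eq0.
Qed.

(** The exceptional set consists of the finitely many lines carrying the sides; off it, no two
    triangles meet ([tri_uniq]). *)
Lemma ae_bary_neq0 : {ae lam, forall x : plane R, forall j i, bary (p j) i x != 0}.
Proof.
have H (ji : 'I_n * 'I_3) : \forall x \ae lam, bary (p ji.1) ji.2 (x : R * R) != 0.
  have := lam_line (- bary (p ji.1) ji.2 0) (bgrad_neq0 ji.1 ji.2).
  apply: negligibleS => x /= /negP; rewrite negbK => /eqP b0.
  have := baryE (p ji.1) ji.2 x 0; rewrite b0 subr0 /dotp => /esym/eqP.
  by rewrite addrC addr_eq0 => /eqP.
have FF : Filter (almost_everywhere (@lam R)) by typeclasses eauto.
have := @filter_forall _ _ (fun (ji : 'I_n * 'I_3) (x : plane R) =>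
  bary (p ji.1) ji.2 (x : R * R) != 0) (almost_everywhere lam) FF H.
by apply: filterS => x hx j i; exact: (hx (j, i)).
Qed.

Lemma tri_subset j k : (forall i, exists l, p k l = p j i) -> tri (p j) `<=` tri (p k).
Proof.
move=> hv x xj; rewrite -(sum_bary_vertex (pn j) x).
apply: tri_conv; [exact: sum_bary|exact: xj|].
by move=> i; have [l <-] := hv i; exact: tri_vertex.
Qed.

(** As all coordinates are nonzero, conformity makes the triangles share all three vertices. *)
Lemma tri_uniq j k x : (forall j i, bary (p j) i x != 0) ->
  tri (p j) x -> tri (p k) x -> j = k.
Proof.
move=> hb xj xk; apply: (mesh_inj M); apply/seteqP; split; apply: tri_subset => i.
  exact: (mesh_conform M xj xk).
exact: (mesh_conform M xk xj).
Qed.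

Lemma measurable_tri j : measurable (tri (p j) : set (plane R)).
Proof. by apply: closed_measurable2; exact: tri_closed. Qed.

(** Almost every point lies in at most one triangle, so the indicators of the [B j] add up to at
    most that of [C]. *)
Lemma sum_lam_le (Z : {set 'I_n}) (B : 'I_n -> set (plane R)) (C : set (plane R)) :
  (forall j, measurable (B j)) -> measurable C ->
  (forall j, j \in Z -> B j `<=` tri (p j) `&` C) ->
  (\sum_(j in Z) lam (B j) <= lam C)%E.
Proof.
move=> mB mC BC.
have mI D : measurable D -> measurable_fun setT (fun x : plane R => (\1_D x)%:E : \bar R).
  by move=> mD; apply/measurable_EFinP; exact: measurable_indic.
have E D : measurable D -> lam D = (\int[lam]_x (\1_D x)%:E)%E :> \bar R.
  by move=> mD; rewrite integral_indic// setIT.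
rewrite (E C)//; under eq_bigr do rewrite E//.
rewrite big_mkcond /=.
pose F j (x : plane R) : \bar R := if j \in Z then (\1_(B j) x)%:E else 0%E.
have F0 j x : (0 <= F j x)%E by rewrite /F; case: ifP => // _; rewrite lee_fin.
have mF j : measurable_fun setT (F j).
  rewrite /F; case: (j \in Z); [exact: mI|exact: measurable_cst].
rewrite (_ : (\sum_j _)%E = (\sum_(j <- index_enum 'I_n) \int[lam]_x F j x)%E); last first.
  by apply: eq_bigr => j _; rewrite /F; case: ifP => // _; rewrite integral0.
rewrite -ge0_integral_sum//.
apply: ae_ge0_le_integral => //.
- by move=> x _; apply: sume_ge0.
- exact: emeasurable_sum.
- exact: mI.
apply: filterS ae_bary_neq0 => x hx _.
have [Z0|] := pselect (forall j, F j x = 0%E).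
  by rewrite big1 ?lee_fin.
move=> /existsNP[j Fj].
have jx k : F k x <> 0%E -> [/\ k \in Z & B k x].
  rewrite /F; case: ifP => // kZ; rewrite indicE; case: (boolP (x \in B k)) => //.
  by rewrite inE.
have [jZ Bj] := jx j Fj; have [Tj Cx] := BC j jZ _ Bj.
rewrite (bigD1 j)//= big1 ?adde0.
  by rewrite /F jZ !indicE lee_fin (mem_set Cx); case: (_ \in _).
move=> k kj; apply/eqP/negP => /negP Fk.
have [kZ Bk] := jx k (elimN eqP Fk); have [Tk _] := BC k kZ _ Bk.
by move: kj; rewrite (tri_uniq hx Tk Tj) eqxx.
Qed.

Lemma h_lb : exists2 e : R, 0 < e & forall j, e <= h j.
Proof.
have [j0|n0] := pselect (exists j : 'I_n, True); last first.
  by exists 1 => // j; case: n0; exists j.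
case: j0 => j0 _; case: (arg_minP h (isT : xpredT j0)) => j _ hj.
by exists (h j); [exact: h_gt0|move=> k; exact: hj].
Qed.

Lemma lam_tri_ge j : (((2 * (h j / s)) ^+ 2)%:E <= lam (tri (p j) : set (plane R)))%E.
Proof.
have h0 := h_gt0 j; have [_ hd [x hx]] := mesh_shape M j.
have r0 : 0 <= h j / s by rewrite divr_ge0// ltW.
rewrite -(lam_ball x r0); apply: le_measure; rewrite ?inE.
- by apply: open_measurable2; exact: ball_open_nbhs.1 || exact: ball_open.
- exact: measurable_tri.
- by move=> y; rewrite -ball_normE /= distrC => /ltW; exact: hx.
Qed.

Lemma lam_tri_le j : (lam (tri (p j) : set (plane R)) <= ((4 * h j) ^+ 2)%:E)%E.
Proof.
have h0 := h_gt0 j.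
have r0 : 0 <= 2 * h j by rewrite mulr_ge0// ltW.
rewrite (_ : 4 * h j = 2 * (2 * h j)); last by ring.
rewrite -(lam_ball (p j o0) r0); apply: le_measure; rewrite ?inE.
- exact: measurable_tri.
- by apply: open_measurable2; exact: ball_open.
- move=> y yj; rewrite -ball_normE /=.
  by apply: le_lt_trans (tri_diam (tri_vertex (pn j) o0) yj) _; lra.
Qed.

(* Rescaling the inscribed squares of the triangles at [z] to a common size. *)
Lemma card_star z (Z : {set 'I_n}) : (forall j, j \in Z -> tri (p j) z) ->
  #|Z|%:R <= (1 + 2 * s) ^+ 2.
Proof.
move=> hZ; have [e e0 he] := h_lb.
have hc j : exists x, forall y, `|y - x| <= h j / s -> tri (p j) y.
  by case: (mesh_shape M j).
pose x j := sval (cid (hc j)); have hx j : forall y, `|y - x j| <= h j / s -> tri (p j) y.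
  exact: svalP (cid (hc j)).
pose c j := z + (e / h j) *: (x j - z).
have es0 : 0 <= e / s by rewrite divr_ge0// ltW.
have C0 : 0 <= e / s + 2 * e by rewrite addr_ge0// mulr_ge0// ltW.
have mb y (r : R) : measurable (ball y r : set (plane R)).
  by apply: open_measurable2; exact: ball_open.
have := @sum_lam_le Z (fun j => ball (c j) (e / s)) (ball z (e / s + 2 * e)).
have sub j : j \in Z -> ball (c j) (e / s) `<=` tri (p j) `&` ball z (e / s + 2 * e).
  move=> jZ y; rewrite -!ball_normE /= distrC => yc; have hj := h_gt0 j.
  have t0 : 0 < e / h j by rewrite divr_gt0.
  have t1 : e / h j <= 1 by rewrite ler_pdivrMr// mul1r.
  split.
    pose y' := z + (h j / e) *: (y - z).
    have -> : y = z + (e / h j) *: (y' - z).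
      rewrite /y' [z + _ - z]addrC addKr scalerA (_ : _ * _ = 1) ?scale1r.
        by rewrite addrC subrK.
      by field; rewrite !gt_eqF.
    apply: tri_segment => //; first by rewrite ltW.
      exact: hZ.
    apply: hx.
    have -> : y' - x j = (h j / e) *: (y - c j).
      rewrite /y' /c; case: (z) (y) (x j) => ? ? [? ?] [? ?].
      by congr pair; rewrite /= /GRing.scale /=; field; rewrite !gt_eqF.
    rewrite normrZ ger0_norm ?divr_ge0 ?(ltW hj) ?(ltW e0)//.
    rewrite (_ : h j / s = h j / e * (e / s)); last by field; rewrite !gt_eqF.
    by rewrite ler_wpM2l ?divr_ge0 ?(ltW hj) ?(ltW e0)// ltW.
  have : `|c j - z| <= e.
    rewrite /c addrC addKr normrZ ger0_norm ?(ltW t0)// mulrAC ler_pdivrMr// ler_wpM2l ?(ltW e0)//.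
    apply: (@tri_diam j); last exact: hZ.
    by apply: hx; rewrite subrr normr0 divr_ge0// ltW.
  have := ler_normD (y - c j) (c j - z).
  rewrite (_ : y - c j + (c j - z) = y - z); last by rewrite addrA subrK.
  rewrite [`|z - y|]distrC; lra.
move=> /(_ (fun j => mb _ _) (mb _ _) sub).
under eq_bigr do rewrite lam_ball//.
rewrite lam_ball// sumEFin lee_fin sumr_const -[_ *+ #|Z|]mulr_natl.
have -> : (2 * (e / s + 2 * e)) ^+ 2 = (1 + 2 * s) ^+ 2 * (2 * (e / s)) ^+ 2.
  by field; rewrite gt_eqF.
by rewrite ler_pM2r// exprn_gt0// mulr_gt0// divr_gt0.
Qed.

Definition nb j k := exists i l, p j i = p k l.

(** A common point other than [z] has a nonzero coordinate at a second vertex, which conformity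
    shares; the common edge is at least [2 * h j / s] and at most [h k] long. *)
Lemma nb_edge j k z x : tri (p j) z -> tri (p k) z -> tri (p j) x -> tri (p k) x -> x != z ->
  (exists i, p j i = z) -> h j <= s * h k.
Proof.
move=> zj zk xj xk xz [i iz].
have [i' i'i bi'] : exists2 i', i' != i & bary (p j) i' x != 0.
  have [//|H] := pselect (exists2 i', i' != i & bary (p j) i' x != 0).
  case/eqP: xz; rewrite -iz.
  have hz (l : 'I_3) : l != i -> bary (p j) l x = 0.
    by move=> li; apply/eqP/negP => /negP bl; apply: H; exists l.
  have bi1 : bary (p j) i x = 1.
    by rewrite -(sum_bary (pn j) x) (bigD1 i)//= big1 ?addr0// => l li; rewrite hz.
  rewrite -[LHS](sum_bary_vertex (pn j)) (bigD1 i)//= bi1 scale1r big1 ?addr0// => l li.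
  by rewrite hz// scale0r.
have [l el] := mesh_conform M xj xk bi'.
have [l' el'] : exists l', p k l' = p j i by apply: vertex_mem; rewrite iz.
have e := edge_ge (pn j) s0 (mesh_shape M j) i'i.
have e2 : `|p j i' - p j i| <= h k by rewrite -el -el'; apply: (@tri_diam k); exact: tri_vertex.
have := le_trans e e2; rewrite ler_pdivrMr// mulrC => h2; have := h_gt0 j; lra.
Qed.

(** The star of [z] is connected through edges. A short segment that avoids [z] and leads from a
    triangle in [S] to one outside stays in triangles at [z]; by connectedness one of its points
    lies in triangles of both kinds, and [nb_edge] applies there. *)
Lemma star_step z (S : {set 'I_n}) j1 k1 : (exists i, p j1 i = z) -> (exists i, p k1 i = z) ->
  j1 \in S -> k1 \notin S ->
  exists j k, [/\ j \in S, k \notin S, tri (p j) z, tri (p k) z & h k <= s * h j].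
Proof.
move=> [i1 z1] [i2 z2] jS kS.
have zj : tri (p j1) z by rewrite -z1; exact: tri_vertex.
have zk : tri (p k1) z by rewrite -z2; exact: tri_vertex.
have [d d0 hd] := near_tri z.
pose c := p k1 (nxt i2) - z.
have c0 : c != 0.
  rewrite subr_eq0 -z2; apply/eqP => /(vertex_inj (pn k1)).
  by clear; move: i2; apply: ord3P.
(* Of the two edges of [j1] at [z] at least one is not parallel to [c]; this makes the segment from
   [z + t a] to [z + t c] miss [z]. *)
have [a aj ac] : exists2 a, tri (p j1) (z + a) & cross a c != 0.
  pose a1 := p j1 (nxt i1) - z; pose a2 := p j1 (nxt (nxt i1)) - z.
  have a12 : cross a1 a2 = area2 (p j1).
    rewrite /a1 /a2 -z1 /area2 /cross; clear; move: i1; apply: ord3P => /=; ring.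
  have [e1|n1_] := eqVneq (cross a1 c) 0; last first.
    by exists a1 => //; rewrite /a1 addrC subrK; exact: tri_vertex.
  have [e2|n2_] := eqVneq (cross a2 c) 0; last first.
    by exists a2 => //; rewrite /a2 addrC subrK; exact: tri_vertex.
  have := pn j1; rewrite -a12; case/eqP.
  have c12 : (c.1 != 0) || (c.2 != 0).
    rewrite -negb_and; apply: contra c0 => /andP[/eqP h1 /eqP h2].
    by apply/eqP; rewrite (surjective_pairing c) h1 h2.
  move: e1 e2; rewrite /cross => e1 e2.
  have m1 : c.1 * (a1.1 * a2.2 - a1.2 * a2.1) = 0.
    have -> : c.1 * (a1.1 * a2.2 - a1.2 * a2.1) = a2.1 * (a1.1 * c.2 - a1.2 * c.1) - a1.1 * (a2.1 * c.2 - a2.2 * c.1) by ring.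
    by rewrite e1 e2 !mulr0 subr0.
  have m2 : c.2 * (a1.1 * a2.2 - a1.2 * a2.1) = 0.
    have -> : c.2 * (a1.1 * a2.2 - a1.2 * a2.1) = a2.2 * (a1.1 * c.2 - a1.2 * c.1) - a1.2 * (a2.1 * c.2 - a2.2 * c.1) by ring.
    by rewrite e1 e2 !mulr0 subr0.
  by move/eqP: m1; move/eqP: m2; rewrite !mulf_eq0; case/orP: c12 => /negbTE -> /= => [_ /eqP|/eqP].
pose t := Num.min 1 (d / (2 * (`|a| + `|c| + 1))).
have L0 : 0 < 2 * (`|a| + `|c| + 1) by rewrite mulr_gt0// ltr_wpDl// addr_ge0.
have t0 : 0 < t by rewrite lt_min ltr01 divr_gt0.
have t1 : t <= 1 by rewrite ge_min lexx.
have td : t * (2 * (`|a| + `|c| + 1)) <= d by rewrite -ler_pdivlMr// ge_min lexx orbT.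
pose x := z + t *: a; pose y := z + t *: c.
have xj : tri (p j1) x.
  have := @tri_segment _ (p j1) z (z + a) t.
  by rewrite [z + a - z]addrC addKr; apply; rewrite ?(ltW t0).
have yk : tri (p k1) y.
  have := @tri_segment _ (p k1) z (p k1 (nxt i2)) t.
  by apply; rewrite ?(ltW t0)//; exact: tri_vertex.
pose u r := x + r *: (y - x).
have ucl r : 0 <= r <= 1 -> closure Om (u r).
  by move=> r01; apply: (cvx_closure (mesh_cvx M)) => //; [exact: tri_sub xj|exact: tri_sub yk].
have uz r : 0 <= r <= 1 -> `|u r - z| < d.
  move=> /andP[r0 r1]; rewrite /u /x /y.
  rewrite (_ : _ - z = t *: ((1 - r) *: a + r *: c)); last first.
    by case: (z) (a) (c) => ? ? [? ?] [? ?]; congr pair; rewrite /= /GRing.scale /=; ring.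
  rewrite normrZ (ger0_norm (ltW t0)).
  have h1 : `|(1 - r) *: a + r *: c| <= `|a| + `|c|.
    apply: le_trans (ler_normD _ _) _; rewrite !normrZ !ger0_norm ?subr_ge0//.
    have := normr_ge0 a; have := normr_ge0 c; move: (`|a|) (`|c|) => *; nra.
  apply: (@le_lt_trans _ _ (t * (`|a| + `|c|))); first by rewrite ler_wpM2l// ltW.
  apply: lt_le_trans td; rewrite ltr_pM2l//; have := normr_ge0 a; have := normr_ge0 c; lra.
have unz r : 0 <= r <= 1 -> u r != z.
  move=> /andP[r0 r1]; apply/eqP => urz.
  have e : (1 - r) *: a + r *: c = 0.
    have : t *: ((1 - r) *: a + r *: c) = 0.
      have -> : t *: ((1 - r) *: a + r *: c) = u r - z; last by rewrite urz subrr.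
      rewrite /u /x /y; case: (z) (a) (c) => ? ? [? ?] [? ?]; congr pair; rewrite /= /GRing.scale /=; ring.
    by move/eqP; rewrite scaler_eq0 (gt_eqF t0) => /eqP.
  have [r1'|r1'] := eqVneq r 1.
    by move: e; rewrite r1' subrr scale0r add0r scale1r => /eqP; rewrite (negbTE c0).
  have : (1 - r) * cross a c = 0.
    have -> : (1 - r) * cross a c = cross ((1 - r) *: a + r *: c) c.
      by rewrite /cross /= /GRing.scale /=; ring.
    by rewrite e /cross /= !mul0r subrr.
  by move/eqP; rewrite mulf_eq0 (negbTE ac) orbF subr_eq0 eq_sym (negbTE r1').
pose inS r := `[< exists2 j, j \in S & tri (p j) (u r) >].
pose inN r := `[< exists2 k, k \notin S & tri (p k) (u r) >].
have cover r : 0 <= r <= 1 -> inS r || inN r.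
  move=> /ucl; rewrite (mesh_cover M) => -[k _ ku].
  have [kS'|kS'] := boolP (k \in S); apply/orP; [left|right]; by apply/asboolP; exists k.
have [[r r01 /andP[/asboolP[j jS' uj] /asboolP[k kS' uk]]]|none] :=
    pselect (exists2 r, 0 <= r <= 1 & inS r && inN r).
  have zj' : tri (p j) z by exact: hd (uz r r01) _ uj.
  have zk' : tri (p k) z by exact: hd (uz r r01) _ uk.
  exists j, k; split => //.
  apply: (@nb_edge k j z (u r)) => //; first exact: unz.
  by rewrite -z1; apply: vertex_mem; rewrite z1.
exfalso.
(* If no point belonged to both kinds of triangles, the indicator of the kind in [S] would be
   locally constant along the segment, yet change from 1 to 0. *)
pose w r : R := if inS r then 1 else 0.
have : `|w 1 - w 0| <= 0 - 0.
  apply: (@creep _ w (fun _ => 0) 0 1) => // r r01.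
  have [d1 d10 hd1] := near_tri (u r).
  have L1 : 0 < `|y - x| + 1 by rewrite ltr_wpDl.
  exists (d1 / (`|y - x| + 1)); first by rewrite divr_gt0.
  move=> r' r'01; rewrite ltr_pdivlMr// => rr'.
  have ud : `|u r' - u r| < d1.
    apply: le_lt_trans rr'; rewrite segmentB normrZ ler_wpM2l//; lra.
  rewrite subrr normr0 normr_le0 subr_eq0; apply/eqP; rewrite /w.
  case: ifPn => [/asboolP[j jS' uj]|nS].
    by rewrite ifT//; apply/asboolP; exists j => //; exact: hd1 uj.
  have := cover r' r'01; rewrite (negbTE nS) /= => /asboolP[k kS' uk].
  have nr : inN r by apply/asboolP; exists k => //; exact: hd1 uk.
  rewrite ifN//; apply/negP => Sr; apply: none; exists r => //.
  by rewrite Sr nr.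
have -> : w 0 = 1.
  rewrite /w ifT//; apply/asboolP; exists j1 => //.
  by rewrite /u scale0r addr0.
have N1 : inN 1.
  by apply/asboolP; exists k1 => //; rewrite /u scale1r addrC subrK.
have -> : w 1 = 0.
  rewrite /w ifN//; apply/negP => S1; apply: none; exists 1; first by rewrite ler01 lexx.
  by rewrite S1 N1.
by rewrite sub0r normrN normr1 subr0 ler10.
Qed.

(** At most [(1 + 2 * s) ^+ 2] triangles meet at a node, and passing to an adjacent one costs a
    factor [s]. *)
Definition kappa : R := s ^+ (Num.bound ((1 + 2 * s) ^+ 2)).

Lemma star_comparable z j k : (exists i, p j i = z) -> (exists i, p k i = z) ->
  h k <= kappa * h j.
Proof.
move=> zj zk; have s2 := s_ge2 j.
have s1 : 1 <= s by lra.
pose Z := [set l : 'I_n | `[< tri (p l) z >]]%SET.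
have vZ l : l \in Z -> exists i, p l i = z.
  rewrite inE => /asboolP lz; case: zj => i iz; rewrite -iz; apply: vertex_mem.
  by rewrite iz.
have jZ : j \in Z by rewrite inE; apply/asboolP; case: zj => i <-; exact: tri_vertex.
have kZ : k \in Z by rewrite inE; apply/asboolP; case: zk => i <-; exact: tri_vertex.
(* [S] grows from [j] by one triangle at a time until it exhausts the star; each step multiplies the
   bound on the sizes by [s]. *)
have grow m : exists S : {set 'I_n}, [/\ S \subset Z, j \in S, (S = Z) \/ (m < #|S|)%N &
    forall l, l \in S -> h l <= s ^+ m * h j].
  elim: m => [|m [S [SZ jS [SE|mS] hS]]].
  - exists [set j]%SET; split; [by rewrite finset.sub1set|by rewrite inE|by right; rewrite cards1|].
    by move=> l; rewrite inE => /eqP ->; rewrite mul1r.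
  - exists S; split => //; first by left.
    move=> l /hS /le_trans; apply; rewrite ler_wpM2r ?(ltW (h_gt0 j))//.
    by rewrite ler_weXn2l.
  - have [E|nE] := eqVneq S Z.
      exists S; split => //; first by left.
      move=> l /hS /le_trans; apply; rewrite ler_wpM2r ?(ltW (h_gt0 j))//.
      by rewrite ler_weXn2l.
    have /properP[_ [l0 l0Z l0S]] : S \proper Z by rewrite finset.properEneq nE.
    have [j' [k' [j'S k'S j'z k'z hk]]] := star_step zj (vZ _ l0Z) jS l0S.
    exists (k' |: S)%SET; split.
    + by rewrite finset.subUset finset.sub1set SZ andbT inE; apply/asboolP.
    + by rewrite !inE jS orbT.
    + by right; rewrite cardsU1 k'S.
    move=> l; rewrite !inE => /orP[/eqP ->|lS].
      apply: le_trans hk _; rewrite exprS -mulrA ler_wpM2l//; first lra.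
      exact: hS.
    apply: le_trans (hS _ lS) _; rewrite ler_wpM2r ?(ltW (h_gt0 j))//.
    by rewrite ler_weXn2l.
have [S [SZ jS hm hS]] := grow (Num.bound ((1 + 2 * s) ^+ 2)).
apply: hS; case: hm => [->//|hm].
have := @card_star z S.
move=> /(_ _)/wrap[l lS|cS].
  by have := fintype.subsetP SZ l lS; rewrite inE => /asboolP.
have c0 : 0 <= (1 + 2 * s) ^+ 2 by rewrite sqr_ge0.
have := archi_boundP c0; move: hm; rewrite -(ltr_nat R); lra.
Qed.

Lemma nb_comparable j k : nb j k -> h k <= kappa * h j.
Proof. by move=> [i [l e]]; apply: (@star_comparable (p j i)); [exists i|exists l]. Qed.

Lemma kappa_gt0 : 0 < kappa.
Proof. by rewrite exprn_gt0. Qed.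

(** The hat function of the node [p j i] is Lipschitz with constant [s * kappa / (2 * h j)], by
    comparability of the sizes around the node, and it drops from 1 to 0 between the two nodes. *)
Lemma node_sep j i k l : p j i != p k l -> 2 * h j <= s * kappa * `|p j i - p k l|.
Proof.
move=> ne; have hj := h_gt0 j.
pose w x : R := (x == p j i)%:R.
pose K := s * kappa / (2 * h j).
have K0 : 0 <= K by rewrite divr_ge0 ?mulr_ge0// ?(ltW s0) ?(ltW kappa_gt0) ?(ltW hj).
have hK k' : n1 (igrad (p k') w) <= K.
  have [[l' e]|ne'] := pselect (exists l', p k' l' = p j i).
    rewrite /w -e igrad_delta//.
    apply: le_trans (bgrad_le (pn k') s0 (mesh_shape M k') _) _.
    have hk := h_gt0 k'.
    rewrite /K ler_pdivrMr ?mulr_gt0//.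
    have c := @star_comparable (p j i) k' j (ex_intro _ l' e) (ex_intro _ i erefl).
    rewrite mulrAC ler_pdivlMr ?mulr_gt0//.
    rewrite -!mulrA ler_pM2l// mulrCA ler_pM2l//.
  rewrite /igrad big1; first by rewrite /n1 /= normr0 addr0.
  move=> l' _; rewrite /w; case: eqP => [e|_]; last by rewrite scale0r.
  by case: ne'; exists l'.
have cl j' i' : closure Om (p j' i') by apply: tri_sub; exact: tri_vertex.
have := @interp_lip w K (p k l) (p j i) (or_intror (conj (cl _ _) (cl _ _))) hK K0.
rewrite !interp_vertex /w eqxx eq_sym (negbTE ne) subr0 normr1 /K mulrAC ler_pdivlMr ?mulr_gt0//.
by rewrite mul1r.
Qed.

End mesh.

(** * A one-dimensional maximal function *)

Section dyadic.
Context {R : realType}.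
Implicit Types (L a p q : R) (k n : nat).

(** The exponent starts at 1, so that every [t] in []0, L]], including [L], satisfies
    [lev L k < t <= 2 * lev L k] for some [k]. *)
Definition lev L k : R := L * 2^-1 ^+ k.+1.

Lemma lev_gt0 L k : 0 < L -> 0 < lev L k.
Proof. by move=> L0; rewrite mulr_gt0// exprn_gt0. Qed.

Lemma levS L k : lev L k.+1 = lev L k / 2.
Proof. by rewrite /lev exprSr mulrA. Qed.

Lemma lev_ex L t : 0 < t -> t <= L -> exists k, lev L k < t <= 2 * lev L k.
Proof.
move=> t0 tL.
have L0 : 0 < L by exact: lt_le_trans tL.
have ex : exists k, lev L k < t.
  have : (fun k : nat => L * 2^-1 ^+ k) @ \oo --> (L * 0 : R).
    apply: cvgM; first exact: cvg_cst.
    by apply: cvg_expr; rewrite ger0_norm ?invr_ge0// invf_lt1// ltr1n.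
  rewrite mulr0 => /cvgrPdist_lt /(_ t t0)[N _ hN]; exists N.
  have := hN N.+1 (leqnSn N); rewrite /= sub0r normrN gtr0_norm//.
  by rewrite mulr_gt0// exprn_gt0.
exists (ex_minn ex); case: ex_minnP => k kt kmin; rewrite kt /=.
case: k kt kmin => [|k] kt kmin; first by rewrite /lev expr1 mulrCA mulfV ?mulr1.
rewrite levS mulrC divfK//; rewrite leNgt; apply/negP => h.
by have := kmin k h; rewrite ltnn.
Qed.

Lemma powR_half q : 2^-1 <= q -> (2^-1 : R) `^ q <= 3 / 4.
Proof.
move=> q1.
have h : (2^-1 : R) `^ q <= 2^-1 `^ 2^-1.
  by apply: ger_powR => //; rewrite invr_gt0 ltr0n /= invf_le1 ?ler1n.
apply: le_trans h _; rewrite powR12_sqrt ?invr_ge0//.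
rewrite -[X in _ <= X]ger0_norm ?divr_ge0// -sqrtr_sqr ler_wsqrtr//; lra.
Qed.

(** The levels below [a] give a geometric series of ratio at most [3 / 4] by [powR_half], whence the
    factor [4 = 1 / (1 - 3 / 4)]. *)
Lemma sum_lev_le L a q n : 0 < L -> 0 <= a -> 2^-1 <= q ->
  \sum_(k < n) (if lev L k < a then lev L k `^ q else 0) <= 4 * a `^ q.
Proof.
move=> L0 a0 hq.
have q0 : 0 <= q by apply: le_trans hq; rewrite invr_ge0.
pose G k := if lev L k < a then lev L k `^ q else 0.
have lv k : 0 < lev L k by exact: lev_gt0.
(* The induction needs the bound by the first level of the sum in place of [a] when that level is
   smaller. *)
have h j m : \sum_(0 <= i < m) G (j + i)%N <= 4 * (Num.min (lev L j) a) `^ q.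
  elim: m j => [|m IH] j; first by rewrite big_geq// mulr_ge0// powR_ge0.
  rewrite big_nat_recl// addn0.
  under eq_bigr do rewrite -addSnnS.
  have := IH j.+1; rewrite {2}/G.
  case: ifPn => [la|]; last first.
    rewrite -leNgt add0r => al /le_trans; apply; rewrite (min_idPr al).
    have hm : Num.min (lev L j.+1) a <= a by rewrite ge_min lexx orbT.
    have h0 : 0 <= Num.min (lev L j.+1) a by rewrite le_min a0 ltW.
    by rewrite ler_wpM2l// ge0_ler_powR// ?nnegrE.
  rewrite (min_idPl (ltW la)) levS.
  have -> : Num.min (lev L j / 2) a = lev L j * 2^-1.
    by apply/min_idPl; apply: le_trans (ltW la); have := lv j; lra.
  have hh : 0 <= (2^-1 : R) by rewrite invr_ge0.
  rewrite (powRM _ (ltW (lv j)) hh) => h1.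
  have h2 := powR_half hq; have h3 := powR_ge0 (lev L j) q.
  move: h1 h2 h3; move: (\sum_(_ <= _ < _) _) (lev L j `^ q) (2^-1 `^ q) => x y z; nra.
have := h 0%N n; rewrite big_mkord => /le_trans; apply.
have hm : Num.min (lev L 0) a <= a by rewrite ge_min lexx orbT.
have h0 : 0 <= Num.min (lev L 0) a by rewrite le_min a0 ltW.
by rewrite ler_wpM2l// ge0_ler_powR// ?nnegrE.
Qed.

End dyadic.

Section maximal1.
Context {R : realType}.
Notation leb := (@lebesgue_measure R).
Implicit Types (m D : R -> R) (p : R).

(** The strong type inequality from the weak type (1,1) one: the part of [D] above [l k / 8]
    controls the measure of the set where [m] exceeds [l k], and the sum over the dyadic levels
    gives back [D ^ p]. Keeping [p] in [[3/2, 3]] makes the constant uniform. *)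
Lemma maximal_Lp m D (L : R) p : 0 < L -> 3 / 2 <= p <= 3 ->
  measurable_fun setT m -> measurable_fun setT D ->
  (forall x, 0 <= m x <= L) -> (forall x, 0 <= D x) ->
  leb.-integrable setT (EFin \o D) ->
  (forall x (t : R), 0 < t -> t < m x ->
     exists2 r, 0 < r & ((t / 4)%:E < iavg D (ball x r))%E) ->
  (\int[leb]_x (m x `^ p)%:E <= (3 * 2 ^+ 14)%:E * \int[leb]_x (D x `^ p)%:E)%E.
Proof.
move=> L0 /andP[p1 p2] mm mD m0 D0 iD H.
have p0 : 0 < p by lra.
pose l k := lev L k.
have l0 k : 0 < l k by exact: lev_gt0.
pose E k := [set x | l k < m x].
have mE k : measurable (E k).
  by rewrite /E -[X in measurable X]setTI; apply: (measurable_fun_ltr (f := cst (l k)) (g := m)).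
pose F k x : \bar R := ((2 * l k) `^ p * \1_(E k) x)%:E.
have F0 k x : (0 <= F k x)%E by rewrite lee_fin mulr_ge0// powR_ge0.
have mF k : measurable_fun setT (F k).
  by apply/measurable_EFinP; apply: measurable_funM => //; exact: measurable_indic.
have mI k : measurable_fun setT (\1_(E k) : R -> R) by exact: measurable_indic.
have iE k : (\int[leb]_x (\1_(E k) x)%:E = leb (E k))%E.
  apply: eq_trans (integral_indic _ _ _) _; [exact: measurableT|exact: mE|].
  by congr (leb _); apply/seteqP; split => [x []|x].
(* Dropping the values up to [l k / 8] lowers an average by at most [l k / 8], so an average above
   [l k / 4] stays above [l k / 8]. *)
pose Dk k x := if l k < 8 * D x then D x else 0.
have mDk k : measurable_fun setT (Dk k).
  by apply: measurable_fun_ifT => //; apply: measurable_fun_ltr => //; exact: measurable_funM.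
have Dk0 k x : 0 <= Dk k x by rewrite /Dk; case: ifP.
have iDk k : leb.-integrable setT (EFin \o Dk k).
  apply: (le_integrable measurableT _ _ iD); first by apply/measurable_EFinP; exact: mDk.
  move=> x _; rewrite /= lee_fin /Dk; case: ifP => // _.
  by rewrite normr0.
(* [24 = 3 * 8]: the weak type constant 3 at height [l k / 8]. *)
pose G k x : \bar R := (24 * 2 `^ p * l k `^ (p - 1) * Dk k x)%:E.
have G0 k x : (0 <= G k x)%E by rewrite lee_fin !mulr_ge0// powR_ge0.
have mG k : measurable_fun setT (G k).
  by apply/measurable_EFinP; exact: measurable_funM.
have FG k : (\int[leb]_x F k x <= \int[leb]_x G k x)%E.
  have -> : (\int[leb]_x F k x = ((2 * l k) `^ p)%:E * leb (E k))%E.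
    rewrite /F; under eq_integral do rewrite EFinM.
    rewrite ge0_integralZl//.
    - by rewrite iE.
    - by apply/measurable_EFinP; exact: mI.
    - by rewrite lee_fin powR_ge0.
  have -> : (\int[leb]_x G k x = (24 * 2 `^ p * l k `^ (p - 1))%:E * \int[leb]_x (Dk k x)%:E)%E.
    rewrite /G; under eq_integral do rewrite EFinM.
    rewrite ge0_integralZl//.
    - by apply/measurable_EFinP; exact: mDk.
    - by move=> x _; rewrite lee_fin; exact: Dk0.
    - by rewrite lee_fin !mulr_ge0// powR_ge0.
  have sub : E k `<=` [set x | (HL_maximal (Dk k) x > (l k / 8)%:E)%E].
    move=> x Ex; have [r r0 hr] := H x (l k) (l0 k) Ex.
    have hD y : D y <= Dk k y + l k / 8.
      rewrite /Dk; case: ifPn => h; first by have := l0 k; lra.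
      by move: h; rewrite -leNgt; lra.
    have fb : (leb (ball x r) < +oo)%E.
      by rewrite lebesgue_measure_ball ?ltW// ltry.
    have b0 : leb (ball x r) != 0%E.
      by rewrite lebesgue_measure_ball ?ltW// eqe mulrn_eq0 /= gt_eqF.
    have le1 : (iavg D (ball x r) <= iavg (Dk k \+ cst (l k / 8))%R (ball x r))%E.
      rewrite /iavg lee_wpmul2l ?inve_ge0//.
      apply: ge0_le_integral => //; first exact: measurable_ball.
      - by do 2 apply: measurableT_comp => //; exact: measurable_funTS.
      - do 2 apply: measurableT_comp => //; apply: measurable_funD => //.
        by apply: measurable_funTS; exact: mDk.
      - move=> y _; have hy := hD y; have dk := Dk0 k y; have lk := l0 k.
        rewrite /= lee_fin (ger0_norm (D0 y)) ger0_norm//.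
        by rewrite addr_ge0// divr_ge0// ltW.
    have le2 : (iavg (Dk k \+ cst (l k / 8))%R (ball x r) <= iavg (Dk k) (ball x r) + (l k / 8)%:E)%E.
      have mDB : measurable_fun (ball x r) (Dk k) by apply: measurable_funTS; exact: mDk.
      have h1 := iavgD (measurable_ball x r) fb mDB (measurable_cst (l k / 8)).
      apply: le_trans h1 _; apply: leeD => //.
      rewrite /iavg /= integral_cst; last exact: measurable_ball.
      have l8 : 0 <= l k / 8 by rewrite divr_ge0// ltW.
      by rewrite (ger0_norm l8) muleCA mulVe ?mule1// ge0_fin_numE.
    have lt3 : ((l k / 8)%:E < iavg (Dk k) (ball x r))%E.
      have := lt_le_trans hr (le_trans le1 le2).
      case: (iavg (Dk k) (ball x r)) => [y||]; last by rewrite addNye ltNge leNye.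
        by rewrite -EFinD !lte_fin; lra.
      by move=> _; exact: ltry.
    apply: lt_le_trans lt3 _; apply: ereal_sup_ubound => /=.
    by exists r => //; rewrite in_itv /= r0.
  have locD : locally_integrable setT (Dk k).
    by apply: open_integrable_locally => //; exact: openT.
  have l8 : 0 < l k / 8 by rewrite divr_gt0.
  have mHL : measurable [set x | (HL_maximal (Dk k) x > (l k / 8)%:E)%E].
    rewrite -[X in measurable X]setTI; apply: emeasurable_fun_o_infty => //.
    exact: measurable_HL_maximal.
  have := maximal_inequality locD l8.
  move=> /(le_trans (le_measure leb (mem_set (mE k)) (mem_set mHL) sub)) hE.
  under eq_integral do rewrite -(ger0_norm (Dk0 k _)).
  apply: le_trans (lee_wpmul2l _ hE) _; first by rewrite lee_fin powR_ge0.
  rewrite muleA -EFinM; apply: lee_wpmul2r; first exact: integral_ge0.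
  rewrite lee_fin (powRM _ _ (ltW (l0 k)))//.
  rewrite (_ : 3 / (l k / 8) = 24 * (l k)^-1); last by field; rewrite gt_eqF.
  rewrite powRB ?(gt_eqF (l0 k)) ?implybT//.
  rewrite (powRr1 (ltW (l0 k))).
  have l1 := powR_ge0 (l k) p; have l2 := powR_ge0 2 p.
  rewrite (_ : 2 `^ p * l k `^ p * (24 / l k) = 24 * 2 `^ p * (l k `^ p / l k))//.
  by field; rewrite gt_eqF.
have mF' x : ((m x `^ p)%:E <= \sum_(0 <= k <oo) F k x)%E.
  have /andP[mx0 mxL] := m0 x.
  move: mx0; rewrite le_eqVlt => /orP[/eqP <-|mx0].
    by rewrite powR0 ?gt_eqF//; apply: nneseries_ge0 => k _ _; exact: F0.
  have [k /andP[k1 k2]] := lev_ex mx0 mxL.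
  apply: (@le_trans _ _ (\sum_(0 <= i < k.+1) F i x)%E); last first.
    by apply: nneseries_lim_ge => i _ _; exact: F0.
  apply: (@le_trans _ _ (F k x)); last first.
    by rewrite big_nat_recr//= leeDr// sume_ge0// => i _; exact: F0.
  rewrite lee_fin /F indicE mem_set//= mulr1 ge0_ler_powR ?nnegrE// ?ltW//.
  by rewrite mulr_gt0.
(* The constant is [24 * 8 * 4 * 64], from [2 ^ p <= 8], the 4 of [sum_lev_le] and
   [8 ^ (p - 1) <= 64]. *)
have G_le x : (\sum_(0 <= k <oo) G k x <= (3 * 2 ^+ 14)%:E * (D x `^ p)%:E)%E.
  apply: lime_le; first by apply: is_cvg_nneseries => k _ _; exact: G0.
  near=> N.
  rewrite big_mkord sumEFin lee_fin.
  have a0 : 0 <= 8 * D x by rewrite mulr_ge0.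
  have hq : 2^-1 <= p - 1 by lra.
  have := sum_lev_le N L0 a0 hq.
  set S := \sum_(_ < N) _ => hS.
  have -> : \sum_(i < N) 24 * 2 `^ p * l i `^ (p - 1) * Dk i x = 24 * 2 `^ p * D x * S.
    rewrite mulr_sumr; apply: eq_bigr => i _; rewrite /Dk; case: ifP => _; last by rewrite !mulr0.
    by rewrite -!mulrA; congr (_ * (_ * _)); rewrite mulrC.
  have := D0 x; rewrite le_eqVlt => /orP[/eqP <-|Dx].
    by rewrite mulr0 mul0r mulr_ge0 ?powR_ge0.
  have hb : 2 `^ p <= (8 : R).
    by rewrite (_ : 8 = 2 `^ 3); [apply: ler_powR; rewrite ?ler1n|rewrite (@powR_mulrn _ 2 3)//; ring].
  have hc : 8 `^ (p - 1) <= (64 : R).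
    by rewrite (_ : 64 = 8 `^ 2); [apply: ler_powR; rewrite ?ler1n//; lra|rewrite (@powR_mulrn _ 8 2)//; ring].
  have hd : D x `^ p = D x * D x `^ (p - 1).
    by rewrite -{2}[D x](powRr1 (ltW Dx)) -powRD ?(gt_eqF Dx) ?implybT// addrC subrK.
  move: hS; rewrite (powRM _ _ (ltW Dx))// hd => hS.
  apply: (@le_trans _ _ (24 * 8 * D x * (4 * (64 * D x `^ (p - 1))))); last by rewrite le_eqVlt; apply/orP; left; apply/eqP; ring.
  have S0 : 0 <= S by apply: sumr_ge0 => i _; case: ifP => // _; exact: powR_ge0.
  apply: ler_pM => //; first by rewrite !mulr_ge0 ?powR_ge0 ?D0.
    by rewrite ler_pM2r// ler_pM2l.
  by apply: le_trans hS _; rewrite ler_pM2l// ler_wpM2r// powR_ge0.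
apply: (@le_trans _ _ (\int[leb]_x \sum_(0 <= k <oo) F k x)%E).
  apply: ge0_le_integral => //.
  - by move=> x _; rewrite lee_fin powR_ge0.
  - by apply/measurable_EFinP; exact: (measurableT_comp (measurable_powR p)).
  - by apply: ge0_emeasurable_sum => // k _; exact: mF.
rewrite integral_nneseries//.
apply: (@le_trans _ _ (\sum_(0 <= k <oo) \int[leb]_x G k x)%E).
  by apply: lee_nneseries => [k _ _|k _]; [apply: integral_ge0 => x _; exact: F0|exact: FG].
rewrite -integral_nneseries//.
rewrite -ge0_integralZl//; last 2 first.
- by apply/measurable_EFinP; exact: (measurableT_comp (measurable_powR p)).
- by move=> x _; rewrite lee_fin powR_ge0.
apply: ge0_le_integral => //.
- by move=> x _; apply: nneseries_ge0 => k _ _; exact: G0.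
- by apply: ge0_emeasurable_sum => // k _; exact: mG.
- apply/measurable_EFinP; apply: measurable_funM => //.
  exact: (measurableT_comp (measurable_powR p)).
Unshelve. all: by end_near. Qed.

End maximal1.

(** * Directional maximal functions on a mesh *)

Section quotient_sup.
Context {R : realType}.
Notation leb := (@lebesgue_measure R).

Definition dqsup (f : R -> R) (s : R) : R :=
  sup [set `|f (s + t) - f s| / `|t| | t in [set t : R | t != 0]].

Section lip.
Variables (f : R -> R) (K : R).
Hypothesis fK : forall s t, `|f s - f t| <= K * `|s - t|.

Lemma dq_le s (t : R) : t != 0 -> `|f (s + t) - f s| / `|t| <= K.
Proof.
move=> t0; rewrite ler_pdivrMr ?normr_gt0//.
by have := fK (s + t) s; rewrite [s + t - s]addrC addKr.
Qed.

Lemma dqsup_has_sup s : has_sup [set `|f (s + t) - f s| / `|t| | t in [set t : R | t != 0]].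
Proof.
split; first by exists (`|f (s + 1) - f s| / `|1|), 1 => //=; exact: oner_neq0.
by exists K => _ [t t0 <-]; exact: dq_le.
Qed.

Lemma dqsup_ge s (t : R) : `|f (s + t) - f s| <= `|t| * dqsup f s.
Proof.
have [->|t0] := eqVneq t 0; first by rewrite addr0 subrr normr0 mul0r.
rewrite mulrC -ler_pdivrMr ?normr_gt0//; apply: ub_le_sup; first by case: (dqsup_has_sup s).
by exists t.
Qed.

Lemma dqsup_ge0 s : 0 <= dqsup f s.
Proof. by have := dqsup_ge s 1; rewrite normr1 mul1r; exact: le_trans. Qed.

Lemma dqsup_le s : dqsup f s <= K.
Proof. by apply: ge_sup; [case: (dqsup_has_sup s)|move=> _ [t t0 <-]; exact: dq_le]. Qed.

Lemma dqsup_gt s (l : R) : l < dqsup f s -> exists2 t, t != 0 & l * `|t| < `|f (s + t) - f s|.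
Proof.
move=> /sup_gt; case; first by case: (dqsup_has_sup s).
by move=> _ [t t0 <-] h; exists t => //; move: h; rewrite ltr_pdivlMr ?normr_gt0.
Qed.

End lip.

(** A quotient above [l] over a step [t] is an increment above [l |t|], charged to a ball of radius
    [2 |t|] and measure [4 |t|]; this is the quarter in [maximal_Lp]. The open ball of radius [|t|]
    would miss an end point of the step. *)
Lemma dqsup_Lp (f D : R -> R) (K B p : R) : 0 < K -> 3 / 2 <= p <= 3 ->
  (forall s t, `|f s - f t| <= K * `|s - t|) ->
  measurable_fun setT (dqsup f) -> measurable_fun setT D -> (forall s, 0 <= D s) ->
  leb.-integrable setT (EFin \o D) ->
  (forall s t, s <= t -> ((`|f t - f s|)%:E <= \int[leb]_(r in `[s, t]) (D r)%:E)%E) ->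
  (\int[leb]_x (dqsup f x `^ p)%:E <= (3 * 2 ^+ 14)%:E * \int[leb]_x (D x `^ p)%:E)%E.
Proof.
move=> K0 p12 fK mm mD D0 iD H.
apply: (maximal_Lp K0 p12) => // [x|x l l0 /(dqsup_gt fK)[t t0 lt]].
  by rewrite (dqsup_ge0 fK) (dqsup_le fK).
have t00 : 0 < `|t| by rewrite normr_gt0.
exists (2 * `|t|); first by rewrite mulr_gt0.
rewrite /iavg lebesgue_measure_ball ?mulr_ge0//.
have e4 : (2 * `|t|) *+ 2 = 4 * `|t| by rewrite mulr2n; ring.
rewrite e4 inver (gt_eqF (mulr_gt0 _ t00))// muleC lte_pdivlMr ?mulr_gt0// -EFinM.
rewrite (_ : l / 4 * (4 * `|t|) = l * `|t|); last by field.
apply: (@lt_le_trans _ _ (`|f (x + t) - f x|)%:E); first by rewrite lte_fin.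
pose a := Num.min x (x + t); pose b := Num.max x (x + t).
have ab : a <= b by rewrite /a /b ge_min le_max lexx.
have -> : `|f (x + t) - f x| = `|f b - f a|.
  rewrite /a /b; have [h|h] := leP x (x + t); first by [].
  by rewrite distrC.
apply: le_trans (H _ _ ab) _.
under [leRHS]eq_integral do rewrite abse_EFin ger0_norm//.
apply: ge0_subset_integral => //=.
- exact: measurable_ball.
- by apply/measurable_EFinP; exact: measurable_funTS.
- move=> y _; rewrite lee_fin; exact: D0.
- move=> y; rewrite /= in_itv /= => /andP[ay yb]; rewrite -ball_normE /=.
  move: ay yb; rewrite /a /b.
  have [h|h] := leP x (x + t) => h1 h2.
    have t1 : `|t| = t by rewrite ger0_norm; lra.
    by rewrite t1 ltr_norml; apply/andP; split; lra.
  have t1 : `|t| = - t by rewrite ltr0_norm; lra.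
  by rewrite t1 ltr_norml; apply/andP; split; lra.
Qed.

End quotient_sup.

Section mesh_maximal.
Context {R : realType} (Om : set (R * R)) (n : nat) (p : 'I_n -> 'I_3 -> R * R)
    (s : R) (h : 'I_n -> R).
Hypothesis M : is_mesh Om p s h.
Notation leb := (@lebesgue_measure R).
Variables (w : R * R -> R).
Hypothesis w0 : bdry0 Om p w.
Implicit Types (x y : R * R) (j k : 'I_n).

Notation v := (interp p w).
Definition gnorm j : R := n1 (igrad (p j) w).
(** Adding up all triangles at a point changes nothing off the sides, but makes the function
    dominate the slope of the interpolant along every line, also along one that contains sides. *)
Definition Dsum (x : plane R) : R := \sum_j (if `[< tri (p j) x >] then gnorm j else 0).
Definition gsum : R := \sum_j gnorm j + 1.

Lemma gnorm_ge0 j : 0 <= gnorm j.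
Proof. exact: n1_ge0. Qed.

Lemma gsum_gt0 : 0 < gsum.
Proof. by rewrite ltr_wpDl// sumr_ge0// => j _; exact: gnorm_ge0. Qed.

Lemma gnorm_le j : gnorm j <= gsum.
Proof.
rewrite /gsum (bigD1 j)//= -addrA lerDl addr_ge0// sumr_ge0// => k _.
exact: gnorm_ge0.
Qed.

Lemma Dsum_ge0 x : 0 <= Dsum x.
Proof. by apply: sumr_ge0 => j _; case: ifP => // _; exact: gnorm_ge0. Qed.

Lemma Dsum_le x : Dsum x <= gsum.
Proof.
rewrite /Dsum /gsum; apply: ler_wpDr => //; apply: ler_sum => j _.
by case: ifP => // _; exact: gnorm_ge0.
Qed.

Lemma Dsum_ge j x : tri (p j) x -> gnorm j <= Dsum x.
Proof.
move=> xj; rewrite /Dsum (bigD1 j)//= asboolT// lerDl sumr_ge0// => k _.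
by case: ifP => // _; exact: gnorm_ge0.
Qed.

Lemma measurable_Dsum : measurable_fun setT Dsum.
Proof.
apply: measurable_sum => j.
rewrite (_ : (fun x => _) = (fun x => gnorm j * \1_(tri (p j) : set (plane R)) x)).
  by apply: measurable_funM => //; apply: measurable_indic; exact: measurable_tri.
apply/funext => x; rewrite indicE; case: asboolP => hx.
  by rewrite (mem_set (hx : (tri (p j) : set (plane R)) x)) mulr1.
by rewrite (memNset (hx : ~ (tri (p j) : set (plane R)) x)) mulr0.
Qed.

Lemma v_lip x y : `|v x - v y| <= gsum * `|x - y|.
Proof. by apply: (interp_lip M (or_introl w0)); [exact: gnorm_le|exact: ltW gsum_gt0]. Qed.

Lemma v_continuous : continuous v.
Proof.
move=> x; apply/cvgrPdist_lt => e e0.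
have c0 := gsum_gt0.
near=> y; apply: le_lt_trans (v_lip x y) _.
rewrite mulrC -ltr_pdivlMr//; near: y.
have d0 : 0 < e / gsum by rewrite divr_gt0.
by move: (nbhsx_ballx x (e / gsum) d0); apply: filterS => y; rewrite -ball_normE.
Unshelve. all: by end_near. Qed.

Lemma mesh_bounded : exists2 L : R, 0 < L & forall j x, tri (p j) x -> `|x| <= L.
Proof.
exists (\sum_j (`|p j o0| + h j) + 1).
  by rewrite ltr_wpDl// sumr_ge0// => j _; rewrite addr_ge0// ltW// (h_gt0 M).
move=> j x xj.
have := tri_diam M xj (tri_vertex (mesh_nondeg M j) o0).
have := ler_normD (x - p j o0) (p j o0); rewrite subrK.
rewrite (bigD1 j)//=.
have : 0 <= \sum_(i < n | i != j) (`|p i o0| + h i).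
  by rewrite sumr_ge0// => k _; rewrite addr_ge0// ltW// (h_gt0 M).
lra.
Qed.

(** [interp_segment] with [Phi] the primitive of [Dsum] along the line: on a triangle the slope is
    at most [gnorm], which [Dsum] dominates. *)
Lemma line_bound (e x : R * R) (a b : R) : `|e| = 1 -> a <= b ->
  measurable_fun setT (fun r : R => Dsum (x + r *: e)) ->
  ((`|v (x + b *: e) - v (x + a *: e)|)%:E <=
    \int[leb]_(r in `[a, b]) (Dsum (x + r *: e))%:E)%E.
Proof.
move=> e1 ab mD; pose d r := Dsum (x + r *: e).
have mI (u u' : R) : measurable_fun setT (fun r : R => d r * \1_(`[u, u'] : set R) r).
  by apply: measurable_funM => //; exact: measurable_indic.
pose I t : \bar R := (\int[leb]_(r in `[a, (a + t * (b - a))%R]) (d r)%:E)%E.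
have I0 t : (0 <= I t)%E by apply: integral_ge0 => r _; rewrite lee_fin Dsum_ge0.
have Ifin t : I t \is a fin_num.
  rewrite ge0_fin_numE//; apply: (@le_lt_trans _ _ (\int[leb]_(r in `[a, (a + t * (b - a))%R]) gsum%:E)%E).
    apply: ge0_le_integral => //.
    - by move=> r _; rewrite lee_fin Dsum_ge0.
    - by apply/measurable_EFinP; exact: measurable_funTS.
    - by move=> r _; rewrite lee_fin Dsum_le.
  rewrite integral_cst//= lebesgue_measure_itv /=; case: ifP => _; last by rewrite mule0 ltry.
  by rewrite -EFinD -EFinM ltry.
have IE : (\int[leb]_(r in `[a, b]) (d r)%:E = (fine (I 1))%:E)%E.
  by rewrite fineK// /I mul1r addrC subrK.
have I00 : I 0 = 0%E by rewrite /I mul0r addr0 set_itv1 integral_set1.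
have Iadd t t' : 0 <= t -> t <= t' -> I t' = (I t + \int[leb]_(r in `](a + t * (b - a))%R, (a + t' * (b - a))%R]) (d r)%:E)%E.
  move=> t0 tt'; rewrite /I -ge0_integral_setU//=.
  - congr integral; apply/seteqP; split => r /=; rewrite !in_itv /=.
      by move=> /andP[h1 h2]; case: (leP r (a + t * (b - a))) => hr; [left|right]; rewrite ?h1.
    have h3 : t * (b - a) <= t' * (b - a) by rewrite ler_wpM2r// subr_ge0.
    have h4 : 0 <= t * (b - a) by rewrite mulr_ge0// subr_ge0.
    by move=> [|] /andP[h1 h2]; apply/andP; split => //; lra.
  - by apply/measurable_EFinP; exact: measurable_funTS.
  - by move=> r _; rewrite lee_fin Dsum_ge0.
  - apply/disj_setPS => r [] /=; rewrite !in_itv /= => /andP[_ h1] /andP[h2 _].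
    by move: h2; rewrite ltNge h1.
rewrite -/d IE lee_fin (_ : fine (I 1) = fine (I 1) - fine (I 0)); last by rewrite I00 subr0.
have := @interp_segment R Om n p s h M w (x + a *: e) (x + b *: e) (fun t => fine (I t)) (or_introl w0).
apply.
  move=> t t' t0 tt' t1; rewrite fine_le// (Iadd t t')//.
  by rewrite leeDl// integral_ge0// => r _; rewrite lee_fin Dsum_ge0.
move=> j t t' t0 tt' t1.
have seg r : x + a *: e + r *: (x + b *: e - (x + a *: e)) = x + (a + r * (b - a)) *: e.
  by rewrite opprD addrACA subrr add0r -scalerBl scalerA -addrA -scalerDl.
rewrite !seg => ht ht'.
rewrite opprD addrACA subrr add0r -scalerBl normrZ e1 mulr1 ger0_norm ?subr_ge0//.
have := Iadd t t' t0 tt'.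
set J := (\int[leb]_(r in _) _)%E => E'.
have J1 : ((gnorm j * ((t' - t) * (b - a)))%:E <= J)%E.
  apply: (@le_trans _ _ (\int[leb]_(r in `](a + t * (b - a))%R, (a + t' * (b - a))%R]) (gnorm j)%:E)%E).
    rewrite integral_cst//= lebesgue_measure_itv /= lte_fin ltrD2l.
    case: ifPn => [_|]; first by rewrite -EFinB -EFinM lee_fin le_eqVlt; apply/orP; left; apply/eqP; ring.
    rewrite -leNgt mule0 lee_fin => hle.
    have hle' : (t' - t) * (b - a) <= 0 by rewrite mulrBl subr_le0.
    exact: (mulr_ge0_le0 (gnorm_ge0 j) hle').
  apply: ge0_le_integral => //.
  - by move=> r _; rewrite lee_fin gnorm_ge0.
  - by apply/measurable_EFinP; exact: measurable_funTS.
  move=> r; rewrite /= in_itv /= => /andP[h1 h2]; rewrite lee_fin; apply: Dsum_ge.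
  pose A := a + t * (b - a); pose B := a + t' * (b - a).
  have AB : A < B by exact: lt_le_trans h1 h2.
  have -> : x + r *: e = (x + A *: e) + ((r - A) / (B - A)) *: ((x + B *: e) - (x + A *: e)).
    rewrite (_ : (x + B *: e) - (x + A *: e) = (B - A) *: e); last by rewrite opprD addrACA subrr add0r -scalerBl.
    rewrite scalerA divfK ?subr_eq0 ?gt_eqF//.
    by rewrite -addrA -scalerDl [A + _]addrC subrK.
  apply: tri_segment => //; apply/andP; split.
    by rewrite divr_ge0// subr_ge0 ltW.
  by rewrite ler_pdivrMr ?subr_gt0// mul1r lerD2r.
have Jfin : J \is a fin_num.
  rewrite ge0_fin_numE; last by apply: integral_ge0 => r _; rewrite lee_fin Dsum_ge0.
  apply: (@le_lt_trans _ _ (I t')); last by rewrite -ge0_fin_numE.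
  by rewrite E' leeDr.
rewrite -lee_fin EFinB !fineK// E'.
by rewrite -/(gnorm j) addeAC subee ?add0e.
Qed.

Definition M1 (x : plane R) : R := dqsup (fun r => v (r, x.2)) x.1.
Definition M2 (x : plane R) : R := dqsup (fun r => v (x.1, r)) x.2.

Lemma v_lip1 (y r r' : R) : `|v (r, y) - v (r', y)| <= gsum * `|r - r'|.
Proof.
apply: le_trans (v_lip _ _) _; rewrite ler_wpM2l ?(ltW gsum_gt0)//.
by rewrite norm_pair /= subrr normr0 ge_max lexx normr_ge0.
Qed.

Lemma v_lip2 (y r r' : R) : `|v (y, r) - v (y, r')| <= gsum * `|r - r'|.
Proof.
apply: le_trans (v_lip _ _) _; rewrite ler_wpM2l ?(ltW gsum_gt0)//.
by rewrite norm_pair /= subrr normr0 ge_max lexx normr_ge0.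
Qed.

(** [M1] and [M2] are suprema over uncountably many steps; they are measurable because their
    superlevel sets are unions of open sets. *)
Lemma measurable_of_open (f : plane R -> R) :
  (forall c : R, open [set x : R * R | c < f x]) -> measurable_fun setT f.
Proof.
move=> fo; apply: (measurability _ (RGenOInfty.measurableE R)).
move=> _ [_ [c ->] <-]; rewrite setTI.
apply: open_measurable2; rewrite (_ : _ @^-1` _ = [set x | c < f x])//.
by apply/seteqP; split => x /=; rewrite in_itv /= andbT.
Qed.

Lemma open_quot (c : R) (e : R * R) (t : R) :
  open [set x : R * R | c * `|t| < `|v (x + t *: e) - v x|].
Proof.
have cont : continuous (fun x : R * R => `|v (x + t *: e) - v x|).
  move=> x; apply: cvg_norm; apply: cvgB; last exact: v_continuous.
  apply: (@cvg_comp _ _ _ (fun x : R * R => x + t *: e) v); last exact: v_continuous.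
  by apply: cvgD; [exact: cvg_id|exact: cvg_cst].
rewrite (_ : [set x | _] = (fun x : R * R => `|v (x + t *: e) - v x|) @^-1` [set y | c * `|t| < y])//.
by apply: open_comp; [move=> x _; exact: cont|exact: open_gt].
Qed.

Lemma measurable_M1 : measurable_fun setT M1.
Proof.
apply: measurable_of_open => c.
rewrite (_ : [set x | _] = \bigcup_(t in [set t : R | t != 0])
  [set x : R * R | c * `|t| < `|v (x + t *: (1, 0)) - v x|]).
  by apply: bigcup_open => t _; exact: open_quot.
have E (x : R * R) t : (x.1 + t, x.2) = x + t *: (1, 0).
  by case: x => ? ?; congr pair; rewrite /= /GRing.scale /= ?mulr1 ?mulr0 ?addr0.
apply/seteqP; split => x /=.
  move=> /(dqsup_gt (v_lip1 x.2)) [t t0 lt]; exists t => //=.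
  by rewrite -E -[X in v (_, _) - v X]surjective_pairing in lt *.
move=> [t /= t0 lt]; rewrite /M1.
have := dqsup_ge (v_lip1 x.2) x.1 t.
rewrite E -surjective_pairing => h1.
have := lt_le_trans lt h1; rewrite mulrC ltr_pM2l// normr_gt0//.
Qed.

Lemma measurable_M2 : measurable_fun setT M2.
Proof.
apply: measurable_of_open => c.
rewrite (_ : [set x | _] = \bigcup_(t in [set t : R | t != 0])
  [set x : R * R | c * `|t| < `|v (x + t *: (0, 1)) - v x|]).
  by apply: bigcup_open => t _; exact: open_quot.
have E (x : R * R) t : (x.1, x.2 + t) = x + t *: (0, 1).
  by case: x => ? ?; congr pair; rewrite /= /GRing.scale /= ?mulr1 ?mulr0 ?addr0.
apply/seteqP; split => x /=.
  move=> /(dqsup_gt (v_lip2 x.1)) [t t0 lt]; exists t => //=.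
  by rewrite -E -[X in v (_, _) - v X]surjective_pairing in lt *.
move=> [t /= t0 lt]; rewrite /M2.
have := dqsup_ge (v_lip2 x.1) x.2 t.
rewrite E -surjective_pairing => h1.
have := lt_le_trans lt h1; rewrite mulrC ltr_pM2l// normr_gt0//.
Qed.

Lemma M1_ge0 x : 0 <= M1 x. Proof. exact: (dqsup_ge0 (v_lip1 x.2)). Qed.
Lemma M2_ge0 x : 0 <= M2 x. Proof. exact: (dqsup_ge0 (v_lip2 x.1)). Qed.

Lemma measurable_powRf (f : plane R -> R) (q : R) : measurable_fun setT f ->
  measurable_fun setT (fun x => (f x `^ q)%:E).
Proof. by move=> mf; apply/measurable_EFinP; exact: (measurableT_comp (measurable_powR q)). Qed.

Lemma integrable_bounded_supp (f : R -> R) (B L : R) : measurable_fun setT f ->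
  (forall r, 0 <= f r <= B) -> (forall r, L < `|r| -> f r = 0) -> 0 <= L ->
  leb.-integrable setT (EFin \o f).
Proof.
move=> mf fB fL L0; apply/integrableP; split; first exact/measurable_EFinP.
apply: (@le_lt_trans _ _ (\int[leb]_r (B * \1_(`[-L, L]%classic) r)%:E)%E).
  apply: ge0_le_integral => //.
  - by do 2 apply: measurableT_comp => //.
  - by apply/measurable_EFinP; apply: measurable_funM => //; exact: measurable_indic.
  move=> r _; rewrite /= lee_fin ger0_norm; last by case/andP: (fB r).
  rewrite indicE; case: (boolP (r \in _)) => hr; first by rewrite mulr1; case/andP: (fB r).
  rewrite mulr0 fL// ltNge; apply: contra hr => hr; rewrite inE /= in_itv /=.
  by rewrite -ler_norml.
have B0 : 0 <= B by case/andP: (fB 0); exact: le_trans.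
under eq_integral do rewrite EFinM.
rewrite ge0_integralZl//.
- rewrite integral_indic// setIT.
  rewrite [X in (_ * X)%E](lebesgue_measure_itv `[- L, L]) /=; case: ifP => _; last by rewrite mule0 ltry.
  by rewrite -EFinB -EFinM ltry.
- by apply/measurable_EFinP; exact: measurable_indic.
Qed.

Lemma Dsum_supp : exists2 L : R, 0 < L & forall x : R * R, L < `|x| -> Dsum x = 0.
Proof.
have [L L0 hL] := mesh_bounded; exists L => // x Lx.
rewrite /Dsum big1// => j _; case: asboolP => // /hL.
by rewrite leNgt Lx.
Qed.

(** Tonelli reduces this to horizontal lines, on each of which [line_bound] provides the hypothesis
    of [dqsup_Lp]. *)
Lemma M1_Lp (q : R) : 3 / 2 <= q <= 3 ->
  (\int[lam]_x (M1 x `^ q)%:E <= (3 * 2 ^+ 14)%:E * \int[lam]_x (Dsum x `^ q)%:E)%E.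
Proof.
move=> hq; have mD := measurable_Dsum.
have pos (f : plane R -> R) x : (0 <= (f x `^ q)%:E)%E by rewrite lee_fin powR_ge0.
rewrite lam_tonelli2; [|exact: (measurable_powRf q measurable_M1)|exact: (pos M1)].
rewrite lam_tonelli2; [|exact: (measurable_powRf q mD)|exact: (pos Dsum)].
have mG (f : plane R -> R) : measurable_fun setT f ->
    measurable_fun setT (fun y : measurableTypeR R => (\int[leb]_x (f (x, y) `^ q)%:E)%E).
  move=> mf.
  exact: (measurable_fun_fubini_tonelli_G (m1:=leb) (T2:=measurableTypeR R) (fun x => (f x `^ q)%:E) (measurable_powRf q mf) (pos f)).
rewrite -ge0_integralZl//; last 2 first.
- exact: (mG Dsum).
- by move=> y _; apply: integral_ge0 => x _; exact: pos.
apply: ge0_le_integral => //.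
- by move=> y _; apply: integral_ge0 => x _; exact: (pos M1).
- exact: (mG M1 measurable_M1).
- by apply: measurable_funeM; exact: (mG Dsum).
move=> y _.
have [L L0 hL] := Dsum_supp.
have sec (f : plane R -> R) : measurable_fun setT f -> measurable_fun setT (fun r : R => f (r, y)).
  by move=> mf; apply: (measurableT_comp mf); exact: measurable_pair2.
apply: (@dqsup_Lp R (fun r => v (r, y)) (fun r => Dsum (r, y)) gsum gsum q) => //.
- exact: gsum_gt0.
- exact: v_lip1.
- exact: (sec M1 measurable_M1).
- exact: sec.
- by move=> r; exact: Dsum_ge0.
- apply: (@integrable_bounded_supp _ gsum L).
  + exact: sec.
  + by move=> r; rewrite Dsum_ge0 Dsum_le.
  + by move=> r Lr; apply: hL; apply: lt_le_trans Lr _; rewrite norm_pair le_max lexx.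
  + exact: ltW.
move=> a b ab.
have E r : (0, y) + r *: (1, 0) = (r, y) :> R * R.
  by congr pair; rewrite /= /GRing.scale /= ?mulr1 ?mulr0 ?addr0 ?add0r.
have := @line_bound (1, 0) (0, y) a b.
rewrite !E norm_pair /= normr1 normr0 (max_idPl ler01) => /(_ erefl ab).
under eq_fun do rewrite E.
by move=> /(_ (sec _ mD)); under eq_integral do rewrite E.
Qed.

Lemma M2_Lp (q : R) : 3 / 2 <= q <= 3 ->
  (\int[lam]_x (M2 x `^ q)%:E <= (3 * 2 ^+ 14)%:E * \int[lam]_x (Dsum x `^ q)%:E)%E.
Proof.
move=> hq; have mD := measurable_Dsum.
have pos (f : plane R -> R) x : (0 <= (f x `^ q)%:E)%E by rewrite lee_fin powR_ge0.
rewrite lam_tonelli1; [|exact: (measurable_powRf q measurable_M2)|exact: (pos M2)].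
rewrite lam_tonelli1; [|exact: (measurable_powRf q mD)|exact: (pos Dsum)].
have mG (f : plane R -> R) : measurable_fun setT f ->
    measurable_fun setT (fun x : measurableTypeR R => (\int[leb]_y (f (x, y) `^ q)%:E)%E).
  move=> mf.
  exact: (measurable_fun_fubini_tonelli_F (m2:=leb) (T1:=measurableTypeR R) (fun x => (f x `^ q)%:E) (measurable_powRf q mf) (pos f)).
rewrite -ge0_integralZl//; last 2 first.
- exact: (mG Dsum).
- by move=> y _; apply: integral_ge0 => x _; exact: pos.
apply: ge0_le_integral => //.
- by move=> y _; apply: integral_ge0 => x _; exact: (pos M2).
- exact: (mG M2 measurable_M2).
- by apply: measurable_funeM; exact: (mG Dsum).
move=> x _.
have [L L0 hL] := Dsum_supp.
have sec (f : plane R -> R) : measurable_fun setT f -> measurable_fun setT (fun r : R => f (x, r)).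
  by move=> mf; apply: (measurableT_comp mf); exact: measurable_pair1.
apply: (@dqsup_Lp R (fun r => v (x, r)) (fun r => Dsum (x, r)) gsum gsum q) => //.
- exact: gsum_gt0.
- exact: v_lip2.
- exact: (sec M2 measurable_M2).
- exact: sec.
- by move=> r; exact: Dsum_ge0.
- apply: (@integrable_bounded_supp _ gsum L).
  + exact: sec.
  + by move=> r; rewrite Dsum_ge0 Dsum_le.
  + by move=> r Lr; apply: hL; apply: lt_le_trans Lr _; rewrite norm_pair le_max lexx orbT.
  + exact: ltW.
move=> a b ab.
have E r : (x, 0) + r *: (0, 1) = (x, r) :> R * R.
  by congr pair; rewrite /= /GRing.scale /= ?mulr1 ?mulr0 ?addr0 ?add0r.
have := @line_bound (0, 1) (x, 0) a b.
rewrite !E norm_pair /= normr1 normr0 (max_idPr ler01) => /(_ erefl ab).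
under eq_fun do rewrite E.
by move=> /(_ (sec _ mD)); under eq_integral do rewrite E.
Qed.

(* One horizontal and one vertical move, each charged to the maximal function at
   one of the two end points. *)
Lemma v_diff x y : `|v x - v y| <= `|x.1 - y.1| * M1 x + `|x.2 - y.2| * M2 y.
Proof.
have h1 := dqsup_ge (v_lip1 x.2) x.1 (y.1 - x.1).
have h2 := dqsup_ge (v_lip2 y.1) y.2 (x.2 - y.2).
move: h1 h2; rewrite ![_ + (_ - _)]addrC !subrK -!surjective_pairing => h1 h2.
rewrite [`|x.1 - y.1|]distrC.
apply: (@le_trans _ _ (`|v (y.1, x.2) - v x| + `|v (y.1, x.2) - v y|)); last exact: lerD.
rewrite [leRHS](_ : _ = `|v x - v (y.1, x.2)| + `|v (y.1, x.2) - v y|); first exact: ler_distD.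
by congr (_ + _); exact: distrC.
Qed.

(* Outside the convex domain [v] vanishes, and one of the four axis-parallel rays
   from [x] leaves the domain not much later than the closest outer point. *)
Lemma v_outer x z : ~ Om z -> `|v x| <= (`|x.1 - z.1| + `|x.2 - z.2|) * (M1 x + M2 x).
Proof.
move=> nz.
pose d := `|x.1 - z.1| + `|x.2 - z.2|.
have d0 : 0 <= d by rewrite addr_ge0.
have H1 (t : R) : `|t| = d -> ~ Om (x.1 + t, x.2) -> `|v x| <= d * (M1 x + M2 x).
  move=> td nO; have := dqsup_ge (v_lip1 x.2) x.1 t.
  rewrite (interp_out M w0 nO) sub0r normrN td -surjective_pairing => /le_trans; apply.
  by rewrite ler_wpM2l// lerDl M2_ge0.
have H2 (t : R) : `|t| = d -> ~ Om (x.1, x.2 + t) -> `|v x| <= d * (M1 x + M2 x).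
  move=> td nO; have := dqsup_ge (v_lip2 x.1) x.2 t.
  rewrite (interp_out M w0 nO) sub0r normrN td -surjective_pairing => /le_trans; apply.
  by rewrite ler_wpM2l// lerDr M1_ge0.
have nd : `|d| = d by rewrite ger0_norm.
have nd' : `|- d| = d by rewrite normrN.
have [a1|] := pselect (Om (x.1 + d, x.2)); last exact: H1.
have [a2|] := pselect (Om (x.1 + - d, x.2)); last exact: H1.
have [a3|] := pselect (Om (x.1, x.2 + d)); last exact: H2.
have [a4|] := pselect (Om (x.1, x.2 + - d)); last exact: H2.
exfalso; apply: nz.
have cO := mesh_cvx M.
have [d00|dn0] := eqVneq d 0.
  move: d00 a1 => /eqP; rewrite /d paddr_eq0// !normr_eq0 !subr_eq0 => /andP[/eqP e1 /eqP e2].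
  by rewrite /d e1 e2 !subrr normr0 !addr0 -surjective_pairing.
have dpos : 0 < d by rewrite lt_neqAle eq_sym dn0.
pose a : R := z.1 - x.1; pose b : R := z.2 - x.2.
have dab : d = `|a| + `|b| by rewrite /d /a /b distrC [`|x.2 - _|]distrC.
(* [z] lies on the side from [A] to [B] of the diamond of radius [d] around [x], whose four corners
   are now assumed to be in the convex domain. *)
pose A : R * R := (x.1 + sg a * d, x.2); pose B : R * R := (x.1, x.2 + sg b * d).
have OA : Om A by rewrite /A /sg; case: ifP => _; rewrite ?mul1r ?mulN1r.
have OB : Om B by rewrite /B /sg; case: ifP => _; rewrite ?mul1r ?mulN1r.
have sgn (t : R) : sg t * `|t| = t.
  by rewrite -mulr_sg mulrCA /sg; case: ifP; rewrite ?mulrNN !mulr1.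
have -> : z = A + (`|b| / d) *: (B - A).
  rewrite [LHS]surjective_pairing; congr pair; rewrite /= /GRing.scale /=.
    rewrite (_ : _ + _ = x.1 + sg a * (d - `|b|)); last by field.
    by rewrite dab addrK sgn /a; ring.
  rewrite (_ : _ + _ = x.2 + sg b * `|b|); last by field.
  by rewrite sgn /b; ring.
apply: cO => //; apply/andP; split; first by rewrite divr_ge0.
by rewrite ler_pdivrMr// mul1r dab lerDr.
Qed.

End mesh_maximal.

(** * Lipschitz truncation of discrete functions *)

Section mcshane.
Context {R : realType}.
Implicit Types (S : set (R * R)) (f : R * R -> R) (x y z : R * R).

(** The extension is the infimal convolution of [f] with [L |x - s|]. *)
Lemma mcshane S f (L : R) : 0 <= L ->
  (forall x y, S x -> S y -> `|f x - f y| <= L * `|x - y|) ->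
  exists F : R * R -> R, (forall x y, F x - F y <= L * `|x - y|) /\
    forall x, S x -> F x = f x.
Proof.
move=> L0 fL; have [[s0 Ss0]|S0] := pselect (exists s0, S s0); last first.
  exists (cst 0); split; last by move=> x Sx; case: S0; exists x.
  by move=> x y; rewrite subrr mulr_ge0.
pose E x := [set f s + L * `|x - s| | s in S].
have lbE x y : S y -> lbound (E x) (f y - L * `|x - y|).
  move=> Sy _ [s Ss <-]; have := fL _ _ Sy Ss; rewrite ler_norml => /andP[_].
  have : L * `|y - s| <= L * (`|x - y| + `|x - s|).
    by rewrite ler_wpM2l// [`|x - y|]distrC; exact: ler_distD.
  lra.
have hE x : has_inf (E x).
  by split; [exists (f s0 + L * `|x - s0|), s0|exists (f s0 - L * `|x - s0|); exact: lbE].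
exists (fun x => inf (E x)); split => [x y|x Sx]; last first.
  apply/eqP; rewrite eq_le; apply/andP; split.
    by apply: ge_inf; [exact: (hE x).2|exists x => //; rewrite subrr normr0 mulr0 addr0].
  by apply: lb_le_inf; [exact: (hE x).1|have := lbE x x Sx; rewrite subrr normr0 mulr0 subr0].
rewrite lerBlDr -lerBlDl; apply: lb_le_inf; first exact: (hE y).1.
move=> _ [s Ss <-]; rewrite lerBlDr.
apply: (@le_trans _ _ (f s + L * `|x - s|)); first by apply: ge_inf; [exact: (hE x).2|exists s].
have : L * `|x - s| <= L * (`|x - y| + `|y - s|) by rewrite ler_wpM2l//; exact: ler_distD.
lra.
Qed.

End mcshane.

Section truncation.
Context {R : realType} (Om : set (R * R)) (n : nat) (p : 'I_n -> 'I_3 -> R * R)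
    (s : R) (h : 'I_n -> R).
Hypothesis M : is_mesh Om p s h.
Variables (w : R * R -> R).
Hypothesis w0 : bdry0 Om p w.
Implicit Types (x y : R * R) (j k : 'I_n).
Notation g := (gnorm p w).
Notation v := (interp p w).

Let s0 := mesh_s M.

Section level.
Variables (xs : 'I_n -> R * R) (a : 'I_n -> R) (l : R).
Hypothesis xs_tri : forall j, tri (p j) (xs j).
Hypothesis ga : forall j, g j <= a j.
Hypothesis Ma : forall j, M1 p w (xs j) + M2 p w (xs j) <= a j.
Hypothesis l0 : 0 < l.

Definition good z := forall k, (exists i, p k i = z) -> a k <= l.

(** The detour of [good_lip] through the sample points costs [3 (h j + h k) + 2 |p j i - p k i'|]
    times the level, and [node_sep] bounds each size by [s * kappa s / 2] times the distance of the
    nodes. *)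
Definition tconst : R := 3 * (s * kappa s) + 2.

Lemma tconst_ge0 : 0 <= tconst.
Proof. by rewrite addr_ge0// mulr_ge0// mulr_ge0// ?(ltW s0) ?(ltW (kappa_gt0 M)). Qed.

Lemma v_vertex_xs j i : a j <= l -> `|w (p j i) - v (xs j)| <= l * h j.
Proof.
move=> al; have := interpB M w (tri_vertex (mesh_nondeg M j) i) (xs_tri j).
rewrite (interp_vertex M) => ->; apply: le_trans (dotp_le _ _) _.
apply: ler_pM; [exact: n1_ge0|exact: normr_ge0|exact: le_trans (ga j) al|].
by apply: (tri_diam M _ (xs_tri j)); exact: (tri_vertex (mesh_nondeg M j)).
Qed.

Lemma M_xs j : a j <= l -> M1 p w (xs j) <= l /\ M2 p w (xs j) <= l.
Proof.
move=> al; have := Ma j; have := M1_ge0 M w0 (xs j); have := M2_ge0 M w0 (xs j).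
by move=> *; split; lra.
Qed.

Lemma dist_xs j i : `|p j i - xs j| <= h j.
Proof. by apply: (tri_diam M _ (xs_tri j)); exact: (tri_vertex (mesh_nondeg M j)). Qed.

(** Each node is joined to the sample point of its triangle at cost [l] times the size, and between
    the sample points [v_diff] charges the maximal functions at exactly these two points. *)
Lemma good_lip j i k i' : good (p j i) -> good (p k i') ->
  `|w (p j i) - w (p k i')| <= l * tconst * `|p j i - p k i'|.
Proof.
move=> gj gk; have [->|ne] := eqVneq (p j i) (p k i'); first by rewrite !subrr !normr0 mulr0.
have aj : a j <= l by apply: gj; exists i.
have ak : a k <= l by apply: gk; exists i'.
have [M1j M2j] := M_xs aj; have [M1k M2k] := M_xs ak.
have sj := node_sep M ne.
have sk : 2 * h k <= s * kappa s * `|p j i - p k i'|.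
  by rewrite distrC; apply: (node_sep M); rewrite eq_sym.
have vj := v_vertex_xs i aj; have vk := v_vertex_xs i' ak.
set d := `|p j i - p k i'| in sj sk *.
have hj := h_gt0 M j; have hk := h_gt0 M k.
have dx : `|xs j - xs k| <= h j + d + h k.
  have e : xs j - xs k = - (p j i - xs j) + (p j i - p k i') + (p k i' - xs k).
    by rewrite opprB !addrA !subrK.
  rewrite e; apply: le_trans (ler_normD _ _) _; apply: lerD; last exact: dist_xs.
  by apply: le_trans (ler_normD _ _) _; rewrite lerD2r normrN; exact: dist_xs.
have vd := v_diff M w0 (xs j) (xs k).
have b1 : `|(xs j).1 - (xs k).1| * M1 p w (xs j) <= (h j + d + h k) * l.
  apply: ler_pM => //; first exact: (M1_ge0 M w0).
  by apply: le_trans dx; exact: (norm1_le (xs j - xs k)).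
have b2 : `|(xs j).2 - (xs k).2| * M2 p w (xs k) <= (h j + d + h k) * l.
  apply: ler_pM => //; first exact: (M2_ge0 M w0).
  by apply: le_trans dx; exact: (norm2_le (xs j - xs k)).
have t3 : `|w (p j i) - w (p k i')| <= `|w (p j i) - v (xs j)| + `|v (xs j) - v (xs k)| + `|w (p k i') - v (xs k)|.
  have e : w (p j i) - w (p k i') = (w (p j i) - v (xs j)) + (v (xs j) - v (xs k)) - (w (p k i') - v (xs k)) by ring.
  rewrite e; apply: le_trans (ler_normB _ _) _; rewrite lerD2r; exact: ler_normD.
have t4 : l * (h j) <= l * (s * kappa s * d / 2) by rewrite ler_pM2l//; lra.
have t5 : l * (h k) <= l * (s * kappa s * d / 2) by rewrite ler_pM2l//; lra.
rewrite (_ : l * tconst * d = 6 * (l * (s * kappa s * d / 2)) + 2 * l * d); last by rewrite /tconst; field.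
lra.
Qed.

(** As [good_lip], with [v_outer] in place of [v_diff]: the second node lies outside the domain and
    contributes through the vanishing of the extension there. *)
Lemma good_bdry j i k i' : good (p j i) -> ~ Om (p k i') ->
  `|w (p j i)| <= l * tconst * `|p j i - p k i'|.
Proof.
move=> gj nO; have [e|ne] := eqVneq (p j i) (p k i').
  by rewrite (w0 _) ?e// normr0 subrr normr0 mulr0.
have aj : a j <= l by apply: gj; exists i.
have [M1j M2j] := M_xs aj.
have sj := node_sep M ne.
have vj := v_vertex_xs i aj.
set d := `|p j i - p k i'| in sj *.
have hj := h_gt0 M j.
have dx : `|xs j - p k i'| <= h j + d.
  have e : xs j - p k i' = - (p j i - xs j) + (p j i - p k i') by rewrite opprB !addrA !subrK.
  by rewrite e; apply: le_trans (ler_normD _ _) _; rewrite lerD2r normrN; exact: dist_xs.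
have vo := v_outer M w0 (xs j) nO.
have b1 : (`|(xs j).1 - (p k i').1| + `|(xs j).2 - (p k i').2|) * (M1 p w (xs j) + M2 p w (xs j)) <= (2 * (h j + d)) * l.
  have m0 := addr_ge0 (M1_ge0 M w0 (xs j)) (M2_ge0 M w0 (xs j)).
  have ml := le_trans (Ma j) aj.
  apply: ler_pM => //.
  have n1 : `|(xs j).1 - (p k i').1| <= `|xs j - p k i'| := norm1_le (xs j - p k i').
  have n2 : `|(xs j).2 - (p k i').2| <= `|xs j - p k i'| := norm2_le (xs j - p k i').
  lra.
have t3 : `|w (p j i)| <= `|w (p j i) - v (xs j)| + `|v (xs j)|.
  by have := ler_normD (w (p j i) - v (xs j)) (v (xs j)); rewrite subrK.
have t4 : l * (h j) <= l * (s * kappa s * d / 2) by rewrite ler_pM2l//; lra.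
have t0 : 0 <= l * (h j) by rewrite mulr_ge0// ltW.
rewrite (_ : l * tconst * d = 6 * (l * (s * kappa s * d / 2)) + 2 * l * d); last by rewrite /tconst; field.
lra.
Qed.

(** Interpolation of the McShane extension keeps its Lipschitz constant up to the factor [s / 2] of
    [igrad_le_norm]. A triangle all of whose neighbours stay below [l] has only good vertices, where
    the nodal values are not changed. *)
Lemma lip_trunc : exists wl : R * R -> R, [/\ bdry0 Om p wl,
    forall j, n1 (igrad (p j) wl) <= l * (tconst * s / 2) &
    forall j, (forall k, nb p j k -> a k <= l) -> igrad (p j) wl = igrad (p j) w].
Proof.
pose S z := (exists j i, z = p j i) /\ (good z \/ ~ Om z).
have K0 : 0 <= l * tconst by rewrite mulr_ge0 ?(ltW l0)// tconst_ge0.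
have [|F [FL FS]] := @mcshane R S w (l * tconst) K0.
  move=> x y [[j [i xE]] Sx] [[k [i' yE]] Sy]; rewrite xE yE in Sx Sy *.
  case: Sx => [gx|nx]; case: Sy => [gy|ny].
  - exact: good_lip.
  - by rewrite (w0 ny) subr0; exact: good_bdry.
  - by rewrite (w0 nx) sub0r normrN distrC; exact: good_bdry.
  - by rewrite (w0 nx) (w0 ny) subrr normr0 mulr_ge0.
exists F; split.
- by move=> j i nO; rewrite FS ?(w0 nO)//; split; [exists j, i|right].
- move=> j; have := igrad_le_norm (mesh_nondeg M j) s0 (mesh_shape M j) (w := F) (K := l * tconst).
  move=> /(_ (fun i i' => FL (p j i) (p j i')) K0).
  by rewrite -!mulrA.
move=> j hj; rewrite /igrad; apply: eq_bigr => i _; rewrite FS//; split; first by exists j, i.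
by left => k [i' e]; apply: hj; exists i, i'.
Qed.

End level.
End truncation.

(** * Powers, levels and measures of elements *)

Section powr.
Context {R : realType}.
Implicit Types (x y q : R).

Lemma powR_mono x y q : 0 <= q -> 0 <= x -> x <= y -> x `^ q <= y `^ q.
Proof.
move=> q0 x0 xy; apply: (ge0_ler_powR q0) => //; rewrite nnegrE//.
exact: le_trans xy.
Qed.

Lemma powRK x q : q != 0 -> 0 <= x -> (x `^ q) `^ q^-1 = x.
Proof. by move=> q0 x0; rewrite -powRrM mulfV// powRr1. Qed.

Lemma powRVK x q : q != 0 -> 0 <= x -> (x `^ q^-1) `^ q = x.
Proof. by move=> q0 x0; rewrite -powRrM mulVf// powRr1. Qed.

(** Every term is at most the l^q norm of all of them; [q <= 3] turns [N ^ q] into a constant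
    independent of [q]. *)
Lemma powR_sum_le n (P : pred 'I_n) (a : 'I_n -> R) (N q : R) : 1 <= q <= 3 ->
  1 <= N -> #|[set k | P k]%SET|%:R <= N -> (forall k, 0 <= a k) ->
  (\sum_(k | P k) a k) `^ q <= N ^+ 3 * \sum_(k | P k) a k `^ q.
Proof.
move=> /andP[q1 q3] N1 cN a0.
have q0 : 0 < q by lra.
have N0 : 0 <= N by lra.
pose S := \sum_(k | P k) a k `^ q.
have S0 : 0 <= S by apply: sumr_ge0 => k _; exact: powR_ge0.
have aS k : P k -> a k <= S `^ q^-1.
  move=> Pk; rewrite -[leLHS](@powRK _ q) ?gt_eqF//; apply: powR_mono.
  - by rewrite invr_ge0 ltW.
  - exact: powR_ge0.
  by rewrite /S (bigD1 k)//= lerDl; apply: sumr_ge0 => i _; exact: powR_ge0.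
apply: (@le_trans _ _ ((N * S `^ q^-1) `^ q)).
  apply: powR_mono; [exact: ltW|by apply: sumr_ge0|].
  apply: (@le_trans _ _ (\sum_(k | P k) S `^ q^-1)); first exact: ler_sum.
  rewrite sumr_const -mulr_natl ler_wpM2r ?powR_ge0//.
  by apply: le_trans cN; rewrite cardsE.
rewrite powRM ?powR_ge0// powRVK ?gt_eqF// ler_wpM2r// -powR_mulrn//.
exact: ler_powR.
Qed.

Lemma powR_add_le x y q : 1 <= q <= 3 -> 0 <= x -> 0 <= y ->
  (x + y) `^ q <= 8 * (x `^ q + y `^ q).
Proof.
move=> hq x0 y0.
have := @powR_sum_le 2 predT (fun k => if k == ord0 then x else y) 2 q hq.
rewrite !big_ord_recl !big_ord0 /= !addr0 => H.
rewrite (_ : 8 = 2 ^+ 3); last by ring.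
apply: H; [by rewrite ler1n|by rewrite cardsE card_ord|by move=> k; case: ifP].
Qed.

(** From [2^-d >= 1 - d * ln 2 >= 1 - d] follows [2^d - 1 <= d * 2^d <= 2 * d]. *)
Lemma powR2_sub1 (d : R) : 0 <= d <= 1 -> 0 <= 2 `^ d - 1 <= 2 * d.
Proof.
move=> /andP[d0 d1].
have h1 : 1 <= 2 `^ d by rewrite -[leLHS](congr1 (@^~ d) (powR1 R)); apply: powR_mono => //; rewrite ler1n.
have h2 : 2 `^ d <= 2 by rewrite -[leRHS]powRr1//; apply: ler_powR => //; rewrite ler1n.
have l2 : ln 2 <= 1 :> R.
  have := @le_ln1Dx R 1; rewrite (_ : 1 + 1 = 2)//; apply; lra.
have l0 : 0 <= ln 2 :> R by rewrite ln_ge0// ler1n.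
have e1 : 1 - d <= 2 `^ (- d).
  rewrite /powR pnatr_eq0 /=; apply: le_trans (expR_ge1Dx _).
  by rewrite mulNr lerD2l lerN2 ler_piMr.
have e2 : 2 `^ (- d) = (2 `^ d)^-1 by rewrite powRN.
have p0 : 0 < 2 `^ d by lra.
have e3 : (1 - d) * 2 `^ d <= 1.
  by rewrite -[leRHS](mulVf (lt0r_neq0 p0)) ler_pM2r// -e2.
have : d * 2 `^ d <= d * 2 by rewrite ler_wpM2l.
by move=> ?; apply/andP; split; lra.
Qed.

(** Since [(2^d - 1) * l^d = (2 l)^d - l^d] and twice a level is the preceding one, the sum
    telescopes: [c] is the d-th power of twice the largest of the [N] levels below [m], or of
    [L / 2^N] if there is none. *)
Lemma telescope_lev (L m d : R) (N : nat) : 0 < L -> 0 < m <= L -> 0 <= d ->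
  let c := (L * 2^-1 ^+ N) `^ d +
    \sum_(k < N) (if lev L k < m then (2 `^ d - 1) * lev L k `^ d else 0) in
  m `^ d <= c <= (Num.max (L * 2^-1 ^+ N) (2 * m)) `^ d.
Proof.
move=> L0 /andP[m0 mL] d0 /=; elim: N => [|N IH].
  rewrite big_ord0 addr0 expr0 mulr1; apply/andP; split; first by apply: powR_mono => //; exact: ltW.
  by apply: powR_mono => //; [exact: ltW|rewrite le_max lexx].
have b0 : 0 < L * 2^-1 ^+ N by rewrite mulr_gt0// exprn_gt0.
have lN : lev L N = L * 2^-1 ^+ N / 2 by rewrite /lev exprSr mulrA.
have l0 : 0 < lev L N := lev_gt0 N L0.
have e2 : L * 2^-1 ^+ N = 2 * lev L N by rewrite lN; field.
rewrite big_ord_recr /= -/(lev L N).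
case: ifPn => [lm|]; last first.
  rewrite -leNgt => ml; rewrite addr0 big1 ?addr0; last first.
    move=> k _; rewrite ltNge (le_trans ml)//= /lev ler_pM2l//.
    by apply: ler_wiXn2l; [rewrite invr_ge0|rewrite invf_le1 ?ler1n|rewrite ltnS ltnW].
  apply/andP; split; first by apply: powR_mono => //; exact: ltW.
  by apply: powR_mono => //; [exact: ltW|rewrite le_max lexx].
move: IH; rewrite e2 powRM ?(ltW l0)//.
rewrite [X in _ -> _ <= X <= _](_ : _ = 2 `^ d * lev L N `^ d +
  \sum_(k < N) (if lev L k < m then (2 `^ d - 1) * lev L k `^ d else 0)); last by rewrite -/(lev L N); ring.
move=> /andP[-> h] /=; apply: le_trans h _; apply: powR_mono => //.
  by rewrite le_max mulr_ge0 ?(ltW l0).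
rewrite ge_max !le_max lexx orbT andbT; apply/orP; right.
by rewrite ler_pM2l// ltW.
Qed.

End powr.

Section mesh_measure.
Context {R : realType} (Om : set (R * R)) (n : nat) (p : 'I_n -> 'I_3 -> R * R)
    (s : R) (h : 'I_n -> R).
Hypothesis M : is_mesh Om p s h.
Implicit Types (x y : R * R) (j k : 'I_n).
Notation T j := (tri (p j) : set (plane R)).

Definition tau j : R := fine (lam (T j)).

Lemma lam_tri_fin j : lam (T j) \is a fin_num.
Proof. by rewrite ge0_fin_numE// (le_lt_trans (lam_tri_le M j))// ltry. Qed.

Lemma tauE j : lam (T j) = (tau j)%:E.
Proof. by rewrite fineK// lam_tri_fin. Qed.

Lemma tau_ge j : (2 * (h j / s)) ^+ 2 <= tau j.
Proof. by rewrite -lee_fin -tauE; exact: (lam_tri_ge M). Qed.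

Lemma tau_le j : tau j <= (4 * h j) ^+ 2.
Proof. by rewrite -lee_fin -tauE; exact: (lam_tri_le M). Qed.

Lemma tau_gt0 j : 0 < tau j.
Proof.
apply: lt_le_trans (tau_ge j); rewrite exprn_gt0// mulr_gt0// divr_gt0 ?(h_gt0 M)//.
exact: (mesh_s M).
Qed.

(** Off the lines carrying the sides, a point of a triangle is interior to it, hence lies strictly
    between a point of the domain and one of its closure, unless it is that point of the domain;
    convexity puts it in the domain. *)
Lemma ae_tri : {ae lam, forall x : plane R, [/\ forall j, T j x -> Om x,
  forall j k, T j x -> T k x -> j = k & Om x -> exists j, T j x]}.
Proof.
have := ae_bary_neq0 M; apply: filterS => x hb; split.
- move=> j xj; have bp i : 0 < bary (p j) i x by rewrite lt_neqAle eq_sym hb xj.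
  pose e : R := Num.min (bary (p j) o0 x / (n1 (bgrad (p j) o0) + 1))
    (Num.min (bary (p j) o1 x / (n1 (bgrad (p j) o1) + 1)) (bary (p j) o2 x / (n1 (bgrad (p j) o2) + 1))).
  have g0 i : 0 < n1 (bgrad (p j) i) + 1 by rewrite ltr_wpDl// n1_ge0.
  have e0 : 0 < e by rewrite !lt_min; do !(apply/andP; split); rewrite divr_gt0.
  have eb y : `|y - x| <= e -> T j y.
    move=> yx i.
    have : n1 (bgrad (p j) i) * `|y - x| <= bary (p j) i x.
      apply: (@le_trans _ _ ((n1 (bgrad (p j) i) + 1) * e)).
        by apply: ler_pM => //; [exact: n1_ge0|rewrite lerDl].
      rewrite mulrC -ler_pdivlMr//; move: i; apply: ord3P; rewrite /e !ge_min ?lexx ?orbT//.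
    have := dotp_le (bgrad (p j) i) (y - x); rewrite ler_norml => /andP[h1 _] h2.
    by rewrite (baryE (p j) i y x); lra.
  have cx : closure Om x by apply: (tri_sub M); exact: xj.
  have [a Oa _] := closure_ex cx (@ltr01 R).
  have [->//|ox] := eqVneq x a.
  have d0 : 0 < `|x - a| by rewrite normr_gt0 subr_eq0.
  pose t := e / `|x - a|; have t0 : 0 < t by rewrite divr_gt0.
  pose y := x + t *: (x - a).
  have yc : closure Om y.
    apply: (tri_sub M); apply: (eb y).
    by rewrite /y addrC addKr normrZ gtr0_norm// divfK// gt_eqF.
  have -> : x = a + (1 / (1 + t)) *: (y - a).
    rewrite (_ : y - a = (1 + t) *: (x - a)); last by rewrite scalerDl scale1r /y addrAC.
    by rewrite scalerA mul1r mulVf ?gt_eqF ?addr_gt0// scale1r addrC subrK.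
  apply: (cvx_open_closure (mesh_open M) (mesh_cvx M) Oa yc).
  by rewrite divr_ge0 ?addr_ge0 ?(ltW t0)//= ltr_pdivrMr ?addr_gt0// mul1r ltrDl.
- by move=> j k; exact: (tri_uniq M).
- by move=> /subset_closure; rewrite (mesh_cover M) => -[j _]; exists j.
Qed.

Lemma ae_patch (f : plane R -> R) :
  {ae lam, forall x : plane R, (f \_ Om) x = \sum_j (f \_ (T j)) x}.
Proof.
have := ae_tri; apply: filterS => x [h1 h2 h3].
rewrite patchE; case: ifPn; rewrite ?inE ?notin_setE => Ox.
  have [j xj] := h3 Ox; rewrite (bigD1 j)//= patchE mem_set// big1 ?addr0// => k kj.
  rewrite patchE memNset// => xk; case/eqP: kj; exact: h2.
rewrite big1// => j _; rewrite patchE memNset// => xj; apply: Ox; exact: h1 xj.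
Qed.

Lemma measurable_patch_tri j (f : plane R -> R) : measurable_fun setT f ->
  measurable_fun setT (f \_ (T j)).
Proof.
move=> mf; apply/(measurable_restrictT f (measurable_tri p j)).
exact: measurable_funTS.
Qed.

Lemma mesh_measurable : measurable (Om : set (plane R)).
Proof. by apply: open_measurable2; exact: (mesh_open M). Qed.

Lemma measurable_patch_Om (f : plane R -> R) : measurable_fun Om f ->
  measurable_fun setT (f \_ Om).
Proof. by move=> mf; apply/(measurable_restrictT f mesh_measurable). Qed.

Lemma ge0_integral_mesh (f : plane R -> R) : measurable_fun setT f -> (forall x, 0 <= f x) ->
  (\int[lam]_(x in Om) (f x)%:E = \sum_j \int[lam]_(x in T j) (f x)%:E)%E.
Proof.
move=> mf f0; rewrite integral_mkcond.
under eq_bigr do rewrite integral_mkcond.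
have mP j : measurable_fun setT (fun x => (f \_ (T j)) x).
  exact: measurable_patch_tri.
have eP (D : set (plane R)) : (fun x => (f x)%:E) \_ D = (fun x => ((f \_ D) x)%:E).
  by apply/funext => x; rewrite !patchE; case: ifP.
have P0 (D : set (plane R)) x : 0 <= (f \_ D) x by rewrite patchE; case: ifP.
rewrite eP; under eq_bigr do rewrite eP.
rewrite -ge0_integral_sum//; last 2 first.
- by move=> j; apply/measurable_EFinP; exact: mP.
- by move=> j x _; rewrite lee_fin; exact: P0.
under [RHS]eq_integral do rewrite sumEFin.
apply: ge0_ae_eq_integral => //.
- by apply/measurable_EFinP; apply: measurable_patch_Om; exact: measurable_funTS.
- by apply/measurable_EFinP; apply: measurable_sum => j; exact: mP.
- by move=> x _; rewrite lee_fin; exact: P0.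
- by move=> x _; rewrite lee_fin; apply: sumr_ge0 => j _; exact: P0.
have := ae_patch f; apply: filterS => x -> //.
Qed.

Lemma sum_integral_tri_le (f : plane R -> R) : measurable_fun setT f -> (forall x, 0 <= f x) ->
  (\sum_j \int[lam]_(x in T j) (f x)%:E <= \int[lam]_x (f x)%:E)%E.
Proof.
move=> mf f0; rewrite -ge0_integral_mesh//; apply: ge0_subset_integral => //.
- exact: mesh_measurable.
- by apply/measurable_EFinP.
- by move=> x _; rewrite lee_fin.
Qed.

(** Otherwise [f] would exceed its mean value everywhere on the triangle, and [f] minus the mean
    would be positive with integral 0. *)
Lemma sample j (f : plane R -> R) : measurable_fun setT f -> (forall x, 0 <= f x) ->
  exists2 x, T j x & ((tau j * f x)%:E <= \int[lam]_(x in T j) (f x)%:E)%E.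
Proof.
move=> mf f0.
have [//|H] := pselect (exists2 x, T j x & ((tau j * f x)%:E <= \int[lam]_(x in T j) (f x)%:E)%E).
exfalso; have t0 := tau_gt0 j.
have lt x : T j x -> (\int[lam]_(x in T j) (f x)%:E < (tau j * f x)%:E)%E.
  by move=> xj; rewrite ltNge; apply/negP => hx; apply: H; exists x.
have v0 := tri_vertex (mesh_nondeg M j) o0.
have I0 : (0 <= \int[lam]_(x in T j) (f x)%:E)%E.
  by apply: integral_ge0 => x _; rewrite lee_fin.
have mT := measurable_tri p j.
have mfT : measurable_fun (T j) (fun x => (f x)%:E) by apply/measurable_EFinP; exact: measurable_funTS.
pose I := fine (\int[lam]_(x in T j) (f x)%:E)%E.
have IE : (\int[lam]_(x in T j) (f x)%:E = I%:E)%E.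
  by rewrite fineK// ge0_fin_numE// (lt_trans (lt _ v0))// ltry.
pose c := I / tau j.
have c0 : 0 <= c by rewrite divr_ge0 ?(ltW t0)// -lee_fin -IE.
have cf x : T j x -> c < f x.
  by move=> xj; rewrite ltr_pdivrMr// mulrC -lte_fin -IE; exact: lt.
have mfc : measurable_fun (T j) (fun x => (f x - c)%:E).
  by apply/measurable_EFinP; apply: measurable_funB => //; exact: measurable_funTS.
have Z : (\int[lam]_(x in T j) (f x - c)%:E = 0)%E.
  have : (\int[lam]_(x in T j) (f x)%:E = \int[lam]_(x in T j) (f x - c)%:E + c%:E * lam (T j))%E.
    rewrite -(integral_cst lam mT c%:E) -ge0_integralD//.
    - by apply: eq_integral => x _; rewrite -EFinD subrK.
    - by move=> x /cf cx; rewrite lee_fin subr_ge0 ltW.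
  rewrite IE tauE -EFinM /c divfK ?gt_eqF//.
  by move=> /(congr1 (fun z : \bar R => (z - I%:E)%E)); rewrite addeK// subee// => <-.
have /ae_eq_integral_abs : (\int[lam]_(x in T j) `|(f x - c)%:E| = 0)%E.
  rewrite -[RHS]Z; apply: eq_integral => x; rewrite inE => /cf cx.
  by rewrite gee0_abs// lee_fin subr_ge0 ltW.
move=> /(_ mT mfc) [N [mN N0 sub]].
have : (lam (T j) <= lam N)%E.
  apply: le_measure; rewrite ?inE// => x xj; apply: sub => /= /(_ xj) /eqP.
  by rewrite eqe subr_eq0 gt_eqF// cf.
by rewrite N0 tauE lee_fin leNgt t0.
Qed.

Lemma Dsum_Lp (w : R * R -> R) q : 0 < q ->
  (\int[lam]_x (Dsum p w x `^ q)%:E <= (\sum_j tau j * gnorm p w j `^ q)%:E)%E.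
Proof.
move=> q0.
have E j : (\int[lam]_x (gnorm p w j `^ q * \1_(T j) x)%:E = (tau j * gnorm p w j `^ q)%:E)%E.
  under eq_integral do rewrite EFinM.
  rewrite ge0_integralZl//.
  - by rewrite integral_indic ?setIT ?tauE 1?muleC//; exact: (measurable_tri p).
  - by apply/measurable_EFinP; apply: measurable_indic; exact: (measurable_tri p).
  - by rewrite lee_fin powR_ge0.
rewrite -sumEFin; under [leRHS]eq_bigr do rewrite -E.
have mI j : measurable_fun setT (fun x => (gnorm p w j `^ q * \1_(T j) x)).
  by apply: measurable_funM => //; apply: measurable_indic; exact: (measurable_tri p).
rewrite -ge0_integral_sum//; last 2 first.
- by move=> j; apply/measurable_EFinP; exact: mI.
- by move=> j x _; rewrite lee_fin mulr_ge0 ?powR_ge0// indicE.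
under [leRHS]eq_integral do rewrite sumEFin.
apply: ae_ge0_le_integral => //.
- by move=> x _; rewrite lee_fin powR_ge0.
- exact: (measurable_powRf q (measurable_Dsum p w)).
- by move=> x _; rewrite lee_fin; apply: sumr_ge0 => j _; rewrite mulr_ge0 ?powR_ge0// indicE.
- by apply/measurable_EFinP; apply: measurable_sum => j; exact: mI.
have := ae_tri; apply: filterS => x [_ h2 _] _.
have S0 : 0 <= \sum_j gnorm p w j `^ q * \1_(T j) x.
  by apply: sumr_ge0 => j _; rewrite mulr_ge0 ?powR_ge0// indicE.
rewrite lee_fin; have [[j xj]|nj] := pselect (exists j, T j x).
  rewrite /Dsum (bigD1 j)//= asboolT// big1 ?addr0.
    rewrite (bigD1 j)//= indicE mem_set// mulr1 lerDl.
    by apply: sumr_ge0 => k _; rewrite mulr_ge0 ?powR_ge0// indicE.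
  by move=> k kj; rewrite asboolF// => xk; case/eqP: kj; exact: h2.
rewrite /Dsum big1 ?powR0 ?gt_eqF// => j _.
by rewrite asboolF// => xj; apply: nj; exists j.
Qed.

End mesh_measure.

(** * The discrete energy bound *)

Section igrad_linear.
Context {R : realType} (p : 'I_3 -> R * R).
Implicit Types (w : R * R -> R).

Lemma igradD w w' : igrad p (fun x => w x + w' x) = igrad p w + igrad p w'.
Proof. by rewrite /igrad -big_split /=; apply: eq_bigr => i _; rewrite scalerDl. Qed.

Lemma igradZ (c : R) w : igrad p (fun x => c * w x) = c *: igrad p w.
Proof. by rewrite /igrad scaler_sumr; apply: eq_bigr => i _; rewrite scalerA. Qed.

Lemma igradB w w' : igrad p (fun x => w x - w' x) = igrad p w - igrad p w'.
Proof. by rewrite /igrad -sumrB; apply: eq_bigr => i _; rewrite scalerBl. Qed.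

Lemma igrad_sum m (W : 'I_m -> R * R -> R) :
  igrad p (fun x => \sum_k W k x) = \sum_k igrad p (W k).
Proof.
rewrite /igrad exchange_big /=; apply: eq_bigr => i _.
by rewrite scaler_suml.
Qed.

Lemma n1D (x y : R * R) : n1 (x + y) <= n1 x + n1 y.
Proof.
rewrite /n1 /= addrACA; apply: lerD; exact: ler_normD.
Qed.

Lemma n1Z (c : R) (x : R * R) : n1 (c *: x) = `|c| * n1 x.
Proof. by rewrite /n1 /= !normrM mulrDr. Qed.

Lemma n1_eq0 (x : R * R) : n1 x = 0 -> x = 0.
Proof.
move/eqP; rewrite /n1 paddr_eq0// !normr_eq0 => /andP[/eqP e1 /eqP e2].
by rewrite [x]surjective_pairing e1 e2.
Qed.

Lemma n1_0 : n1 (0 : R * R) = 0.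
Proof. by rewrite /n1 /= normr0 addr0. Qed.

Lemma n1_sum m (P : pred 'I_m) (F : 'I_m -> R * R) :
  n1 (\sum_(k | P k) F k) <= \sum_(k | P k) n1 (F k).
Proof.
elim/big_ind2 : _ => [|x a y b h1 h2|//]; first by rewrite n1_0.
by apply: le_trans (n1D _ _) _; exact: lerD.
Qed.

Lemma dotp_sumr m (P : pred 'I_m) (g : R * R) (F : 'I_m -> R * R) :
  dotp g (\sum_(k | P k) F k) = \sum_(k | P k) dotp g (F k).
Proof.
elim/big_ind2 : _ => [|x a y b <- <-|//]; first by rewrite /dotp !mulr0 addr0.
by rewrite dotpD.
Qed.

End igrad_linear.

(** Double counting: each [a k] is charged by the at most [N] indices [j] related to [k], whose
    weights are at most [K * t k]. *)
Lemma neighbour_sum_le (R : realType) m (P : rel 'I_m) (t a b : 'I_m -> R) (S K N : R) :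
  0 <= S -> 0 <= K -> (forall k, 0 <= t k) -> (forall k, 0 <= a k) ->
  (forall j, b j <= S * \sum_(k | P j k) a k) ->
  (forall j k, P j k -> t j <= K * t k) ->
  (forall k, #|[set j | P j k]%SET|%:R <= N) ->
  \sum_j t j * b j <= N * S * K * \sum_k t k * a k.
Proof.
move=> S0 K0 t0 a0 bS tK PN.
apply: (@le_trans _ _ (\sum_j \sum_(k | P j k) S * K * (t k * a k))).
  apply: ler_sum => j _; apply: (@le_trans _ _ (t j * (S * \sum_(k | P j k) a k))).
    by rewrite ler_wpM2l.
  rewrite mulrCA !mulr_sumr; apply: ler_sum => k jk.
  by rewrite -mulrA ler_wpM2l// mulrA ler_wpM2r//; exact: tK.
rewrite (exchange_big_dep xpredT)//= mulr_sumr; apply: ler_sum => k _.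
rewrite sumr_const -mulr_natl -!mulrA ler_wpM2r//; first by rewrite !mulr_ge0.
by apply: le_trans (PN k); rewrite cardsE.
Qed.

Section stability.
Context {R : realType}.

(** Three vertices, each with at most [(1 + 2 * s) ^+ 2] triangles. *)
Definition starN (s : R) : R := 3 * (1 + 2 * s) ^+ 2.
(** [starN s ^+ 4] collects the third power in [powR_sum_le] and the overlap of the neighbourhoods,
    [4 * (kappa s * s) ^+ 2] is the ratio of the areas of neighbours, and the last factor adds the
    bounds of the maximal functions and of the gradient. *)
Definition maxC (s : R) : R :=
  starN s ^+ 4 * (4 * (kappa s * s) ^+ 2) * (8 * (16 * (3 * 2 ^+ 14) + 1)).
Definition truncC (s : R) : R := tconst s * s / 2.

Variables (Om : set (R * R)) (n : nat) (p : 'I_n -> 'I_3 -> R * R) (s : R) (h : 'I_n -> R).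
Hypothesis M : is_mesh Om p s h.
Variables (w : R * R -> R).
Hypothesis w0 : bdry0 Om p w.
Implicit Types (x y : R * R) (j k : 'I_n).
Notation g := (gnorm p w).
Notation T j := (tri (p j) : set (plane R)).
Notation tau := (tau p).

Let s0 := mesh_s M.

Lemma starN_ge1 : 1 <= starN s.
Proof.
rewrite /starN; have : 1 <= (1 + 2 * s) ^+ 2.
  rewrite exprn_ege1// lerDl; have := s0; lra.
lra.
Qed.

Lemma nb_sym j k : nb p j k -> nb p k j.
Proof. by move=> [i [i' e]]; exists i', i. Qed.

Lemma nb_card j : #|[set k | `[< nb p j k >]]%SET|%:R <= starN s.
Proof.
pose Z (i : 'I_3) := [set k | `[< tri (p k) (p j i) >]]%SET.
have sub : ([set k | `[< nb p j k >]] \subset \bigcup_i Z i)%SET.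
  apply/fintype.subsetP => k; rewrite inE => /asboolP [i [i' e]].
  apply/bigcupP; exists i => //; rewrite inE; apply/asboolP; rewrite e.
  exact: (tri_vertex (mesh_nondeg M k)).
apply: (@le_trans _ _ (\sum_i #|Z i|)%:R).
  rewrite ler_nat; apply: leq_trans (subset_leq_card sub) _.
  elim/big_ind2 : _ => [|A a B b hA hB|//]; first by rewrite cards0.
  by apply: leq_trans (leq_add hA hB); rewrite cardsU leq_subr.
rewrite natr_sum /starN; apply: (@le_trans _ _ (\sum_(i < 3) (1 + 2 * s) ^+ 2)).
  apply: ler_sum => i _; apply: (card_star M (z := p j i)) => k; rewrite inE.
  by move/asboolP.
set X := (1 + 2 * s) ^+ 2; rewrite sum3; lra.
Qed.

Lemma tau_nb j k : nb p j k -> tau j <= 4 * (kappa s * s) ^+ 2 * tau k.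
Proof.
move=> /nb_sym/(nb_comparable M) hjk.
apply: le_trans (tau_le M j) _.
have hj := h_gt0 M j; have hk := h_gt0 M k; have k0 := kappa_gt0 M.
apply: (@le_trans _ _ ((4 * (kappa s * h k)) ^+ 2)).
  rewrite ler_pXn2r ?nnegrE ?mulr_ge0 ?(ltW hj) ?(ltW hk) ?(ltW k0)//.
  by rewrite ler_pM2l.
apply: (@le_trans _ _ (4 * (kappa s * s) ^+ 2 * (2 * (h k / s)) ^+ 2)).
  rewrite le_eqVlt; apply/orP; left; apply/eqP; field.
  by rewrite gt_eqF.
rewrite ler_wpM2l ?(tau_ge M)// mulr_ge0// exprn_ge0// mulr_ge0// ltW//.
Qed.

Section exponent.
Variable d : R.
Hypothesis d01 : 0 < d <= 1.
Notation q := (2 + d).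

Let d0 : 0 < d. Proof. by case/andP: d01. Qed.
Let q13 : 1 <= q <= 3. Proof. by move: d01 => /andP[? ?]; apply/andP; split; lra. Qed.
Let q0 : 0 < q. Proof. by move: d0 => ?; lra. Qed.
Let q323 : 3 / 2 <= q <= 3. Proof. by move: d01 => /andP[? ?]; apply/andP; split; lra. Qed.

Definition mm (x : plane R) : R := M1 p w x + M2 p w x.

Lemma mm_ge0 x : 0 <= mm x.
Proof. exact: addr_ge0 (M1_ge0 M w0 x) (M2_ge0 M w0 x). Qed.

Lemma measurable_mm : measurable_fun setT mm.
Proof. exact: measurable_funD (measurable_M1 M w0) (measurable_M2 M w0). Qed.

Definition Egy : R := \sum_j tau j * g j `^ q.

Lemma mm_Lp : (\int[lam]_x (mm x `^ q)%:E <= (16 * (3 * 2 ^+ 14) * Egy)%:E)%E.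
Proof.
have D := Dsum_Lp M w q0.
have B1 := le_trans (M1_Lp M w0 q323) (lee_wpmul2l _ D).
have B2 := le_trans (M2_Lp M w0 q323) (lee_wpmul2l _ D).
have C0 : (0 <= (3 * 2 ^+ 14)%:E :> \bar R)%E by rewrite lee_fin mulr_ge0.
have m1 := measurable_powRf q (measurable_M1 M w0).
have m2 := measurable_powRf q (measurable_M2 M w0).
apply: (@le_trans _ _ (8%:E * \int[lam]_x ((M1 p w x `^ q)%:E + (M2 p w x `^ q)%:E))%E).
  rewrite -ge0_integralZl//; last 2 first.
  - exact: emeasurable_funD m1 m2.
  - by move=> x _; rewrite adde_ge0// lee_fin powR_ge0.
  apply: ge0_le_integral => //.
  - by move=> x _; rewrite lee_fin powR_ge0.
  - exact: (measurable_powRf q measurable_mm).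
  - by apply: measurable_funeM; exact: emeasurable_funD m1 m2.
  - move=> x _; rewrite -EFinD -EFinM lee_fin; apply: (powR_add_le q13).
      exact: (M1_ge0 M w0).
    exact: (M2_ge0 M w0).
have p1 (x : plane R) : [set: plane R] x -> (0 <= (M1 p w x `^ q)%:E)%E by rewrite lee_fin powR_ge0.
have p2 (x : plane R) : [set: plane R] x -> (0 <= (M2 p w x `^ q)%:E)%E by rewrite lee_fin powR_ge0.
rewrite (ge0_integralD lam measurableT p1 m1 p2 m2).
have h8 : (0 <= 8%:E :> \bar R)%E by rewrite lee_fin.
apply: le_trans (lee_wpmul2l h8 (leeD (B1 C0) (B2 C0))) _.
have E (b c : R) : (8%:E * (c%:E * b%:E + c%:E * b%:E) = (16 * c * b)%:E)%E.
  by transitivity ((8 * (c * b + c * b))%:E) => //; congr EFin; ring.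
by rewrite E.
Qed.

(** One point per triangle where [mm ^ q] is at most its mean replaces the integral by a finite sum,
    and gives the truncation definite points at which to compare with the maximal functions. *)
Lemma sample_points : exists2 xs : 'I_n -> R * R, forall j, tri (p j) (xs j) &
  \sum_j tau j * mm (xs j) `^ q <= 16 * (3 * 2 ^+ 14) * Egy.
Proof.
have mq : measurable_fun setT (fun x => mm x `^ q).
  by apply: (measurableT_comp (measurable_powR q)); exact: measurable_mm.
have q0' x : 0 <= mm x `^ q by exact: powR_ge0.
have [xs xT xle] := fin_all_exists2 (fun j => sample M j mq q0').
exists xs => //; rewrite -lee_fin -sumEFin; apply: le_trans mm_Lp.
apply: le_trans (sum_integral_tri_le M mq q0').
by apply: lee_sum => j _; exact: xle.
Qed.

Lemma majorant : exists xs : 'I_n -> R * R, exists a Ma : 'I_n -> R, [/\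
  forall j, tri (p j) (xs j) /\ M1 p w (xs j) + M2 p w (xs j) <= a j,
  forall j, 0 <= g j <= a j,
  forall j, a j <= Ma j,
  forall j (l : R), Ma j <= l -> forall k, nb p j k -> a k <= l &
  \sum_j tau j * Ma j `^ q <= maxC s * Egy].
Proof.
have [xs xT xle] := sample_points.
pose a j := mm (xs j) + g j.
have a0 j : 0 <= a j by rewrite addr_ge0 ?mm_ge0 ?gnorm_ge0.
(* A sum over the neighbours does the work of their maximum: it dominates each of them, and
   [powR_sum_le] handles its powers. *)
pose Ma j := \sum_(k | `[< nb p j k >]) a k.
have aM j k : nb p j k -> a k <= Ma j.
  move=> jk; rewrite /Ma (bigD1 k) ?asboolT//= lerDl.
  by apply: sumr_ge0.
exists xs, a, Ma; split.
- by move=> j; split => //; rewrite /a -/(mm (xs j)) lerDl gnorm_ge0.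
- by move=> j; rewrite gnorm_ge0 /a lerDr mm_ge0.
- by move=> j; apply: aM; exists o0, o0.
- by move=> j l Ml k jk; apply: le_trans Ml; exact: aM.
have N1 := starN_ge1; have N0 : 0 <= starN s by lra.
have K0 : 0 <= 4 * (kappa s * s) ^+ 2.
  by rewrite mulr_ge0// exprn_ge0// mulr_ge0// ltW// (kappa_gt0 M).
have pw k : 0 <= a k `^ q by exact: powR_ge0.
have t0 j : 0 <= tau j by rewrite ltW// (tau_gt0 M).
have S0 : 0 <= starN s ^+ 3 by rewrite exprn_ge0.
apply: le_trans (neighbour_sum_le (P := fun j k => `[< nb p j k >]) S0 K0 t0 pw (N := starN s) _ _ _) _.
- by move=> j; apply: powR_sum_le => //; exact: nb_card.
- by move=> j k /asboolP; exact: tau_nb.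
- move=> k; apply: le_trans (nb_card k); rewrite ler_nat; apply: subset_leq_card.
  apply/fintype.subsetP => j; rewrite finset.in_set => /asboolP jk.
  by rewrite finset.in_set; apply/asboolP; exact: nb_sym.
rewrite -exprS /maxC -[leRHS]mulrA; apply: ler_wpM2l; first by rewrite mulr_ge0// exprn_ge0.
apply: (@le_trans _ _ (\sum_k 8 * (tau k * mm (xs k) `^ q + tau k * g k `^ q))).
  apply: ler_sum => k _; rewrite -mulrDr mulrCA ler_wpM2l//.
  by apply: powR_add_le => //; [exact: mm_ge0|exact: gnorm_ge0].
rewrite -mulr_sumr big_split /= -mulrA ler_pM2l// mulrDl mul1r.
by rewrite lerD2r.
Qed.

Section energy.
Variables (c Lam K : R) (b : 'I_n -> R * R).
Hypotheses (c_gt0 : 0 < c) (Lam_gt0 : 0 < Lam) (K_ge0 : 0 <= K).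
Hypothesis b_coercive : forall j, c * tau j * g j ^+ 2 <= dotp (b j) (igrad (p j) w).
Hypothesis b_bounded : forall j y, `|dotp (b j) y| <= Lam * tau j * g j * n1 y.
Hypothesis b_source : forall phi, bdry0 Om p phi ->
  \sum_j dotp (b j) (igrad (p j) phi) <=
  K * (\sum_j tau j * n1 (igrad (p j) phi) `^ (q / (1 + d))) `^ ((1 + d) / q).
Hypothesis d_small : d * (16 * Lam * truncC s * maxC s) <= c.

Lemma truncC_ge0 : 0 <= truncC s.
Proof. by rewrite /truncC mulr_ge0// mulr_ge0 ?(ltW s0)// (tconst_ge0 M). Qed.

(* The test function combines [w] with its Lipschitz truncations at dyadic levels so that
   its gradient is essentially [|grad w| ^ d] times that of [w]. *)
Lemma test_function_ex : exists Ma : 'I_n -> R, exists phi, [/\ bdry0 Om p phi,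
  forall j, 0 <= Ma j, \sum_j tau j * Ma j `^ q <= maxC s * Egy,
  forall j, c * (tau j * g j `^ q) <=
    dotp (b j) (igrad (p j) phi) + 8 * Lam * d * truncC s * (tau j * Ma j `^ q) &
  forall j, n1 (igrad (p j) phi) <= (2 + 8 * truncC s) * Ma j `^ (1 + d)].
Proof.
have [xs [a [Ma [xsa ga aMa Mal MaE]]]] := majorant.
have C10 := truncC_ge0.
have Ma0 j : 0 <= Ma j by have /andP[h1 h2] := ga j; apply: le_trans (le_trans h1 h2) (aMa j).
pose L := \sum_j Ma j + 1.
have L0 : 0 < L by rewrite ltr_wpDl// sumr_ge0.
have MaL j : Ma j <= L.
  by rewrite /L (bigD1 j)//= -addrA lerDl addr_ge0// sumr_ge0.
(* Enough levels for the lowest one, [L / 2^N], to be at most every positive [Ma j]. *)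
have [N hN] : exists N : nat, forall j, 0 < Ma j -> L * 2^-1 ^+ N <= Ma j.
  have H j : exists k : nat, 0 < Ma j -> lev L k < Ma j.
    have [m0|m0] := ltP 0 (Ma j); last by exists 0%N.
    by have [k /andP[kl _]] := lev_ex m0 (MaL j); exists k.
  have [N hN] := fin_all_exists H.
  exists (\sum_j (N j).+1)%N => j /hN/ltW; apply: le_trans; rewrite /lev ler_pM2l//.
  apply: ler_wiXn2l; [by rewrite invr_ge0|by rewrite invf_le1 ?ler1n|].
  by rewrite (bigD1 j)//= leq_addr.
have wlE (k : nat) : exists wl : R * R -> R, [/\ bdry0 Om p wl,
    forall j, n1 (igrad (p j) wl) <= lev L k * truncC s &
    forall j, Ma j <= lev L k -> igrad (p j) wl = igrad (p j) w].
  have := @lip_trunc R Om n p s h M w w0 xs a (lev L k) (fun j => (xsa j).1)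
    (fun j => proj2 (andP (ga j))) (fun j => (xsa j).2) (lev_gt0 k L0).
  move=> [wl [h1 h2 h3]]; exists wl; split => // j Ml.
  by apply: h3; exact: Mal Ml.
have [W hW] := fin_all_exists (fun k : 'I_N => wlE k).
pose th : R := 2 `^ d - 1.
have [th0 th2] : 0 <= th /\ th <= 2 * d.
  apply/andP; apply: powR2_sub1; case/andP: d01 => ? ?; apply/andP; split; lra.
(* The initial term of [telescope_lev], which makes the total weight of [w] on a triangle comparable
   to [Ma j ^ d]. *)
pose beta := (L * 2^-1 ^+ N) `^ d.
have l0 (k : nat) : 0 <= lev L k by rewrite ltW// lev_gt0.
exists Ma, (fun x => beta * w x + \sum_(k < N) (th * lev L k `^ d) * (w x - W k x)).
pose gr j := igrad (p j) (fun x => beta * w x + \sum_(k < N) (th * lev L k `^ d) * (w x - W k x)).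
(* On triangle [j] the levels from [Ma j] upwards contribute nothing, since there [W k] has the
   gradient of [w]. *)
have grE j : gr j = (beta + \sum_(k < N) (if lev L k < Ma j then th * lev L k `^ d else 0)) *: igrad (p j) w
    - \sum_(k < N | lev L k < Ma j) (th * lev L k `^ d) *: igrad (p j) (W k).
  rewrite /gr igradD igradZ scalerDl -addrA; congr (_ + _).
  rewrite igrad_sum -big_mkcond scaler_suml -sumrB [in RHS]big_mkcond /=.
  apply: eq_bigr => k _; rewrite igradZ igradB.
  have [_ _ hk] := hW k.
  case: ifPn => [_|]; first by rewrite scalerBr.
  by rewrite -leNgt => /hk ->; rewrite subrr scaler0.
have tau0 j : 0 <= tau j by rewrite ltW// (tau_gt0 M).
have main j : c * (tau j * g j `^ q) <=
    dotp (b j) (gr j) + 8 * Lam * d * truncC s * (tau j * Ma j `^ q) /\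
    n1 (gr j) <= (2 + 8 * truncC s) * Ma j `^ (1 + d).
  have [g0 gM] : 0 <= g j /\ g j <= Ma j.
    by have /andP[h1 h2] := ga j; split => //; exact: le_trans h2 (aMa j).
  (* Where [Ma j] is 0 the gradient of [w] vanishes and no level is below [Ma j], so the gradient of
     the test function is 0 too. *)
  have [m0|m0] := ltP 0 (Ma j); last first.
    have M00 : Ma j = 0 by apply/eqP; rewrite eq_le m0 Ma0.
    have gj0 : g j = 0 by apply/eqP; rewrite eq_le g0 -M00 gM.
    have ig0 := n1_eq0 gj0.
    have -> : gr j = 0.
      rewrite grE ig0 scaler0 big_pred0 ?subrr// => k.
      by apply/negbTE; rewrite -leNgt M00; exact: l0.
    by rewrite gj0 M00 n1_0 /dotp !mulr0 addr0 !powR0 ?gt_eqF ?mulr0//; have := d0; lra.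
  have mL : 0 < Ma j <= L by rewrite m0 MaL.
  have := telescope_lev N L0 mL (ltW d0); rewrite -/beta -/th grE.
  set co := beta + _ => /andP[co1 co2].
  have {}co2 : co <= 2 * Ma j `^ d.
    apply: le_trans co2 _; apply: (@le_trans _ _ ((2 * Ma j) `^ d)).
      apply: powR_mono; [exact: ltW d0|by rewrite le_max (mulr_ge0 _ (ltW m0)) ?orbT|].
      rewrite ge_max lexx andbT; have := hN j m0; lra.
    rewrite powRM ?(ltW m0)// ler_wpM2r ?powR_ge0//.
    have : 2 `^ d <= 2 `^ 1 by apply: ler_powR; [rewrite ler1n|case/andP: d01].
    by rewrite powRr1.
  pose S := \sum_(k < N | lev L k < Ma j) lev L k `^ (1 + d).
  have S4 : S <= 4 * Ma j `^ (1 + d).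
    rewrite /S big_mkcond; apply: (@sum_lev_le R L (Ma j) (1 + d) N) => //.
    by have := d0; have := q0; lra.
  have pM (k : nat) : lev L k `^ d * lev L k = lev L k `^ (1 + d).
    rewrite powRD; last by apply/implyP => _; rewrite gt_eqF// lev_gt0.
    by rewrite powRr1// mulrC.
  have n1S : \sum_(k < N | lev L k < Ma j) n1 ((th * lev L k `^ d) *: igrad (p j) (W k)) <= th * truncC s * S.
    rewrite /S mulr_sumr; apply: ler_sum => k _; rewrite n1Z ger0_norm; last by rewrite mulr_ge0// powR_ge0.
    have [_ hk _] := hW k.
    rewrite -pM (_ : th * truncC s * _ = th * lev L k `^ d * (lev L k * truncC s)); last by ring.
    by rewrite ler_wpM2l ?hk// mulr_ge0// powR_ge0.
  have e1 : Ma j `^ (1 + d) = Ma j * Ma j `^ d.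
    by rewrite powRD ?powRr1 ?(ltW m0)//; apply/implyP => _; rewrite gt_eqF.
  have e2 : Ma j `^ q = Ma j * Ma j `^ (1 + d).
    rewrite (_ : q = 1 + (1 + d)); last by ring.
    by rewrite powRD ?powRr1 ?(ltW m0)//; apply/implyP => _; rewrite gt_eqF.
  have P0 : 0 <= Ma j `^ (1 + d) by exact: powR_ge0.
  have Pd : 0 <= Ma j `^ d by exact: powR_ge0.
  (* The source of smallness: [th <= 2 * d], times the 4 of [sum_lev_le]. *)
  have thS : th * truncC s * S <= 8 * d * truncC s * Ma j `^ (1 + d).
    apply: (@le_trans _ _ ((2 * d) * truncC s * (4 * Ma j `^ (1 + d)))); last first.
      by rewrite le_eqVlt; apply/orP; left; apply/eqP; ring.
    apply: ler_pM => //; first by rewrite mulr_ge0.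
      by apply: sumr_ge0 => k _; exact: powR_ge0.
    by rewrite ler_wpM2r.
  split; last first.
    apply: le_trans (n1D _ _) _; rewrite -scaleN1r !n1Z normrN1 mul1r.
    have co0 : 0 <= co by apply: le_trans co1.
    rewrite ger0_norm// [leRHS]mulrDl; apply: lerD.
      rewrite e1 (_ : 2 * _ = 2 * Ma j `^ d * Ma j); last by ring.
      exact: ler_pM.
    apply: le_trans (n1_sum _ _) (le_trans n1S (le_trans thS _)).
    rewrite ler_wpM2r// ler_wpM2r// -[leRHS]mulr1 ler_pM2l//.
    by case/andP: d01.
  rewrite dotpB dotpZ.
  have h1 : c * (tau j * g j `^ q) <= co * dotp (b j) (igrad (p j) w).
    apply: (@le_trans _ _ (Ma j `^ d * (c * tau j * g j ^+ 2))).
      rewrite (_ : Ma j `^ d * _ = c * (tau j * (g j ^+ 2 * Ma j `^ d))); last by ring.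
      rewrite ler_pM2l// ler_wpM2l//.
      have [gj0|gj0] := eqVneq (g j) 0; first by rewrite gj0 powR0 ?gt_eqF// expr0n mul0r.
      rewrite powRD ?gj0 ?implybT// powR_mulrn// ler_wpM2l ?exprn_ge0//.
      by apply: powR_mono => //; exact: ltW d0.
    apply: ler_pM => //.
    by rewrite mulr_ge0 ?exprn_ge0// mulr_ge0// ltW.
  have h2 : dotp (b j) (\sum_(k < N | lev L k < Ma j) (th * lev L k `^ d) *: igrad (p j) (W k)) <=
     8 * Lam * d * truncC s * (tau j * Ma j `^ q).
    apply: le_trans (ler_norm _) (le_trans (b_bounded _ _) _).
    have lt0 : 0 <= Lam * tau j by rewrite mulr_ge0// ltW.
    apply: (@le_trans _ _ (Lam * tau j * Ma j * (8 * d * truncC s * Ma j `^ (1 + d)))).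
      apply: ler_pM; [by rewrite mulr_ge0|exact: n1_ge0|by rewrite ler_wpM2l|].
      exact: le_trans (n1_sum _ _) (le_trans n1S thS).
    by rewrite e2 le_eqVlt; apply/orP; left; apply/eqP; ring.
  lra.
split => //; last 2 first.
- by move=> j; case: (main j).
- by move=> j; case: (main j).
move=> j i nO; rewrite (w0 nO) mulr0 add0r big1// => k _.
by have [hk _ _] := hW k; rewrite (hk _ _ nO) subrr mulr0.
Qed.

(** Coercivity bounds [c * Egy] by the source term plus an error that [d_small] makes at most
    [c / 2 * Egy]. As the gradient of the test function is at most a multiple of [Ma ^ (1 + d)], the
    source term is at most a multiple of [K * Egy ^ ((1 + d) / q)]; dividing leaves
    [Egy ^ (1 / q)]. *)
Lemma energy_bound : Egy `^ q^-1 <= 2 * (2 + 8 * truncC s) * (1 + maxC s) / c * K.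
Proof.
have [Ma [phi [phi0 Ma0 MaE h1 h2]]] := test_function_ex.
have C10 := truncC_ge0; have d0' := d0; have q0' := q0.
have tau0 j : 0 <= tau j by rewrite ltW// (tau_gt0 M).
have E0 : 0 <= Egy by apply: sumr_ge0 => j _; rewrite mulr_ge0// powR_ge0.
have C20 : 0 <= maxC s.
  by rewrite /maxC !mulr_ge0 ?exprn_ge0 ?addr_ge0 ?mulr_ge0 ?exprn_ge0 ?(ltW s0) ?(ltW (kappa_gt0 M))//; have := s0; lra.
pose D := 2 + 8 * truncC s; have D0 : 0 <= D by rewrite addr_ge0// mulr_ge0.
have e1d : 0 < 1 + d by lra.
pose X := (1 + d) / q.
have X0 : 0 < X by rewrite divr_gt0.
have X1 : X <= 1 by rewrite /X ler_pdivrMr//; lra.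
have F : \sum_j dotp (b j) (igrad (p j) phi) <= K * (D * ((1 + maxC s) * Egy `^ X)).
  apply: le_trans (b_source phi0) _; rewrite ler_wpM2l//.
  apply: (@le_trans _ _ ((D `^ (q / (1 + d)) * (maxC s * Egy)) `^ X)).
    apply: powR_mono; [exact: ltW|by apply: sumr_ge0 => j _; rewrite mulr_ge0// powR_ge0|].
    apply: le_trans (ler_wpM2l (powR_ge0 _ _) MaE); rewrite mulr_sumr; apply: ler_sum => j _.
    rewrite mulrCA ler_wpM2l//.
    have -> : Ma j `^ q = (Ma j `^ (1 + d)) `^ (q / (1 + d)).
      by rewrite -powRrM mulrCA mulfV ?mulr1// gt_eqF.
    rewrite -powRM ?powR_ge0//; apply: powR_mono. 3: exact: (h2 j).
      by rewrite divr_ge0 ?(ltW q0')// ltW.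
    exact: n1_ge0.
  have DX : (D `^ (q / (1 + d))) `^ X = D.
    rewrite -powRrM /X (_ : q / (1 + d) * _ = 1) ?powRr1//; field.
    by rewrite !gt_eqF.
  have ME0 : 0 <= maxC s * Egy by rewrite mulr_ge0.
  rewrite powRM ?powR_ge0// DX ler_wpM2l// powRM// ler_wpM2r ?powR_ge0//.
  apply: (@le_trans _ _ ((1 + maxC s) `^ X)); first by apply: powR_mono => //; lra.
  apply: (@le_trans _ _ ((1 + maxC s) `^ 1)); last by rewrite powRr1// addr_ge0.
  by apply: ler_powR => //; rewrite lerDl.
have hS : c * Egy <= \sum_j dotp (b j) (igrad (p j) phi) + 8 * Lam * d * truncC s * (maxC s * Egy).
  apply: (@le_trans _ _ (\sum_j (dotp (b j) (igrad (p j) phi) + 8 * Lam * d * truncC s * (tau j * Ma j `^ q)))).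
    by rewrite /Egy mulr_sumr; apply: ler_sum => j _; exact: h1.
  rewrite big_split /= lerD2l -mulr_sumr; apply: ler_wpM2l => //.
  by apply: mulr_ge0 => //; apply: mulr_ge0; [apply: mulr_ge0 => //; exact: ltW|exact: ltW].
have half : 8 * Lam * d * truncC s * (maxC s * Egy) <= c / 2 * Egy.
  rewrite mulrA ler_wpM2r//; have := d_small; lra.
have key : Egy <= 2 * D * (1 + maxC s) / c * K * Egy `^ X.
  rewrite (_ : _ * Egy `^ X = K * (D * ((1 + maxC s) * Egy `^ X)) / (c / 2)); last by field; rewrite gt_eqF.
  rewrite ler_pdivlMr ?divr_gt0//.
  have := le_trans hS (lerD F half); set Y := K * _ => hS2.
  by have : c * Egy = c / 2 * Egy + Egy * (c / 2); [field|move: hS2; lra].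
have R0 : 0 <= 2 * D * (1 + maxC s) / c * K.
  by rewrite mulr_ge0// divr_ge0 ?(ltW c_gt0)// !mulr_ge0// addr_ge0.
have [->|En0] := eqVneq Egy 0; first by rewrite powR0// invr_eq0 gt_eqF.
have Ep : 0 < Egy by rewrite lt_neqAle eq_sym En0.
have EX : Egy `^ q^-1 * Egy `^ X = Egy.
  rewrite -powRD; last by rewrite En0 implybT.
  by rewrite (_ : q^-1 + X = 1) ?powRr1// /X; field; rewrite gt_eqF.
by rewrite -(ler_pM2r (powR_gt0 X Ep)) EX.
Qed.

End energy.
End exponent.
End stability.

(** * Lipschitz and test functions *)

Section plane_lipschitz.
Context {R : realType}.
Implicit Types (f g : R * R -> R) (x y e : R * R).

Definition lip (K : R) f := forall x y, `|f x - f y| <= K * `|x - y|.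

Lemma lip_continuous K f : lip K f -> continuous f.
Proof.
move=> fK x; apply/cvgrPdist_lt => e e0.
have d0 : 0 < e / (`|K| + 1) by rewrite divr_gt0// ltr_wpDl.
near=> y; apply: le_lt_trans (fK x y) _.
apply: (@le_lt_trans _ _ ((`|K| + 1) * `|x - y|)).
  by rewrite ler_wpM2r//; have := ler_norm K; lra.
rewrite mulrC -ltr_pdivlMr; last by rewrite ltr_wpDl.
near: y; move: (nbhsx_ballx x _ d0); apply: filterS => y.
by rewrite -ball_normE.
Unshelve. all: by end_near. Qed.

Lemma lip_measurable K f : lip K f -> measurable_fun setT (f : plane R -> R).
Proof. by move=> fK; exact: continuous_measurable2 (lip_continuous fK). Qed.

Lemma lipM (K L A B : R) f g : lip K f -> lip L g -> (forall x, `|f x| <= A) ->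
  (forall x, `|g x| <= B) -> lip (A * L + B * K) (fun x => f x * g x).
Proof.
move=> fK gL fA gB x y.
have -> : f x * g x - f y * g y = f x * (g x - g y) + g y * (f x - f y) by ring.
apply: le_trans (ler_normD _ _) _; rewrite !normrM mulrDl -!mulrA.
by apply: lerD; apply: ler_pM.
Qed.

Lemma measurable_shift (v : R * R) :
  measurable_fun setT (fun x : plane R => (x + v : R * R) : plane R).
Proof.
have h1 : measurable_fun setT (fun x : plane R => x.1 + v.1).
  by apply: measurable_funD => //; exact: measurable_fst.
have h2 : measurable_fun setT (fun x : plane R => x.2 + v.2).
  by apply: measurable_funD => //; exact: measurable_snd.
by apply/measurable_fun_pairP; split.
Qed.

Lemma integral_shift (v : R * R) f : lam.-integrable setT (EFin \o (f : plane R -> R)) ->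
  lam.-integrable setT (fun x : plane R => (f (x + v))%:E) ->
  (\int[lam]_x (f (x + v))%:E = \int[lam]_x (f x)%:E)%E.
Proof.
move=> fi fvi.
have mf : measurable_fun setT (EFin \o (f : plane R -> R)) by case/integrableP: fi.
have := integral_pushforward (measurable_shift v) mf (mu := lam) (D := setT) fvi measurableT.
rewrite preimage_setT => <-.
by apply: (eq_measure_integral lam) => [|mv A mA _]; [exact: measurable_shift|exact: (lam_shift v mA)].
Qed.

Lemma integrable_supp f (B L : R) : measurable_fun setT (f : plane R -> R) ->
  {ae lam, forall x : plane R, `|f x| <= B} -> (forall x, L < `|x| -> f x = 0) -> 0 <= L ->
  lam.-integrable setT (EFin \o (f : plane R -> R)).
Proof.
move=> mf fB fL L0.
pose D : set (plane R) := ball (0 : R * R) (L + 1).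
have mD : measurable D by apply: open_measurable2; exact: ball_open.
have lD : lam D = ((2 * (L + 1)) ^+ 2)%:E by apply: lam_ball; rewrite addr_ge0.
have mI : measurable_fun setT (fun x : plane R => \1_D x * `|B| : R).
  by apply: measurable_funM => //; exact: measurable_indic.
apply/integrableP; split; first exact/measurable_EFinP.
apply: (@le_lt_trans _ _ (\int[lam]_x (\1_D x * `|B|)%:E)%E).
  apply: ae_ge0_le_integral => //.
  - by do 2 apply: measurableT_comp => //.
  - by apply/measurable_EFinP; exact: mI.
  move: fB; apply: filterS => x xB _; rewrite lee_fin indicE.
  case: (boolP (x \in D)) => [_|]; first by rewrite mul1r; apply: le_trans xB _; exact: ler_norm.
  rewrite notin_setE /D -ball_normE /= sub0r normrN => /negP; rewrite -leNgt => Lx.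
  by rewrite fL ?normr0 ?mul0r//; apply: lt_le_trans Lx; rewrite ltrDl.
under eq_integral do rewrite EFinM muleC.
rewrite ge0_integralZl//.
- by rewrite integral_indic// setIT lD -EFinM ltry.
- by apply/measurable_EFinP; exact: measurable_indic.
Qed.

(* The integral of a difference quotient vanishes by translation invariance. *)
Lemma integral_lip_derive f f' e (K L : R) : lip K f -> 0 <= L -> (forall x, L < `|x| -> f x = 0) ->
  measurable_fun setT (f' : plane R -> R) ->
  {ae lam, forall x : plane R,
    n.+1%:R * (f (x + n.+1%:R^-1 *: e) - f x) @[n --> \oo] --> f' x} ->
  lam.-integrable setT (EFin \o (f' : plane R -> R)) /\
  (\int[lam]_x (f' x)%:E = 0)%E.
Proof.
move=> fK L0 fL mf' ff'.
have cf := lip_continuous fK.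
have mf := lip_measurable fK.
have f0B x : `|f x| <= `|f 0| + `|K| * L.
  have [xL|Lx] := leP `|x| L; last by rewrite fL ?normr0 ?addr_ge0 ?mulr_ge0.
  have h1 := fK x 0; rewrite subr0 in h1.
  have h2 : K * `|x| <= `|K| * L 
    by apply: (@le_trans _ _ (`|K| * `|x|)); [rewrite ler_wpM2r// ler_norm|rewrite ler_wpM2l].
  have := ler_normD (f x - f 0) (f 0); rewrite subrK; lra.
pose F n x : R := n.+1%:R * (f (x + n.+1%:R^-1 *: e) - f x).
have fi : lam.-integrable setT (EFin \o (f : plane R -> R)).
  apply: (integrable_supp mf _ fL L0); by apply: aeW => x; exact: f0B.
have mfv v : measurable_fun setT (fun x : plane R => f (x + v)).
  exact: (measurableT_comp mf (measurable_shift v)).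
have far v x : L + `|v| < `|x| -> f (x + v) = 0.
  by move=> h; apply: fL; have := ler_normB (x + v) v; rewrite addrK; lra.
have fvi v : lam.-integrable setT (fun x : plane R => (f (x + v))%:E).
  apply: (integrable_supp (mfv v) (B := `|f 0| + `|K| * L) (L := L + `|v|)) => //.
  - by apply: aeW => x; exact: f0B.
  - exact: far.
  - by rewrite addr_ge0.
have mF n : measurable_fun setT (F n : plane R -> R).
  by apply: measurable_funM => //; apply: measurable_funB => //; exact: mfv.
have IF n : (\int[lam]_x (F n x)%:E = 0)%E.
  rewrite /F; under eq_integral do rewrite EFinM EFinB.
  have fvi' := fvi (n.+1%:R^-1 *: e).
  rewrite (integralZl measurableT (integrableB measurableT fvi' fi)).
  rewrite (integralB measurableT fvi' fi) (integral_shift fi fvi') subee ?mule0//.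
  exact: (integrable_fin_num measurableT fi).
pose L' := L + `|e|.
have L'0 : 0 <= L' by rewrite addr_ge0.
pose D : set (plane R) := ball (0 : R * R) (L' + 1).
have mD : measurable D by apply: open_measurable2; exact: ball_open.
have nv n : `|n.+1%:R^-1 *: e| = n.+1%:R^-1 * `|e| by rewrite normrZ ger0_norm.
have nv1 n : `|n.+1%:R^-1 *: e| <= `|e|.
  by rewrite nv ler_piMl// invf_le1 ?ler1n.
have FB n x : `|F n x| <= \1_D x * (`|K| * `|e|).
  rewrite indicE; case: (boolP (x \in D)) => [_|].
    rewrite mul1r /F normrM ger0_norm//.
    apply: (@le_trans _ _ (n.+1%:R * (`|K| * (n.+1%:R^-1 * `|e|)))).
      rewrite ler_pM2l//; apply: le_trans (fK _ _) _.
      rewrite [_ + _ - x]addrC addKr nv ler_wpM2r ?mulr_ge0//; exact: ler_norm.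
    by rewrite mulrCA mulVKf.
  rewrite notin_setE /D -ball_normE /= sub0r normrN => /negP; rewrite -leNgt => Lx.
  rewrite mul0r /F far ?fL ?subrr ?mulr0 ?normr0//.
    by have := normr_ge0 e; rewrite /L' in Lx; lra.
  by have := nv1 n; rewrite /L' in Lx; lra.
have gi : lam.-integrable setT (fun x : plane R => (\1_D x * (`|K| * `|e|))%:E).
  apply: (integrable_supp _ (B := `|K| * `|e|) (L := L' + 1)).
  - by apply: measurable_funM => //; exact: measurable_indic.
  - apply: aeW => x; rewrite indicE; case: (_ \in _); rewrite ?mul1r ?mul0r ?normr0 ?mulr_ge0//.
    by rewrite ger0_norm// mulr_ge0.
  - move=> x Lx; rewrite indicE memNset ?mul0r//= /D -ball_normE /= sub0r normrN.
    by move=> /lt_trans/(_ Lx); rewrite ltxx.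
  - by rewrite addr_ge0.
have [|||||if' _ cI] := @dominated_convergence _ _ _ lam setT measurableT
  (fun n x => (F n x)%:E) (EFin \o (f' : plane R -> R)) (fun x => (\1_D x * (`|K| * `|e|))%:E).
- by move=> n; apply/measurable_EFinP; exact: mF.
- exact/measurable_EFinP.
- move: ff'; apply: filterS => x xf _; by apply/fine_cvgP; split; [exact: nearW|exact: xf].
- exact: gi.
- by apply: aeW => x n _; rewrite lee_fin; exact: FB.
split => //.
have E : (\int[lam]_x (F n x)%:E)%E @[n --> \oo] --> (\int[lam]_x (f' x)%:E)%E := cI.
rewrite (_ : (fun n => _) = (fun=> 0%E)) in E; last by apply/funext => n; exact: IF.
by rewrite -(cvg_lim _ E)//; apply: lim_cst.
Qed.

End plane_lipschitz.

Section test_functions.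
Context {R : realType}.
Implicit Types (Om : set (R * R)) (phi u g : R * R -> R) (x y e : R * R) (i : 'I_2).

Definition esupp phi : set (R * R) := closure [set x | phi x != 0].

Lemma esupp0 phi x : ~ esupp phi x -> phi x = 0.
Proof.
by move=> nx; apply/eqP/negP => /negP h; apply: nx; exact: subset_closure.
Qed.

Lemma esupp_near0 phi x : ~ esupp phi x -> \forall y \near x, phi y = 0.
Proof.
move=> nx; have oC : open (~` esupp phi) by apply: closed_openC; exact: closed_closure.
by have := open_nbhs_nbhs (conj oC nx); apply: filterS => y; exact: esupp0.
Qed.

Lemma smooth_derive phi e : smooth phi -> smooth ('D_e phi).
Proof.
by move=> sp s x; have := sp (rcons s e) x; rewrite -cats1 foldr_cat.
Qed.

Lemma smooth_diff phi x : smooth phi -> differentiable phi x.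
Proof. by move=> sp; exact: (sp [::]). Qed.

Lemma smooth_cont phi : smooth phi -> continuous phi.
Proof. by move=> sp x; apply: differentiable_continuous; exact: smooth_diff. Qed.

Lemma derive_near0 phi e x : (\forall y \near x, phi y = 0) -> 'D_e phi x = 0.
Proof.
move=> h; rewrite (near_eq_derive _ h); first exact: derive_cst.
Qed.

Lemma test_derive Om phi e : test_function Om phi -> test_function Om ('D_e phi).
Proof.
move=> [sp cp sO].
have sub : esupp ('D_e phi) `<=` esupp phi.
  rewrite [X in _ `<=` X](closure_id _).1; last exact: closed_closure.
  apply: closure_subset => x /= /eqP nz; apply: contrapT => nx; apply: nz.
  exact/derive_near0/esupp_near0.
split; [exact: smooth_derive| |exact: subset_trans sO].
apply: (subclosed_compact _ cp sub); exact: closed_closure.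
Qed.

Lemma test_bounded Om phi : test_function Om phi -> exists2 B : R, 0 < B & forall x, `|phi x| <= B.
Proof.
move=> [sp cp _]; have [[a ea]|n0] := pselect (exists a, esupp phi a); last first.
  by exists 1 => // x; rewrite esupp0 ?normr0// => h; apply: n0; exists x.
have cn : {within esupp phi, continuous (fun x => `|phi x|)}.
  apply: continuous_subspaceT => x; apply: cvg_norm; exact: smooth_cont.
have [c cS hc] := compact_EVT_max (ex_intro _ a ea) cp cn.
exists (`|phi c| + 1); first by rewrite ltr_wpDl.
move=> x; have [xs|xs] := pselect (esupp phi x); last by rewrite esupp0// normr0 addr_ge0.
by have := hc x; rewrite inE => /(_ xs) h; lra.
Qed.

Lemma test_supp Om phi : test_function Om phi ->
  exists2 L : R, 0 < L & forall x, L < `|x| -> phi x = 0.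
Proof.
move=> [sp cp _]; have := compact_bounded cp; rewrite /bounded_set /bounded_near => -[L [Lr hL]].
exists (`|L| + 1); first by rewrite ltr_wpDl.
move=> x Lx; apply: esupp0 => xs.
have L1 : L < `|L| + 1 by have := ler_norm L; lra.
by have := hL _ L1 x xs; rewrite /= leNgt Lx.
Qed.

Lemma deriveD2 phi x e : differentiable phi x ->
  'D_e phi x = e.1 * partial 0 phi x + e.2 * partial 1 phi x.
Proof.
move=> dp; rewrite /partial /Defs.basis /= !(deriveE _ dp).
rewrite {1}(_ : e = e.1 *: (1, 0) + e.2 *: (0, 1)).
  by rewrite linearD !linearZ.
by rewrite [LHS]surjective_pairing; congr pair; rewrite /= /GRing.scale /= ?mulr1 ?mulr0 ?addr0 ?add0r.
Qed.

Lemma is_derive_line phi x e (t : R) : (forall y, differentiable phi y) ->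
  is_derive t 1 (fun r : R => phi (x + r *: e)) ('D_e phi (x + t *: e)).
Proof.
move=> dp.
have E : (fun h : R => h^-1 *: (phi (x + (h *: 1 + t) *: e) - phi (x + t *: e))) =
         (fun h : R => h^-1 *: (phi (h *: e + (x + t *: e)) - phi (x + t *: e))).
  apply/funext => h; congr (_ *: (phi _ - _)).
  rewrite scalerDl addrCA; congr (_ + _); congr (_ *: _).
  by rewrite /GRing.scale /= mulr1.
have d := diff_derivable (v := e) (dp (x + t *: e)).
by apply: DeriveDef; [rewrite /derivable /= E|rewrite /derive /= E].
Qed.

Lemma test_lip Om phi : test_function Om phi -> exists2 K : R, 0 < K & lip K phi.
Proof.
move=> tp; have [sp _ _] := tp.
have [B0 B00 hB0] := test_bounded (test_derive (Defs.basis 0) tp).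
have [B1 B10 hB1] := test_bounded (test_derive (Defs.basis 1) tp).
exists (B0 + B1); first exact: addr_gt0.
move=> x y; pose e := x - y.
have dl (t : R) := @is_derive_line phi y e t (fun z => smooth_diff z sp).
have cl : {within `[0, 1], continuous (fun r : R => phi (y + r *: e))}.
  apply: continuous_subspaceT => t; apply: differentiable_continuous.
  by apply/derivable1_diffP; case: (dl t).
have [t _] := MVT_segment ler01 (fun t _ => dl t) cl.
rewrite scale1r scale0r addr0 subr0 mulr1 {1}/e [y + (x - y)]addrC subrK => ->.
rewrite deriveD2; last exact: smooth_diff.
apply: le_trans (ler_normD _ _) _; rewrite !normrM mulrDl -/e.
apply: lerD; rewrite mulrC; apply: ler_pM => //; [exact: hB0|exact: norm1_le|exact: hB1|exact: norm2_le].
Qed.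

Lemma lip_W1inf Om phi i : test_function Om phi ->
  exists2 K : R, 0 < K & lip K (partial i phi).
Proof. by move=> tp; exact: (test_lip (test_derive (Defs.basis i) tp)). Qed.

End test_functions.

(** * The fundamental lemma *)

Section boxes.
Context {R : realType}.
Implicit Types (a b x : R * R) (Om : set (R * R)).

Definition box a b : set (R * R) := `]a.1, b.1[ `*` `]a.2, b.2[.
Definition cbox a b : set (R * R) := `[a.1, b.1] `*` `[a.2, b.2].
Definition boxes : set (set (R * R)) := [set A | exists a b, A = box a b].

Lemma open_box a b : open (box a b).
Proof.
rewrite (_ : box a b = (fst @^-1` `]a.1, b.1[) `&` (snd @^-1` `]a.2, b.2[)); last by [].
by apply: openI; apply: open_comp => [x _|]; [exact: cvg_fst|exact: interval_open|exact: cvg_snd|exact: interval_open].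
Qed.

Lemma box_cbox a b : box a b `<=` cbox a b.
Proof. by move=> x [/= /subset_itv_oo_cc ? /subset_itv_oo_cc ?]. Qed.

Lemma compact_cbox a b : compact (cbox a b).
Proof. by apply: compact_setX; exact: segment_compact. Qed.

Lemma measurable_box a b : measurable (box a b : set (plane R)).
Proof. by apply: open_measurable2; exact: open_box. Qed.

Lemma box_setI a b a' b' :
  box a b `&` box a' b' = box (Num.max a.1 a'.1, Num.max a.2 a'.2) (Num.min b.1 b'.1, Num.min b.2 b'.2).
Proof.
apply/seteqP; split => x; rewrite /box /= !in_itv /= !gt_max !lt_min.
  by move=> [[/andP[-> ->] /andP[-> ->]] [/andP[-> ->] /andP[-> ->]]].
by move=> [/andP[/andP[-> ->] /andP[-> ->]] /andP[/andP[-> ->] /andP[-> ->]]].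
Qed.

Lemma bigcup_sym_itv : \bigcup_n `](- n.+1%:R : R), n.+1%:R[%classic = setT.
Proof.
apply/seteqP; split => // y _; exists (Num.bound `|y|) => //=.
rewrite in_itv /= -ltr_norml.
by apply: lt_le_trans (archi_boundP (normr_ge0 y)) _; rewrite ler_nat.
Qed.

Lemma measurable_plane_boxes :
  (measurable : set (set (plane R))) = <<s (boxes : set (set (plane R))) >>.
Proof.
apply/seteqP; split => S mS; last first.
  apply: mS; split; first exact: sigma_algebra_measurable.
  by move=> _ [a [b ->]]; exact: measurable_box.
pose T' := g_sigma_algebraType (boxes : set (set (plane R))).
have mb a b : measurable (box a b : set T').
  by apply: sub_sigma_algebra; exists a, b.
have m1 : measurable_fun setT (fst : T' -> measurableTypeR R).
  apply: (measurability _ (measurable_realfun.RGenOpens.measurableE R)).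
  move=> _ [_ [a [b ->] <-]]; rewrite setTI.
  have -> : (fst : T' -> R) @^-1` `]a, b[ = \bigcup_n (box (a, - n.+1%:R) (b, n.+1%:R) : set T').
    rewrite /box /= -setX_bigcupr bigcup_sym_itv.
    by apply/seteqP; split => [x|x []].
  by apply: bigcupT_measurable => n; exact: mb.
have m2 : measurable_fun setT (snd : T' -> measurableTypeR R).
  apply: (measurability _ (measurable_realfun.RGenOpens.measurableE R)).
  move=> _ [_ [a [b ->] <-]]; rewrite setTI.
  have -> : (snd : T' -> R) @^-1` `]a, b[ = \bigcup_n (box (- n.+1%:R, a) (n.+1%:R, b) : set T').
    rewrite /box /= -setX_bigcupl bigcup_sym_itv.
    by apply/seteqP; split => [x|x []].
  by apply: bigcupT_measurable => n; exact: mb.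
have mid : measurable_fun setT (fun x : T' => (x.1, x.2) : plane R).
  by apply/measurable_fun_pairP; split.
have := mid measurableT S mS; rewrite setTI.
by rewrite (_ : _ @^-1` S = S)//; apply/seteqP; split => -[].
Qed.

Lemma setI_closed_boxes : setI_closed (boxes : set (set (plane R))).
Proof.
move=> _ _ [a [b ->]] [a' [b' ->]]; rewrite box_setI.
by eexists; eexists.
Qed.

(** Boxes form a pi-system generating the Borel sets, and Dynkin induction makes the integral vanish
    on all of these. The hypothesis on the whole plane serves the step to complements. *)
Lemma boxes_ae0 (k : plane R -> R) : lam.-integrable setT (EFin \o k) ->
  (\int[lam]_x (k x)%:E = 0)%E ->
  (forall a b, (\int[lam]_(x in (box a b : set (plane R))) (k x)%:E = 0)%E) ->
  {ae lam, forall x : plane R, k x = 0}.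
Proof.
move=> ki kT kb.
have kS (S : set (plane R)) : measurable S -> (\int[lam]_(x in S) (k x)%:E = 0)%E.
  move=> mS.
  have iS D : measurable D -> lam.-integrable D (EFin \o k).
    by move=> mD; exact: integrableS ki.
  apply: (@dynkin_induction _ (plane R) _ (fun S => \int[lam]_(x in S) (k x)%:E = 0)%E
    measurable_plane_boxes setI_closed_boxes) => //.
  - by move=> _ [a [b ->]]; exact: kb.
  - move=> D mD D0.
    have mC := measurableC mD.
    have := @integral_setU _ _ _ lam D (~` D) (EFin \o k) mD mC.
    rewrite setUv D0 add0e => <-//; first by case/integrableP: ki.
    by apply/disj_setPS; rewrite setICr.
  - move=> F mF tF F0; rewrite integral_bigcup//; last by apply: iS; exact: bigcup_measurable.
    by rewrite eseries0// => n _ _; exact: F0.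
  by rewrite -measurable_plane_boxes.
have : ae_eq lam setT (EFin \o k) (cst 0%E).
  apply: (integral_ae_eq measurableT ki) => [|E _ mE]; first exact: measurable_cst.
  by rewrite integral_cst// mul0e; exact: kS.
by apply: filterS => x /(_ Logic.I) [].
Qed.

End boxes.

Section box_test_function.
Context {R : realType}.
Implicit Types (a b x : R * R) (Om : set (R * R)) (n : nat).

Lemma flat0_le1 (t : R) : flat 0 t <= 1.
Proof.
rewrite /flat; case: ifP => // t0; rewrite expr0 invr1 mul1r -expR0 ler_expR.
by rewrite oppr_le0 invr_ge0 ltW.
Qed.

(** Smooth functions vanishing off []a, b[] that converge to its indicator as [n] grows, because
    [flat 0 (n t) = exp (-1 / (n t))] for positive [t]. *)
Definition win n (a b t : R) : R := flat 0 (n.+1%:R * (t - a)) * flat 0 (n.+1%:R * (b - t)).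

Lemma smooth1_win n (a b : R) : smooth1 (win n a b).
Proof.
have sf : smooth1 (flat 0 : R -> R) by move=> m; exact: Cn_flat.
rewrite /win; apply: smooth1M.
  rewrite (_ : (fun t => _) = (fun t => flat 0 (n.+1%:R * t + - (n.+1%:R * a)))); first exact: smooth1_affine.
  by apply/funext => t; rewrite mulrBr.
rewrite (_ : (fun t => _) = (fun t => flat 0 (- n.+1%:R * t + n.+1%:R * b))); first exact: smooth1_affine.
by apply/funext => t; congr flat; ring.
Qed.

Lemma win_ge0 n (a b t : R) : 0 <= win n a b t.
Proof. by rewrite mulr_ge0 ?flat_ge0. Qed.

Lemma win_le1 n (a b t : R) : win n a b t <= 1.
Proof. by rewrite /win mulr_ile1 ?flat_ge0 ?flat0_le1. Qed.

Lemma win_out n (a b t : R) : ~~ (a < t < b) -> win n a b t = 0.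
Proof.
rewrite negb_and -!leNgt => /orP[ta|bt]; rewrite /win.
  by rewrite (flat_le0 _ (x := n.+1%:R * (t - a))) ?mul0r// mulr_ge0_le0// subr_le0.
by rewrite (flat_le0 _ (x := n.+1%:R * (b - t))) ?mulr0// mulr_ge0_le0// subr_le0.
Qed.

Lemma flat0_cvg (t : R) : 0 < t -> flat 0 (n.+1%:R * t) @[n --> \oo] --> (1 : R).
Proof.
move=> t0.
have E : (fun n => flat 0 (n.+1%:R * t)) = (fun n => expR (- (n.+1%:R^-1 * t^-1))).
  by apply/funext => n; rewrite /flat mulr_gt0// expr0 invr1 mul1r invfM.
rewrite E -[X in _ --> X](expR0 R).
apply: (@cvg_comp _ _ _ (fun n => - (n.+1%:R^-1 * t^-1)) expR); last exact: continuous_expR.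
have : (n.+1%:R^-1 * t^-1) @[n --> \oo] --> (0 * t^-1).
  by apply: cvgM; [exact: cvg_harmonic|exact: cvg_cst].
by move/cvgN; rewrite mul0r oppr0.
Qed.

Lemma win_cvg (a b t : R) : win n a b t @[n --> \oo] --> ((a < t < b)%R%:R : R).
Proof.
case: (boolP (a < t < b)) => [/andP[ta tb]|out]; last first.
  rewrite (_ : (fun n => _) = (fun=> 0)); first exact: cvg_cst.
  by apply/funext => n; exact: win_out.
by rewrite -[X in _ --> X](mulr1 1); apply: cvgM; apply: flat0_cvg; rewrite subr_gt0.
Qed.

Definition wbox n a b x : R := win n a.1 b.1 x.1 * win n a.2 b.2 x.2.

Lemma wbox_out n a b x : ~ box a b x -> wbox n a b x = 0.
Proof.
move=> nb; rewrite /wbox; case: (boolP (a.1 < x.1 < b.1)) => h1; last by rewrite win_out ?mul0r.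
case: (boolP (a.2 < x.2 < b.2)) => h2; last by rewrite [X in _ * X]win_out ?mulr0.
by exfalso; apply: nb; split; rewrite /= in_itv.
Qed.

Lemma wbox_norm n a b x : `|wbox n a b x| <= 1.
Proof.
rewrite /wbox ger0_norm; first by apply: mulr_ile1; rewrite ?win_ge0 ?win_le1.
by apply: mulr_ge0; exact: win_ge0.
Qed.

Lemma wbox_cvg a b x : wbox n a b x @[n --> \oo] --> (\1_(box a b) x : R).
Proof.
rewrite indicE (_ : (x \in box a b) = (a.1 < x.1 < b.1) && (a.2 < x.2 < b.2)).
  by rewrite -mulnb natrM; apply: cvgM; exact: win_cvg.
apply/idP/idP; first by rewrite inE /box /= !in_itv /= => -[-> ->].
by move=> /andP[h1 h2]; rewrite inE; split; rewrite /= in_itv.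
Qed.

Lemma closed_cbox a b : closed (cbox a b).
Proof.
rewrite (_ : cbox a b = (fst @^-1` `[a.1, b.1]) `&` (snd @^-1` `[a.2, b.2])); last by [].
by apply: closedI; apply: closed_comp => [x _|]; [exact: cvg_fst|exact: interval_closed|exact: cvg_snd|exact: interval_closed].
Qed.

Lemma test_wbox Om n a b : cbox a b `<=` Om -> test_function Om (wbox n a b).
Proof.
move=> bO.
have sub : esupp (wbox n a b) `<=` cbox a b.
  rewrite [X in _ `<=` X](closure_id _).1; last exact: closed_cbox.
  apply: closure_subset => x /= /eqP nz; apply: box_cbox; apply: contrapT => nx; apply: nz.
  exact: wbox_out.
split; [|exact: (subclosed_compact (@closed_closure _ _) (@compact_cbox _ a b) sub)|exact: subset_trans bO].
by apply/tensor_smooth/tensor_prod; exact: smooth1_win.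
Qed.

Lemma rational_box Om x : open Om -> Om x ->
  exists q : (rat * rat) * nat, let r : R * R := (ratr q.1.1, ratr q.1.2) in
    let e : R * R := (q.2.+1%:R^-1, q.2.+1%:R^-1) in
    box (r - e) (r + e) x /\ cbox (r - e) (r + e) `<=` Om.
Proof.
move=> oO Ox; have /nbhs_ballP[e /= e0 eO] := open_nbhs_nbhs (conj oO Ox).
pose n := Num.bound (2 / e); pose d : R := n.+1%:R^-1.
have d0 : 0 < d by rewrite invr_gt0.
have d2 : 2 * d < e.
  have h : 2 / e < n.+1%:R.
    by apply: lt_le_trans (archi_boundP _) _; [rewrite divr_ge0// ltW|rewrite ler_nat].
  by rewrite /d ltr_pdivrMr// mulrC -ltr_pdivrMr.
have rt (t : R) : exists r : rat, t - d < ratr r < t + d.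
  have /rat_in_itvoo[r] : t - d < t + d by lra.
  by rewrite in_itv /=; exists r.
have [r1 h1] := rt x.1; have [r2 h2] := rt x.2.
exists ((r1, r2), n) => /=; rewrite -/d.
move: h1 h2 => /andP[h1 h1'] /andP[h2 h2']; split.
  by split => /=; rewrite in_itv /=; apply/andP; split; lra.
move=> y [/=]; rewrite !in_itv /= => /andP[y1 y1'] /andP[y2 y2'].
apply: eO; split; rewrite /= /ball /= ltr_norml; apply/andP; split; lra.
Qed.

(** In a box whose closure lies in the domain, the products [wbox] are test functions converging to
    indicators of smaller boxes, and [boxes_ae0] applies. Countably many boxes with rational data
    cover the domain. *)
Lemma fundamental_lemma Om (k : plane R -> R) : open Om -> measurable_fun (Om : set (plane R)) k ->
  (forall K : set (R * R), compact K -> K `<=` Om -> lam.-integrable (K : set (plane R)) (EFin \o k)) ->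
  (forall phi, test_function Om phi -> (\int[lam]_(x in (Om : set (plane R))) (k x * phi x)%:E = 0)%E) ->
  {ae lam, forall x : plane R, Om x -> k x = 0}.
Proof.
move=> oO mk kK kphi.
have mO : measurable (Om : set (plane R)) by exact: open_measurable2.
have key a b : cbox a b `<=` Om -> {ae lam, forall x : plane R, box a b x -> k x = 0}.
  move=> bO.
  have mc : measurable (box a b : set (plane R)) by exact: measurable_box.
  have mcc : measurable (cbox a b : set (plane R)) by apply: closed_measurable2; exact: closed_cbox.
  pose kb : plane R -> R := k \_ (box a b : set (plane R)).
  have patchEF (D : set (plane R)) (f : plane R -> R) : (EFin \o f) \_ D = EFin \o (f \_ D).
    by apply/funext => x; rewrite /= !patchE; case: ifP.
  have ki : lam.-integrable setT (EFin \o kb).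
    rewrite -patchEF -(integrable_mkcond _ mc).
    exact: (integrableS mcc mc (@box_cbox _ a b) (kK _ (@compact_cbox _ a b) bO)).
  have mkb : measurable_fun setT kb by apply/measurable_EFinP; case/integrableP: ki.
  have box0 a' b' : box a' b' `<=` box a b -> cbox a' b' `<=` cbox a b ->
      (\int[lam]_(x in (box a' b' : set (plane R))) (kb x)%:E = 0)%E.
    move=> bb cc; have mw n : measurable_fun setT (wbox n a' b' : plane R -> R).
      apply: continuous_measurable2; apply: smooth_cont.
      by case: (test_wbox n (@subset_refl _ (cbox a' b'))).
    pose F n x : \bar R := (kb x * wbox n a' b' x)%:E.
    have F0 n : (\int[lam]_x F n x = 0)%E.
      rewrite -[RHS](kphi _ (test_wbox n (subset_trans cc bO))) [RHS]integral_mkcond.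
      apply: eq_integral => x _; rewrite /F /kb !patchE.
      have [xb|xb] := pselect (box a b x).
        have xO : Om x by apply: bO; exact: box_cbox.
        by rewrite (mem_set (xb : (box a b : set (plane R)) x)) (mem_set (xO : (Om : set (plane R)) x)).
      rewrite wbox_out; last by move=> /bb.
      by rewrite !mulr0; case: ifP.
    have [|||||_ _ cI] := @dominated_convergence _ _ _ lam setT measurableT F
      (fun x => (kb x * \1_(box a' b' : set (plane R)) x)%:E) (fun x => `|(kb x)%:E|%E).
    - by move=> n; apply/measurable_EFinP; apply: measurable_funM => //; exact: mw.
    - apply/measurable_EFinP; apply: measurable_funM => //; apply: measurable_indic; exact: measurable_box.
    - apply: aeW => x _; apply/fine_cvgP; split; first exact: nearW.
      by apply: cvgM; [exact: cvg_cst|exact: wbox_cvg].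
    - exact: integrable_abse.
    - apply: aeW => x n _; rewrite /F lee_fin normrM -[leRHS]mulr1 ler_wpM2l//; exact: wbox_norm.
    have E : (\int[lam]_x F n x)%E @[n --> \oo] --> (\int[lam]_x (kb x * \1_(box a' b' : set (plane R)) x)%:E)%E := cI.
    rewrite (_ : (fun n => _) = (fun=> 0%E)) in E; last by apply/funext => n; exact: F0.
    rewrite integral_mkcond; transitivity (\int[lam]_x (kb x * \1_(box a' b' : set (plane R)) x)%:E)%E.
      apply: eq_integral => x _; rewrite patchE indicE.
      by case: (x \in _); rewrite ?mulr1 ?mulr0.
    by rewrite -(cvg_lim _ E)//; exact: lim_cst.
  have box1 a' b' : (\int[lam]_(x in (box a' b' : set (plane R))) (kb x)%:E = 0)%E.
    pose a1 := (Num.max a'.1 a.1, Num.max a'.2 a.2); pose b1 := (Num.min b'.1 b.1, Num.min b'.2 b.2).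
    have e : box a' b' `&` box a b = box a1 b1 by exact: box_setI.
    have h : (\int[lam]_(x in (box a1 b1 : set (plane R))) (kb x)%:E = 0)%E.
      apply: box0; first by rewrite -e => x [].
      move=> x [/=]; rewrite !in_itv /= !ge_max !le_min.
      move=> /andP[/andP[_ h1] /andP[_ h2]] /andP[/andP[_ h3] /andP[_ h4]].
      by split; rewrite /= in_itv /= ?h1 ?h3.
    rewrite -[RHS]h -e integral_mkcond [RHS]integral_mkcond; apply: eq_integral => x _.
    rewrite !patchE; have [xb|xb] := pselect (box a b x); last first.
      have -> : kb x = 0 by rewrite /kb patchE (memNset (xb : ~ (box a b : set (plane R)) x)).
      by case: ifP; case: ifP.
    congr (if _ then _ else _); apply/idP/idP; rewrite !inE; first by move=> h'; split.
    by case.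
  have kT : (\int[lam]_x (kb x)%:E = 0)%E.
    rewrite -[RHS](box1 a b) [RHS]integral_mkcond; apply: eq_integral => x _.
    by rewrite /kb !patchE; case: ifP => // ->.
  have := boxes_ae0 ki kT box1; apply: filterS => x kx xb; move: kx.
  by rewrite /kb patchE (mem_set (xb : (box a b : set (plane R)) x)).
(* The claim on the rational box with code [m]; the enumeration by natural numbers suits
   [ae_foralln]. *)
pose Q m (x : plane R) := forall q : (rat * rat) * nat, unpickle m = Some q ->
  let r : R * R := (ratr q.1.1, ratr q.1.2) in
  let e : R * R := (q.2.+1%:R^-1, q.2.+1%:R^-1) in
  cbox (r - e) (r + e) `<=` Om -> box (r - e) (r + e) x -> k x = 0.
have Qm m : {ae lam, forall x, Q m x}.
  rewrite /Q; case: (unpickle m) => [q|]; last by apply: aeW.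
  pose r : R * R := (ratr q.1.1, ratr q.1.2); pose e : R * R := (q.2.+1%:R^-1, q.2.+1%:R^-1).
  have [qO|nO] := pselect (cbox (r - e) (r + e) `<=` Om); last by apply: aeW => x _ [<-].
  by have := key _ _ qO; apply: filterS => x xk _ [<-] _.
have : {ae lam, forall x : plane R, forall m, Q m x} by apply/ae_foralln.
apply: filterS => x H Ox; have [q [xb bO]] := rational_box oO Ox.
by have := H (pickle q) q; rewrite pickleK; apply.
Qed.

End box_test_function.

(** * Sobolev pairs *)

Section sobolev_plane.
Context {R : realType} (Om : set (R * R)) (L : R).
Hypothesis oO : open Om.
Hypothesis L0 : 0 < L.
Hypothesis OmL : forall x, Om x -> `|x| <= L.
Implicit Types (u v w b g h : plane R -> R) (phi : R * R -> R) (G H : 'I_2 -> plane R -> R) (q : R) (i : 'I_2).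
Notation O := (Om : set (plane R)).

Lemma mO : measurable O. Proof. exact: open_measurable2. Qed.

Lemma lam_Om_fin : (lam O < +oo)%E.
Proof.
apply: (@le_lt_trans _ _ (lam (ball (0 : R * R) (L + 1) : set (plane R)))).
  apply: le_measure; rewrite ?inE; [exact: mO|apply: open_measurable2; exact: ball_open|].
  move=> x /OmL xL; rewrite -ball_normE /= sub0r normrN; apply: le_lt_trans xL _.
  by rewrite ltrDl.
by rewrite lam_ball ?ltry// addr_ge0// ltW.
Qed.

Definition inLp q u := measurable_fun O u /\ (Ip lam O q u < +oo)%E.

Lemma LpP q u : 0 < q -> Lp Om q%:E u <-> inLp q u.
Proof.
move=> q0; rewrite lam_Lp; split.
  rewrite inE => /andP[]; rewrite !inE /= => mu fu.
  split; first exact/(measurable_restrictT _ mO).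
  move: fu; rewrite /finite_norm -/(Lnr lam O q u) LnrE// poweR_ltyP ?invr_gt0//.
  exact: Ip_ge0.
move=> [mu fu]; rewrite inE; apply/andP; split; rewrite !inE /=.
  exact/(measurable_restrictT _ mO).
rewrite /finite_norm -/(Lnr lam O q u) LnrE// poweR_ltyP ?invr_gt0//.
exact: Ip_ge0.
Qed.

Lemma Lp_normE q u : Lp_norm Om q%:E u = Lnr lam O q u.
Proof. by rewrite lam_Lp_norm. Qed.

Lemma inLp_Lnr q u : 0 < q -> measurable_fun O u -> (Lnr lam O q u < +oo)%E -> inLp q u.
Proof.
move=> q0 mu fu; split => //; rewrite Ip_Lnr// poweR_ltyP//; exact: Lnr_ge0.
Qed.

Lemma Lnr_fin q u : 0 < q -> inLp q u -> (Lnr lam O q u < +oo)%E.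
Proof. by move=> q0 [mu fu]; rewrite LnrE// poweR_ltyP ?invr_gt0//; exact: Ip_ge0. Qed.

Lemma Lnr_fin_num q u : 0 < q -> inLp q u -> Lnr lam O q u \is a fin_num.
Proof. by move=> q0 fu; rewrite ge0_fin_numE ?Lnr_ge0//; exact: Lnr_fin. Qed.

Lemma inLpZ q (c : R) u : 0 < q -> inLp q u -> inLp q (fun x => c * u x).
Proof.
move=> q0 fu; have [mu _] := fu; apply: inLp_Lnr => //; first exact: measurable_funM.
by rewrite (LnrZ lam c mO mu q0) lte_mul_pinfty// Lnr_fin.
Qed.

Lemma inLpD q u v : 1 <= q -> inLp q u -> inLp q v -> inLp q (fun x => u x + v x).
Proof.
move=> q1 fu fv; have q0 : 0 < q by lra.
have [mu _] := fu; have [mv _] := fv; apply: inLp_Lnr => //; first exact: measurable_funD.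
by apply: le_lt_trans (LnrD lam mO mu mv q1) _; rewrite lte_add_pinfty// Lnr_fin.
Qed.

Lemma inLpB q u v : 1 <= q -> inLp q u -> inLp q v -> inLp q (fun x => u x - v x).
Proof.
move=> q1 fu fv; have q0 : 0 < q by lra.
rewrite (_ : (fun x => _) = (fun x => u x + (-1) * v x)); last by apply/funext => x; rewrite mulN1r.
exact: (inLpD q1 fu (inLpZ (-1) q0 fv)).
Qed.

Lemma Lnr0 q : 0 < q -> Lnr lam O q (fun=> 0) = 0%E.
Proof.
move=> q0; rewrite LnrE// /Ip integral0_eq; last by move=> x _; rewrite normr0 powR0// gt_eqF.
by rewrite poweR_EFin powR0// invr_neq0// gt_eqF.
Qed.

Lemma LnrN q u : 0 < q -> measurable_fun O u -> Lnr lam O q (fun x => - u x) = Lnr lam O q u.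
Proof.
move=> q0 mu; rewrite (_ : (fun x => _) = (fun x => (-1) * u x)); last by apply/funext => x; rewrite mulN1r.
by rewrite (LnrZ lam (-1) mO mu q0) normrN1 mul1e.
Qed.

Lemma LnrBC q u v : 0 < q -> measurable_fun O u -> measurable_fun O v ->
  Lnr lam O q (fun x => u x - v x) = Lnr lam O q (fun x => v x - u x).
Proof.
move=> q0 mu mv; rewrite -(LnrN q0); last exact: measurable_funB.
by congr Lnr; apply/funext => x; rewrite opprB.
Qed.

Lemma inLp_bounded q u (B : R) : 0 < q -> measurable_fun O u -> 0 <= B ->
  {ae lam, forall x : plane R, O x -> `|u x| <= B} -> inLp q u.
Proof.
move=> q0 mu B0 uB; split => //.
apply: le_lt_trans (Ip_bounded mO mu (ltW q0) B0 uB) _.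
by rewrite lte_mul_pinfty ?lee_fin ?powR_ge0// lam_Om_fin.
Qed.

Lemma inLp_integrable q u : 1 <= q -> inLp q u -> lam.-integrable O (EFin \o u).
Proof.
move=> q1 [mu fu].
have i1 : lam.-integrable O (fun x => (1 + `|u x| `^ q)%:E).
  have mp := measurable_powR_norm q mu.
  apply: (integrableD mO (f := fun=> 1%E) (g := fun x => (`|u x| `^ q)%:E)).
    apply/integrableP; split; first exact: measurable_cst.
    under eq_integral do rewrite abse1.
    by rewrite (integral_cst lam mO) mul1e; exact: lam_Om_fin.
  apply/integrableP; split => //.
  under eq_integral do rewrite abse_EFin ger0_norm ?powR_ge0//.
  exact: fu.
apply: (le_integrable mO _ _ i1); first exact/measurable_EFinP.
move=> x _; rewrite /= lee_fin [leRHS]ger0_norm ?addr_ge0 ?powR_ge0//.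
have [u1|u1] := leP `|u x| 1; first by apply: le_trans u1 _; rewrite lerDl powR_ge0.
apply: (@le_trans _ _ (`|u x| `^ q)); last by rewrite lerDr.
by rewrite -{1}[`|u x|]powRr1//; apply: ler_powR => //; exact: ltW.
Qed.

Lemma integrable_mul u b (B : R) : lam.-integrable O (EFin \o u) -> measurable_fun O b ->
  (forall x, `|b x| <= B) -> lam.-integrable O (fun x => (u x * b x)%:E).
Proof.
move=> iu mb bB.
have mu : measurable_fun O u by apply/measurable_EFinP; case/integrableP: iu.
have B0 : 0 <= B by apply: le_trans (bB 0).
apply: (le_integrable mO _ _ (integrableZl mO B iu)).
  by apply/measurable_EFinP; exact: measurable_funM.
move=> x _; rewrite /= lee_fin !normrM mulrC (ger0_norm B0).
by rewrite ler_wpM2r.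
Qed.

Lemma measurable_test phi : test_function Om phi -> measurable_fun O (phi : plane R -> R).
Proof.
move=> [sp _ _]; apply: measurable_funTS; apply: continuous_measurable2; exact: smooth_cont.
Qed.

Lemma integrable_test u phi : lam.-integrable O (EFin \o u) -> test_function Om phi ->
  lam.-integrable O (fun x => (u x * phi x)%:E).
Proof.
move=> iu tp; have [B _ hB] := test_bounded tp.
by apply: (integrable_mul iu _ hB); exact: measurable_test.
Qed.

Lemma test_partial phi i : test_function Om phi -> test_function Om (partial i phi).
Proof. exact: test_derive. Qed.

Lemma loc_integrable_test g phi : loc_integrable Om g -> test_function Om phi ->
  lam.-integrable O (fun x => (g x * phi x)%:E).
Proof.
move=> [mg gK] tp; have [sp cp sO] := tp; have [B B0 hB] := test_bounded tp.
pose K : set (plane R) := esupp phi.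
have mK : measurable K by apply: closed_measurable2; exact: closed_closure.
have iK : lam.-integrable K (EFin \o g) := gK _ cp sO.
have mgO : measurable_fun O g := mg.
have mgK : measurable_fun K g := measurable_funS mO sO mgO.
have mpK : measurable_fun K (phi : plane R -> R) := measurable_funS mO sO (measurable_test tp).
have iKp : lam.-integrable K (fun x => (g x * phi x)%:E).
  apply: (le_integrable mK _ _ (integrableZl mK B iK)).
    by apply/measurable_EFinP; exact: measurable_funM.
  by move=> x _; rewrite /= lee_fin !normrM mulrC (gtr0_norm B0) ler_wpM2r.
move: iKp; rewrite (integrable_mkcond _ mK) (integrable_mkcond _ mO).
rewrite (_ : _ \_ K = (fun x => (g x * phi x)%:E) \_ O)//.
apply/funext => x; rewrite !patchE.
have [xK|xK] := pselect (K x); first by rewrite !mem_set//; exact: sO.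
by rewrite (esupp0 xK) mulr0; case: ifP; case: ifP.
Qed.

Lemma Rint_lam (D : set (plane R)) u : \int[leb2 R]_(x in D) u x = \int[lam]_(x in D) u x.
Proof. by rewrite /Rintegral lam_integral. Qed.

Lemma weak_partial_uniq i u g h : weak_partial_of Om i u g -> weak_partial_of Om i u h ->
  {ae lam, forall x : plane R, O x -> g x = h x}.
Proof.
move=> [_ lg wg] [_ lh wh].
have mg : measurable_fun O g by case: lg.
have mh : measurable_fun O h by case: lh.
have : {ae lam, forall x : plane R, O x -> g x - h x = 0}.
  apply: (fundamental_lemma (k := fun x => g x - h x) oO).
  - exact: measurable_funB.
  - move=> K cK KO.
    have mK : measurable (K : set (plane R)) by apply: closed_measurable2; apply: compact_closed.
    exact: (integrableB mK (lg.2 _ cK KO) (lh.2 _ cK KO)).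
  move=> phi tp.
  have ig := loc_integrable_test lg tp; have ih := loc_integrable_test lh tp.
  under eq_integral do rewrite mulrBl EFinB.
  rewrite (integralB mO ig ih).
  have := wg _ tp; rewrite (wh _ tp) => /eqP; rewrite eqr_opp !Rint_lam /Rintegral => /eqP E.
  rewrite -(fineK (integrable_fin_num mO ig)) -E fineK ?(integrable_fin_num mO ih)//.
  by rewrite subee// (integrable_fin_num mO ih).
by apply: filterS => x xk /xk /eqP; rewrite subr_eq0 => /eqP.
Qed.

(** Weak derivatives with integrability over the whole domain; as the domain is bounded, functions
    in L^q with [q >= 1] satisfy it by [inLp_integrable]. *)
Definition wp i u g := [/\ lam.-integrable O (EFin \o u), lam.-integrable O (EFin \o g) &
  forall phi, test_function Om phi ->
    \int[lam]_(x in O) (u x * partial i phi x) = - \int[lam]_(x in O) (g x * phi x)].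

Lemma integrable_loc u : lam.-integrable O (EFin \o u) -> loc_integrable Om u.
Proof.
move=> iu; split; first by apply/measurable_EFinP; case/integrableP: iu.
move=> K cK KO; rewrite lam_integrable.
by apply: (integrableS mO _ KO iu); apply: closed_measurable2; apply: compact_closed.
Qed.

Lemma wp_of i u g : wp i u g -> weak_partial_of Om i u g.
Proof.
move=> [iu ig h]; split; [exact: integrable_loc|exact: integrable_loc|].
by move=> phi tp; rewrite !Rint_lam; exact: h.
Qed.

Lemma of_wp i u g : lam.-integrable O (EFin \o u) -> lam.-integrable O (EFin \o g) ->
  weak_partial_of Om i u g -> wp i u g.
Proof.
by move=> iu ig [_ _ h]; split => // phi tp; have := h _ tp; rewrite !Rint_lam.
Qed.

Lemma wp_weak_partial i u g : wp i u g ->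
  measurable_fun O (weak_partial Om i u) /\
  {ae lam, forall x : plane R, O x -> weak_partial Om i u x = g x}.
Proof.
move=> /wp_of wg.
have w0 : weak_partial_of Om i u (weak_partial Om i u).
  by apply: (xgetPex (cst 0) (P := [set g | weak_partial_of Om i u g])); exists g.
by split; [case: w0 => _ []|exact: weak_partial_uniq w0 wg].
Qed.

(** The gradient is an explicit component, so that pairs can be combined linearly; [sob_normE] links
    them to the norm built on the chosen [weak_partial]. *)
Definition sob q u G := inLp q u /\ forall i, wp i u (G i) /\ inLp q (G i).
Definition sn q u G : \bar R := (Lnr lam O q u + \sum_i Lnr lam O q (G i))%E.

Lemma sob_W1 q u G : 1 <= q -> sob q u G -> W1 Om q%:E u.
Proof.
move=> q1 [fu fG]; have q0 : 0 < q by lra.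
split; first exact/LpP.
by move=> i; have [w f] := fG i; exists (G i); [exact: wp_of|exact/LpP].
Qed.

Lemma W1_sob q u : 1 <= q -> W1 Om q%:E u -> exists G, sob q u G.
Proof.
move=> q1 [/LpP fu wu]; have q0 : 0 < q by lra.
have {}fu := fu q0.
have [G h1 h2] := fin_all_exists2 wu.
exists G; split; first exact: fu.
move=> i; have fG : inLp q (G i) by apply/LpP => //; exact: h2.
split; last exact: fG.
exact: of_wp (inLp_integrable q1 fu) (inLp_integrable q1 fG) (h1 i).
Qed.

Lemma sob_normE q u G : 1 <= q -> sob q u G -> W1_norm Om q%:E u = sn q u G.
Proof.
move=> q1 [fu fG]; have q0 : 0 < q by lra.
rewrite /W1_norm /sn Lp_normE; congr (_ + _)%E; apply: eq_bigr => i _.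
rewrite Lp_normE; have [w [mG _]] := fG i; have [m e] := wp_weak_partial w.
exact: eq_Lnr mO m mG q0 e.
Qed.

Lemma RintZ (c : R) u : lam.-integrable O (EFin \o u) ->
  \int[lam]_(x in O) (c * u x) = c * \int[lam]_(x in O) u x.
Proof. by move=> iu; rewrite RintegralZl//; exact: mO. Qed.

Lemma wp_lin i (c : R) u v g h : wp i u g -> wp i v h ->
  wp i (fun x => c * u x + v x) (fun x => c * g x + h x).
Proof.
move=> [iu ig eu] [iv ih ev].
split; [exact: (integrableD mO (integrableZl mO c iu) iv)|exact: (integrableD mO (integrableZl mO c ig) ih)|].
move=> phi tp; have tp' := test_partial i tp.
have E (a b : plane R -> R) psi : lam.-integrable O (EFin \o a) -> lam.-integrable O (EFin \o b) -> test_function Om psi ->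
    \int[lam]_(x in O) ((c * a x + b x) * psi x) =
    c * \int[lam]_(x in O) (a x * psi x) + \int[lam]_(x in O) (b x * psi x).
  move=> ia ib tpsi; have ja := integrable_test ia tpsi; have jb := integrable_test ib tpsi.
  rewrite -(RintZ c ja) -(RintegralD mO (integrableZl mO c ja) jb).
  by congr Rintegral; apply/funext => x; ring.
by rewrite !E// eu// ev//; ring.
Qed.

Lemma sob_lin q (c : R) u v G H : 1 <= q -> sob q u G -> sob q v H ->
  sob q (fun x => c * u x + v x) (fun i x => c * G i x + H i x).
Proof.
move=> q1 [fu fG] [fv fH]; have q0 : 0 < q by lra.
split; first exact: (inLpD q1 (inLpZ c q0 fu) fv).
move=> i; have [wG lG] := fG i; have [wH lH] := fH i.
by split; [exact: wp_lin|exact: (inLpD q1 (inLpZ c q0 lG) lH)].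
Qed.

Lemma sobB q u v G H : 1 <= q -> sob q u G -> sob q v H ->
  sob q (fun x => u x - v x) (fun i x => G i x - H i x).
Proof.
move=> q1 su sv; have := sob_lin (-1) q1 sv su.
rewrite (_ : (fun x => _) = (fun x => u x - v x)); last by apply/funext => x; ring.
by rewrite (_ : (fun i x => _) = (fun i x => G i x - H i x))//; apply/funext => i; apply/funext => x; ring.
Qed.

Definition sob0 q u G := sob q u G /\
  forall e : R, 0 < e -> exists2 phi, test_function Om phi &
    (sn q (fun x => (u x - phi x)%R) (fun i x => (G i x - partial i phi x)%R) < e%:E)%E.

Lemma cvg_shift (x e : R * R) : x + n.+1%:R^-1 *: e @[n --> \oo] --> x.
Proof.
have : x + n.+1%:R^-1 *: e @[n --> \oo] --> x + 0 *: e.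
  by apply: cvgD; [exact: cvg_cst|apply: cvgZr_tmp; exact: cvg_harmonic].
by rewrite scale0r addr0.
Qed.

Lemma derive_seq phi e x : differentiable phi x ->
  n.+1%:R * (phi (x + n.+1%:R^-1 *: e) - phi x) @[n --> \oo] --> 'D_e phi x.
Proof.
move=> /diff_derivable dp; have {}dp : derivable phi x e := dp e.
have /cvgr_dnbhsP h : h^-1 *: (phi (h *: e + x) - phi x) @[h --> 0^'] --> 'D_e phi x := dp.
have := h (fun n => n.+1%:R^-1); set F := (fun n => _ *: _).
have -> : F = (fun n : nat => n.+1%:R * (phi (x + n.+1%:R^-1 *: e) - phi x)).
  by apply/funext => n; rewrite /F invrK [_ *: e + x]addrC.
by apply; split; [move=> n; exact: lt0r_neq0|exact: cvg_harmonic].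
Qed.

Lemma holder_int p q u v : 0 < p -> 0 < q -> p^-1 + q^-1 = 1 ->
  measurable_fun O u -> measurable_fun O v ->
  (\int[lam]_(x in O) (`|u x * v x|)%:E <= Lnr lam O p u * Lnr lam O q v)%E.
Proof.
move=> p0 q0 pq mu mv.
have mu' : measurable_fun setT (u \_ O) by apply/(measurable_restrictT _ mO).
have mv' : measurable_fun setT (v \_ O) by apply/(measurable_restrictT _ mO).
have := @hoelder _ _ R lam (u \_ O) (v \_ O) p q mu' mv' p0 q0 pq.
rewrite -/(Lnr lam O p u) -/(Lnr lam O q v); apply: le_trans.
rewrite Lnorm1 [in leLHS]integral_mkcond le_eqVlt; apply/orP; left; apply/eqP; apply: eq_integral => x _.
by rewrite /= !patchE; case: ifP => // _; rewrite mul0r normr0.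
Qed.

Lemma holder_Rint p q u v : 0 < p -> 0 < q -> p^-1 + q^-1 = 1 -> inLp p u -> inLp q v ->
  lam.-integrable O (fun x => (u x * v x)%:E) /\
  ((`|\int[lam]_(x in O) (u x * v x)|)%:E <= Lnr lam O p u * Lnr lam O q v)%E.
Proof.
move=> p0 q0 pq fu fv; have [mu _] := fu; have [mv _] := fv.
have h := holder_int p0 q0 pq mu mv.
have i1 : lam.-integrable O (fun x => (u x * v x)%:E).
  apply/integrableP; split; first by apply/measurable_EFinP; exact: measurable_funM.
  apply: le_lt_trans h _; rewrite lte_mul_pinfty ?Lnr_ge0 ?Lnr_fin_num//; exact: Lnr_fin.
split => //; apply: le_trans h.
rewrite -abse_EFin /Rintegral fineK ?(integrable_fin_num mO i1)//.
exact: (le_abse_integral lam mO (measurable_int lam i1)).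
Qed.

(* [v] is tested against [psi] through the Lipschitz function [v * psi]. *)
Lemma lip_wp i v g (K A B : R) : lip K v -> (forall x, `|v x| <= A) ->
  measurable_fun setT g -> (forall x, `|g x| <= B) ->
  {ae lam, forall x : plane R, O x ->
    n.+1%:R * (v (x + n.+1%:R^-1 *: Defs.basis i) - v x) @[n --> \oo] --> g x} ->
  wp i v g.
Proof.
move=> vK vA mg gB vg.
have mv := lip_measurable vK.
have A0 : 0 <= A by apply: le_trans (vA 0).
have B0 : 0 <= B by apply: le_trans (gB 0).
have iv : lam.-integrable O (EFin \o v).
  apply: (@inLp_integrable 1 v (lexx _)); apply: (inLp_bounded ltr01 _ A0); first exact: measurable_funTS.
  by apply: aeW => x _; exact: vA.
have ig : lam.-integrable O (EFin \o g).
  apply: (@inLp_integrable 1 g (lexx _)); apply: (inLp_bounded ltr01 _ B0); first exact: measurable_funTS.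
  by apply: aeW => x _; exact: gB.
split => // phi tp; have [sp cp sO] := tp; have tp' := test_partial i tp.
have [K' K'0 phiK] := test_lip tp; have [B' B'0 phiB] := test_bounded tp.
have [L' L'0 phiL] := test_supp tp.
pose f x := v x * phi x.
pose f' (x : plane R) := g x * phi x + v x * partial i phi x.
have fK : lip (A * K' + B' * K) f by exact: lipM.
have mf' : measurable_fun setT f'.
  apply: measurable_funD; apply: measurable_funM => //.
    by apply: continuous_measurable2; exact: smooth_cont.
  by apply: continuous_measurable2; apply: smooth_cont; case: tp'.
have ff' : {ae lam, forall x : plane R,
    n.+1%:R * (f (x + n.+1%:R^-1 *: Defs.basis i) - f x) @[n --> \oo] --> f' x}.
  move: vg; apply: filterS => x vx.
  have dphi := derive_seq (e := Defs.basis i) (smooth_diff x sp).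
  (* Off the support of [phi] nothing is known about the quotients of [v]; there the quotients of
     [phi] tend to 0 and [v] is continuous. *)
  have [xs|xs] := pselect (esupp phi x); last first.
    have -> : f' x = 0.
      by rewrite /f' (esupp0 xs) /partial (derive_near0 _ (esupp_near0 xs)) !mulr0 addr0.
    have E n : n.+1%:R * (f (x + n.+1%:R^-1 *: Defs.basis i) - f x) =
        v (x + n.+1%:R^-1 *: Defs.basis i) * (n.+1%:R * (phi (x + n.+1%:R^-1 *: Defs.basis i) - phi x)).
      by rewrite /f (esupp0 xs); ring.
    have -> : 0 = v x * 'D_(Defs.basis i) phi x by rewrite (derive_near0 _ (esupp_near0 xs)) mulr0.
    under eq_fun do rewrite E.
    apply: cvgM => //; apply: (@cvg_comp _ _ _ (fun n : nat => x + n.+1%:R^-1 *: Defs.basis i) v); last exact: lip_continuous vK x.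
    exact: cvg_shift.
  have {}vx := vx (sO _ xs).
  have E n : n.+1%:R * (f (x + n.+1%:R^-1 *: Defs.basis i) - f x) =
      (n.+1%:R * (v (x + n.+1%:R^-1 *: Defs.basis i) - v x)) * phi (x + n.+1%:R^-1 *: Defs.basis i) +
      v x * (n.+1%:R * (phi (x + n.+1%:R^-1 *: Defs.basis i) - phi x)).
    by rewrite /f; ring.
  under eq_fun do rewrite E.
  apply: cvgD; last by apply: cvgM => //; exact: cvg_cst.
  apply: cvgM => //.
  apply: (@cvg_comp _ _ _ (fun n : nat => x + n.+1%:R^-1 *: Defs.basis i) phi); last exact: lip_continuous phiK x.
  exact: cvg_shift.
have fL x : L' < `|x| -> f x = 0 by move=> /phiL e; rewrite /f e mulr0.
have [if' I0] := integral_lip_derive fK (ltW L'0) fL mf' ff'.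
have i1 := integrable_test ig tp; have i2 := integrable_test iv tp'.
have J : \int[lam]_(x in O) f' x = 0.
  rewrite /Rintegral integral_mkcond -[RHS]/(fine (0%E : \bar R)) -[in RHS]I0; congr fine.
  apply: eq_integral => x _; rewrite patchE; case: ifPn => //; rewrite notin_setE => nx.
  have xs : ~ esupp phi x by move=> /sO.
  by rewrite /f' (esupp0 xs) /partial (derive_near0 _ (esupp_near0 xs)) !mulr0 addr0.
move: J; rewrite /f' (RintegralD mO i1 i2) => /eqP.
by rewrite addrC addr_eq0 => /eqP.
Qed.

Lemma test_sob q phi : 1 <= q -> test_function Om phi -> sob q phi (fun i => partial i phi).
Proof.
move=> q1 tp; have q0 : 0 < q by lra.
have bl psi : test_function Om psi -> inLp q psi.
  move=> t; have [B B0 hB] := test_bounded t.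
  apply: (inLp_bounded q0 (measurable_test t) (ltW B0)); apply: aeW => x _; exact: hB.
have [K K0 phiK] := test_lip tp; have [B B0 phiB] := test_bounded tp.
split; first exact: bl.
move=> i; have tp' := test_partial i tp; have [B' _ hB'] := test_bounded tp'.
split; last exact: bl.
apply: (lip_wp phiK phiB _ hB').
  by apply: continuous_measurable2; apply: smooth_cont; case: tp'.
by apply: aeW => x _; apply: derive_seq; apply: smooth_diff; case: tp.
Qed.

Lemma sob0_W1_0 q u G : 1 <= q -> sob0 q u G -> W1_0 Om q%:E u.
Proof.
move=> q1 [su h]; split; first exact: sob_W1 su.
move=> e e0; have [phi tp le] := h e e0; exists phi => //.
by rewrite (sob_normE q1 (sobB q1 su (test_sob q1 tp))).
Qed.

Lemma W1_0_sob0 q u G : 1 <= q -> sob q u G -> W1_0 Om q%:E u -> sob0 q u G.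
Proof.
move=> q1 su [_ h]; split => // e e0; have [phi tp le] := h e e0; exists phi => //.
by rewrite -(sob_normE q1 (sobB q1 su (test_sob q1 tp))).
Qed.

End sobolev_plane.

(** * Limits and linear combinations of Sobolev pairs *)

Section poincare.
Context {R : realType} (Om : set (R * R)) (L : R).
Hypothesis oO : open Om.
Hypothesis L0 : 0 < L.
Hypothesis OmL : forall x, Om x -> `|x| <= L.
Implicit Types (u v w b g h : plane R -> R) (phi : R * R -> R) (G H : 'I_2 -> plane R -> R) (q : R) (i : 'I_2).
Notation O := (Om : set (plane R)).
Let mO := mO oO.

Lemma RintIp2 u : inLp O 2 u -> Ip lam O 2 u = (\int[lam]_(x in O) (u x ^+ 2))%:E.
Proof.
move=> [mu fu]; rewrite Ip2E /Rintegral fineK// -Ip2E ge0_fin_numE//; exact: Ip_ge0.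
Qed.

(** For a fixed test function both sides of the integration by parts are continuous in L^2, by
    Hoelder's inequality. *)
Lemma wp_closed i u g : inLp O 2 u -> inLp O 2 g ->
  (forall e : R, 0 < e -> exists u' g', [/\ wp Om i u' g', inLp O 2 u', inLp O 2 g',
    (Lnr lam O 2 (fun x => (u' x - u x)%R) <= e%:E)%E & (Lnr lam O 2 (fun x => (g' x - g x)%R) <= e%:E)%E]) ->
  wp Om i u g.
Proof.
move=> fu fg appr; have q1 : 1 <= 2 :> R by rewrite ler1n.
have iL w : inLp O 2 w -> lam.-integrable O (EFin \o w) by exact: (inLp_integrable oO L0 OmL q1).
split; [exact: iL|exact: iL|].
move=> phi tp; have tp' := test_partial i tp.
have [fp _] := test_sob oO L0 OmL q1 tp; have [fp' _] := test_sob oO L0 OmL q1 tp'.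
pose a := fine (Lnr lam O 2 phi); pose b := fine (Lnr lam O 2 (partial i phi)).
have aE : Lnr lam O 2 phi = a%:E by rewrite fineK// Lnr_fin_num.
have bE : Lnr lam O 2 (partial i phi) = b%:E by rewrite fineK// Lnr_fin_num.
have a0 : 0 <= a by rewrite fine_ge0// Lnr_ge0.
have b0 : 0 <= b by rewrite fine_ge0// Lnr_ge0.
have half : (2^-1 : R) + 2^-1 = 1 by field.
have key w w' psi (c e : R) : inLp O 2 w -> inLp O 2 w' -> inLp O 2 psi -> test_function Om psi ->
    Lnr lam O 2 psi = c%:E -> 0 <= c -> (Lnr lam O 2 (fun x => (w' x - w x)%R) <= e%:E)%E ->
    `|\int[lam]_(x in O) (w' x * psi x) - \int[lam]_(x in O) (w x * psi x)| <= e * c.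
  move=> fw fw' fpsi tpsi cE c0 le.
  have j := integrable_test oO (iL _ fw) tpsi; have j' := integrable_test oO (iL _ fw') tpsi.
  rewrite -(RintegralB mO j' j).
  have [_] := holder_Rint oO (ltr0n _ 2) (ltr0n _ 2) half (inLpB oO q1 fw' fw) fpsi.
  rewrite cE => h; rewrite -lee_fin; apply: le_trans (le_trans h _); last first.
    by rewrite EFinM; apply: lee_wpmul2r => //; rewrite lee_fin.
  rewrite lee_fin le_eqVlt; apply/orP; left; apply/eqP; congr (`|_|).
  by apply: eq_Rintegral => x _; rewrite mulrBl.
set X := \int[lam]_(x in O) _; set Y := \int[lam]_(x in O) (g x * phi x).
suff : forall e, 0 < e -> `|X + Y| <= e.
  move=> h; apply/eqP; rewrite -addr_eq0 -normr_le0; apply/ler_addgt0Pr => e e0.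
  by rewrite add0r; exact: h.
move=> e e0; have d0 : 0 < e / (a + b + 1) by rewrite divr_gt0// ltr_wpDl// addr_ge0.
have [u' [g' [[_ _ w] fu' fg' ue ge]]] := appr _ d0.
have h1 := key _ _ _ _ _ fu fu' fp' tp' bE b0 ue.
have h2 := key _ _ _ _ _ fg fg' fp tp aE a0 ge.
have {}w := w _ tp; rewrite -/X in h1; rewrite -/Y in h2; rewrite w in h1.
set Y' := \int[lam]_(x in O) (g' x * phi x) in h1 h2.
have -> : X + Y = - ((- Y' - X) + (Y' - Y)) by ring.
rewrite normrN; apply: le_trans (ler_normD _ _) _.
apply: le_trans (lerD h1 h2) _; rewrite -mulrDr mulrAC ler_pdivrMr; last by rewrite ltr_wpDl// addr_ge0.
by rewrite ler_pM2l//; lra.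
Qed.

Lemma smooth_lin (c : R) (f g : R * R -> R) : smooth f -> smooth g -> smooth (fun x => c * f x + g x).
Proof.
move=> sf sg.
have E (s : seq (R * R)) : foldr (fun e psi => 'D_e psi) (fun x => c * f x + g x) s =
    (fun x => c * foldr (fun e psi => 'D_e psi) f s x + foldr (fun e psi => 'D_e psi) g s x).
  elim: s => //= e s ->; apply/funext => x.
  have df : differentiable (foldr (fun e psi => 'D_e psi) f s) x by exact: sf.
  have dg : differentiable (foldr (fun e psi => 'D_e psi) g s) x by exact: sg.
  have df' : differentiable (fun x => c * foldr (fun e psi => 'D_e psi) f s x) x.
    exact: (differentiableZ c df).
  rewrite (deriveD (diff_derivable df') (diff_derivable dg)); congr (_ + _).
  exact: (deriveZ c (diff_derivable df)).
move=> s x; rewrite E; apply: differentiableD; last exact: sg.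
exact: (differentiableZ c (sf s x)).
Qed.

Lemma partial_lin (c : R) (f g : R * R -> R) i x : smooth f -> smooth g ->
  partial i (fun x => c * f x + g x) x = c * partial i f x + partial i g x.
Proof.
move=> sf sg; have df := smooth_diff x sf; have dg := smooth_diff x sg.
have df' : differentiable (fun x => c * f x) x by exact: (differentiableZ c df).
rewrite /partial (deriveD (diff_derivable df') (diff_derivable dg)); congr (_ + _).
exact: (deriveZ c (diff_derivable df)).
Qed.

Lemma test_lin (c : R) phi psi : test_function Om phi -> test_function Om psi ->
  test_function Om (fun x => c * phi x + psi x).
Proof.
move=> [sp cp pO] [sq cq qO].
have sub : esupp (fun x => c * phi x + psi x) `<=` esupp phi `|` esupp psi.
  rewrite [X in _ `<=` X](closure_id _).1; last by apply: closedU; exact: closed_closure.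
  apply: closure_subset => x /= /eqP nz; apply: contrapT => /not_orP[n1 n2]; apply: nz.
  by rewrite (esupp0 n1) (esupp0 n2) mulr0 addr0.
split; first exact: smooth_lin.
  by apply: (subclosed_compact _ (compactU cp cq) sub); exact: closed_closure.
by apply: subset_trans sub _ => x [/pO|/qO].
Qed.

Lemma sn_lin q (c : R) u v G H : 1 <= q -> sob Om q u G -> sob Om q v H ->
  (sn Om q (fun x => (c * u x + v x)%R) (fun i x => (c * G i x + H i x)%R) <= `|c|%:E * sn Om q u G + sn Om q v H)%E.
Proof.
move=> q1 [[mu _] fG] [[mv _] fH]; have q0 : 0 < q by lra.
have key a b : measurable_fun O a -> measurable_fun O b ->
    (Lnr lam O q (fun x => (c * a x + b x)%R) <= `|c|%:E * Lnr lam O q a + Lnr lam O q b)%E.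
  move=> ma mb; rewrite -(LnrZ lam c mO ma q0); apply: LnrD => //; exact: measurable_funM.
have mG i : measurable_fun O (G i) by case: (fG i) => _ [].
have mH i : measurable_fun O (H i) by case: (fH i) => _ [].
rewrite /sn ge0_muleDr ?Lnr_ge0 ?sume_ge0//; last by move=> i _; exact: Lnr_ge0.
rewrite addeACA; apply: leeD; first exact: key.
rewrite ge0_sume_distrr; last by move=> i _; exact: Lnr_ge0.
by rewrite -big_split; apply: lee_sum => i _; exact: key.
Qed.

Lemma sob0_lin q (c : R) u v G H : 1 <= q -> sob0 Om q u G -> sob0 Om q v H ->
  sob0 Om q (fun x => c * u x + v x) (fun i x => c * G i x + H i x).
Proof.
move=> q1 [su au] [sv av]; split; first exact: (sob_lin oO).
move=> e e0; have d0 : 0 < e / (`|c| + 1) / 2 by rewrite divr_gt0// divr_gt0// ltr_wpDl.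
have e2 : 0 < e / 2 by rewrite divr_gt0.
have [phi tp le1] := au _ d0; have [psi tq le2] := av _ e2.
exists (fun x => c * phi x + psi x); first exact: test_lin.
have sup := sobB oO q1 su (test_sob oO L0 OmL q1 tp).
have svp := sobB oO q1 sv (test_sob oO L0 OmL q1 tq).
have := sn_lin c q1 sup svp.
have [sp _ _] := tp; have [sq _ _] := tq.
rewrite (_ : (fun x => c * (u x - phi x) + _) = (fun x => c * u x + v x - (c * phi x + psi x))); last by apply/funext => x; ring.
rewrite (_ : (fun i x => c * (G i x - _) + _) = (fun i x => c * G i x + H i x - partial i (fun x => c * phi x + psi x) x)); last first.
  by apply/funext => i; apply/funext => x; rewrite partial_lin//; ring.
move=> /le_lt_trans; apply.
apply: (@le_lt_trans _ _ ((e / 2)%:E + sn Om q (fun x => (v x - psi x)%R) (fun i x => (H i x - partial i psi x)%R))%E); last first.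
  by rewrite [X in (_ < X%:E)%E](splitr e) EFinD lteD2lE.
rewrite leeD2r//; apply: (@le_trans _ _ (`|c|%:E * (e / (`|c| + 1) / 2)%:E)%E).
  by apply: lee_wpmul2l; [rewrite lee_fin|exact: ltW].
rewrite -EFinM lee_fin mulrA ler_pM2r// mulrCA ler_piMr ?(ltW e0)//.
by rewrite ler_pdivrMr ?ltr_wpDl// mul1r lerDl.
Qed.

Lemma test_sob0 q phi : 1 <= q -> test_function Om phi -> sob0 Om q phi (fun i => partial i phi).
Proof.
move=> q1 tp; have q0 : 0 < q by lra.
split; first exact: (test_sob oO L0 OmL).
move=> e e0; exists phi => //; rewrite /sn.
have E (f : plane R -> R) : Lnr lam O q (fun x => f x - f x) = 0%E.
  by rewrite (_ : (fun x => _) = fun=> 0) ?Lnr0//; apply/funext => x; rewrite subrr.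
by rewrite E big1 ?add0e ?lte_fin// => i _; exact: E.
Qed.

Lemma sob0B q u v G H : 1 <= q -> sob0 Om q u G -> sob0 Om q v H ->
  sob0 Om q (fun x => u x - v x) (fun i x => G i x - H i x).
Proof.
move=> q1 su sv; have := sob0_lin (-1) q1 sv su.
rewrite (_ : (fun x => _) = (fun x => u x - v x)); last by apply/funext => x; ring.
by rewrite (_ : (fun i x => _) = (fun i x => G i x - H i x))//; apply/funext => i; apply/funext => x; ring.
Qed.

End poincare.

(** * Gradients of interpolants *)

Section interpolant_gradient.
Context {R : realType} (Om : set (R * R)) (n : nat) (p : 'I_n -> 'I_3 -> R * R)
    (s : R) (h : 'I_n -> R).
Hypothesis M : is_mesh Om p s h.
Variable L : R.
Hypothesis L0 : 0 < L.
Hypothesis OmL : forall x, Om x -> `|x| <= L.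
Implicit Types (x y : R * R) (j k : 'I_n) (i : 'I_2) (w : R * R -> R) (q : R).
Notation O := (Om : set (plane R)).
Notation T j := (tri (p j) : set (plane R)).
Let oO := mesh_open M.
Let mO := mO oO.

(** Translates the index in ['I_2] of a partial derivative into the projections of a pair. *)
Definition co i (x : R * R) : R := if i == 0 then x.1 else x.2.

(* On the null set of common sides, the gradients of all adjacent triangles are added up. *)
Definition Dg w i (x : plane R) : R :=
  \sum_j (if `[< tri (p j) x >] then co i (igrad (p j) w) else 0).

Lemma co_le i x : `|co i x| <= n1 x.
Proof. by rewrite /co /n1; case: ifP => _; rewrite ?lerDl ?lerDr. Qed.

Lemma n1_co x : n1 x = \sum_i `|co i x|.
Proof. by rewrite !big_ord_recl big_ord0 addr0. Qed.

Lemma dotp_co x y : dotp x y = \sum_i co i x * co i y.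
Proof. by rewrite !big_ord_recl big_ord0 addr0. Qed.

Lemma measurable_Dg w i : measurable_fun setT (Dg w i).
Proof.
apply: measurable_sum => j.
rewrite (_ : (fun x => _) = (fun x => co i (igrad (p j) w) * \1_(T j) x)).
  by apply: measurable_funM => //; apply: measurable_indic; exact: measurable_tri.
apply/funext => x; rewrite indicE; case: asboolP => hx.
  by rewrite (mem_set (hx : T j x)) mulr1.
by rewrite (memNset (hx : ~ T j x)) mulr0.
Qed.

Lemma Dg_bound w i x : `|Dg w i x| <= gsum p w.
Proof.
apply: le_trans (ler_norm_sum _ _ _) _; rewrite /gsum; apply: ler_wpDr => //; apply: ler_sum => j _.
by case: ifP => _; [exact: co_le|rewrite normr0 gnorm_ge0].
Qed.

Lemma ae_Dg w : {ae lam, forall x : plane R, forall j, T j x -> forall i, Dg w i x = co i (igrad (p j) w)}.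
Proof.
have := ae_tri M; apply: filterS => x [_ h2 _] j xj i.
rewrite /Dg (bigD1 j)//= asboolT// big1 ?addr0// => k kj.
by rewrite asboolF// => xk; case/eqP: kj; exact: h2.
Qed.

Lemma tri_interior j x : (forall j (i : 'I_3), bary (p j) i x != 0) -> tri (p j) x ->
  exists2 e : R, 0 < e & forall y, `|y - x| <= e -> tri (p j) y.
Proof.
move=> hb xj; have bp (i : 'I_3) : 0 < bary (p j) i x by rewrite lt_neqAle eq_sym hb xj.
have g0 (i : 'I_3) : 0 < n1 (bgrad (p j) i) + 1 by rewrite ltr_wpDl// n1_ge0.
pose e : R := Num.min (bary (p j) o0 x / (n1 (bgrad (p j) o0) + 1))
  (Num.min (bary (p j) o1 x / (n1 (bgrad (p j) o1) + 1)) (bary (p j) o2 x / (n1 (bgrad (p j) o2) + 1))).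
exists e; first by rewrite !lt_min; do !(apply/andP; split); rewrite divr_gt0.
move=> y yx i.
have : n1 (bgrad (p j) i) * `|y - x| <= bary (p j) i x.
  apply: (@le_trans _ _ ((n1 (bgrad (p j) i) + 1) * e)).
    by apply: ler_pM => //; [exact: n1_ge0|rewrite lerDl].
  by rewrite mulrC -ler_pdivlMr//; move: i; apply: ord3P; rewrite /e !ge_min ?lexx ?orbT.
have := dotp_le (bgrad (p j) i) (y - x); rewrite ler_norml => /andP[h1 _] h2.
by rewrite (baryE (p j) i y x); lra.
Qed.

Lemma co_basis i x (t : R) : dotp x (t *: Defs.basis i) = t * co i x.
Proof.
by rewrite /dotp /co /Defs.basis; case: ifP => _; rewrite /= /GRing.scale /= ?mulr0 ?mulr1 ?add0r ?addr0 mulrC.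
Qed.

Definition vsum w : R := \sum_j \sum_(i < 3) `|w (p j i)|.

Lemma interp_bound w x : `|interp p w x| <= vsum w.
Proof.
have v0 : 0 <= vsum w by do 2 (apply: sumr_ge0 => ? _).
rewrite /interp; case: pickP => [j /asboolP xj|_]; last by rewrite normr0.
have vj (i : 'I_3) : `|w (p j i)| <= vsum w.
  rewrite /vsum (bigD1 j)//= (bigD1 i)//= -addrA lerDl addr_ge0//; first by apply: sumr_ge0.
  by do 2 (apply: sumr_ge0 => ? _).
rewrite ler_norml; apply: (ival_range (mesh_nondeg M j)) => // i.
by rewrite -ler_norml.
Qed.

(** Almost every point of the domain is interior to a triangle, where the difference quotients are
    eventually constant; [lip_wp] makes this pointwise derivative the weak one. *)
Lemma wp_interp w i : bdry0 Om p w -> wp Om i (interp p w) (Dg w i).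
Proof.
move=> w0; apply: (lip_wp oO L0 OmL (v_lip M w0) (interp_bound w) (measurable_Dg w i) (Dg_bound w i)).
have := ae_bary_neq0 M; have := ae_tri M; have := ae_Dg w; apply: filterS3 => x hD [_ _ hO] hb Ox.
have [j xj] := hO Ox; have [e e0 he] := tri_interior hb xj.
rewrite (hD j xj); apply: cvg_near_cst; near=> m.
have xm : tri (p j) (x + m.+1%:R^-1 *: Defs.basis i).
  apply: he; rewrite addrC addKr normrZ.
  have -> : `|Defs.basis i| = 1 :> R.
    by rewrite /Defs.basis; case: ifP => _; rewrite norm_pair /= normr0 normr1 ?(max_idPl ler01) ?(max_idPr ler01).
  rewrite mulr1 ger0_norm//; apply: ltW; near: m; exact: (near_infty_natSinv_lt (PosNum e0)).
by rewrite (interpB M w xm xj) addrC addKr co_basis mulrA mulfV ?mul1r.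
Unshelve. all: by end_near. Qed.

Lemma sob_interp w q : 1 <= q -> bdry0 Om p w -> sob Om q (interp p w) (Dg w).
Proof.
move=> q1 w0; have q0 : 0 < q by lra.
have v0 : 0 <= vsum w by do 2 (apply: sumr_ge0 => ? _).
split.
  apply: (inLp_bounded oO L0 OmL q0 _ v0); last by apply: aeW => x _; exact: interp_bound.
  by apply: measurable_funTS; exact: lip_measurable (v_lip M w0).
move=> i; split; first exact: wp_interp.
apply: (inLp_bounded oO L0 OmL q0 _ (ltW (gsum_gt0 p w))); last by apply: aeW => x _; exact: Dg_bound.
by apply: measurable_funTS; exact: measurable_Dg.
Qed.

Lemma Ip_Dg w i q : Ip lam O q (Dg w i) = (\sum_j tau p j * `|co i (igrad (p j) w)| `^ q)%:E.
Proof.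
have mD : measurable_fun setT (fun x => `|Dg w i x| `^ q).
  apply: (measurableT_comp (measurable_powR q)); apply: measurableT_comp => //.
  exact: measurable_Dg.
rewrite /Ip (ge0_integral_mesh M mD); last by move=> x; exact: powR_ge0.
rewrite -sumEFin; apply: eq_bigr => j _.
have mT := measurable_tri p j.
rewrite (@ae_eq_integral _ _ _ _ _ (fun=> (`|co i (igrad (p j) w)| `^ q)%:E)) //.
- by rewrite (integral_cst lam mT) (tauE M) -EFinM mulrC.
- by apply/measurable_EFinP; exact: measurable_funTS.
- have := ae_Dg w; apply: filterS => x hx xj; by rewrite (hx j xj).
Qed.

Lemma Ip_Dg_le w i q : 0 <= q ->
  (Ip lam O q (Dg w i) <= (\sum_j tau p j * gnorm p w j `^ q)%:E)%E.
Proof.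
move=> q0; rewrite Ip_Dg lee_fin; apply: ler_sum => j _.
rewrite ler_wpM2l ?(ltW (tau_gt0 M j))//; apply: powR_mono => //; exact: co_le.
Qed.

(* The value of the interpolant is charged to the horizontal maximal function
   by a jump out of the domain. *)
Lemma interp_M1 w x : bdry0 Om p w -> `|interp p w x| <= 3 * L * M1 p w x.
Proof.
move=> w0; have [Ox|nO] := pselect (Om x); last first.
  by rewrite (interp_out M w0 nO) normr0 mulr_ge0 ?(M1_ge0 M w0)// mulr_ge0// ltW.
have := dqsup_ge (v_lip1 M w0 x.2) x.1 (3 * L).
have nO : ~ Om (x.1 + 3 * L, x.2).
  move=> /OmL; rewrite norm_pair /= ge_max => /andP[+ _].
  have := le_trans (norm1_le x) (OmL Ox); rewrite !ler_norml => /andP[? ?] /andP[? ?].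
  by have := L0; lra.
rewrite (interp_out M w0 nO) sub0r normrN -surjective_pairing [`|3 * L|]ger0_norm//.
by rewrite mulr_ge0// ltW.
Qed.

(** A discrete Poincare inequality, from [interp_M1] and the L^q bound of the maximal function. *)
Lemma Ip_interp w q : bdry0 Om p w -> 3 / 2 <= q <= 3 ->
  (Ip lam O q (interp p w) <= ((3 * L) `^ q)%:E * ((3 * 2 ^+ 14)%:E * (\sum_j tau p j * gnorm p w j `^ q)%:E))%E.
Proof.
move=> w0 hq; have q0 : 0 < q by move/andP: hq => [? _]; lra.
have L30 : 0 <= 3 * L by rewrite mulr_ge0// ltW.
have mM := measurable_powRf q (measurable_M1 M w0).
apply: (@le_trans _ _ (((3 * L) `^ q)%:E * \int[lam]_x (M1 p w x `^ q)%:E)%E); last first.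
  apply: lee_wpmul2l; first by rewrite lee_fin powR_ge0.
  apply: le_trans (M1_Lp M w0 hq) _; apply: lee_wpmul2l; first by rewrite lee_fin mulr_ge0.
  exact: (Dsum_Lp M).
rewrite -ge0_integralZl//; last 2 first.
- by move=> x _; rewrite lee_fin powR_ge0.
- by rewrite lee_fin powR_ge0.
rewrite /Ip integral_mkcond; apply: ge0_le_integral => //.
- by move=> x _; rewrite patchE; case: ifP => // _; rewrite lee_fin powR_ge0.
- apply/(measurable_restrictT _ mO); apply: measurable_powR_norm.
  by apply: measurable_funTS; exact: lip_measurable (v_lip M w0).
- by apply: measurable_funeM.
move=> x _; rewrite patchE; case: ifP => _; last by rewrite -EFinM lee_fin mulr_ge0 ?powR_ge0.
rewrite -EFinM lee_fin -powRM ?(M1_ge0 M w0)//; apply: powR_mono => //; [exact: ltW|exact: interp_M1].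
Qed.

End interpolant_gradient.

(** * Interpolants are limits of test functions *)

Section quasi_interpolation.
Context {R : realType}.
Implicit Types (v : R * R -> R) (x y e : R * R).

Lemma rho_far (t : R) : 2 < `|t| -> rho t = 0.
Proof. by rewrite ltr_normr => h; apply: rho_out; lra. Qed.

(** [rho] is smooth and vanishes outside [[-1, 2]], so bounds of [rho] and of its derivative on
    [[-3, 3]] suffice; steps longer than 1 or leaving this interval are treated apart. *)
Lemma rho_bound : exists2 B : R, 0 < B & forall t, `|rho t| <= B /\ forall t', `|rho t - rho t'| <= B * `|t - t'|.
Proof.
have sb (f : R -> R) : continuous f -> 
    exists2 B : R, 0 < B & forall t, -3 <= t <= 3 -> `|f t| <= B.
  move=> cf; have cn : {within `[-3, 3], continuous (fun t => `|f t|)}.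
    by apply: continuous_subspaceT => t; apply: cvg_norm; exact: cf.
  have m12 : -3 <= 3 :> R by lra.
  have [c _ hc] := EVT_max m12 cn.
  exists (`|f c| + 1); first by rewrite ltr_wpDl.
  by move=> t t3; have := hc t; rewrite in_itv /= t3 => /(_ isT); lra.
have s1 : smooth1 (rho : R -> R) := smooth1_rho.
have [B1 B10 h1] := sb rho (smooth1_continuous s1).
have [B2 B20 h2] := sb (derive1 rho) (smooth1_continuous (smooth1_der s1)).
have b1 t : `|rho t| <= B1.
  have [/h1//|h] := boolP (-3 <= t <= 3).
  by rewrite rho_far ?normr0 ?ltW//; rewrite -ler_norml -ltNge in h; lra.
have l1 t t' : -3 <= t -> t <= t' -> t' <= 3 -> `|rho t' - rho t| <= B2 * (t' - t).
  move=> t3 tt' t'3.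
  have [z zt ->] := MVT_segment tt' (fun z _ => smooth1_is_derive z s1) (continuous_subspaceT (smooth1_continuous s1)).
  rewrite normrM [`|t' - t|]ger0_norm ?subr_ge0// ler_wpM2r ?subr_ge0// h2//.
  by move: zt; rewrite in_itv /=; lra.
have l2 t t' : t <= t' -> `|rho t - rho t'| <= (B1 + B2) * (t' - t).
  move=> tt'; have d0 : 0 <= t' - t by rewrite subr_ge0.
  have [c1|c1] := leP (t' - t) 1; last first.
    have [n1_|n1_] := leP 2 `|t|.
      have -> : rho t = 0 by apply: rho_out; move: n1_; rewrite ler_normr; lra.
      rewrite sub0r normrN; apply: le_trans (b1 _) _; rewrite -[X in X <= _]mulr1 ler_pM//; lra.
    have [n2|n2] := leP 2 `|t'|.
      have -> : rho t' = 0 by apply: rho_out; move: n2; rewrite ler_normr; lra.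
      rewrite subr0; apply: le_trans (b1 _) _; rewrite -[X in X <= _]mulr1 ler_pM//; lra.
    rewrite distrC; apply: le_trans (l1 _ _ _ tt' _) _; [move: n1_; rewrite ltr_norml; lra|move: n2; rewrite ltr_norml; lra|].
    by rewrite ler_wpM2r//; lra.
  have [h3|h3] := boolP ((-3 <= t) && (t' <= 3)).
    by case/andP: h3 => *; rewrite distrC; apply: le_trans (l1 _ _ _ tt' _) _ => //; rewrite ler_wpM2r//; lra.
  have -> : rho t = 0 by apply: rho_out; move: h3; rewrite negb_and -!ltNge; lra.
  have -> : rho t' = 0 by apply: rho_out; move: h3; rewrite negb_and -!ltNge; lra.
  by rewrite subrr normr0 mulr_ge0//; lra.
exists (B1 + B2); first exact: addr_gt0.
move=> t; split; first by apply: le_trans (b1 t) _; rewrite lerDl ltW.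
move=> t'; have [tt'|tt'] := leP t t'; last rewrite distrC.
  by rewrite [`|t - t'|]distrC [`|t' - t|]ger0_norm ?subr_ge0// l2.
by rewrite [`|t - t'|]ger0_norm ?subr_ge0 ?l2// ltW.
Qed.

Lemma count_near (m : nat) (y : R) : \sum_(a < m) (if `|y - a%:R| <= 3 then 1 else 0 : R) <= 7.
Proof.
rewrite -big_mkcond /= sumr_const.
set A := #|_|; suff : (A <= 7)%N by rewrite -(ler_nat R).
pose k := Num.trunc (y + 3).
have near (a : 'I_m) : `|y - a%:R| <= 3 -> nat_of_ord a \in iota (k - 6) 7.
  rewrite ler_norml => /andP[h1 h2].
  have a0 : 0 <= (a : nat)%:R :> R by [].
  have y0 : 0 <= y + 3 by lra.
  have /andP[k1 k2] := truncn_itv y0; rewrite -/k in k1 k2.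
  have e1 : (a < k.+1)%N by rewrite -(ltr_nat R); lra.
  have e2 : (k <= a + 6)%N by rewrite -(ler_nat R) natrD; lra.
  rewrite mem_iota leq_subLR addnC e2 /=.
  by rewrite -[7%N]/(6 + 1)%N addnA addn1 ltnS addnC -maxnE leq_max -[(a <= k)%N]/(a < k.+1)%N e1 orbT.
have -> : A = size (enum [pred a : 'I_m | `|y - (a : nat)%:R| <= 3]) by rewrite -cardE.
rewrite -(size_map (@nat_of_ord m)) -(size_iota (k - 6) 7).
apply: uniq_leq_size; first by rewrite map_inj_uniq ?enum_uniq//; exact: ord_inj.
by move=> b /mapP[a]; rewrite mem_enum inE => /near h ->.
Qed.

Variables (eta c : R) (m : nat).
Hypothesis eta0 : 0 < eta.

(** Grid points of mesh size [eta]; the shift [c] lets natural indices reach negative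
    coordinates. *)
Definition node (a b : nat) : R * R := (eta * (a%:R - c), eta * (b%:R - c)).
Definition hat1 (a : nat) (t : R) : R := rho (eta^-1 * t + (c - a%:R)).
Definition quasi v x : R := \sum_(a < m) \sum_(b < m) v (node a b) * (hat1 a x.1 * hat1 b x.2).
(** The range of [sum_rho] and [sum_id_rho]: all translates of [rho] that do not vanish at the point
    have an index below [m]. *)
Definition inr1 (t : R) := 1 <= eta^-1 * t + c /\ eta^-1 * t + c + 1 <= m%:R.
Definition inr x := inr1 x.1 /\ inr1 x.2.

Lemma smooth_quasi v : smooth (quasi v).
Proof.
apply: tensor_smooth; do 2 (apply: tensor_sum => ?); apply: tensor_scale.
by apply: tensor_prod; apply: smooth1_affine; exact: smooth1_rho.
Qed.

Lemma hat1_far a t : 2 * eta < `|t - eta * (a%:R - c)| -> hat1 a t = 0.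
Proof.
move=> h; apply: rho_far.
rewrite (_ : _ + _ = eta^-1 * (t - eta * (a%:R - c))); last by field; rewrite gt_eqF.
by rewrite normrM ger0_norm ?invr_ge0 ?(ltW eta0)// ltr_pdivlMl// mulrC.
Qed.

Lemma quasi_neq0 v x : quasi v x != 0 -> exists a b, v (node a b) != 0 /\ `|node a b - x| <= 2 * eta.
Proof.
move=> h; have [//|n0] := pselect (exists a b, v (node a b) != 0 /\ `|node a b - x| <= 2 * eta).
case/eqP: h; rewrite /quasi big1// => a _; rewrite big1// => b _.
have [->|v0] := eqVneq (v (node a b)) 0; first by rewrite mul0r.
have : ~ (`|node a b - x| <= 2 * eta) by move=> h; apply: n0; exists a, b.
move/negP; rewrite -ltNge distrC prod_normE /= lt_max => /orP[|] /hat1_far ->; rewrite ?mul0r ?mulr0//.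
Qed.

Lemma sum_hat1 t : inr1 t -> \sum_(a < m) hat1 a t = 1.
Proof.
by move=> [t1 t2]; rewrite -(sum_rho t2 t1); apply: eq_bigr => a _; rewrite /hat1 addrA.
Qed.

Lemma sum_id_hat1 t : inr1 t -> \sum_(a < m) eta * (a%:R - c) * hat1 a t = t.
Proof.
move=> it; have [t1 t2] := it.
transitivity (eta * (\sum_(a < m) a%:R * rho (eta^-1 * t + c - a%:R) - c * \sum_(a < m) hat1 a t)).
  rewrite mulr_sumr -sumrB mulr_sumr; apply: eq_bigr => a _.
  by rewrite /hat1 addrA -mulrBl mulrA.
by rewrite (sum_id_rho t2 t1) (sum_hat1 it); field; rewrite gt_eqF.
Qed.

Lemma quasi_sumM x : inr x -> \sum_(a < m) \sum_(b < m) hat1 a x.1 * hat1 b x.2 = 1.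
Proof.
move=> [i1 i2]; under eq_bigr do rewrite -mulr_sumr (sum_hat1 i2) mulr1.
exact: sum_hat1.
Qed.

(** The hats sum to 1, and averaging the nodes with them returns the coordinates ([sum_hat1],
    [sum_id_hat1]). *)
Lemma quasi_affine (al : R) e x : inr x ->
  quasi (fun y => al + dotp e y) x = al + dotp e x.
Proof.
move=> [i1 i2]; rewrite /quasi.
transitivity (al * ((\sum_(a < m) hat1 a x.1) * (\sum_(b < m) hat1 b x.2)) +
  e.1 * ((\sum_(a < m) eta * (a%:R - c) * hat1 a x.1) * (\sum_(b < m) hat1 b x.2)) +
  e.2 * ((\sum_(a < m) hat1 a x.1) * (\sum_(b < m) eta * (b%:R - c) * hat1 b x.2))).
  rewrite !big_distrlr /= !mulr_sumr -!big_split /=; apply: eq_bigr => a _.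
  rewrite !mulr_sumr -!big_split /=; apply: eq_bigr => b _.
  by rewrite /dotp /node /=; ring.
rewrite !sum_hat1// !sum_id_hat1// /dotp; ring.
Qed.

Definition ind1 (a : nat) (t : R) : R := if `|eta^-1 * t + c - a%:R| <= 3 then 1 else 0.

Lemma ind1_ge0 a t : 0 <= ind1 a t. Proof. by rewrite /ind1; case: ifP. Qed.

Lemma sum_ind1 x : \sum_(a < m) \sum_(b < m) ind1 a x.1 * ind1 b x.2 <= 49.
Proof.
rewrite -big_distrlr /= (_ : 49 = 7 * 7); last by ring.
by apply: ler_pM; rewrite ?count_near//; apply: sumr_ge0 => a _; exact: ind1_ge0.
Qed.

Lemma quasi_sum_le x (g : nat -> nat -> R) (C : R) : 0 <= C ->
  (forall a b, `|g a b| <= C * (ind1 a x.1 * ind1 b x.2)) ->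
  `|\sum_(a < m) \sum_(b < m) g a b| <= C * 49.
Proof.
move=> C0 hg; apply: le_trans (ler_norm_sum _ _ _) _.
apply: le_trans (ler_wpM2l C0 (sum_ind1 x)).
rewrite mulr_sumr; apply: ler_sum => a _.
apply: le_trans (ler_norm_sum _ _ _) _.
by rewrite mulr_sumr; apply: ler_sum => b _.
Qed.

Lemma node_dist a b x : 3 * eta < `|node a b - x| -> ind1 a x.1 * ind1 b x.2 = 0.
Proof.
have h (k : nat) (t : R) : 3 * eta < `|eta * (k%:R - c) - t| -> ind1 k t = 0.
  rewrite distrC (_ : t - _ = eta * (eta^-1 * t + c - k%:R)); last by field; rewrite gt_eqF.
  by rewrite normrM (ger0_norm (ltW eta0)) mulrC ltr_pM2l// /ind1 => h; rewrite leNgt h.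
by rewrite prod_normE /= lt_max => /orP[|] /h ->; rewrite ?mul0r ?mulr0.
Qed.

Section bounds.
Variables (B K : R) (v : R * R -> R).
Hypotheses (B0 : 0 < B) (K0 : 0 <= K) (vK : lip K v).
Hypothesis hB : forall t : R, `|rho t| <= B /\ forall t', `|rho t - rho t'| <= B * `|t - t'|.

Lemma hat1_le a t : `|hat1 a t| <= B * ind1 a t.
Proof.
rewrite /ind1; case: ifPn => [_|]; first by rewrite mulr1; case: (hB (eta^-1 * t + (c - a%:R))).
by rewrite -ltNge mulr0 /hat1 addrA => h; rewrite rho_far ?normr0//; lra.
Qed.

Lemma hat1_near_le a t t' : `|t' - t| <= eta -> `|hat1 a t'| <= B * ind1 a t.
Proof.
move=> tt'; rewrite /ind1; case: ifPn => [_|]; first by rewrite mulr1; case: (hB (eta^-1 * t' + (c - a%:R))).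
rewrite -ltNge mulr0 /hat1 addrA => h; rewrite rho_far ?normr0//.
have e : `|eta^-1 * (t' - t)| <= 1.
  by rewrite normrM ger0_norm ?invr_ge0 ?(ltW eta0)// ler_pdivrMl// mulr1.
have := ler_normB (eta^-1 * t' + c - a%:R) (eta^-1 * (t' - t)).
rewrite (_ : _ - _ - _ = eta^-1 * t + c - a%:R); [lra|ring].
Qed.

Lemma hat1_diff a t t' : `|t' - t| <= eta ->
  `|hat1 a t' - hat1 a t| <= B * eta^-1 * `|t' - t| * ind1 a t.
Proof.
move=> tt'; rewrite /ind1; case: ifPn => [_|h].
  rewrite mulr1; apply: le_trans ((hB _).2 _) _.
  rewrite (_ : _ - _ = eta^-1 * (t' - t)); last by ring.
  by rewrite normrM (@ger0_norm _ eta^-1) ?invr_ge0 ?(ltW eta0)// mulrA.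
have e0 : ind1 a t = 0 by rewrite /ind1 (negbTE h).
have := hat1_near_le a tt'; have := hat1_le a t.
by rewrite e0 !mulr0 !normr_le0 => /eqP -> /eqP ->; rewrite subrr.
Qed.

(** The weights sum to 1, and only nodes within [3 * eta] of [x] carry any, at most 49 of them;
    [147 = 3 * 49]. *)
Lemma quasi_near x : inr x -> `|quasi v x - v x| <= K * (147 * B ^+ 2) * eta.
Proof.
move=> ix; pose g a b := (v (node a b) - v x) * (hat1 a x.1 * hat1 b x.2).
have -> : quasi v x - v x = \sum_(a < m) \sum_(b < m) g a b.
  rewrite -[X in _ - X]mulr1 -(quasi_sumM ix) mulr_sumr -sumrB; apply: eq_bigr => a _.
  by rewrite mulr_sumr -sumrB; apply: eq_bigr => b _; rewrite /g mulrBl.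
have C0 : 0 <= K * (3 * eta) * B ^+ 2 by rewrite mulr_ge0 ?sqr_ge0// mulr_ge0// mulr_ge0// ltW.
rewrite (_ : K * _ * eta = K * (3 * eta) * B ^+ 2 * 49); last by ring.
apply: (@quasi_sum_le x g _ C0) => a b.
have hh : `|hat1 a x.1 * hat1 b x.2| <= B ^+ 2 * (ind1 a x.1 * ind1 b x.2).
  rewrite normrM expr2 mulrACA; apply: ler_pM; rewrite ?hat1_le//.
have [d|d] := leP `|node a b - x| (3 * eta).
  rewrite -mulrA normrM; apply: ler_pM => //.
  by apply: le_trans (vK _ _) _; rewrite ler_wpM2l.
have i0 := node_dist d; rewrite i0 mulr0; move: hh; rewrite i0 mulr0 normr_le0 => /eqP h.
by rewrite /g h mulr0 normr0.
Qed.

(** As the weights sum to 1 at both points, [v] may be replaced by [v - v x], which is at most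
    [3 * eta * K] at the nodes that count and compensates the factor [1 / eta] in the slope of the
    hats; [294 = 3 * 2 * 49]. *)
Lemma quasi_lip x z : inr x -> inr z -> `|z - x| <= eta ->
  `|quasi v z - quasi v x| <= K * (294 * B ^+ 2) * `|z - x|.
Proof.
move=> ix iz zx.
pose g a b := (v (node a b) - v x) * (hat1 a z.1 * hat1 b z.2 - hat1 a x.1 * hat1 b x.2).
have -> : quasi v z - quasi v x = \sum_(a < m) \sum_(b < m) g a b.
  rewrite (_ : quasi v z - quasi v x = quasi v z - quasi v x - v x * (1 - 1)); last by ring.
  rewrite -{1}(quasi_sumM iz) -(quasi_sumM ix) -!sumrB mulr_sumr -sumrB; apply: eq_bigr => a _.
  by rewrite -!sumrB mulr_sumr -sumrB; apply: eq_bigr => b _; rewrite /g; ring.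
have ei : 0 <= eta^-1 by rewrite invr_ge0 ltW.
have C0 : 0 <= K * (3 * eta) * (2 * B ^+ 2 * eta^-1 * `|z - x|).
  by rewrite (mulr_ge0 (mulr_ge0 K0 (mulr_ge0 _ (ltW eta0))) (mulr_ge0 (mulr_ge0 (mulr_ge0 _ (sqr_ge0 B)) ei) (normr_ge0 _))).
rewrite (_ : K * _ * `|z - x| = K * (3 * eta) * (2 * B ^+ 2 * eta^-1 * `|z - x|) * 49); last first.
  by field; rewrite gt_eqF.
have z1 : `|z.1 - x.1| <= `|z - x| by rewrite prod_normE /= le_max lexx.
have z2 : `|z.2 - x.2| <= `|z - x| by rewrite prod_normE /= le_max lexx orbT.
apply: (@quasi_sum_le x g _ C0) => a b.
have hh : `|hat1 a z.1 * hat1 b z.2 - hat1 a x.1 * hat1 b x.2| <=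
    2 * B ^+ 2 * eta^-1 * `|z - x| * (ind1 a x.1 * ind1 b x.2).
  rewrite (_ : _ - _ = (hat1 a z.1 - hat1 a x.1) * hat1 b z.2 + hat1 a x.1 * (hat1 b z.2 - hat1 b x.2)); last by ring.
  apply: le_trans (ler_normD _ _) _; rewrite !normrM.
  have a1 := hat1_diff a (le_trans z1 zx); have a2 := hat1_diff b (le_trans z2 zx).
  have a3 := hat1_near_le b (le_trans z2 zx); have a4 := hat1_le a x.1.
  have i1 := ind1_ge0 a x.1; have i2 := ind1_ge0 b x.2.
  have a1' : `|hat1 a z.1 - hat1 a x.1| <= B * eta^-1 * `|z - x| * ind1 a x.1.
    by apply: le_trans a1 _; rewrite ler_wpM2r// ler_wpM2l// mulr_ge0// ltW.
  have a2' : `|hat1 b z.2 - hat1 b x.2| <= B * eta^-1 * `|z - x| * ind1 b x.2.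
    by apply: le_trans a2 _; rewrite ler_wpM2r// ler_wpM2l// mulr_ge0// ltW.
  rewrite (_ : 2 * _ * _ * _ * _ = B * eta^-1 * `|z - x| * ind1 a x.1 * (B * ind1 b x.2) +
    B * ind1 a x.1 * (B * eta^-1 * `|z - x| * ind1 b x.2)); last by ring.
  by apply: lerD; apply: ler_pM.
have [d|d] := leP `|node a b - x| (3 * eta).
  rewrite -mulrA normrM; apply: ler_pM => //.
  by apply: le_trans (vK _ _) _; rewrite ler_wpM2l.
have i0 := node_dist d; rewrite i0 mulr0; move: hh; rewrite i0 mulr0 normr_le0 => /eqP h.
by rewrite /g h mulr0 normr0.
Qed.

End bounds.

Lemma quasi_local v w x : (forall y, `|y - x| <= 2 * eta -> v y = w y) -> quasi v x = quasi w x.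
Proof.
move=> vw; apply: eq_bigr => a _; apply: eq_bigr => b _.
have [/vw -> //|] := leP `|node a b - x| (2 * eta).
by rewrite distrC prod_normE /= lt_max => /orP[|] /hat1_far ->; rewrite ?mul0r ?mulr0.
Qed.

Lemma derive_lip_le (f : R * R -> R) (e x : R * R) (C d : R) : 0 < d -> differentiable f x ->
  (forall z, `|z - x| <= d -> `|f z - f x| <= C * `|z - x|) -> `|'D_e f x| <= C * `|e|.
Proof.
move=> d0 df hf.
have e1 : 0 < `|e| + 1 by rewrite ltr_wpDl.
have cs : `|k.+1%:R * (f (x + k.+1%:R^-1 *: e) - f x)| @[k --> \oo] --> `|'D_e f x|.
  by apply: cvg_norm; exact: derive_seq.
rewrite -(cvg_lim (@norm_hausdorff _ _) cs); apply: limr_le; first by apply/cvg_ex; eexists; exact: cs.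
near=> k.
have k0 : 0 < k.+1%:R^-1 :> R by rewrite invr_gt0.
have kd : k.+1%:R^-1 * (`|e| + 1) <= d.
  rewrite -ler_pdivlMr//; apply: ltW; near: k; apply: near_infty_natSinv_lt (PosNum (divr_gt0 d0 e1)).
have E : `|k.+1%:R^-1 *: e| = k.+1%:R^-1 * `|e| by rewrite normrZ ger0_norm// ltW.
have := hf (x + k.+1%:R^-1 *: e); rewrite [x + _]addrC addrK E => /(_ _) h.
rewrite normrM ger0_norm// -ler_pdivlMl//; apply: le_trans (h _) _.
  by apply: le_trans kd; rewrite ler_wpM2l ?(ltW k0)// lerDl.
by rewrite mulrCA.
Unshelve. all: by end_near. Qed.

End quasi_interpolation.

Section interp_sob0.
Context {R : realType}.
Local Notation lam := (@lam R).
Variables (n : nat) (p : 'I_n -> 'I_3 -> R * R) (h : 'I_n -> R) (s L : R) (Om : set (R * R)).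
Hypothesis (M : is_mesh Om p s h).
Hypothesis (L0 : 0 < L) (OmL : forall x, Om x -> `|x| <= L).
Local Notation O := (Om : set (plane R)).
Let oO := mesh_open M.

Lemma Lnr_dct (q C : R) (f : nat -> plane R -> R) : 0 < q -> 0 <= C ->
  (forall k, measurable_fun O (f k)) -> (forall k (x : plane R), O x -> `|f k x| <= C) ->
  {ae lam, forall x : plane R, O x -> f k x @[k --> \oo] --> (0 : R)} ->
  forall e : R, 0 < e -> \forall k \near \oo, (Lnr lam O q (f k) <= e%:E)%E.
Proof.
move=> q0 C0 mf fC f0 e e0.
have mo : measurable O := mO oO.
have [|||||_ _ cI] := @dominated_convergence _ _ _ lam O mo (fun k x => (`|f k x| `^ q)%:E) (fun=> 0%E) (fun=> (C `^ q)%:E).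
- by move=> k; exact: measurable_powR_norm.
- exact: measurable_cst.
- apply: filterS f0 => x fx Ox; apply/fine_cvgP; split; first exact: nearW.
  apply/cvgr0Pnorm_le => d d0; have dq : 0 < d `^ q^-1 by rewrite powR_gt0.
  have := fx Ox; move/cvgr0Pnorm_le => /(_ _ dq); apply: filterS => k hk.
  by rewrite ger0_norm ?powR_ge0// -[leRHS](powRVK (lt0r_neq0 q0) (ltW d0)); apply: powR_mono => //; exact: ltW.
- apply/integrableP; split; first exact: measurable_cst.
  rewrite (integral_cst lam mo `|(C `^ q)%:E|%E); apply: lte_mul_pinfty; [exact: abse_ge0|by rewrite abse_EFin|exact: (lam_Om_fin oO L0 OmL)].
- apply: aeW => x k Ox; rewrite abse_EFin lee_fin ger0_norm ?powR_ge0//.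
  by apply: powR_mono => //; [exact: ltW|exact: fC].
have E : (Ip lam O q (f k))%E @[k --> \oo] --> 0%E by rewrite integral0 in cI; exact: cI.
have eq0 : 0 < e `^ q by rewrite powR_gt0.
move/fine_cvgP: E => [fn /cvgr0Pnorm_le/(_ _ eq0)]; apply: filterS2 fn => k fk hk.
rewrite Lnr_le ?(ltW e0)// -(fineK fk) lee_fin; exact: le_trans (ler_norm _) hk.
Qed.

Lemma sume2 (F : 'I_2 -> \bar R) : (\sum_i F i = F 0%R + F 1%R)%E.
Proof.
rewrite !big_ord_recl big_ord0 adde0; congr (_ + F _)%E; exact: val_inj.
Qed.

Lemma pt_shift (x c y : R * R) (t : R) :
  c + (1 + t) *: (y - c) - x = (1 + t) *: (y - x) + t *: (x - c).
Proof. by case: x c y => ? ? [? ?] [? ?]; congr pair; rewrite /= /GRing.scale /=; ring. Qed.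

Lemma dotp_shift (g x c y : R * R) (t : R) :
  dotp g (c + t *: (y - c) - x) = dotp g (c - t *: c - x) + dotp (t *: g) y.
Proof. by rewrite /dotp /= /GRing.scale /=; ring. Qed.

Lemma harmonic0 (c : R) : c * k.+1%:R^-1 @[k --> \oo] --> (0 : R).
Proof.
have : c * k.+1%:R^-1 @[k --> \oo] --> c * 0 by apply: cvgMr; exact: cvg_harmonic.
by rewrite mulr0.
Qed.

Variables (o : R * R) (r : R).
Hypothesis (r0 : 0 < r) (hr : forall y, `|y - o| < r -> Om y).
Variables (w : R * R -> R).
Hypothesis w0 : bdry0 Om p w.
Let v := interp p w.

(** [vk k] is [v] contracted towards [o] by the factor [1 / th k = (k + 1) / (k + 2)]. This leaves a
    collar of width [r / (k + 2)] inside the domain, more than the [3 * de k] over which smoothing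
    is allowed to spread. The grid given by [cc] and [mm] covers the ball of radius [X]. *)
Let th (k : nat) : R := 1 + k.+1%:R^-1.
Let de (k : nat) : R := r / (4 * k.+2%:R).
Let X := L + r.
Let cc k := X / de k + 1.
Let mm k : nat := (Num.trunc (2 * X / de k + 3)).+1.
Let vk k x := v (o + th k *: (x - o)).
Let psi k := quasi (de k) (cc k) (mm k) (vk k).

Let de0 k : 0 < de k. Proof. by rewrite divr_gt0// mulr_gt0. Qed.

Let de_r k : de k <= r.
Proof. by rewrite ler_pdivrMr ?mulr_gt0// ler_peMr ?(ltW r0)// -natrM ler1n muln_gt0. Qed.

Let inr_X k x : `|x| <= X -> inr (de k) (cc k) (mm k) x.
Proof.
have d0 := de0 k.
have X0 : 0 <= 2 * X / de k + 3 by rewrite addr_ge0// divr_ge0 ?(ltW d0)// mulr_ge0// addr_ge0// ltW.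
have hm : 2 * X / de k + 3 <= (mm k)%:R by have /andP[_ /ltW] := truncn_itv X0.
have one (t : R) : `|t| <= X -> inr1 (de k) (cc k) (mm k) t.
  rewrite ler_norml => /andP[t1 t2].
  have u1 : - (X / de k) <= (de k)^-1 * t by rewrite [_^-1 * t]mulrC -mulNr ler_pM2r ?invr_gt0.
  have u2 : (de k)^-1 * t <= X / de k by rewrite [_^-1 * t]mulrC ler_pM2r ?invr_gt0.
  by move: u1 u2 hm; rewrite /inr1 /cc -[2 * X / _]mulrA; move: (X / de k) ((de k)^-1 * t) => *; split; lra.
by rewrite prod_normE ge_max => /andP[/one ? /one ?].
Qed.

Let th0 k : 0 < th k. Proof. by rewrite addr_gt0// invr_gt0. Qed.
Let thE k : th k = k.+2%:R / k.+1%:R.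
Proof. by rewrite /th -[k.+2%:R]natr1; field; rewrite gt_eqF. Qed.

Let psi_test k : test_function Om (psi k).
Proof.
have sub : esupp (psi k) `<=` Om.
  move=> x cx; have [y py yx] := closure_ex cx (de0 k).
  have [a [b [nv ny]]] := quasi_neq0 (de0 k) py.
  set nd := node _ _ a b in nv ny.
  have Oz : Om (o + th k *: (nd - o)).
    by apply: contrapT => nO; case/eqP: nv; rewrite /vk /v (interp_out M w0 nO).
  have d3 : `|x - nd| < 3 * de k.
    have := ler_normD (x - y) (y - nd); rewrite addrA subrK.
    move: yx ny; rewrite [`|y - x|]distrC [`|nd - y|]distrC; lra.
  pose x' := o + k.+2%:R *: (x - nd).
  have Ox' : Om x'.
    apply: hr; rewrite /x' addrC addKr normrZ ger0_norm//.
    apply: (@lt_trans _ _ (k.+2%:R * (3 * de k))); first by rewrite ltr_pM2l.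
    rewrite (_ : _ * _ = 3 / 4 * r); last by rewrite /de; field; rewrite gt_eqF.
    by move: r0; lra.
  rewrite (_ : x = x' + (k.+1%:R / k.+2%:R) *: ((o + th k *: (nd - o)) - x')); last first.
    rewrite /x' thE -[k.+2%:R]natr1; have : k.+1%:R != 0 :> R by [].
    have : k.+1%:R + 1 != 0 :> R by rewrite natr1.
    move: (k.+1%:R : R) => z z1 z2; case: x o nd {cx yx d3 x' Ox' Oz ny nv} => ? ? [? ?] [? ?].
    by congr pair; rewrite /= /GRing.scale /=; field; rewrite ?z1 ?z2.
  apply: (mesh_cvx M) => //; rewrite divr_ge0//= ler_pdivrMr// mul1r ler_nat.
  exact: leqnSn.
split => //; first exact: smooth_quasi.
apply: (subclosed_compact _ (@compact_cbox _ (-L, -L) (L, L))); first exact: closed_closure.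
move=> x /sub /OmL; rewrite prod_normE ge_max !ler_norml => /andP[h1 h2].
by split; rewrite /= in_itv.
Qed.

Let K := gsum p w.
Let K0 : 0 <= K. Proof. exact: ltW (gsum_gt0 p w). Qed.

Let vlip : lip K v. Proof. exact: (v_lip M w0). Qed.

Let vk_lip k : lip (2 * K) (vk k).
Proof.
move=> x y; apply: le_trans (vlip _ _) _.
rewrite (_ : _ - _ = th k *: (x - y)); last first.
  by rewrite opprD addrACA subrr add0r -scalerBr opprB addrA subrK.
rewrite normrZ (ger0_norm (ltW (th0 k))) [2 * K]mulrC -[X in _ <= X]mulrA ler_wpM2l// ler_wpM2r//.
by rewrite /th (_ : 2 = 1 + 1)// lerD2l invf_le1// ler1n.
Qed.

(** The functions [psi k] have gradients bounded uniformly in [k], and they converge uniformly to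
    [v]. At a point interior to a triangle the smoothing sees a single affine function for large [k]
    and reproduces it, so the gradients converge almost everywhere; dominated convergence gives the
    limit in L^q. *)
Lemma interp_sob0 q : 1 <= q -> sob0 Om q v (Dg p w).
Proof.
move=> q1; have q0 : 0 < q by lra.
split; first exact: (sob_interp M L0 OmL q1 w0).
have [B B0 hB] := @rho_bound R.
have psiv k (x : plane R) : O x -> `|v x - psi k x| <= (2 * K * (147 * B ^+ 2) * r + K * (2 * L)) * k.+1%:R^-1.
  move=> Ox; have xX : `|x : R * R| <= X by apply: le_trans (OmL Ox) _; rewrite lerDl ltW.
  have K2 : 0 <= 2 * K by rewrite mulr_ge0.
  have h1 := quasi_near (de0 k) K2 (vk_lip k) hB (inr_X k xX).
  have Oo : Om o by apply: hr; rewrite subrr normr0.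
  have h2 : `|v x - vk k x| <= K * (2 * L) * k.+1%:R^-1.
    apply: le_trans (vlip _ _) _; rewrite -mulrA ler_wpM2l//.
    rewrite (_ : x - _ = - (k.+1%:R^-1 *: ((x : R * R) - o))); last first.
      by rewrite /th scalerDl scale1r addrA [_ + (x - o)]addrC subrK opprD addrA subrr sub0r.
    rewrite normrN normrZ ger0_norm ?invr_ge0// mulrC ler_wpM2r ?invr_ge0//.
    by apply: le_trans (ler_normB _ _) _; have := OmL Ox; have := OmL Oo; lra.
  have h3 : de k <= r * k.+1%:R^-1.
    rewrite /de ler_wpM2l ?(ltW r0)// lef_pV2 ?posrE ?mulr_gt0// -natrM ler_nat.
    by rewrite (leq_trans (leqnSn _))// leq_pmull.
  have := ler_normD (v x - vk k x) (vk k x - psi k x); rewrite addrA subrK.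
  rewrite [`|vk k x - _|]distrC => h4; apply: le_trans h4 _.
  rewrite mulrDl addrC; apply: lerD => //; apply: le_trans h1 _.
  by rewrite -[X in _ <= X]mulrA ler_wpM2l// mulr_ge0// mulr_ge0// sqr_ge0.
have Dpsi k i (x : plane R) : O x -> `|partial i (psi k) x| <= 2 * K * (294 * B ^+ 2).
  move=> Ox; have xX : `|x : R * R| <= X by apply: le_trans (OmL Ox) _; rewrite lerDl ltW.
  have K2 : 0 <= 2 * K by rewrite mulr_ge0.
  have b1 : `|Defs.basis i : R * R| = 1.
    rewrite /Defs.basis prod_normE; case: ifP => _ /=; rewrite normr0 normr1.
      by apply/max_idPl.
    by apply/max_idPr.
  rewrite -[X in _ <= X]mulr1 -[X in _ <= _ * X]b1.
  rewrite /partial; apply: (@derive_lip_le _ (psi k) _ _ _ _ (de0 k)); first by apply: smooth_diff; exact: smooth_quasi.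
  have ql := quasi_lip (de0 k) B0 K2 (vk_lip k) hB (inr_X k xX).
  move=> z zx; apply: ql => //; apply: inr_X.
  rewrite -[z](subrK (x : R * R)); apply: le_trans (ler_normD _ _) _.
  by have := OmL Ox; have := de_r k; rewrite /X; lra.
have Dcvg i : {ae lam, forall x : plane R, O x -> Dg p w i x - partial i (psi k) x @[k --> \oo] --> (0 : R)}.
  have := ae_bary_neq0 M; have := ae_tri M; have := ae_Dg M w; apply: filterS3 => x hD [_ _ hO] hb Ox.
  have [j xj] := hO Ox; have [e e0 he] := tri_interior hb xj.
  rewrite (hD j xj); set g := igrad (p j) w.
  have c0 : 0 < 6 * r + 2 * L by rewrite addr_gt0// mulr_gt0.
  have lim0 := @harmonic0 (- co i g).
  apply: cvg_trans lim0; apply: near_eq_cvg; near=> k.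
  have Oo : Om o by apply: hr; rewrite subrr normr0.
  have ke : k.+1%:R^-1 * (6 * r + 2 * L) <= e.
    rewrite -ler_pdivlMr//; apply: ltW; near: k; apply: near_infty_natSinv_lt (PosNum (divr_gt0 e0 c0)).
  have kr : de k <= k.+1%:R^-1 * r.
    rewrite mulrC /de ler_wpM2l ?(ltW r0)// lef_pV2 ?posrE ?mulr_gt0// -natrM ler_nat.
    by rewrite (leq_trans (leqnSn _))// leq_pmull.
  have k1 : k.+1%:R^-1 <= 1 :> R by rewrite invf_le1// ler1n.
  have ki : 0 <= k.+1%:R^-1 :> R by [].
  (* Within [3 * de k] of [x] the function [vk k] is affine with constant term [al] and gradient
     [th k *: g]. *)
  pose al := v x + dotp g (o - th k *: o - x).
  have vkE y : `|y - x| <= 3 * de k -> vk k y = al + dotp (th k *: g) y.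
    move=> yx; have xy : tri (p j) (o + th k *: (y - o)).
      apply: he; rewrite (_ : _ - _ = th k *: (y - x) + k.+1%:R^-1 *: ((x : R * R) - o)); last first.
        by rewrite /th pt_shift.
      apply: le_trans (ler_normD _ _) _; rewrite !normrZ (ger0_norm (ltW (th0 k))) (ger0_norm ki).
      have xo : `|(x : R * R) - o| <= 2 * L.
        by apply: le_trans (ler_normB _ _) _; have := OmL Ox; have := OmL Oo; lra.
      apply: le_trans ke; rewrite mulrDr; apply: lerD; last by rewrite ler_wpM2l.
      apply: (@le_trans _ _ (2 * (3 * de k))); last by rewrite mulrCA; move: kr; move: (k.+1%:R^-1 : R) (de k) => a b ?; lra.
      apply: ler_pM => //; first exact: ltW (th0 k).
      by rewrite /th; move: k1; move: (k.+1%:R^-1 : R) => a ?; lra.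
    rewrite /vk -[v _](subrK (v x)) (interpB M w xy xj) /al -/g dotp_shift; ring.
  have psiE z : `|z - x| <= de k -> psi k z = al + dotp (th k *: g) z.
    move=> zx; rewrite /psi (@quasi_local _ _ _ _ (de0 k) _ (fun y => al + dotp (th k *: g) y)).
      apply: (quasi_affine (de0 k)); apply: inr_X; rewrite -[z](subrK (x : R * R)); apply: le_trans (ler_normD _ _) _.
      by have := OmL Ox; have := de_r k; rewrite /X; lra.
    move=> y yz; apply: vkE; have := ler_normD (y - z) (z - x); rewrite addrA subrK; lra.
  have -> : partial i (psi k) x = th k * co i g.
    have c1 := derive_seq (e := Defs.basis i) (smooth_diff x (smooth_quasi (de k) (cc k) (mm k) (vk k))).
    have c2 : n.+1%:R * (psi k (x + n.+1%:R^-1 *: Defs.basis i) - psi k x) @[n --> \oo] --> th k * co i g.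
      have dk0 := de0 k; apply: cvg_near_cst; near=> l.
      have lk : l.+1%:R^-1 <= de k by apply: ltW; near: l; exact: (near_infty_natSinv_lt (PosNum dk0)).
      rewrite !psiE; last 2 first.
      - by rewrite subrr normr0 ltW.
      - rewrite addrC addKr normrZ; apply: le_trans lk; rewrite ger0_norm//.
        have -> : `|Defs.basis i| = 1 :> R.
          by rewrite /Defs.basis; case: ifP => _; rewrite norm_pair /= normr0 normr1 ?(max_idPl ler01) ?(max_idPr ler01).
        by rewrite mulr1.
      rewrite -(co_basis i) [dotp g _]/dotp /dotp.
      have l0 : l.+1%:R != 0 :> R by [].
      by case: (x) (g) => ? ? [? ?]; rewrite /Defs.basis; case: ifP => _; rewrite /= /GRing.scale /=; field.
    exact: (cvg_unique _ c1 c2).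
  by rewrite /th; ring.
move=> e e0.
pose C := 2 * K * (147 * B ^+ 2) * r + K * (2 * L).
have C0 : 0 <= C by rewrite addr_ge0 ?mulr_ge0 ?sqr_ge0// ltW.
pose D := gsum p w + 2 * K * (294 * B ^+ 2).
have D0 : 0 <= D.
  apply: (addr_ge0 K0); apply: mulr_ge0; first by rewrite mulr_ge0.
  by apply: mulr_ge0; [exact: ler0n|exact: sqr_ge0].
have e4 : 0 < e / 4 by rewrite divr_gt0.
have mv : measurable_fun O v by apply: measurable_funTS; exact: lip_measurable vlip.
have A1 : \forall k \near \oo, (Lnr lam O q (fun x => (v x - psi k x)%R) <= (e / 4)%:E)%E.
  apply: (Lnr_dct q0 C0 _ _ _ e4).
  - by move=> k; apply: measurable_funB; [exact: mv|exact: measurable_test].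
  - move=> k x Ox; apply: le_trans (psiv k x Ox) _; rewrite ler_piMr// invf_le1// ler1n//.
  - apply: aeW => x Ox.
    apply/norm_cvg0P; apply: (@squeeze_cvgr _ _ _ _ (fun=> 0) (fun k => C * k.+1%:R^-1)).
    + by apply: nearW => k; rewrite normr_ge0 /=; exact: psiv.
    + exact: cvg_cst.
    + exact: harmonic0.
have A2 i : \forall k \near \oo, (Lnr lam O q (fun x => (Dg p w i x - partial i (psi k) x)%R) <= (e / 4)%:E)%E.
  apply: (Lnr_dct q0 D0 _ _ _ e4) => //.
  - move=> k; apply: measurable_funB; first by apply: measurable_funTS; exact: measurable_Dg.
    by apply: measurable_test; exact: test_partial.
  - move=> k x Ox; apply: le_trans (ler_normB _ _) _; apply: lerD; [exact: Dg_bound|exact: Dpsi].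
have [N _ a] := A1; have [N0 _ a0] := A2 0; have [N1 _ a1] := A2 1.
pose k := maxn N (maxn N0 N1).
have {}a := a k (leq_maxl _ _).
have {}a0 := a0 k (leq_trans (leq_maxl _ _) (leq_maxr _ _)).
have {}a1 := a1 k (leq_trans (leq_maxr _ _) (leq_maxr _ _)).
exists (psi k); first exact: psi_test.
rewrite /sn sume2.
apply: (@le_lt_trans _ _ ((e / 4)%:E + ((e / 4)%:E + (e / 4)%:E))%E).
  exact: (leeD a (leeD a0 a1)).
rewrite lte_fin; lra.
Unshelve. all: by end_near. Qed.

End interp_sob0.

(** * Nodal interpolation *)

Section nodal_interpolation.
Context {R : realType}.
Local Notation lam := (@lam R).
Variables (L : R) (Om : set (R * R)).
Hypothesis (oO : open Om) (L0 : 0 < L) (OmL : forall x, Om x -> `|x| <= L).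
Local Notation O := (Om : set (plane R)).

Lemma Lnr_bounded (q K : R) (u : plane R -> R) : 0 < q -> 0 <= K -> measurable_fun O u ->
  {ae lam, forall x : plane R, O x -> `|u x| <= K} ->
  (Lnr lam O q u <= (K * (fine (lam O) `^ q^-1))%:E)%E.
Proof.
move=> q0 K0 mu uK.
have lf : lam O \is a fin_num by rewrite ge0_fin_numE// (lam_Om_fin oO L0 OmL).
have l0 : 0 <= fine (lam O) by rewrite fine_ge0.
rewrite Lnr_le//; last by rewrite mulr_ge0// powR_ge0.
apply: le_trans (Ip_bounded (mO oO) mu (ltW q0) K0 uK) _.
by rewrite powRM ?powR_ge0// (powRVK (lt0r_neq0 q0) l0) -[X in (_ * X <= _)%E](fineK lf).
Qed.

Lemma igrad_dotp (p : 'I_3 -> R * R) (g : R * R) : area2 p != 0 -> igrad p (dotp g) = g.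
Proof.
move=> pn; have E x : ival p (dotp g) x = dotp g x.
  rewrite -[in RHS](sum_bary_vertex pn x) dotp_sumr.
  by apply: eq_bigr => i _; rewrite dotpZ.
have h x : dotp (igrad p (dotp g)) x = dotp g x.
  have d0 g' : dotp g' 0 = 0 :> R by rewrite /dotp /= !mulr0 addr0.
  by have := ivalB p (dotp g) x 0; rewrite !E d0 !subr0.
rewrite [LHS]surjective_pairing [RHS]surjective_pairing; congr pair.
  by have := h (1, 0); rewrite /dotp /= !mulr1 !mulr0 !addr0.
by have := h (0, 1); rewrite /dotp /= !mulr1 !mulr0 !add0r.
Qed.

Lemma test_mean_value phi (x y : R * R) : test_function Om phi ->
  exists t : R, 0 <= t <= 1 /\ phi y - phi x =
    dotp (partial 0 phi (x + t *: (y - x)), partial 1 phi (x + t *: (y - x))) (y - x).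
Proof.
move=> [sp _ _]; pose e := y - x.
have dl (t : R) := @is_derive_line _ phi x e t (fun z => smooth_diff z sp).
have cl : {within `[0, 1], continuous (fun r : R => phi (x + r *: e))}.
  apply: continuous_subspaceT => t; apply: differentiable_continuous.
  by apply/derivable1_diffP; case: (dl t).
have [t ht] := MVT_segment ler01 (fun t _ => dl t) cl.
rewrite scale1r scale0r addr0 subr0 mulr1 {1}/e [x + (y - x)]addrC subrK => ->.
exists t; split; first by move: ht; rewrite in_itv.
by rewrite deriveD2; [rewrite /dotp /=; ring|exact: smooth_diff].
Qed.

(** The constant does not depend on the mesh. For the gradient, subtracting the linear function of
    slope [grad phi x] leaves nodal differences of second order, because the gradient of [phi] is
    Lipschitz; [igrad_le_norm] then costs the factor [s / 2]. *)
Lemma nodal_test phi (q s : R) : Om !=set0 -> 1 <= q -> test_function Om phi ->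
  exists2 C : R, 0 <= C & forall n (p : 'I_n -> 'I_3 -> R * R) h, is_mesh Om p s h ->
  forall H, (forall j, h j <= H) ->
  (sn Om q (fun x => (interp p phi x - phi x)%R)
     (fun i x => (Dg p phi i x - partial i phi x)%R) <= (C * H)%:E)%E.
Proof.
move=> [x0 Ox0] q1 tp; have q0 : 0 < q by lra.
have [K K0 hK] := test_lip tp.
have [K1 K10 hK1] := lip_W1inf 0 tp; have [K2 K20 hK2] := lip_W1inf 1 tp.
pose V := fine (lam O) `^ q^-1.
have V0 : 0 <= V by exact: powR_ge0.
have [s0|s0] := leP s 0; first by exists 0 => // n p h M; have := mesh_s M; rewrite ltNge s0.
exists ((K + (K1 + K2) * s) * V).
  by rewrite mulr_ge0// addr_ge0 ?ltW// mulr_gt0// addr_gt0.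
move=> n p h M H hH.
have phi0 : bdry0 Om p phi.
  move=> j i nO; apply: esupp0 => /= es; apply: nO; case: tp => _ _; exact.
have H0 : 0 < H.
  have : closure Om x0 by exact: subset_closure.
  by rewrite (mesh_cover M) => -[j _ _]; apply: lt_le_trans (hH j); exact: (h_gt0 M).
have mphi : measurable_fun O phi by exact: measurable_test.
have mv : measurable_fun O (interp p phi).
  by apply: measurable_funTS; exact: (lip_measurable (v_lip M phi0)).
have A1 : (Lnr lam O q (fun x => (interp p phi x - phi x)%R) <= (K * H * V)%:E)%E.
  apply: Lnr_bounded => //; [by rewrite mulr_ge0// ltW|exact: measurable_funB|].
  apply: aeW => x Ox; have : closure Om x by exact: subset_closure.
  rewrite (mesh_cover M) => -[j _ xj]; rewrite (interpE M phi xj).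
  have hr (i : 'I_3) : phi x - K * H <= phi (p j i) <= phi x + K * H.
    rewrite -ler_distl; apply: le_trans (hK _ _) _; rewrite ler_wpM2l ?(ltW K0)//.
    apply: le_trans (hH j); apply: (tri_diam M _ xj); exact: (tri_vertex (mesh_nondeg M j)).
  rewrite ler_distl; exact: (ival_range (mesh_nondeg M j) hr xj).
have A2 i : (Lnr lam O q (fun x => (Dg p phi i x - partial i phi x)%R) <= ((K1 + K2) * s / 2 * H * V)%:E)%E.
  have c0 : 0 <= (K1 + K2) * s / 2 * H by rewrite mulr_ge0 ?(ltW H0)// divr_ge0// mulr_ge0 ?addr_ge0// ltW.
  apply: (Lnr_bounded q0 c0).
    apply: measurable_funB; first by apply: measurable_funTS; exact: measurable_Dg.
    by apply: measurable_test; exact: test_partial.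
  have := ae_tri M; have := ae_Dg M phi; apply: filterS2 => x hD [_ _ hO] Ox.
  have [j xj] := hO Ox; rewrite (hD j xj).
  pose g := (partial 0 phi x, partial 1 phi x).
  have -> : co i (igrad (p j) phi) - partial i phi x = co i (igrad (p j) (fun y => phi y - dotp g y)).
    rewrite igradB igrad_dotp ?(mesh_nondeg M j)//.
    have [->|->] : i = 0 \/ i = 1.
      by case: i => -[|[|//]] ?; [left|right]; apply: val_inj.
    - by rewrite /co /= /g.
    - by rewrite /co /= /g.
  apply: le_trans (co_le _ _) _.
  have pj i' : tri (p j) (p j i') by exact: (tri_vertex (mesh_nondeg M j)).
  have hj0 : 0 <= (K1 + K2) * h j by rewrite mulr_ge0 ?addr_ge0// ltW// (h_gt0 M).
  apply: le_trans (igrad_le_norm (mesh_nondeg M j) (mesh_s M) (mesh_shape M j) (K := (K1 + K2) * h j) _ hj0) _.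
    move=> i1 i2; have [t [t01 e]] := test_mean_value (p j i2) (p j i1) tp.
    set z := p j i2 + _ in e.
    have zj : tri (p j) z by apply: tri_segment.
    have zx : `|z - x| <= h j by exact: (tri_diam M zj xj).
    rewrite (_ : _ - _ = dotp ((partial 0 phi z, partial 1 phi z) - g) (p j i1 - p j i2)); last first.
      rewrite (_ : forall a b c d : R, a - b - (c - d) = a - c - (b - d)); last by move=> *; ring.
      by rewrite e /dotp /=; ring.
    apply: le_trans (ler_norm _) _; apply: le_trans (dotp_le _ _) _; rewrite ler_wpM2r//.
    rewrite /n1 /= mulrDl; apply: lerD.
      by apply: le_trans (hK1 _ _) _; rewrite ler_wpM2l// ltW.
    by apply: le_trans (hK2 _ _) _; rewrite ler_wpM2l// ltW.
  rewrite (_ : (K1 + K2) * h j * s / 2 = (K1 + K2) * s / 2 * h j); last by ring.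
  by rewrite ler_wpM2l// divr_ge0// mulr_ge0 ?addr_ge0// ltW.
rewrite /sn sume2.
apply: le_trans (leeD A1 (leeD (A2 0) (A2 1))) _.
by rewrite lee_fin; lra.
Qed.

End nodal_interpolation.

(** * Continuous piecewise affine functions and their nodal values *)

Section V1_functions.
Context {R : realType} (Om : set (R * R)).
Implicit Types (v w : R * R -> R).

(** The two functions have the same set of weak derivatives, so [xget] selects the same element: the
    equality holds everywhere, not only almost everywhere. *)
Lemma weak_partial_congr i v w : (forall x, Om x -> v x = w x) ->
  weak_partial Om i v = weak_partial Om i w.
Proof.
suff h v' w' g : (forall x, Om x -> v' x = w' x) -> weak_partial_of Om i v' g -> weak_partial_of Om i w' g.
  move=> vw; rewrite /weak_partial; congr xget; apply/seteqP; split => g /=; apply: h => //.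
  by move=> x Ox; rewrite vw.
move=> vw [[mv iv] lg e].
have E K : K `<=` Om -> {in K, (EFin \o v') =1 (EFin \o w')}.
  by move=> KO x; rewrite inE => /KO Ox; rewrite /= vw.
split => //.
  split; first by apply: eq_measurable_fun mv => x; rewrite inE => Ox; rewrite vw.
  move=> K cK KO; apply: eq_integrable (iv K cK KO) => //; last exact: E.
  by apply: closed_measurable2; apply: compact_closed.
move=> phi tp; rewrite -e//; apply: eq_Rintegral => x; rewrite inE => Ox.
by rewrite vw.
Qed.

Variables (n : nat) (p : 'I_n -> 'I_3 -> R * R) (h : 'I_n -> R) (s : R).
Hypothesis (M : is_mesh Om p s h).

Lemma affine_interp v :
  (forall j, exists a b c : R, forall x, tri (p j) x -> v x = a + b * x.1 + c * x.2) ->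
  forall x, closure Om x -> v x = interp p v x.
Proof.
move=> hv x; rewrite (mesh_cover M) => -[j _ xj]; rewrite (interpE M v xj).
have [a [b [c e]]] := hv j; have pn := mesh_nondeg M j.
rewrite (e _ xj) /ival; transitivity (\sum_i bary (p j) i x * (a + dotp (b, c) (p j i))).
  transitivity (a * 1 + dotp (b, c) x); first by rewrite /dotp /=; ring.
  rewrite -{1}(sum_bary pn x) -[X in _ + dotp _ X](sum_bary_vertex pn x) dotp_sumr mulr_sumr -big_split /=.
  by apply: eq_bigr => i _; rewrite dotpZ; ring.
apply: eq_bigr => i _; rewrite e; first by rewrite /dotp /= addrA.
exact: tri_vertex.
Qed.

Lemma interp_affine w j : exists a b c : R, forall x, tri (p j) x -> interp p w x = a + b * x.1 + c * x.2.
Proof.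
pose g := igrad (p j) w; exists (ival (p j) w 0), g.1, g.2 => x xj.
rewrite (interpE M w xj); have := ivalB (p j) w x 0; rewrite subr0 -/g /dotp => e.
by rewrite -addrA -e addrC subrK.
Qed.

Lemma interp_congr v w : (forall j i, v (p j i) = w (p j i)) -> interp p v = interp p w.
Proof.
move=> vw; apply/funext => x; rewrite /interp; case: pickP => [j _|//].
by apply: eq_bigr => i _; rewrite vw.
Qed.

Lemma igrad_congr v w j : (forall i, v (p j i) = w (p j i)) -> igrad (p j) v = igrad (p j) w.
Proof. by move=> vw; apply: eq_bigr => i _; rewrite vw. Qed.

Lemma interp_lin (k : R) v w : interp p (fun x => k * v x + w x) = (fun x => k * interp p v x + interp p w x).
Proof.
apply/funext => x; rewrite /interp; case: pickP => [j _|_]; last by rewrite mulr0 addr0.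
rewrite /ival mulr_sumr -big_split /=; apply: eq_bigr => i _; ring.
Qed.

Lemma Dg_lin (k : R) v w i x : Dg p (fun y => k * v y + w y) i x = k * Dg p v i x + Dg p w i x.
Proof.
rewrite /Dg mulr_sumr -big_split /=; apply: eq_bigr => j _; case: ifP => _; last by rewrite mulr0 addr0.
by rewrite igradD igradZ /co; case: ifP.
Qed.

(** The interpolant is Lipschitz with constant 0 and vanishes outside the domain. *)
Lemma igrad0_eq0 w : bdry0 Om p w -> (exists x, ~ Om x) -> (forall j, igrad (p j) w = 0) ->
  forall j i, w (p j i) = 0.
Proof.
move=> w0 [y ny] g0 j i; rewrite -(interp_vertex M w).
have n0 k : n1 (igrad (p k) w) <= 0 by rewrite g0 n1_0.
have := interp_lip M (x := y) (y := p j i) (or_introl w0) n0 (lexx 0).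
by rewrite mul0r (interp_out M w0 ny) subr0 normr_le0 => /eqP.
Qed.

End V1_functions.

(** * Discrete problems *)

Section galerkin.
Context {R : realType} (Om : set (R * R)) (n : nat) (p : 'I_n -> 'I_3 -> R * R).
Implicit Types (u v w : R * R -> R).
Let bdry0 := bdry0 Om p.
Definition veq v w := forall j i, v (p j i) = w (p j i).

(** Linear forms on the discrete space, which is the quotient by [veq] of the functions satisfying
    [bdry0]. *)
Definition nodal_linear (G : (R * R -> R) -> R) :=
  (forall v w, veq v w -> G v = G w) /\
  forall k v w, bdry0 v -> bdry0 w -> G (fun x => k * v x + w x) = k * G v + G w.

Lemma bdry0_lin k v w : bdry0 v -> bdry0 w -> bdry0 (fun x => k * v x + w x).
Proof. by move=> v0 w0 j i nO; rewrite v0// w0// mulr0 addr0. Qed.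

Lemma bdry0_0 : bdry0 (fun=> 0). Proof. by []. Qed.

Lemma nodal_linear0 G : nodal_linear G -> G (fun=> 0) = 0.
Proof.
move=> [gc gl]; have := gl (-1) _ _ bdry0_0 bdry0_0.
by rewrite mulr0 addr0 mulN1r addNr.
Qed.

Lemma bdry0_sum m (c : 'I_m -> R) (H : 'I_m -> R * R -> R) : (forall k, bdry0 (H k)) ->
  bdry0 (fun x => \sum_k c k * H k x).
Proof. by move=> H0 j i nO; rewrite big1// => k _; rewrite H0// mulr0. Qed.

Lemma nodal_linear_sum G m (c : 'I_m -> R) (H : 'I_m -> R * R -> R) : nodal_linear G ->
  (forall k, bdry0 (H k)) -> G (fun x => \sum_k c k * H k x) = \sum_k c k * G (H k).
Proof.
move=> lG; have [gc gl] := lG; elim: m c H => [|m IH] c H H0.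
  rewrite big_ord0 -[RHS](nodal_linear0 lG); congr G.
  by apply/funext => x; rewrite big_ord0.
rewrite big_ord_recl -(IH (fun k => c (lift ord0 k)) (fun k => H (lift ord0 k))); last first.
  by move=> k; exact: H0.
rewrite -gl; [|exact: H0|by apply: bdry0_sum => k; exact: H0].
by congr G; apply/funext => x; rewrite big_ord_recl.
Qed.

Variables (B : (R * R -> R) -> (R * R -> R) -> R) (F : (R * R -> R) -> R).
Hypothesis Bl : forall w, bdry0 w -> nodal_linear (B ^~ w).
Hypothesis Br : forall w, bdry0 w -> nodal_linear (B w).
Hypothesis Fl : nodal_linear F.
Hypothesis Bpos : forall w, bdry0 w -> B w w = 0 -> veq w (fun=> 0).

Lemma galerkin_ex : exists2 w, bdry0 w & forall v, bdry0 v -> B w v = F v.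
Proof.
(* The interior nodes without repetition. As only nodal values count, the indicator of a node serves
   as its basis function. *)
pose vs := undup [seq p ji.1 ji.2 | ji <- enum {: 'I_n * 'I_3} & `[< Om (p ji.1 ji.2) >]].
pose m := size vs; pose e (k : 'I_m) := nth 0 vs k.
pose hat (k : 'I_m) (x : R * R) : R := (x == e k)%:R.
have eO k : Om (e k).
  have : e k \in vs by rewrite mem_nth.
  by rewrite mem_undup => /mapP[ji]; rewrite mem_filter => /andP[/asboolP h _] ->.
have hat0 k : bdry0 (hat k).
  move=> j i nO; rewrite /hat; case: eqP => // E; exfalso; apply: nO; rewrite E; exact: eO.
pose W (c : 'rV[R]_m) (x : R * R) := \sum_k c 0 k * hat k x.
have W0 c : bdry0 (W c) by exact: bdry0_sum.
have We c k : W c (e k) = c 0 k.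
  rewrite /W (bigD1 k)//= /hat eqxx mulr1 big1 ?addr0// => l lk.
  by rewrite nth_uniq ?undup_uniq// eq_sym (inj_eq val_inj) (negbTE lk) mulr0.
have vsP j i : Om (p j i) -> exists k, p j i = e k.
  move=> Oji; have ji : p j i \in vs.
    rewrite mem_undup; apply/mapP; exists (j, i) => //.
    by rewrite mem_filter mem_enum andbT; apply/asboolP.
  have lt : (index (p j i) vs < m)%N by rewrite index_mem.
  by exists (Ordinal lt); rewrite /e nth_index.
have WE v : bdry0 v -> veq v (W (\row_k v (e k))).
  move=> v0 j i; have [/vsP[k ->]|nO] := pselect (Om (p j i)); first by rewrite We mxE.
  by rewrite v0// W0.
pose A : 'M[R]_m := \matrix_(k, l) B (hat k) (hat l).
have AE c l : (c *m A) 0 l = B (W c) (hat l).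
  rewrite mxE (nodal_linear_sum _ (Bl (hat0 l)) hat0).
  by apply: eq_bigr => k _; rewrite mxE.
(* A row vector killed by the matrix gives a function [w] with [B w w = 0], and definiteness makes
   it 0. *)
have uA : A \in unitmx.
  rewrite -row_free_unit; apply: inj_row_free => c cA.
  have h : veq (W c) (fun=> 0).
    apply: (Bpos (W0 c)).
    rewrite (nodal_linear_sum _ (Br (W0 c)) hat0) big1// => l _.
    by rewrite -AE cA mxE mulr0.
  apply/rowP => k; rewrite mxE -We.
  have : e k \in vs by rewrite mem_nth.
  by rewrite mem_undup => /mapP[[j i] _ ->]; exact: h.
pose c := (\row_l F (hat l)) *m invmx A.
exists (W c); first exact: W0.
move=> v v0; have [bc _] := Br (W0 c); have [fc _] := Fl.
rewrite (bc _ _ (WE v v0)) (fc _ _ (WE v v0)).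
rewrite (nodal_linear_sum _ (Br (W0 c)) hat0) (nodal_linear_sum _ Fl hat0).
by apply: eq_bigr => l _; rewrite -AE /c mulmxKV// [in RHS]mxE [in LHS]mxE mxE.
Qed.

End galerkin.

(** * The bilinear form *)

Section bilinear_form.
Context {R : realType}.
Local Notation lam := (@lam R).
Variables (Om : set (R * R)) (L : R).
Hypothesis (oO : open Om) (L0 : 0 < L) (OmL : forall x, Om x -> `|x| <= L).
Local Notation O := (Om : set (plane R)).
Implicit Types (u v : plane R -> R) (G H : 'I_2 -> plane R -> R) (q p : R).
Local Notation rint u := (\int[lam]_(x in O) u x).
Local Notation L1 u := (lam.-integrable O (EFin \o (u : plane R -> R))).
Let mo := mO oO.

Lemma L1_measurable u : L1 u -> measurable_fun O u.
Proof. by move=> /integrableP[mu _]; exact/measurable_EFinP. Qed.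

Lemma rint_ge0_ae u : L1 u -> {ae lam, forall x : plane R, O x -> 0 <= u x} -> 0 <= rint u.
Proof.
move=> iu u0; have mu := L1_measurable iu.
rewrite (_ : rint u = rint (fun x => `|u x|)); first by apply: Rintegral_ge0 => x _.
rewrite /Rintegral; congr fine.
apply: (@ae_eq_integral _ _ _ lam O (EFin \o (fun x => `|u x|)) (EFin \o u) mo).
- exact/measurable_EFinP.
- by apply/measurable_EFinP; exact: measurableT_comp.
- by apply: filterS u0 => x ux Ox; rewrite /= ger0_norm// ux.
Qed.

Lemma L1_lin (c : R) u v : L1 u -> L1 v -> L1 (fun x => c * u x + v x).
Proof. by move=> iu iv; exact: (integrableD mo (integrableZl mo c iu) iv). Qed.

Lemma rint_lin (c : R) u v : L1 u -> L1 v -> rint (fun x => c * u x + v x) = c * rint u + rint v.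
Proof.
move=> iu iv; rewrite -(RintZ oO c iu).
by apply: (RintegralD mo (f1 := fun x => c * u x)) => //; exact: (integrableZl mo c iu).
Qed.

Lemma rint_le_ae u v : L1 u -> L1 v -> {ae lam, forall x : plane R, O x -> u x <= v x} -> rint u <= rint v.
Proof.
move=> iu iv uv; have := rint_lin (-1) iu iv; rewrite mulN1r addrC => e.
rewrite -subr_ge0 -e; apply: rint_ge0_ae; first exact: L1_lin.
by apply: filterS uv => x uv Ox; rewrite mulN1r addrC subr_ge0 uv.
Qed.

Lemma L1_0 : L1 (fun=> 0).
Proof. exact: (integrable0 lam O). Qed.

Lemma L1_sum n (F : 'I_n -> plane R -> R) : (forall j, L1 (F j)) -> L1 (fun x => \sum_j F j x).
Proof.
elim: n F => [|n IH] F iF.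
  rewrite (_ : (fun x => _) = (fun=> 0)); first exact: L1_0.
  by apply/funext => x; rewrite big_ord0.
rewrite (_ : (fun x => _) = (fun x => 1 * F ord0 x + \sum_j F (lift ord0 j) x)).
  by apply: L1_lin => //; exact: IH.
by apply/funext => x; rewrite big_ord_recl mul1r.
Qed.

Lemma rint_sum n (F : 'I_n -> plane R -> R) : (forall j, L1 (F j)) ->
  rint (fun x => \sum_j F j x) = \sum_j rint (F j).
Proof.
elim: n F => [|n IH] F iF.
  rewrite (_ : (fun x => _) = (fun=> 0)); first by rewrite big_ord0 Rintegral_cst// mul0r.
  by apply/funext => x; rewrite big_ord0.
rewrite (_ : (fun x => _) = (fun x => 1 * F ord0 x + \sum_j F (lift ord0 j) x)).
  by rewrite rint_lin// ?big_ord_recl ?mul1r ?IH//; exact: L1_sum.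
by apply/funext => x; rewrite big_ord_recl mul1r.
Qed.

Lemma eq_rint_ae u v : measurable_fun O u -> measurable_fun O v ->
  {ae lam, forall x : plane R, O x -> u x = v x} -> rint u = rint v.
Proof.
move=> mu mv uv; rewrite /Rintegral; congr fine.
apply: (@ae_eq_integral _ _ _ lam O (EFin \o v) (EFin \o u) mo).
- exact/measurable_EFinP.
- exact/measurable_EFinP.
- by apply: filterS uv => x uv Ox; rewrite /= uv.
Qed.

Definition rn q u : R := fine (Lnr lam O q u).

Lemma rnE q u : 0 < q -> inLp Om q u -> Lnr lam O q u = (rn q u)%:E.
Proof. by move=> q0 fu; rewrite /rn fineK//; exact: Lnr_fin_num. Qed.

Lemma rn_ge0 q u : 0 <= rn q u.
Proof. by rewrite /rn fine_ge0// Lnr_ge0. Qed.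

Lemma rn_lin q (c : R) u v : 1 <= q -> inLp Om q u -> inLp Om q v ->
  rn q (fun x => c * u x + v x) <= `|c| * rn q u + rn q v.
Proof.
move=> q1 fu fv; have q0 : 0 < q by lra.
have fcu := inLpZ oO c q0 fu; have [mu _] := fu; have [mv _] := fv; have [mcu _] := fcu.
have fs := inLpD oO q1 fcu fv.
rewrite -lee_fin EFinD EFinM -!rnE//.
by apply: le_trans (LnrD lam mo mcu mv q1) _; rewrite (LnrZ lam c mo mu q0).
Qed.

Definition Gin q G := forall i, inLp Om q (G i).
Definition gn q G : R := \sum_i rn q (G i).

Lemma gn_ge0 q G : 0 <= gn q G.
Proof. by apply: sumr_ge0 => i _; exact: rn_ge0. Qed.

Lemma Gin_lin q (c : R) G H : 1 <= q -> Gin q G -> Gin q H -> Gin q (fun i x => c * G i x + H i x).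
Proof. by move=> q1 fG fH i; apply: (inLpD oO q1 (inLpZ oO c _ (fG i)) (fH i)); lra. Qed.

Lemma gn_lin q (c : R) G H : 1 <= q -> Gin q G -> Gin q H ->
  gn q (fun i x => c * G i x + H i x) <= `|c| * gn q G + gn q H.
Proof.
by move=> q1 fG fH; rewrite /gn mulr_sumr -big_split /=; apply: ler_sum => i _; exact: rn_lin.
Qed.

Definition pair G H : R := rint (fun x => \sum_i G i x * H i x).

Lemma pair_L1 p q G H : 0 < p -> 0 < q -> p^-1 + q^-1 = 1 -> Gin p G -> Gin q H ->
  L1 (fun x => \sum_i G i x * H i x) /\ `|pair G H| <= gn p G * gn q H.
Proof.
move=> p0 q0 pq fG fH.
have h i := holder_Rint oO p0 q0 pq (fG i) (fH i).
have iGH i : L1 (fun x => G i x * H i x) by exact: (h i).1.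
split; first exact: L1_sum.
rewrite /pair rint_sum//; apply: le_trans (ler_norm_sum _ _ _) _.
rewrite /gn mulr_suml; apply: ler_sum => i _.
apply: (@le_trans _ _ (rn p (G i) * rn q (H i))).
  by rewrite -lee_fin EFinM -!rnE//; exact: (h i).2.
by rewrite ler_wpM2l ?rn_ge0// (bigD1 i)//= lerDl sumr_ge0// => k _; exact: rn_ge0.
Qed.

Lemma pair_linr p q (c : R) G H K : 0 < p -> 1 <= q -> p^-1 + q^-1 = 1 -> Gin p G -> Gin q H -> Gin q K ->
  pair G (fun i x => c * H i x + K i x) = c * pair G H + pair G K.
Proof.
move=> p0 q1 pq fG fH fK; have q0 : 0 < q by lra.
rewrite /pair -rint_lin; [|exact: (pair_L1 p0 q0 pq fG fH).1|exact: (pair_L1 p0 q0 pq fG fK).1].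
apply: eq_Rintegral => x _; rewrite mulr_sumr -big_split /=; apply: eq_bigr => i _; ring.
Qed.

Lemma pairC G H : pair G H = pair H G.
Proof. by apply: eq_Rintegral => x _; apply: eq_bigr => i _; rewrite mulrC. Qed.

Lemma pair_linl p q (c : R) G H K : 1 <= p -> 0 < q -> p^-1 + q^-1 = 1 -> Gin p G -> Gin p H -> Gin q K ->
  pair (fun i x => c * G i x + H i x) K = c * pair G K + pair H K.
Proof.
by move=> p1 q0 pq fG fH fK; rewrite ![pair _ K]pairC (pair_linr (p := q) (q := p))// addrC.
Qed.

Lemma pair_sqr G : Gin 2 G -> pair G G = \sum_i rn 2 (G i) ^+ 2.
Proof.
move=> fG; have h2 : (2 : R)^-1 + 2^-1 = 1 by lra.
have t0 : 0 < 2 :> R by [].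
have h i := holder_Rint oO t0 t0 h2 (fG i) (fG i).
rewrite /pair rint_sum; last by move=> i; exact: (h i).1.
apply: eq_bigr => i _; have := RintIp2 (fG i).
have [mG fi] := fG i.
have -> : rint (fun x => G i x ^+ 2) = rint (fun x => G i x * G i x) by [].
move=> e; rewrite /rn LnrE// e poweR_EFin /= -powR_mulrn ?powR_ge0// -powRrM mulVf// powRr1//.
by apply: Rintegral_ge0 => x _; rewrite -expr2 sqr_ge0.
Qed.

Lemma gn_sqr_le G : Gin 2 G -> gn 2 G ^+ 2 <= 2 * pair G G.
Proof.
move=> fG; rewrite (pair_sqr fG) /gn !big_ord_recl !big_ord0 !addr0.
by move: (rn _ _) (rn _ _) => a b; have := sqr_ge0 (a - b); rewrite !expr2; lra.
Qed.

Section coefficients.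
Variables (A : R * R -> 'M[R]_2) (c Lm : R).
Hypothesis mA : forall i k, measurable_fun O (fun x : plane R => A x i k).
Hypothesis Lm0 : 0 <= Lm.
Hypothesis AL : {ae lam, forall x : plane R, O x -> forall i k, `|A x i k| <= Lm}.
Hypothesis Ac : {ae lam, forall x : plane R, O x -> forall a : 'I_2 -> R,
  c * \sum_i a i ^+ 2 <= \sum_i (\sum_k A x i k * a k) * a i}.
Hypothesis c0 : 0 < c.

Definition flux G i (x : plane R) : R := \sum_k A x i k * G k x.

Lemma inLp_coef q i k u : 0 < q -> inLp Om q u ->
  inLp Om q (fun x => A x i k * u x) /\ rn q (fun x => A x i k * u x) <= Lm * rn q u.
Proof.
move=> q0 fu; have [mu uf] := fu; have fL := inLpZ oO Lm q0 fu; have [mLu LF] := fL.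
have mAu : measurable_fun O (fun x => A x i k * u x) by exact: measurable_funM.
have ae : {ae lam, forall x : plane R, O x -> `|A x i k * u x| <= `|Lm * u x|}.
  by apply: filterS AL => x h Ox; rewrite !normrM ler_wpM2r// [leRHS]ger0_norm// h.
have fA : inLp Om q (fun x => A x i k * u x).
  split; first exact: mAu.
  by apply: le_lt_trans LF; exact: (le_Ip mo mAu mLu (ltW q0) ae).
split => //; rewrite -lee_fin EFinM -!rnE//.
have := le_Lnr mo mAu mLu q0 ae; rewrite (LnrZ lam Lm mo mu q0) ger0_norm//.
Qed.

Lemma flux_Gin q G : 1 <= q -> Gin q G -> Gin q (flux G) /\ gn q (flux G) <= 2 * Lm * gn q G.
Proof.
move=> q1 fG; have q0 : 0 < q by lra.
have E i : flux G i = (fun x => 1 * (A x i 0 * G 0 x) + A x i 1 * G 1 x).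
  apply/funext => x; rewrite /flux mul1r !big_ord_recl big_ord0 addr0.
  by congr (_ + A x i _ * G _ x); apply: val_inj.
have h i k := inLp_coef i k q0 (fG k).
split; first by move=> i; rewrite E; exact: (inLpD oO q1 (inLpZ oO 1 q0 (h i 0).1) (h i 1).1).
have b i : rn q (flux G i) <= Lm * gn q G.
  rewrite E; apply: le_trans (rn_lin 1 q1 (h i 0).1 (h i 1).1) _.
  rewrite normr1 mul1r; apply: le_trans (lerD (h i 0).2 (h i 1).2) _.
  rewrite /gn -mulrDr !big_ord_recl big_ord0 addr0 (_ : lift ord0 ord0 = 1)//; exact: val_inj.
rewrite {1}/gn !big_ord_recl big_ord0 addr0; apply: le_trans (lerD (b _) (b _)) _; lra.
Qed.

Lemma flux_lin (k : R) G H i x : flux (fun i x => k * G i x + H i x) i x = k * flux G i x + flux H i x.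
Proof. rewrite /flux mulr_sumr -big_split /=; apply: eq_bigr => l _; ring. Qed.

Definition bf G H : R := pair (flux G) H.

Lemma bf_le p q G H : 1 <= p -> 0 < q -> p^-1 + q^-1 = 1 -> Gin p G -> Gin q H ->
  `|bf G H| <= 2 * Lm * gn p G * gn q H.
Proof.
move=> p1 q0 pq fG fH; have [ff fn] := flux_Gin p1 fG.
apply: le_trans (pair_L1 _ q0 pq ff fH).2 _; first by lra.
by rewrite ler_wpM2r// gn_ge0.
Qed.

Lemma bf_linl p q k G H K : 1 <= p -> 0 < q -> p^-1 + q^-1 = 1 -> Gin p G -> Gin p H -> Gin q K ->
  bf (fun i x => k * G i x + H i x) K = k * bf G K + bf H K.
Proof.
move=> p1 q0 pq fG fH fK; rewrite /bf -(pair_linl _ p1 q0 pq (flux_Gin p1 fG).1 (flux_Gin p1 fH).1 fK).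
by congr pair; apply/funext => i; apply/funext => x; exact: flux_lin.
Qed.

Lemma bf_linr p q k G H K : 1 <= p -> 1 <= q -> p^-1 + q^-1 = 1 -> Gin p G -> Gin q H -> Gin q K ->
  bf G (fun i x => k * H i x + K i x) = k * bf G H + bf G K.
Proof.
move=> p1 q1 pq fG fH fK; apply: (pair_linr _ _ q1 pq (flux_Gin p1 fG).1 fH fK); lra.
Qed.

Lemma bf_coercive G : Gin 2 G -> c * gn 2 G ^+ 2 <= 2 * bf G G.
Proof.
move=> fG; have h2 : (2 : R)^-1 + 2^-1 = 1 by lra.
have t1 : 1 <= 2 :> R by lra.
have t0 : 0 < 2 :> R by [].
have [ff _] := flux_Gin t1 fG.
have i1 := (pair_L1 t0 t0 h2 fG fG).1; have i2 := (pair_L1 t0 t0 h2 ff fG).1.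
have : c * pair G G <= bf G G.
  rewrite /pair -(RintZ oO c i1); apply: rint_le_ae => //; first exact: (integrableZl mo c i1).
  apply: filterS Ac => x h Ox; have := h Ox (G ^~ x).
  by under eq_bigr do rewrite expr2.
have := gn_sqr_le fG; rewrite -(ler_pM2l c0) => h h'; apply: le_trans h _; lra.
Qed.

End coefficients.
End bilinear_form.

(** * Discrete stability *)

Lemma powR_absorb (R : realType) (a b E q : R) : 0 <= a -> 1 <= b -> 0 <= E -> 1 <= q ->
  a `^ q * (b * E) <= (a * b * E `^ q^-1) `^ q.
Proof.
move=> a0 b1 E0 q1; have b0 : 0 <= b by lra.
have q0 : 0 < q by lra.
rewrite powRM ?mulr_ge0 ?powR_ge0// powRM// (powRVK (lt0r_neq0 q0) E0) mulrA ler_wpM2r// ler_wpM2l ?powR_ge0//.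
by rewrite -{1}[b]powRr1//; apply: ler_powR.
Qed.

Section discrete_problem.
Context {R : realType}.
Local Notation lam := (@lam R).
Variables (Om : set (R * R)) (L : R) (n : nat) (p : 'I_n -> 'I_3 -> R * R) (s : R) (h : 'I_n -> R).
Hypothesis M : is_mesh Om p s h.
Hypothesis (L0 : 0 < L) (OmL : forall x, Om x -> `|x| <= L).
Local Notation O := (Om : set (plane R)).
Local Notation rint u := (\int[lam]_(x in O) u x).
Local Notation L1 u := (lam.-integrable O (EFin \o (u : plane R -> R))).
Implicit Types (w phi : R * R -> R).
Let oO := mesh_open M.
Let mo := mO oO.
Let pn := mesh_nondeg M.

Lemma L1_bounded (B : R) (u : plane R -> R) : measurable_fun O u -> 0 <= B ->
  {ae lam, forall x : plane R, O x -> `|u x| <= B} -> L1 u.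
Proof.
move=> mu B0 uB; apply: (inLp_integrable oO L0 OmL (lexx 1)).
exact: (inLp_bounded oO L0 OmL ltr01 mu B0 uB).
Qed.

Definition ch j (x : plane R) : R := if `[< tri (p j) x >] then 1 else 0.

Lemma measurable_ch j : measurable_fun setT (ch j).
Proof.
rewrite (_ : ch j = \1_(tri (p j) : set (plane R))).
  by apply: measurable_indic; exact: measurable_tri.
apply/funext => x; rewrite indicE /ch; case: asboolP => hx.
  by rewrite (mem_set (hx : (tri (p j) : set (plane R)) x)).
by rewrite (memNset (hx : ~ (tri (p j) : set (plane R)) x)).
Qed.

Lemma ch01 j x : 0 <= ch j x <= 1.
Proof. by rewrite /ch; case: ifP; rewrite ?lexx ?ler01. Qed.

Lemma L1_ch j : L1 (ch j).
Proof.
apply: (@L1_bounded 1) => //; first by apply: measurable_funTS; exact: measurable_ch.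
by apply: aeW => x _; have /andP[h1 h2] := ch01 j x; rewrite ger0_norm.
Qed.

Lemma rint_ch j : rint (ch j) = tau p j.
Proof.
rewrite /Rintegral /tau; congr fine.
have mT := measurable_tri p j.
have := integral_indic lam measurableT mT; rewrite setIT => <-; rewrite integral_mkcond.
apply: (@ae_eq_integral _ _ _ lam setT (fun x => (\1_(tri (p j) : set (plane R)) x)%:E)
   ((fun x => (ch j x)%:E) \_ O) measurableT).
- apply/(measurable_restrictT _ mo); apply/measurable_EFinP; apply: measurable_funTS; exact: measurable_ch.
- by apply/measurable_EFinP; exact: measurable_indic.
have := ae_tri M; apply: filterS => x [hO _ _] _.
rewrite patchE indicE /ch; case: asboolP => hx.
  by rewrite (mem_set (hO j hx : O x)) (mem_set (hx : (tri (p j) : set (plane R)) x)).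
by rewrite (memNset (hx : ~ (tri (p j) : set (plane R)) x)); case: ifP.
Qed.

Lemma Gin_Dg q w : 1 <= q -> bdry0 Om p w -> Gin Om q (Dg p w).
Proof. by move=> q1 w0 i; exact: ((sob_interp M L0 OmL q1 w0).2 i).2. Qed.

Lemma gn_Dg q w : 1 <= q -> bdry0 Om p w ->
  gn Om q (Dg p w) <= 2 * (\sum_j tau p j * gnorm p w j `^ q) `^ q^-1.
Proof.
move=> q1 w0; have q0 : 0 < q by lra.
have E0 : 0 <= \sum_j tau p j * gnorm p w j `^ q.
  by apply: sumr_ge0 => j _; rewrite mulr_ge0 ?powR_ge0// ltW// (tau_gt0 M).
have b i : rn Om q (Dg p w i) <= (\sum_j tau p j * gnorm p w j `^ q) `^ q^-1.
  rewrite -lee_fin -(rnE q0 (Gin_Dg q1 w0 i)) (Lnr_le _ _ _ q0) ?powR_ge0//.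
  by rewrite (powRVK (lt0r_neq0 q0) E0); exact: (Ip_Dg_le M w i (ltW q0)).
rewrite /gn !big_ord_recl big_ord0 addr0; have := lerD (b 0) (b (lift ord0 ord0)); lra.
Qed.

Lemma sn_interp_le q w : 3 / 2 <= q <= 3 -> bdry0 Om p w ->
  (sn Om q (interp p w) (Dg p w) <=
    ((3 * L * (3 * 2 ^+ 14) + 2) * (\sum_j tau p j * gnorm p w j `^ q) `^ q^-1)%:E)%E.
Proof.
move=> hq w0; have q1 : 1 <= q by move/andP: hq => [? _]; lra.
have q0 : 0 < q by lra.
set E := \sum_j _.
have E0 : 0 <= E by apply: sumr_ge0 => j _; rewrite mulr_ge0 ?powR_ge0// ltW// (tau_gt0 M).
have gE : (\sum_i Lnr lam O q (Dg p w i) <= (2 * E `^ q^-1)%:E)%E.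
  rewrite (eq_bigr (fun i => (rn Om q (Dg p w i))%:E)).
    by rewrite sumEFin lee_fin; exact: gn_Dg.
  by move=> i _; rewrite (rnE q0 (Gin_Dg q1 w0 i)).
rewrite mulrDl EFinD; apply: leeD; last exact: gE.
have c1 : 1 <= 3 * 2 ^+ 14 :> R by rewrite -natrX -natrM ler1n muln_gt0 expn_gt0.
have L30 : 0 <= 3 * L by rewrite mulr_ge0// ltW.
have c0 : 0 <= 3 * 2 ^+ 14 :> R by apply: le_trans c1.
have B0 : 0 <= 3 * L * (3 * 2 ^+ 14) * E `^ q^-1 by apply: mulr_ge0; [exact: mulr_ge0|exact: powR_ge0].
rewrite (Lnr_le _ _ _ q0 B0); apply: le_trans (Ip_interp M L0 OmL w0 hq) _.
rewrite -/E -!EFinM lee_fin.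
exact: powR_absorb.
Qed.

Section coefficients.
Variables (A : R * R -> 'M[R]_2) (c Lm : R).
Hypothesis mA : forall i k, measurable_fun O (fun x : plane R => A x i k).
Hypothesis Lm0 : 0 < Lm.
Hypothesis AL : {ae lam, forall x : plane R, O x -> forall i k, `|A x i k| <= Lm}.
Hypothesis Ac : {ae lam, forall x : plane R, O x -> forall a : 'I_2 -> R,
  c * \sum_i a i ^+ 2 <= \sum_i (\sum_k A x i k * a k) * a i}.
Hypothesis c0 : 0 < c.

Definition form (x : plane R) (g y : R * R) : R := \sum_i (\sum_k A x i k * co k g) * co i y.

Definition acoef j i k : R := rint (fun x => A x i k * ch j x).

(** The flux of [w] integrated over triangle [j]: as discrete gradients are constant on triangles,
    it is all that the bilinear form sees there. *)
Definition bvec w j : R * R :=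
  (\sum_k acoef j 0 k * co k (igrad (p j) w), \sum_k acoef j 1 k * co k (igrad (p j) w)).

Lemma L1_Ach j i k : L1 (fun x => A x i k * ch j x).
Proof.
apply: (@L1_bounded Lm) => //; [|exact: ltW|].
  by apply: measurable_funM; [exact: mA|apply: measurable_funTS; exact: measurable_ch].
apply: filterS AL => x Ax Ox; rewrite normrM -[leRHS]mulr1.
have /andP[h1 h2] := ch01 j x; apply: ler_pM => //; first exact: Ax.
by rewrite ger0_norm.
Qed.

Lemma formE j x g y : form x g y * ch j x = \sum_i \sum_k (co k g * co i y) * (A x i k * ch j x).
Proof.
rewrite /form mulr_suml; apply: eq_bigr => i _; rewrite !mulr_suml; apply: eq_bigr => k _; ring.
Qed.

Lemma L1_form j g y : L1 (fun x => form x g y * ch j x).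
Proof.
rewrite (_ : (fun x => _) = (fun x => \sum_i \sum_k (co k g * co i y) * (A x i k * ch j x))); last first.
  by apply/funext => x; exact: formE.
do 2 (apply: (L1_sum oO) => ?); exact: (integrableZl mo _ (L1_Ach _ _ _)).
Qed.

Lemma dotp_bvec w j y : dotp (bvec w j) y = rint (fun x => form x (igrad (p j) w) y * ch j x).
Proof.
set g := igrad (p j) w.
transitivity (\sum_i \sum_k (co k g * co i y) * acoef j i k).
  rewrite dotp_co; apply: eq_bigr => i _.
  have -> : co i (bvec w j) = \sum_k acoef j i k * co k g.
    have [->|->] : i = 0 \/ i = 1 by case: i => -[|[|//]] ?; [left|right]; apply: val_inj.
      by rewrite /co /=.
    by rewrite {1}/co /=.
  rewrite mulr_suml; apply: eq_bigr => k _; ring.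
transitivity (rint (fun x => \sum_i \sum_k (co k g * co i y) * (A x i k * ch j x))); last first.
  by apply: eq_Rintegral => x _; rewrite formE.
have i1 i k : L1 (fun x => (co k g * co i y) * (A x i k * ch j x)) by exact: (integrableZl mo _ (L1_Ach _ _ _)).
rewrite (rint_sum oO); last by move=> i; apply: (L1_sum oO) => k; exact: i1.
apply: eq_bigr => i _; rewrite (rint_sum oO)//; apply: eq_bigr => k _.
by rewrite (RintZ oO)//; exact: L1_Ach.
Qed.

Lemma bf_mesh w phi : bdry0 Om p w -> bdry0 Om p phi ->
  bf Om A (Dg p w) (Dg p phi) = \sum_j dotp (bvec w j) (igrad (p j) phi).
Proof.
move=> w0 phi0; under eq_bigr do rewrite dotp_bvec.
rewrite -(rint_sum oO); last by move=> j; exact: L1_form.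
have t1 : 1 <= 2 :> R by lra.
have t0 : 0 < 2 :> R by [].
have h2 : (2 : R)^-1 + 2^-1 = 1 by lra.
have [ff _] := flux_Gin oO mA (ltW Lm0) AL t1 (Gin_Dg t1 w0).
apply: (eq_rint_ae oO).
- exact: (L1_measurable (pair_L1 oO t0 t0 h2 ff (Gin_Dg t1 phi0)).1).
- apply: L1_measurable; apply: (L1_sum oO) => j; exact: L1_form.
have := ae_tri M; have := ae_Dg M w; have := ae_Dg M phi; apply: filterS3 => x hp hw [_ hu hO] Ox.
have [j xj] := hO Ox.
rewrite [X in _ = X](bigD1 j)//= [X in _ = _ + X]big1 ?addr0; last first.
  move=> k kj; rewrite /ch; case: asboolP; rewrite ?mulr0// => xk.
  by move: kj; rewrite (hu k j xk xj) eqxx.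
rewrite /ch asboolT// mulr1 /form; apply: eq_bigr => i _.
by rewrite (hp j xj) /flux; congr (_ * _); apply: eq_bigr => k _; rewrite (hw j xj).
Qed.

(** The constant is halved because [gnorm] is the sum norm, whose square is at most twice the
    Euclidean one. *)
Lemma bvec_coercive w j : c / 2 * tau p j * gnorm p w j ^+ 2 <= dotp (bvec w j) (igrad (p j) w).
Proof.
set g := igrad (p j) w; rewrite dotp_bvec -/g.
apply: (@le_trans _ _ (rint (fun x => c * (\sum_i co i g ^+ 2) * ch j x))).
  rewrite (RintZ oO); last exact: L1_ch.
  rewrite rint_ch (_ : c / 2 * _ * _ = (c / 2 * gnorm p w j ^+ 2) * tau p j); last by ring.
  rewrite ler_wpM2r ?(ltW (tau_gt0 M j))//.
  rewrite -mulrA ler_wpM2l ?(ltW c0)// /gnorm -/g n1_co !big_ord_recl !big_ord0 !addr0.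
  rewrite -[co ord0 g ^+ 2]real_normK ?num_real// -[co _ g ^+ 2 in X in _ <= _ + X]real_normK ?num_real//.
  move: `|_| `|_| => a b; have := sqr_ge0 (a - b); rewrite !expr2; lra.
apply: (rint_le_ae oO); [exact: (integrableZl mo _ (L1_ch j))|exact: L1_form|].
apply: filterS Ac => x Ax Ox; have /andP[h1 _] := ch01 j x; rewrite ler_wpM2r//.
exact: (Ax Ox (fun i => co i g)).
Qed.

Lemma bvec_bounded w j y : `|dotp (bvec w j) y| <= Lm * tau p j * gnorm p w j * n1 y.
Proof.
set g := igrad (p j) w.
have B : {ae lam, forall x : plane R, O x -> `|form x g y * ch j x| <= Lm * n1 g * n1 y * ch j x}.
  apply: filterS AL => x Ax Ox; have /andP[h1 _] := ch01 j x.
  rewrite normrM (ger0_norm h1) ler_wpM2r//.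
  apply: le_trans (ler_norm_sum _ _ _) _; rewrite [n1 y]n1_co mulr_sumr; apply: ler_sum => i _.
  rewrite normrM ler_wpM2r//; apply: le_trans (ler_norm_sum _ _ _) _.
  rewrite n1_co mulr_sumr; apply: ler_sum => k _; rewrite normrM ler_wpM2r//; exact: Ax.
have iC : L1 (fun x => Lm * n1 g * n1 y * ch j x) by exact: (integrableZl mo _ (L1_ch j)).
have E : rint (fun x => Lm * n1 g * n1 y * ch j x) = Lm * tau p j * gnorm p w j * n1 y.
  rewrite (RintZ oO); last exact: L1_ch.
  rewrite rint_ch /gnorm -/g; ring.
rewrite -E dotp_bvec -/g ler_norml; apply/andP; split; last first.
  apply: (rint_le_ae oO) => //; first exact: L1_form.
  by apply: filterS B => x Bx Ox; apply: le_trans (ler_norm _) (Bx Ox).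
rewrite -mulN1r -(RintZ oO _ iC); apply: (rint_le_ae oO); [exact: (integrableZl mo _ iC)|exact: L1_form|].
by apply: filterS B => x Bx Ox; rewrite mulN1r; have := Bx Ox; rewrite ler_norml => /andP[].
Qed.

Lemma discrete_stability (d K : R) w : 0 < d <= 1 -> 0 <= K -> bdry0 Om p w ->
  (forall phi, bdry0 Om p phi -> bf Om A (Dg p w) (Dg p phi) <=
     K * (\sum_j tau p j * gnorm p phi j `^ ((2 + d) / (1 + d))) `^ ((1 + d) / (2 + d))) ->
  d * (16 * Lm * truncC s * maxC s) <= c / 2 ->
  (\sum_j tau p j * gnorm p w j `^ (2 + d)) `^ (2 + d)^-1 <=
    2 * (2 + 8 * truncC s) * (1 + maxC s) / (c / 2) * K.
Proof.
move=> d01 K0 w0 hK hd.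
have c20 : 0 < c / 2 by rewrite divr_gt0.
apply: (energy_bound M w0 d01 c20 Lm0 K0 (bvec_coercive w) (bvec_bounded w) _ hd).
by move=> phi phi0; rewrite -bf_mesh//; exact: hK.
Qed.

Lemma bf_eq0 w : bdry0 Om p w -> bf Om A (Dg p w) (Dg p w) = 0 -> veq p w (fun=> 0).
Proof.
move=> w0 e0; have t1 : 1 <= 2 :> R by lra.
apply: (igrad0_eq0 M w0).
  exists (L + 1, 0) => /OmL; rewrite norm_pair /= normr0 ge_max => /andP[+ _].
  by have := ler_norm (L + 1); lra.
move=> j; apply: n1_eq0; move: e0; rewrite (bf_mesh w0 w0) => e0.
have e1 k : 0 <= c / 2 * tau p k * gnorm p w k ^+ 2.
  by rewrite mulr_ge0 ?sqr_ge0// mulr_ge0 ?(ltW (tau_gt0 M k))// divr_ge0// ltW.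
have h2 k : 0 <= dotp (bvec w k) (igrad (p k) w) by apply: le_trans (e1 k) (bvec_coercive w k).
move/eqP: e0; rewrite psumr_eq0// => /allP/(_ j (mem_index_enum _)) /= /eqP e.
have := bvec_coercive w j; rewrite e => h3.
have /eqP : c / 2 * tau p j * gnorm p w j ^+ 2 = 0 by apply/eqP; rewrite eq_le h3 e1.
rewrite mulf_eq0 (gt_eqF (mulr_gt0 _ (tau_gt0 M j))) ?divr_gt0//= sqrf_eq0 => /eqP; exact.
Qed.

Lemma Dg_linE (k : R) v w : Dg p (fun y => k * v y + w y) = (fun i x => k * Dg p v i x + Dg p w i x).
Proof. by apply/funext => i; apply/funext => x; exact: Dg_lin. Qed.

Lemma Dg_congr v v' : veq p v v' -> Dg p v = Dg p v'.
Proof.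
move=> vv; apply/funext => i; apply/funext => x; apply: eq_bigr => j _.
by rewrite (igrad_congr (vv j)).
Qed.

Lemma nodal_linear_bfl w : bdry0 Om p w -> nodal_linear Om p (fun v => bf Om A (Dg p v) (Dg p w)).
Proof.
move=> w0; have t1 : 1 <= 2 :> R by lra.
have h2 : (2 : R)^-1 + 2^-1 = 1 by lra.
split => [v v' vv|k v v' v0 v0'].
  by rewrite (Dg_congr vv).
rewrite -(bf_linl oO mA (ltW Lm0) AL k t1 _ h2) => //; try exact: Gin_Dg.
by rewrite -(Dg_linE k v v').
Qed.

Lemma nodal_linear_bfr w : bdry0 Om p w -> nodal_linear Om p (fun v => bf Om A (Dg p w) (Dg p v)).
Proof.
move=> w0; have t1 : 1 <= 2 :> R by lra.
have h2 : (2 : R)^-1 + 2^-1 = 1 by lra.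
split => [v v' vv|k v v' v0 v0'].
  by rewrite (Dg_congr vv).
rewrite -(bf_linr oO mA (ltW Lm0) AL k t1 t1 h2) => //; try exact: Gin_Dg.
by rewrite -(Dg_linE k v v').
Qed.

Lemma discrete_ex F : nodal_linear Om p F ->
  exists2 w, bdry0 Om p w & forall v, bdry0 Om p v -> bf Om A (Dg p w) (Dg p v) = F v.
Proof.
move=> Fl.
exact: (@galerkin_ex _ Om n p (fun u v => bf Om A (Dg p u) (Dg p v)) F
  nodal_linear_bfl nodal_linear_bfr Fl bf_eq0).
Qed.

Lemma discrete_uniq w w' : bdry0 Om p w -> bdry0 Om p w' ->
  (forall v, bdry0 Om p v -> bf Om A (Dg p w) (Dg p v) = bf Om A (Dg p w') (Dg p v)) ->
  veq p w w'.
Proof.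
move=> w0 w0' e; have d0 := bdry0_lin (-1) w0' w0.
have := bf_eq0 d0; have [_ lin] := nodal_linear_bfl d0.
rewrite (lin (-1) w' w w0' w0) e// mulN1r addNr => /(_ erefl) e1 j i.
by have := e1 j i; rewrite mulN1r => /eqP; rewrite addrC subr_eq0 => /eqP.
Qed.

End coefficients.
End discrete_problem.

(** * Completeness and convexity of Lebesgue spaces *)

Lemma powR_cvg (R : realType) (p a : R) : 0 < p -> 0 <= a -> (`|x| `^ p) @[x --> a] --> `|a| `^ p.
Proof.
move=> p0; rewrite le_eqVlt => /orP[/eqP <-|a0].
  rewrite normr0 powR0 ?gt_eqF//; apply/cvgr0Pnorm_le => e e0.
  have d0 : 0 < e `^ p^-1 by rewrite powR_gt0.
  near=> x; have hx : `|x| <= e `^ p^-1.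
    by near: x; apply: cvgr0_norm_le => //; exact: cvg_id.
  rewrite ger0_norm ?powR_ge0// -[leRHS](powRVK (lt0r_neq0 p0) (ltW e0)); apply: powR_mono => //; exact: ltW.
have h : expR (p * ln `|x|) @[x --> a] --> expR (p * ln `|a|).
  apply: (@cvg_comp _ _ _ (fun x => p * ln `|x|) expR); last exact: continuous_expR.
  apply: cvgMr; apply: (@cvg_comp _ _ _ (fun x : R => `|x|) (@ln R)); first by apply: cvg_norm; exact: cvg_id.
  by apply: continuous_ln; rewrite normr_gt0 gt_eqF.
have E (x : R) : x != 0 -> expR (p * ln `|x|) = `|x| `^ p.
  by move=> x0; rewrite /powR normr_eq0 (negbTE x0).
rewrite -E ?gt_eqF//; apply: cvg_trans h; apply: near_eq_cvg; near=> x.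
by apply: E; rewrite gt_eqF//; near: x; exact: lt_nbhsr.
Unshelve. all: by end_near. Qed.

Lemma powR_norm_cvg (R : realType) (p a : R) (u : nat -> R) : 0 < p ->
  u k @[k --> \oo] --> a -> `|u k| `^ p @[k --> \oo] --> `|a| `^ p.
Proof.
move=> p0 ua; have c1 := powR_cvg p0 (normr_ge0 a).
have ua' : `|u k| @[k --> \oo] --> `|a| by exact: cvg_norm.
have := @cvg_comp _ _ _ (fun k => `|u k|) (fun y : R => `|y| `^ p) _ _ _ ua' c1.
rewrite normr_id; apply: cvg_trans; apply: near_eq_cvg; apply: nearW => k /=.
by rewrite normr_id.
Qed.

Lemma le_powR_root (R : realType) (p x C : R) : 0 < p -> 0 <= x -> x `^ p <= C -> x <= C `^ p^-1.
Proof.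
move=> p0 x0 xC; rewrite -[leLHS](powRK (lt0r_neq0 p0) x0); apply: powR_mono => //.
  by rewrite invr_ge0 ltW.
exact: powR_ge0.
Qed.

Lemma powR_exprn (R : realType) (a p : R) k : 0 <= a -> (a ^+ k) `^ p = (a `^ p) ^+ k.
Proof.
move=> a0; elim: k => [|k IH]; first by rewrite powR1.
by rewrite !exprS powRM ?exprn_ge0// IH.
Qed.

Lemma powR1r (R : realType) (p : R) : 1 `^ p = 1 :> R.
Proof. by rewrite powR1. Qed.

Section Lp_completeness.
Context {R : realType}.
Context d (T : measurableType d) (mu : {measure set T -> \bar R}).

(** Riesz-Fischer: a fast subsequence converges almost everywhere, and Fatou's lemma bounds the
    distance to its limit. *)
Lemma Lp_complete (p : R) Om (g : nat -> T -> R) : 0 < p -> measurable Om ->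
  (forall n, measurable_fun Om (g n)) ->
  (forall e : R, 0 < e -> exists N, forall m n, (N <= m)%N -> (N <= n)%N ->
     (Ip mu Om p (fun x => (g m x - g n x)%R) <= e%:E)%E) ->
  exists h : T -> R, measurable_fun Om h /\
    forall e : R, 0 < e -> exists N, forall n, (N <= n)%N ->
     (Ip mu Om p (fun x => (g n x - h x)%R) <= e%:E)%E.
Proof.
move=> p0 mOm mg cau.
(* With [2 ^ p * r = 1 / 4], weighting the p-th power of increment [k] by [2 ^ (p k)] still leaves a
   summable series of integrals; where the weighted series is finite, the increments are bounded by
   a multiple of [2 ^ -k]. *)
pose r : R := (2 `^ p)^-1 * 4^-1.
have r0 : 0 < r by rewrite mulr_gt0// invr_gt0 powR_gt0.
have pos k : 0 < r ^+ k by rewrite exprn_gt0.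
pose N k := sval (cid (cau _ (pos k))).
have NP k m n : (N k <= m)%N -> (N k <= n)%N ->
    (Ip mu Om p (fun x => (g m x - g n x)%R) <= (r ^+ k)%:E)%E.
  exact: (svalP (cid (cau _ (pos k)))).
pose s := fix s k := if k is k'.+1 then maxn (s k').+1 (N k) else N 0%N.
have sN k : (N k <= s k)%N by case: k => //= k; rewrite leq_maxr.
have s_incr k : (s k <= s k.+1)%N by rewrite /= ltnW// leq_maxl.
have s_homo : {homo s : i j / (i <= j)%N}.
  by apply: homo_leq; [exact: leqnn|exact: leq_trans|exact: s_incr].
have sk k : (k <= s k)%N by elim: k => // k IH; rewrite (leq_ltn_trans IH)//= leq_maxl.
have sD k : (Ip mu Om p (fun x => (g (s k.+1) x - g (s k) x)%R) <= (r ^+ k)%:E)%E.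
  by apply: NP; [exact: leq_trans (sN k) (s_incr k)|exact: sN].
pose D k x : \bar R := ((2 `^ p) ^+ k * `|g (s k.+1) x - g (s k) x| `^ p)%:E.
have mD k : measurable_fun Om (D k).
  apply/measurable_EFinP; apply: measurable_funM; first exact: measurable_cst.
  by apply/measurable_EFinP; apply: measurable_powR_norm; exact: measurable_funB.
have D0 k x : (0 <= D k x)%E by rewrite lee_fin mulr_ge0 ?powR_ge0// exprn_ge0// powR_ge0.
have finS : (\int[mu]_(x in Om) (\sum_(0 <= k <oo) D k x) < +oo)%E.
  rewrite integral_nneseries//.
  apply: (@le_lt_trans _ _ (\sum_(0 <= k <oo) (4^-1 ^+ k)%:E)%E).
    apply: lee_nneseries => [k _ _|k _]; first by apply: integral_ge0 => x _; exact: D0.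
    rewrite /D; under eq_integral do rewrite EFinM.
    rewrite ge0_integralZl//; last first.
      by apply: measurable_powR_norm; exact: measurable_funB.
    apply: (@le_trans _ _ (((2 `^ p) ^+ k)%:E * (r ^+ k)%:E)%E).
      by apply: lee_wpmul2l; [rewrite lee_fin exprn_ge0// powR_ge0|exact: sD].
    rewrite -EFinM lee_fin -exprMn (_ : 2 `^ p * r = 4^-1 :> R)// /r mulrA mulfV ?mul1r//.
  have -> : (\sum_(0 <= k <oo) (4^-1 ^+ k)%:E)%E = (limn (series (geometric 1 (4^-1 : R))))%:E.
    rewrite -EFin_lim; last first.
      by apply: is_cvg_geometric_series; rewrite ger0_norm ?invr_ge0// invf_lt1// ltr1n.
    congr (limn _); apply/funext => n /=; rewrite /series /= -sumEFin.
    by apply: eq_bigr => i _; rewrite mul1r.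
  exact: ltry.
have aeS : {ae mu, forall x, Om x -> (\sum_(0 <= k <oo) D k x)%E \is a fin_num}.
  apply: integrable_ae => //; apply/integrableP; split.
    apply: ge0_emeasurable_sum => //.
  rewrite (eq_integral (fun x => (\sum_(0 <= k <oo) D k x))%E)// => x _.
  by rewrite gee0_abs// nneseries_ge0.
have aecvg : {ae mu, forall x, Om x -> cvgn (fun k => g (s k) x)}.
  apply: filterS aeS => x /[apply] fx.
  pose C := fine (\sum_(0 <= k <oo) D k x)%E.
  have DC k : (2 `^ p) ^+ k * `|g (s k.+1) x - g (s k) x| `^ p <= C.
    rewrite -lee_fin /C fineK//.
    apply: (@le_trans _ _ (\sum_(0 <= i < k.+1) D i x)%E); last first.
      by apply: nneseries_lim_ge => i _ _; exact: D0.
    by rewrite big_nat_recr//= leeDr// sume_ge0// => i _; exact: D0.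
  apply: (@increments_cvg _ _ (C `^ p^-1)) => k.
  have C0 : 0 <= C by apply: le_trans (DC 0%N); rewrite mul1r powR_ge0.
  rewrite exprVn ler_pdivlMr ?exprn_gt0// mulrC.
  have pV : 0 <= p^-1 by rewrite invr_ge0 ltW.
  have a0 : 0 <= 2 ^+ k * `|g (s k.+1) x - g (s k) x| by rewrite mulr_ge0// exprn_ge0.
  apply: (le_powR_root p0 a0); apply: le_trans (DC k).
  by rewrite powRM ?exprn_ge0// powR_exprn.
(* The upper limit is measurable without reference to the set of convergence. *)
pose h x := fine (limn_esup (fun k => (g (s k) x)%:E)).
have hE x : cvgn (fun k => g (s k) x) -> (fun k => g (s k) x) @ \oo --> h x.
  move=> cx; rewrite /h.
  have /cvg_limn_einf_sup [_ ->] : (g (s k) x)%:E @[k --> \oo] --> (limn (fun k => g (s k) x))%:E.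
    by apply: cvg_EFin; [near=> k|exact: cx].
  exact: cx.
have mh : measurable_fun Om h.
  apply: (measurableT_comp (fine_measurable measurableT)) => //.
  by apply: measurable_fun_limn_esup => k; apply/measurable_EFinP.
exists h; split => // e e0; have [M MP] := cau e e0; exists M => n Mn.
rewrite /Ip.
pose f k x : \bar R := (`|g n x - g (s (k + M)%N) x| `^ p)%:E.
have mf k : measurable_fun Om (f k).
  by apply: measurable_powR_norm; exact: measurable_funB.
have -> : (\int[mu]_(x in Om) (`|g n x - h x| `^ p)%:E)%E =
    (\int[mu]_(x in Om) limn_einf (f^~ x))%E.
  apply: ae_eq_integral => //.
  - by apply: measurable_powR_norm; exact: measurable_funB.
  - rewrite (_ : (fun x => _) = (fun x => (- limn_esup (fun k => - f k x)%E)%E)); last first.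
      apply/funext => x; rewrite -limn_einfN; congr limn_einf.
      by apply/funext => k /=; rewrite -[RHS]/(- - f k x)%E oppeK.
    apply: measurableT_comp => //; apply: measurable_fun_limn_esup => k.
    exact: measurableT_comp.
  apply: filterS aecvg => x /[apply] /hE cx.
  apply/esym; apply: (cvg_limn_einf_sup _).1.
  apply: cvg_EFin; first by near=> k.
  rewrite /f /=.
  have : g (s (k + M)%N) x @[k --> \oo] --> h x by rewrite (@cvg_shiftn M _ (fun k => g (s k) x)).
  by move=> c; apply: (powR_norm_cvg p0); apply: cvgB; [exact: cvg_cst|exact: c].
apply: le_trans (fatou _ _ _ _) _ => //.
  by move=> k x _; rewrite lee_fin powR_ge0.
set u := fun k => _.
have ue k : (u k <= e%:E)%E.
  rewrite /u /f; apply: MP => //; apply: leq_trans (sk _); exact: leq_addl.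
rewrite limn_einf_lim; apply: lime_le; first exact: is_cvg_einfs.
near=> k; apply: le_trans (ue k); apply: ereal_inf_lbound => /=.
by exists k => //=.
Unshelve. all: by end_near. Qed.
End Lp_completeness.

(** * Clarkson's inequality *)

Section clarkson.
Context {R : realType}.
Implicit Types (a b p : R).

Lemma powR_superadd a b r : 0 <= a -> 0 <= b -> 1 <= r -> a `^ r + b `^ r <= (a + b) `^ r.
Proof.
move=> a0 b0 r1; have [ab0|ab0] := eqVneq (a + b) 0.
  have -> : a = 0 by lra.
  have -> : b = 0 by lra.
  by rewrite addr0 powR0 ?addr0 ?lexx//; lra.
have r10 : 0 <= r - 1 by lra.
have e x : 0 <= x -> x `^ r = x * x `^ (r - 1).
  move=> x0; have [->|xn0] := eqVneq x 0; first by rewrite mul0r powR0//; lra.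
  rewrite -{2}[x]powRr1// -powRD ?xn0 ?implybT//; congr (_ `^ _); ring.
have E x : 0 <= x -> x <= a + b -> x `^ r <= x * (a + b) `^ (r - 1).
  by move=> x0 xab; rewrite e// ler_wpM2l// powR_mono.
apply: (@le_trans _ _ (a * (a + b) `^ (r - 1) + b * (a + b) `^ (r - 1))).
  by apply: lerD; apply: E; lra.
by rewrite -mulrDl -e// addr_ge0.
Qed.

Lemma powR_midpoint a b r : 0 <= a -> 0 <= b -> 1 <= r -> ((a + b) / 2) `^ r <= (a `^ r + b `^ r) / 2.
Proof.
move=> a0 b0 r1; have t0 : 0 <= 2^-1 :> R by lra.
have t1 : 2^-1 <= 1 :> R by lra.
have ia : a \in [set` `[0, +oo[%R] by rewrite inE /= in_itv /= a0.
have ib : b \in [set` `[0, +oo[%R] by rewrite inE /= in_itv /= b0.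
have : (2^-1 * a + (1 - 2^-1) * b) `^ r <= 2^-1 * a `^ r + (1 - 2^-1) * b `^ r.
  exact: (convex_powR r1 (Itv01 t0 t1) ia ib).
rewrite (_ : 2^-1 * a + _ = (a + b) / 2); last by field.
by move=> h; apply: le_trans h _; lra.
Qed.

(** The parallelogram identity for squares, with superadditivity of [t ^ (p / 2)] before it and
    midpoint convexity after it. *)
Lemma clarkson a b p : 2 <= p ->
  `|2^-1 * (a + b)| `^ p + `|2^-1 * (a - b)| `^ p <= 2^-1 * (`|a| `^ p + `|b| `^ p).
Proof.
move=> p2; have r1 : 1 <= p / 2 by lra.
have E (x : R) : `|x| `^ p = (x ^+ 2) `^ (p / 2).
  by rewrite -[x ^+ 2]real_normK ?num_real// -powR_mulrn// -powRrM; congr (_ `^ _); field.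
rewrite !E; apply: le_trans (powR_superadd (sqr_ge0 _) (sqr_ge0 _) r1) _.
rewrite (_ : (2^-1 * (a + b)) ^+ 2 + (2^-1 * (a - b)) ^+ 2 = (a ^+ 2 + b ^+ 2) / 2); last by field.
by rewrite mulrC mulrC; apply: le_trans (powR_midpoint (sqr_ge0 _) (sqr_ge0 _) r1) _; rewrite mulrC.
Qed.

End clarkson.

(** * Embeddings between Lebesgue spaces *)

Section embedding.
Context {R : realType}.
Local Notation lam := (@lam R).
Variables (L : R) (Om : set (R * R)).
Hypothesis (oO : open Om) (L0 : 0 < L) (OmL : forall x, Om x -> `|x| <= L).
Local Notation O := (Om : set (plane R)).
Implicit Types (u v : plane R -> R) (G H : 'I_2 -> plane R -> R) (p q r : R).
Let mo := mO oO.

Definition embC q : R := (fine (lam O) + 1) `^ q^-1.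

Lemma embC_gt0 q : 0 < embC q.
Proof. by rewrite powR_gt0// ltr_wpDl// fine_ge0. Qed.

(** [t ^ q <= 1 + t ^ r] is applied to [u / K] for [K] slightly above the norm of [u]; letting [K]
    tend to the norm also covers the norm 0. *)
Lemma rn_embed q r u : 0 < q -> q <= r -> inLp Om r u -> inLp Om q u /\ rn Om q u <= embC q * rn Om r u.
Proof.
move=> q0 qr fu; have r0 : 0 < r by lra.
have [mu _] := fu.
have lf : lam O \is a fin_num by rewrite ge0_fin_numE// (lam_Om_fin oO L0 OmL).
have l0 : 0 <= fine (lam O) by rewrite fine_ge0.
have key (K : R) : 0 < K -> rn Om r u <= K -> (Lnr lam O q u <= (embC q * K)%:E)%E.
  move=> K0 uK; have fu' := inLpZ oO K^-1 r0 fu; have [mu' _] := fu'.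
  have h1 : (Ip lam O r (fun x => (K^-1 * u x)%R) <= 1%:E)%E.
    rewrite -[1](powR1r r) -(Lnr_le lam O _ r0 ler01) (LnrZ lam _ mo mu r0) (rnE r0 fu) -EFinM lee_fin.
    by rewrite ger0_norm ?invr_ge0 ?(ltW K0)// ler_pdivrMl// mulr1.
  have h2 : (Ip lam O q (fun x => (K^-1 * u x)%R) <= lam O + Ip lam O r (fun x => (K^-1 * u x)%R))%E.
    have -> : lam O = (\int[lam]_(x in O) (1 : R)%:E)%E by rewrite (integral_cst lam mo) mul1e.
    have mp := measurable_powR_norm r mu'.
    rewrite /Ip -(ge0_integralD lam mo _ _ _ mp); last 3 first.
    - by move=> x _; rewrite lee_fin.
    - exact: measurable_cst.
    - by move=> x _; rewrite lee_fin powR_ge0.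
    apply: ge0_le_integral => //.
    - exact: (measurable_powR_norm q mu').
    - by apply: emeasurable_funD; [exact: measurable_cst|exact: mp].
    move=> x _; rewrite -EFinD lee_fin; move: (normr_ge0 (K^-1 * u x)); move: `|_| => t t0.
    have [t1|t1] := leP t 1.
      apply: (@le_trans _ _ 1); last by rewrite lerDl powR_ge0.
      by rewrite -[X in _ <= X](powR1r q); apply: powR_mono => //; exact: ltW.
    by apply: ler_wpDl => //; apply: ler_powR => //; exact: ltW.
  have h3 : (Lnr lam O q (fun x => (K^-1 * u x)%R) <= (embC q)%:E)%E.
    rewrite (Lnr_le lam O _ q0 (ltW (embC_gt0 q))) /embC (powRVK (lt0r_neq0 q0)); last by rewrite addr_ge0.
    by apply: le_trans h2 _; rewrite EFinD fineK// leeD2l.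
  have -> : u = (fun x => K * (K^-1 * u x)) by apply/funext => x; rewrite mulrA mulfV ?mul1r// gt_eqF.
  rewrite (LnrZ lam K mo mu' q0) ger0_norm ?(ltW K0)// mulrC EFinM.
  by apply: lee_wpmul2l => //; rewrite lee_fin ltW.
have fq : inLp Om q u.
  have K0 : 0 < rn Om r u + 1 by rewrite ltr_wpDl// rn_ge0.
  apply: (inLp_Lnr q0 mu); apply: le_lt_trans (key _ K0 _) _; last exact: ltry.
  by rewrite lerDl.
split => //; rewrite -subr_le0; apply/ler_addgt0Pr => e e0; rewrite add0r lerBlDr.
have d0 : 0 < e / embC q by rewrite divr_gt0// embC_gt0.
have K0 : 0 < rn Om r u + e / embC q by rewrite ltr_wpDl// rn_ge0.
have := key _ K0; rewrite lerDl (ltW d0) (rnE q0 fq) lee_fin => /(_ isT).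
by rewrite mulrDr [embC q * (e / _)]mulrC divfK ?(gt_eqF (embC_gt0 q))// addrC.
Qed.

Lemma gn_embed q r G : 0 < q -> q <= r -> Gin Om r G -> Gin Om q G /\ gn Om q G <= embC q * gn Om r G.
Proof.
move=> q0 qr fG; have h i := rn_embed q0 qr (fG i); split; first by move=> i; case: (h i).
by rewrite /gn mulr_sumr; apply: ler_sum => i _; case: (h i).
Qed.

Lemma Lp_complete_rn p (g : nat -> plane R -> R) : 1 <= p -> (forall n, inLp Om p (g n)) ->
  (forall e : R, 0 < e -> exists N, forall m n, (N <= m)%N -> (N <= n)%N ->
     rn Om p (fun x => g m x - g n x) <= e) ->
  exists2 h, inLp Om p h & forall e : R, 0 < e -> exists N, forall n, (N <= n)%N ->
     rn Om p (fun x => g n x - h x) <= e.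
Proof.
move=> p1 fg cau; have p0 : 0 < p by lra.
have mg n : measurable_fun O (g n) by case: (fg n).
have [|h [mh hl]] := Lp_complete p0 mo mg (mu := lam).
  move=> e e0; have se : 0 < e `^ p^-1 by rewrite powR_gt0.
  have [N hN] := cau _ se; exists N => m n Nm Nn.
  have := hN m n Nm Nn; rewrite -lee_fin -(rnE p0 (inLpB oO p1 (fg m) (fg n))).
  by rewrite (Lnr_le lam O _ p0 (ltW se)) (powRVK (lt0r_neq0 p0) (ltW e0)).
have fh : inLp Om p h.
  have [N /(_ N (leqnn N)) hN] := hl 1 ltr01.
  rewrite (_ : h = fun x => g N x - (g N x - h x)); last by apply/funext => x; ring.
  apply: (inLpB oO p1 (fg N)); split; first exact: measurable_funB.
  by apply: le_lt_trans hN _; rewrite ltry.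
exists h => // e e0; have [N hN] := hl (e `^ p) (powR_gt0 p e0).
exists N => n Nn; rewrite -lee_fin -(rnE p0 (inLpB oO p1 (fg n) fh)).
by rewrite (Lnr_le lam O _ p0 (ltW e0)); exact: hN.
Qed.

End embedding.

(** * Weak limits *)

Section weak_limits.
Context {R : realType}.
Local Notation lam := (@lam R).
Variables (L : R) (Om : set (R * R)).
Hypothesis (oO : open Om) (L0 : 0 < L) (OmL : forall x, Om x -> `|x| <= L).
Local Notation O := (Om : set (plane R)).
Local Notation rint u := (\int[lam]_(x in O) u x).
Local Notation L1 u := (lam.-integrable O (EFin \o (u : plane R -> R))).
Let mo := mO oO.
Variables (p CP : R).
Hypothesis (p2 : 2 <= p) (CP0 : 0 <= CP).
Local Notation field := ('I_2 -> plane R -> R).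
Implicit Types (u v : plane R -> R) (G H : field).
Hypothesis poinc : forall u G, sob0 Om p u G -> rn Om p u <= CP * gn Om p G.

Let p1 : 1 <= p. Proof. by move: p2 => ?; lra. Qed.
Let p0 : 0 < p. Proof. by move: p2 => ?; lra. Qed.

Definition gsub G H : field := fun i x => G i x - H i x.

Lemma sob0_in u G : sob0 Om p u G -> inLp Om p u /\ Gin Om p G.
Proof. by move=> [[fu fG] _]; split; [exact: fu|move=> i; exact: (fG i).2]. Qed.

Lemma Gin_sub G H : Gin Om p G -> Gin Om p H -> Gin Om p (gsub G H).
Proof. by move=> fG fH i; exact: (inLpB oO p1 (fG i) (fH i)). Qed.

Lemma rn_le_gn G i : rn Om p (G i) <= gn Om p G.
Proof. by rewrite /gn (bigD1 i)//= lerDl sumr_ge0// => k _; exact: rn_ge0. Qed.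

(** The Poincare inequality makes the functions a Cauchy sequence along with their gradients, and
    [wp_closed], after embedding in L^2, identifies the limit gradient. *)
Lemma sob0_complete_p (u : nat -> plane R -> R) (G : nat -> field) :
  (forall n, sob0 Om p (u n) (G n)) ->
  (forall e : R, 0 < e -> exists N, forall m n, (N <= m)%N -> (N <= n)%N ->
     gn Om p (gsub (G m) (G n)) <= e) ->
  exists u0 G0, sob0 Om p u0 G0 /\ forall e : R, 0 < e -> exists N, forall n, (N <= n)%N ->
     gn Om p (gsub (G n) G0) <= e.
Proof.
move=> su cau.
have fu n : inLp Om p (u n) by case: (sob0_in (su n)).
have fG n : Gin Om p (G n) by case: (sob0_in (su n)).
have wG n i : wp Om i (u n) (G n i) by case: (su n) => -[_ /(_ i)[]].
have C1 : 0 < CP + 1 by rewrite ltr_wpDl.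
have [e e0|u0 fu0 hu] := Lp_complete_rn oO p1 fu.
  have [N hN] := cau _ (divr_gt0 e0 C1).
  exists N => m n Nm Nn; apply: le_trans (poinc (sob0B oO L0 OmL p1 (su m) (su n))) _.
  have h := hN m n Nm Nn.
  apply: (@le_trans _ _ (CP * (e / (CP + 1)))); first by rewrite ler_wpM2l.
  rewrite mulrCA ger_pMr// ler_pdivrMr// mul1r lerDl//.
have hG i : exists g, inLp Om p g /\ forall e : R, 0 < e -> exists N, forall n, (N <= n)%N ->
     rn Om p (fun x => G n i x - g x) <= e.
  have [e e0|g f1 f2] := Lp_complete_rn oO p1 (g := fun n => G n i) (fun n => fG n i); last by exists g.
  have [N hN] := cau _ e0; exists N => m n Nm Nn.
  by apply: le_trans (hN m n Nm Nn); exact: (rn_le_gn (gsub (G m) (G n)) i).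
have [G0 hG0] := fin_all_exists hG.
have fG0 : Gin Om p G0 by move=> i; case: (hG0 i).
have lim e : 0 < e -> exists N, forall n, (N <= n)%N -> forall i, rn Om p (fun x => G n i x - G0 i x) <= e.
  move=> e0; have [N hN] := fin_all_exists (fun i => (hG0 i).2 e e0).
  exists (\sum_i N i)%N => n Nn i; apply: hN; apply: leq_trans Nn.
  by rewrite (bigD1 i)//= leq_addr.
exists u0, G0; split; last first.
  move=> e e0; have e2 : 0 < e / 2 by rewrite divr_gt0.
  have [N hN] := lim _ e2; exists N => n Nn.
  by rewrite /gn !big_ord_recl big_ord0 addr0; have := lerD (hN n Nn 0) (hN n Nn (lift ord0 ord0)); rewrite /gsub; lra.
have t0 : 0 < 2 :> R by [].
have em f : inLp Om p f -> inLp Om 2 f by move=> ff; exact: (rn_embed oO L0 OmL t0 p2 ff).1.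
have en f e : inLp Om p f -> rn Om p f <= e / embC Om 2 -> (Lnr lam O 2 f <= e%:E)%E.
  move=> ff fe; have [f2 le] := rn_embed oO L0 OmL t0 p2 ff.
  rewrite (rnE t0 f2) lee_fin; apply: le_trans le _.
  by rewrite mulrC -ler_pdivlMr// embC_gt0.
have s0 : sob Om p u0 G0.
  split; first exact: fu0.
  move=> i; split; last exact: fG0.
  apply: (wp_closed oO L0 OmL (em _ fu0) (em _ (fG0 i))).
  move=> e e0; have d0 : 0 < e / embC Om 2 by rewrite divr_gt0// embC_gt0.
  have [N1 h1] := hu _ d0; have [N2 h2] := lim _ d0.
  exists (u (N1 + N2)%N), (G (N1 + N2)%N i).
  split; [exact: wG|exact: (em _ (fu _))|exact: (em _ (fG _ i))|apply: en|apply: en].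
  - exact: (inLpB oO p1 (fu _) fu0).
  - exact: h1 (leq_addr _ _).
  - exact: (inLpB oO p1 (fG _ i) (fG0 i)).
  - exact: h2 (leq_addl _ _) i.
split => // e e0; have d0 : 0 < e / 4 by rewrite divr_gt0.
have [N1 h1] := hu _ d0; have [N2 h2] := lim _ d0; pose n := (N1 + N2)%N.
have [_ /(_ _ d0) [phi tp le]] := su n.
exists phi => //.
have := sn_lin oO 1 p1 (sobB oO p1 s0 (su n).1) (sobB oO p1 (su n).1 (test_sob oO L0 OmL p1 tp)).
rewrite (_ : (fun x => 1 * _ + _) = (fun x => u0 x - phi x)); last by apply/funext => x; ring.
rewrite (_ : (fun i x => 1 * _ + _) = (fun i x => G0 i x - partial i phi x)); last first.
  by apply/funext => i; apply/funext => x; ring.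
move=> /le_lt_trans; apply; rewrite normr1 mul1e.
apply: (@le_lt_trans _ _ ((3 * (e / 4))%:E + sn Om p (fun x => (u n x - phi x)%R) (fun i x => (G n i x - partial i phi x)%R))%E); last first.
  have eE : e%:E = ((3 * (e / 4))%:E + (e / 4)%:E)%E by rewrite -EFinD; congr EFin; field.
  by rewrite [X in (_ < X)%E]eE lteD2lE.
rewrite leeD2r// /sn sume2.
have b1 : (Lnr lam O p (fun x => (u0 x - u n x)%R) <= (e / 4)%:E)%E.
  rewrite (LnrBC oO p0 fu0.1 (fu n).1) (rnE p0 (inLpB oO p1 (fu n) fu0)) lee_fin.
  exact: h1 (leq_addr _ _).
have b2 i : (Lnr lam O p (fun x => (G0 i x - G n i x)%R) <= (e / 4)%:E)%E.
  rewrite (LnrBC oO p0 (fG0 i).1 (fG n i).1) (rnE p0 (inLpB oO p1 (fG n i) (fG0 i))) lee_fin.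
  exact: h2 (leq_addl _ _) i.
apply: le_trans (leeD b1 (leeD (b2 0) (b2 1))) _.
by rewrite -!EFinD lee_fin; lra.
Qed.

Definition ipr u : R := rint (fun x => `|u x| `^ p).
(** The p-th powers of the component norms are summed because Clarkson's inequality then adds up
    over the components. *)
Definition Q G : R := \sum_i ipr (G i).

Lemma L1_pow u : inLp Om p u -> L1 (fun x => `|u x| `^ p).
Proof.
move=> [mu fu]; apply/integrableP; split; first exact: (measurable_powR_norm p mu).
rewrite (eq_integral (fun x => (`|u x| `^ p)%:E)); first exact: fu.
by move=> x _; rewrite /= ger0_norm// powR_ge0.
Qed.

Lemma ipr_ge0 u : 0 <= ipr u.
Proof. by apply: Rintegral_ge0 => x _; exact: powR_ge0. Qed.

Lemma rn_ipr u : inLp Om p u -> rn Om p u = ipr u `^ p^-1.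
Proof.
move=> fu; have [mu Iu] := fu.
have E : Ip lam O p u = (ipr u)%:E by rewrite /ipr /Rintegral fineK// ge0_fin_numE// Ip_ge0.
by rewrite /rn (LnrE lam O u p0) E poweR_EFin.
Qed.

Lemma Q_clarkson G H : Gin Om p G -> Gin Om p H ->
  Q (fun i x => 2^-1 * (G i x + H i x)) + Q (fun i x => 2^-1 * (G i x - H i x)) <= 2^-1 * (Q G + Q H).
Proof.
move=> fG fH; rewrite /Q -!big_split /= mulr_sumr; apply: ler_sum => i _.
have fD := inLpZ oO 2^-1 p0 (inLpD oO p1 (fG i) (fH i)).
have fB := inLpZ oO 2^-1 p0 (inLpB oO p1 (fG i) (fH i)).
have lD := rint_lin oO 1 (L1_pow fD) (L1_pow fB).
have lS := rint_lin oO 1 (L1_pow (fG i)) (L1_pow (fH i)).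
have iS := L1_lin oO 1 (L1_pow (fG i)) (L1_pow (fH i)).
rewrite !mul1r in lD lS.
rewrite /ipr -lD -lS -(RintZ oO 2^-1 iS); apply: (rint_le_ae oO).
- exact: (L1_lin oO 1 (L1_pow fD) (L1_pow fB)).
- exact: (integrableZl mo _ iS).
by apply: aeW => x _; rewrite !mul1r; exact: clarkson.
Qed.

Lemma gn_Q G H (e : R) : 0 < e -> Gin Om p G -> Gin Om p H ->
  Q (fun i x => 2^-1 * (G i x - H i x)) <= (e / 4) `^ p -> gn Om p (gsub G H) <= e.
Proof.
move=> e0 fG fH hQ; have e4 : 0 < e / 4 by rewrite divr_gt0.
have b i : rn Om p (gsub G H i) <= e / 2.
  have fB := inLpB oO p1 (fG i) (fH i); have fh := inLpZ oO 2^-1 p0 fB.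
  have -> : gsub G H i = (fun x => 2 * (2^-1 * (G i x - H i x))).
    by apply/funext => x; rewrite mulrA mulfV// mul1r.
  have [mh _] := fh.
  have h1 : rn Om p (fun x => 2^-1 * (G i x - H i x)) <= e / 4.
    rewrite rn_ipr// -[leRHS](powRK (lt0r_neq0 p0) (ltW e4)); apply: powR_mono; rewrite ?invr_ge0 ?(ltW p0) ?ipr_ge0//.
    by apply: le_trans hQ; rewrite /Q (bigD1 i)//= lerDl sumr_ge0// => k _; exact: ipr_ge0.
  rewrite -lee_fin -(rnE p0 (inLpZ oO 2 p0 fh)) (LnrZ lam 2 mo mh p0) (rnE p0 fh) -EFinM lee_fin.
  by rewrite ger0_norm//; lra.
by rewrite /gn !big_ord_recl big_ord0 addr0; have := lerD (b 0) (b (lift ord0 ord0)); lra.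
Qed.

(* Weak compactness through nearest points: the elements of almost minimal norm in the
   decreasing convex sets [Kset n] form a Cauchy sequence by Clarkson's inequality. *)
Lemma weak_limit (I : Type) (ell : I -> field -> R) (u : nat -> plane R -> R) (G : nat -> field) (B : R) :
  (forall i G H, Gin Om p G -> Gin Om p H ->
     ell i (fun k x => 2^-1 * (G k x + H k x)) = 2^-1 * (ell i G + ell i H)) ->
  (forall i, exists2 C : R, 0 <= C & forall G H, Gin Om p G -> Gin Om p H ->
     `|ell i G - ell i H| <= C * gn Om p (gsub G H)) ->
  (forall n, sob0 Om p (u n) (G n)) -> (forall n, Q (G n) <= B) ->
  (forall i (e : R), 0 < e -> exists N, forall n, (N <= n)%N -> `|ell i (G n)| <= e) ->
  exists u0 G0, sob0 Om p u0 G0 /\ forall i, ell i G0 = 0.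
Proof.
move=> aff lipe su QB ell0.
pose Kset n : set field := [set F | (exists v, sob0 Om p v F) /\
  forall i (e : R), (forall m, (n <= m)%N -> `|ell i (G m)| <= e) -> `|ell i F| <= e].
have KG m n : (n <= m)%N -> Kset n (G m) by move=> nm; split; [exists (u m)|move=> i e; exact].
have Kmono m n : (n <= m)%N -> Kset m `<=` Kset n.
  by move=> nm F [sF hF]; split => // i e h; apply: hF => k mk; apply: h; exact: leq_trans mk.
have Kmid n F F' : Kset n F -> Kset n F' -> Kset n (fun k x => 2^-1 * (F k x + F' k x)).
  move=> [[v sv] hF] [[v' sv'] hF']; split.
    exists (fun x => 2^-1 * v x + 2^-1 * v' x).
    (* [sob0_lin] has a coefficient on its first argument only, so half of [v'] is written
       [(1/2 - 1) v' + v']. *)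
    have s2 := sob0_lin oO L0 OmL (2^-1 - 1) p1 sv' sv'.
    have := sob0_lin oO L0 OmL 2^-1 p1 sv s2.
    rewrite (_ : (fun x => _) = (fun x => 2^-1 * v x + 2^-1 * v' x)); last by apply/funext => x; ring.
    by rewrite (_ : (fun i x => _) = (fun k x => 2^-1 * (F k x + F' k x)))//; apply/funext => k; apply/funext => x; ring.
  move=> i e h; rewrite aff; [|by case: (sob0_in sv)|by case: (sob0_in sv')].
  rewrite normrM ger0_norm//; apply: (@le_trans _ _ (2^-1 * (`|ell i F| + `|ell i F'|))).
    by rewrite ler_wpM2l// ler_normD.
  by have := hF i e h; have := hF' i e h; lra.
have Q0 F : 0 <= Q F by apply: sumr_ge0 => i _; exact: ipr_ge0.
pose dn n := inf [set Q F | F in Kset n].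
have Kinf n : has_inf [set Q F | F in Kset n].
  split; first by exists (Q (G n)); exists (G n) => //; exact: KG.
  by exists 0 => _ [F _ <-].
have dn_le n F : Kset n F -> dn n <= Q F.
  by move=> KF; apply: ge_inf; [case: (Kinf n)|exists F].
have dnB n : dn n <= B by apply: le_trans (QB n); apply: dn_le; exact: KG.
pose D := sup (range dn).
have hD : has_sup (range dn).
  by split; [exists (dn 0%N); exists 0%N|exists B => _ [n _ <-]; exact: dnB].
have dnD n : dn n <= D by apply: ub_le_sup; [case: hD|exists n].
have dn_mono m n : (n <= m)%N -> dn n <= dn m.
  move=> nm; apply: lb_le_inf; first by case: (Kinf m).
  by move=> _ [F KF <-]; apply: dn_le; exact: Kmono KF.
have /choice[w hw] : forall n, exists F, Kset n F /\ Q F < dn n + n.+1%:R^-1.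
  move=> n; have n0 : 0 < n.+1%:R^-1 :> R by [].
  by have [_ [F KF <-] lt] := inf_adherent n0 (Kinf n); exists F.
have /choice[v hv] : forall n, exists f, sob0 Om p f (w n).
  by move=> n; case: (hw n) => -[[f sf] _] _; exists f.
have fw n : Gin Om p (w n) by case: (sob0_in (hv n)).
have cau (e : R) : 0 < e -> exists N, forall m n, (N <= m)%N -> (N <= n)%N -> gn Om p (gsub (w m) (w n)) <= e.
  (* By Clarkson's inequality, [Q] of half the difference is at most [(D + d) - dn N], the midpoint
     being in the set with infimum [dn N]; this is below [2 d]. *)
  move=> e0; pose d := (e / 4) `^ p / 2; have d0 : 0 < d by rewrite divr_gt0// powR_gt0// divr_gt0.
  have [_ [N1 _ <-] hN1] := sup_adherent d0 hD.
  have [N2 _ hN2] := near_infty_natSinv_lt (PosNum d0).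
  pose N := (N1 + N2)%N.
  have DN : D - d < dn N by apply: lt_le_trans hN1 _; apply: dn_mono; exact: leq_addr.
  have Qw n : (N <= n)%N -> Q (w n) <= D + d.
    move=> Nn; apply: le_trans (ltW (hw n).2) _; apply: lerD => //.
    by apply: ltW; apply: hN2 => /=; apply: leq_trans Nn; exact: leq_addl.
  exists N => m n Nm Nn; apply: gn_Q => //.
  have K1 := Kmono _ _ Nm _ (hw m).1; have K2 := Kmono _ _ Nn _ (hw n).1.
  have := Q_clarkson (fw m) (fw n); have := dn_le _ _ (Kmid _ _ _ K1 K2).
  have := Qw m Nm; have := Qw n Nn; rewrite (_ : (e / 4) `^ p = 2 * d); last by rewrite /d; field.
  clear -DN; move: DN; move: (Q _) (Q _) (Q _) (Q _) (dn N) => a1 a2 a3 a4 a5; move: (D) (d) => a6 a7; lra.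
have [u0 [G0 [s0 lim]]] := sob0_complete_p hv cau.
exists u0, G0; split => // i.
have fG0 : Gin Om p G0 by case: (sob0_in s0).
have [C C0 hC] := lipe i.
apply/eqP; rewrite -normr_le0; apply/ler_addgt0Pr => e e0; rewrite add0r.
have C1 : 0 < 2 * (C + 1) by rewrite mulr_gt0// ltr_wpDl.
have e2 : 0 < e / 2 by rewrite divr_gt0.
have [N1 h1] := ell0 i _ e2; have [N2 h2] := lim _ (divr_gt0 e0 C1).
pose n := (N1 + N2)%N.
have a1 : `|ell i (w n)| <= e / 2.
  by apply: (hw n).1.2 => m nm; apply: h1; apply: leq_trans nm; exact: leq_addr.
have a2 := hC _ _ (fw n) fG0.
have a3 : C * gn Om p (gsub (w n) G0) <= e / 2.
  apply: (@le_trans _ _ (C * (e / (2 * (C + 1))))).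
    by rewrite ler_wpM2l//; apply: h2; exact: leq_addl.
  rewrite mulrCA ler_pM2l// invfM mulrA ler_pdivrMr ?ltr_wpDl//; lra.
have := ler_normB (ell i (w n)) (ell i (w n) - ell i G0).
rewrite opprB addrC subrK; lra.
Qed.

End weak_limits.

(** * Sobolev norms and functionals *)

Section sobolev_bounds.
Context {R : realType}.
Local Notation lam := (@lam R).
Variables (L : R) (Om : set (R * R)).
Hypothesis (oO : open Om) (L0 : 0 < L) (OmL : forall x, Om x -> `|x| <= L).
Local Notation O := (Om : set (plane R)).
Let mo := mO oO.
Local Notation field := ('I_2 -> plane R -> R).
Implicit Types (u v : plane R -> R) (G H : field).

Lemma snE q u G : 0 < q -> inLp Om q u -> Gin Om q G -> sn Om q u G = (rn Om q u + gn Om q G)%:E.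
Proof.
move=> q0 fu fG; rewrite /sn EFinD (rnE q0 fu) /gn -sumEFin; congr (_ + _)%E.
by apply: eq_bigr => i _; rewrite (rnE q0 (fG i)).
Qed.

Lemma sob_in q u G : sob Om q u G -> inLp Om q u /\ Gin Om q G.
Proof. by move=> [fu fG]; split; [exact: fu|move=> i; exact: (fG i).2]. Qed.

(** The constant of [sn_interp_le], which compares the full norm of a discrete function with its
    gradient; it also serves as Poincare constant. *)
Definition CE : R := 3 * L * (3 * 2 ^+ 14) + 2.

Lemma CE_gt0 : 0 < CE.
Proof. by rewrite /CE ltr_wpDl// mulr_ge0// ?mulr_ge0 ?exprn_ge0// ltW. Qed.

Section one_mesh.
Variables (n : nat) (p : 'I_n -> 'I_3 -> R * R) (s : R) (h : 'I_n -> R).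
Hypothesis M : is_mesh Om p s h.

Lemma gnormS_ge0 w q : 0 <= \sum_j tau p j * gnorm p w j `^ q.
Proof. by apply: sumr_ge0 => j _; rewrite mulr_ge0 ?powR_ge0// ltW// (tau_gt0 M). Qed.

(** Minkowski's inequality for the sum of the absolute partial derivatives, which equals [gnorm] on
    each triangle. *)
Lemma gnorm_gn w q : 1 <= q -> bdry0 Om p w ->
  (\sum_j tau p j * gnorm p w j `^ q) `^ q^-1 <= gn Om q (Dg p w).
Proof.
move=> q1 w0; have q0 : 0 < q by lra.
pose F (x : plane R) := `|Dg p w 0 x| + `|Dg p w 1 x|.
have fD := Gin_Dg M L0 OmL q1 w0.
have mD i : measurable_fun setT (fun x => `|Dg p w i x|).
  by apply: measurableT_comp => //; exact: measurable_Dg.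
have mDO i : measurable_fun O (fun x => `|Dg p w i x|) by exact: measurable_funTS.
have mF : measurable_fun setT F by exact: measurable_funD.
have mFq : measurable_fun setT (fun x => F x `^ q) by apply: (measurableT_comp (measurable_powR q)).
have F0 x : 0 <= F x by rewrite addr_ge0.
have E : Ip lam O q F = (\sum_j tau p j * gnorm p w j `^ q)%:E.
  rewrite /Ip (eq_integral (fun x => (F x `^ q)%:E)); last by move=> x _; rewrite ger0_norm.
  rewrite (ge0_integral_mesh M mFq); last by move=> x; exact: powR_ge0.
  rewrite -sumEFin; apply: eq_bigr => j _.
  have mT := measurable_tri p j.
  rewrite (@ae_eq_integral _ _ _ _ _ (fun=> (gnorm p w j `^ q)%:E)) //.
  - by rewrite (integral_cst lam mT) (tauE M) -EFinM mulrC.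
  - by apply/measurable_EFinP; exact: measurable_funTS.
  - have := ae_Dg M w; apply: filterS => x hx xj.
    by rewrite /F !(hx j xj) /gnorm /n1 /co.
have LF : Lnr lam O q F = ((\sum_j tau p j * gnorm p w j `^ q) `^ q^-1)%:E.
  by rewrite (LnrE lam O F q0) E poweR_EFin.
rewrite -lee_fin -LF; apply: le_trans (LnrD lam mo (mDO 0) (mDO 1) q1) _.
have nrm i : Lnr lam O q (fun x => `|Dg p w i x|) = (rn Om q (Dg p w i))%:E.
  rewrite -(rnE q0 (fD i)) (LnrE lam O (fun x => `|Dg p w i x|) q0) (LnrE lam O (Dg p w i) q0); congr (_ `^ _)%E; apply: eq_integral => x _.
  by rewrite normr_id.
rewrite !nrm -EFinD lee_fin /gn !big_ord_recl big_ord0 addr0 lerD2l.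
by rewrite (_ : lift ord0 ord0 = 1)//; apply: val_inj.
Qed.

Lemma rn_interp w q : 3 / 2 <= q <= 3 -> bdry0 Om p w ->
  rn Om q (interp p w) + gn Om q (Dg p w) <= CE * gn Om q (Dg p w).
Proof.
move=> hq w0; have q1 : 1 <= q by move/andP: hq => [? _]; lra.
have q0 : 0 < q by lra.
have [fi fD] := sob_in (sob_interp M L0 OmL q1 w0).
rewrite -lee_fin -(snE q0 fi fD); apply: le_trans (sn_interp_le M L0 OmL hq w0) _.
by rewrite lee_fin -/CE ler_wpM2l ?(ltW CE_gt0)// gnorm_gn.
Qed.

End one_mesh.

Variables (s : R).
Hypothesis fam : forall H : R, 0 < H -> exists n (p : 'I_n -> 'I_3 -> R * R) h, is_mesh Om p s h /\ forall j, h j <= H.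
Hypothesis O0 : Om !=set0.

Lemma test_bdry0 n (p : 'I_n -> 'I_3 -> R * R) phi : test_function Om phi -> bdry0 Om p phi.
Proof. by move=> [_ _ sO] j i nO; apply: esupp0 => /sO. Qed.

(** The maximal function yields the inequality for discrete functions. Interpolation on fine meshes
    ([nodal_test]) transfers it to test functions, and density to W^{1,q}_0. *)
Lemma poincare_p q u G : 3 / 2 <= q <= 3 -> sob0 Om q u G -> rn Om q u <= CE * gn Om q G.
Proof.
move=> hq; have q1 : 1 <= q by move/andP: hq => [? _]; lra.
have q0 : 0 < q by lra.
have C0 := CE_gt0.
have test phi : test_function Om phi -> rn Om q phi <= CE * gn Om q (fun i => partial i phi).
  move=> tp; have [C C00 hC] := nodal_test oO L0 OmL s O0 q1 tp.
  have st := test_sob oO L0 OmL q1 tp; have [fp fG] := sob_in st.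
  apply/ler_addgt0Pr => e e0.
  have c1 : 0 < C * (1 + CE) + 1 by rewrite ltr_wpDl// mulr_ge0// addr_ge0// ltW.
  have H0 : 0 < e / (C * (1 + CE) + 1) by rewrite divr_gt0.
  have [n [p [h [M hH]]]] := fam H0.
  have p0 := test_bdry0 (p := p) tp.
  have := hC n p h M _ hH.
  have [fi fD] := sob_in (sob_interp M L0 OmL q1 p0).
  have fB : Gin Om q (fun i x => Dg p phi i x - partial i phi x) by move=> i; exact: (inLpB oO q1 (fD i) (fG i)).
  rewrite (snE q0 (inLpB oO q1 fi fp) fB).
  rewrite lee_fin; set a := rn _ _ _; set b := gn _ _ _ => ab.
  have a0 : 0 <= a by exact: rn_ge0.
  have b0 : 0 <= b by exact: gn_ge0.
  have h1 : rn Om q phi <= a + rn Om q (interp p phi).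
    have := rn_lin oO (-1) q1 (inLpB oO q1 fi fp) fi.
    rewrite normrN1 mul1r -/a; congr (rn _ _ _ <= _); apply/funext => x; ring.
  have h2 : gn Om q (Dg p phi) <= b + gn Om q (fun i => partial i phi).
    have := gn_lin oO 1 q1 fB fG.
    rewrite normr1 mul1r -/b; congr (gn _ _ _ <= _); apply/funext => i; apply/funext => x; ring.
  have h3 := rn_interp M hq p0.
  have h4 : CE * gn Om q (Dg p phi) <= CE * (b + gn Om q (fun i => partial i phi)) by rewrite ler_wpM2l// ltW.
  have h5 : 0 <= gn Om q (Dg p phi) by exact: gn_ge0.
  have h6 : a + CE * b <= e.
    apply: (@le_trans _ _ (C * (e / (C * (1 + CE) + 1)) * (1 + CE))).
      move: ab; move: (C * _) => t ab; move: (CE) C0 => K K0.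
      have k1 : K * b <= K * t by rewrite ler_wpM2l ?(ltW K0)//; lra.
      lra.
    rewrite mulrAC mulrA ler_pdivrMr// mulrC ler_pM2l//; lra.
  by move: h1 h2 h3 h4 h5 h6; rewrite mulrDr; lra.
move=> su; have [[fu fG] ap] := su.
have fG' : Gin Om q G by move=> i; case: (fG i).
apply/ler_addgt0Pr => e e0.
have d0 : 0 < e / (CE + 1) by rewrite divr_gt0// addr_gt0.
have [phi tp] := ap _ d0.
have [fp fP] := sob_in (test_sob oO L0 OmL q1 tp).
have fB : Gin Om q (fun i x => G i x - partial i phi x) by move=> i; exact: (inLpB oO q1 (fG' i) (fP i)).
rewrite (snE q0 (inLpB oO q1 fu fp) fB).
rewrite lte_fin; set a := rn _ _ _; set b := gn _ _ _; rewrite (ltr_pdivlMr _ _ (addr_gt0 C0 ltr01)) => ab.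
have a0 : 0 <= a by exact: rn_ge0.
have b0 : 0 <= b by exact: gn_ge0.
have h1 : rn Om q u <= a + rn Om q phi.
  have := rn_lin oO 1 q1 (inLpB oO q1 fu fp) fp.
  rewrite normr1 mul1r -/a; congr (rn _ _ _ <= _); apply/funext => x; ring.
have h2 : gn Om q (fun i => partial i phi) <= b + gn Om q G.
  have := gn_lin oO (-1) q1 fB fG'.
  rewrite normrN1 mul1r -/b; congr (gn _ _ _ <= _); apply/funext => i; apply/funext => x; ring.
have h4 : CE * gn Om q (fun i => partial i phi) <= CE * (b + gn Om q G) by rewrite ler_wpM2l// ltW.
have h5 := test _ tp.
have h6 : 0 <= CE * a by rewrite mulr_ge0// ltW.
by move: h1 h2 h4 h5 h6 ab; rewrite !mulrDr !mulrDl !mulr1; lra.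
Qed.

End sobolev_bounds.

(** * Functionals on W^{1,q}_0 *)

Section dual.
Context {R : realType}.
Local Notation lam := (@lam R).
Variables (L : R) (Om : set (R * R)).
Hypothesis (oO : open Om) (L0 : 0 < L) (OmL : forall x, Om x -> `|x| <= L).
Local Notation O := (Om : set (plane R)).
Variables (p q : R) (f : (R * R -> R) -> R).
Hypothesis (p1 : 1 < p) (q1 : 1 <= q) (pq : p^-1 + q^-1 = 1).
Hypothesis Wf : Wm1 Om p%:E f.
Let q0 : 0 < q. Proof. by move: q1 => ?; lra. Qed.

Lemma conj_pq : hoelder_conjugate p%:E = q%:E.
Proof.
have p0 : p != 0 by rewrite gt_eqF// (lt_trans ltr01).
have q00 : q != 0 by rewrite gt_eqF.
apply/esym; apply/hoelder_conjugateP; rewrite ?ltNyr ?eqe//.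
by rewrite !inver (negbTE p0) (negbTE q00) -EFinD pq.
Qed.

Definition dn : R := fine (dual_norm Om p%:E f).

Lemma test0 : test_function Om (fun=> 0).
Proof.
have E : [set x : R * R | (0 : R) != 0] = set0 by apply/seteqP; split => x //=; rewrite eqxx.
by split; [apply: tensor_smooth; exact: tensor0|rewrite E closure0; exact: compact0|rewrite E closure0].
Qed.

Lemma f_lin k u v G H : sob0 Om q u G -> sob0 Om q v H ->
  f (fun x => k * u x + v x) = k * f u + f v.
Proof.
move=> su sv; have := Wf.1; rewrite conj_pq; apply.
  exact: (sob0_W1_0 oO L0 OmL q1 su).
exact: (sob0_W1_0 oO L0 OmL q1 sv).
Qed.

Lemma sob0Z (t : R) u G : sob0 Om q u G -> sob0 Om q (fun x => t * u x) (fun i x => t * G i x).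
Proof.
move=> su; have := sob0_lin oO L0 OmL (t - 1) q1 su su.
rewrite (_ : (fun x => _) = (fun x => t * u x)); last by apply/funext => x; ring.
by rewrite (_ : (fun i x => _) = (fun i x => t * G i x))//; apply/funext => i; apply/funext => x; ring.
Qed.

Lemma fZ (t : R) u G : sob0 Om q u G -> f (fun x => t * u x) = t * f u.
Proof.
move=> su; have := f_lin (t - 1) su su.
rewrite (_ : (fun x => _) = (fun x => t * u x)); last by apply/funext => x; ring.
by move=> ->; ring.
Qed.

Lemma rnZ (t : R) u : 0 <= t -> inLp Om q u -> rn Om q (fun x => t * u x) = t * rn Om q u.
Proof.
move=> t0 fu; have [mu _] := fu; apply: EFin_inj.
by rewrite EFinM -(rnE q0 fu) -(rnE q0 (inLpZ oO t q0 fu)) (LnrZ lam t (mO oO) mu q0) ger0_norm.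
Qed.

Lemma dual_sup u G : sob0 Om q u G -> rn Om q u + gn Om q G <= 1 ->
  ((`|f u|)%:E <= dual_norm Om p%:E f)%E.
Proof.
move=> su h; rewrite /dual_norm conj_pq; apply: ereal_sup_ubound; exists u => //.
split; first exact: (sob0_W1_0 oO L0 OmL q1 su).
have [fu fG] := sob_in su.1.
by rewrite (sob_normE oO q1 su.1) (snE q0 fu fG) lee_fin.
Qed.

Lemma dual_ge0 : (0 <= dual_norm Om p%:E f)%E.
Proof.
have s0 := sob0Z 0 (test_sob0 oO L0 OmL q1 test0).
apply: le_trans (dual_sup s0 _); first by rewrite lee_fin.
have [f0 fG] := sob_in (test_sob oO L0 OmL q1 test0).
rewrite (rnZ (lexx 0) f0) mul0r add0r /gn big1 ?ler01// => i _.
by rewrite (rnZ (lexx 0) (fG i)) mul0r.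
Qed.

Lemma dualE : dual_norm Om p%:E f = dn%:E.
Proof. by rewrite /dn fineK// ge0_fin_numE ?dual_ge0//; case: Wf. Qed.

Lemma dn_ge0 : 0 <= dn.
Proof. by rewrite -lee_fin -dualE dual_ge0. Qed.

Lemma dual_bound u G : sob0 Om q u G -> `|f u| <= dn * (rn Om q u + gn Om q G).
Proof.
move=> su; have [fu fG] := sob_in su.1; set N := rn _ _ _ + _.
have N0 : 0 <= N by rewrite addr_ge0 ?rn_ge0 ?gn_ge0.
have key t : 0 < t -> t * N <= 1 -> t * `|f u| <= dn.
  move=> t0 tN; have := @dual_sup _ _ (sob0Z t su).
  rewrite (fZ t su) normrM (gtr0_norm t0) dualE lee_fin; apply.
  have gZ : gn Om q (fun i x => t * G i x) = t * gn Om q G.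
    by rewrite /gn mulr_sumr; apply: eq_bigr => i _; exact: (rnZ (ltW t0) (fG i)).
  by rewrite (rnZ (ltW t0) fu) gZ -mulrDr.
(* For norm 0 every multiple of [u] is admissible in the supremum, which forces [f u = 0]. *)
have [Nz|Nz] := eqVneq N 0.
  rewrite Nz mulr0; apply/ler_addgt0Pr => e e0; rewrite add0r.
  have d1 : 0 < dn + 1 by rewrite ltr_wpDl// dn_ge0.
  have := key ((dn + 1) / e) (divr_gt0 d1 e0); rewrite Nz mulr0 ler01 => /(_ isT).
  rewrite mulrAC ler_pdivrMr// => h; rewrite -(ler_pM2l d1); apply: le_trans h _.
  by rewrite ler_pM2r// lerDl.
have Np : 0 < N by rewrite lt_neqAle eq_sym Nz.
have := key N^-1; rewrite invr_gt0 Np mulVf// lexx => /(_ isT isT).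
by rewrite ler_pdivrMl// mulrC.
Qed.
End dual.

(** * Convergence of the Galerkin solutions *)

Lemma sum2_le (R : realType) (F : 'I_2 -> R) (a : R) : (forall i, F i <= a) -> \sum_i F i <= 2 * a.
Proof.
by move=> h; rewrite !big_ord_recl big_ord0 addr0; have := lerD (h 0) (h (lift ord0 ord0)); lra.
Qed.

Section galerkin_convergence.
Context {R : realType}.
Local Notation lam := (@lam R).
Variables (L : R) (Om : set (R * R)).
Hypothesis (oO : open Om) (L0 : 0 < L) (OmL : forall x, Om x -> `|x| <= L).
Local Notation O := (Om : set (plane R)).
Variables (o : R * R) (r : R).
Hypothesis (r0 : 0 < r) (hr : forall y, `|y - o| < r -> Om y).
Variable s : R.
Hypothesis fam : forall H : R, 0 < H ->
  exists n (p : 'I_n -> 'I_3 -> R * R) h, is_mesh Om p s h /\ forall j, h j <= H.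
Variables (A : R * R -> 'M[R]_2) (c Lm : R).
Hypothesis mA : forall i k, measurable_fun O (fun x : plane R => A x i k).
Hypothesis Lm0 : 0 < Lm.
Hypothesis AL : {ae lam, forall x : plane R, O x -> forall i k, `|A x i k| <= Lm}.
Hypothesis Ac : {ae lam, forall x : plane R, O x -> forall a : 'I_2 -> R,
  c * \sum_i a i ^+ 2 <= \sum_i (\sum_k A x i k * a k) * a i}.
Hypothesis c0 : 0 < c.
Let mo := mO oO.
Local Notation field := ('I_2 -> plane R -> R).
Local Notation bf := (bf Om A).
Local Notation dphi phi := (fun i => partial i phi).

Let O0 : Om !=set0. Proof. by exists o; apply: hr; rewrite subrr normr0. Qed.

Lemma sob0_embed q1 q2 (u : plane R -> R) (G : field) : 1 <= q1 -> q1 <= q2 -> sob0 Om q2 u G -> sob0 Om q1 u G.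
Proof.
move=> h1 h2 [[fu fG] ap]; have q10 : 0 < q1 by lra.
have q21 : 1 <= q2 by lra.
have q20 : 0 < q2 by lra.
have su : sob Om q1 u G.
  split; first exact: (rn_embed oO L0 OmL q10 h2 fu).1.
  by move=> i; have [w fi] := fG i; split; [exact: w|exact: (rn_embed oO L0 OmL q10 h2 fi).1].
split => // e e0; have E0 := embC_gt0 Om q1.
have [phi tp apx] := ap _ (divr_gt0 e0 E0); exists phi; first exact: tp.
have [fp fP] := sob_in (test_sob oO L0 OmL q21 tp).
have fd := inLpB oO q21 fu fp.
have fD : Gin Om q2 (fun i x => G i x - partial i phi x) by move=> i; exact: (inLpB oO q21 (fG i).2 (fP i)).
have [a1 a2] := rn_embed oO L0 OmL q10 h2 fd; have [b1 b2] := gn_embed oO L0 OmL q10 h2 fD.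
move: apx; rewrite (snE q20 fd fD) (snE q10 a1 b1) !lte_fin ltr_pdivlMr// mulrC mulrDr.
by apply: le_lt_trans; exact: lerD.
Qed.

Variable d : R.
Hypothesis d01 : 0 < d <= 1.
Hypothesis d_small : d * (16 * Lm * truncC s * maxC s) <= c / 2.
Local Notation p := (2 + d).
Local Notation q := ((2 + d) / (1 + d)).
Let d0 : 0 < d. Proof. by case/andP: d01. Qed.
Let d1 : d <= 1. Proof. by case/andP: d01. Qed.
Let p1 : 1 <= p. Proof. by move: d0 => ?; lra. Qed.
Let p0 : 0 < p. Proof. by move: d0 => ?; lra. Qed.
Let p2 : 2 <= p. Proof. by move: d0 => ?; lra. Qed.
Let e0 : 0 < 1 + d. Proof. by move: d0 => ?; lra. Qed.
Let q32 : 3 / 2 <= q <= 3.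
Proof. by rewrite ler_pdivlMr// ler_pdivrMr//; move: d0 d1 => ? ?; apply/andP; split; lra. Qed.
Let p32 : 3 / 2 <= p <= 3. Proof. by move: d0 d1 => ? ?; apply/andP; split; lra. Qed.
Let q1 : 1 <= q. Proof. by case/andP: q32 => ? _; lra. Qed.
Let q0 : 0 < q. Proof. by move: q1 => ?; lra. Qed.
Let pq : p^-1 + q^-1 = 1. Proof. by field; rewrite !gt_eqF. Qed.
Let p11 : 1 < p. Proof. by move: d0 => ?; lra. Qed.

Variable f : (R * R -> R) -> R.
Hypothesis Wf : Wm1 Om p%:E f.
Local Notation D := (dn Om p f).
Let D0 : 0 <= D. Proof. exact: (dn_ge0 oO L0 OmL p11 q1 pq Wf). Qed.

Definition stabC : R := `|2 * (2 + 8 * truncC s) * (1 + maxC s) / (c / 2)|.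
Local Notation S := stabC.
Let S0 : 0 <= S. Proof. exact: normr_ge0. Qed.

Section one_mesh.
Variables (n : nat) (P : 'I_n -> 'I_3 -> R * R) (h : 'I_n -> R).
Hypothesis M : is_mesh Om P s h.

Definition galer w := bdry0 Om P w /\ forall phi, bdry0 Om P phi ->
  bf (Dg P w) (Dg P phi) = - f (interp P phi).

Lemma interp_s0 q' w : 1 <= q' -> bdry0 Om P w -> sob0 Om q' (interp P w) (Dg P w).
Proof. by move=> h1 w0; exact: (interp_sob0 M L0 OmL r0 hr w0 h1). Qed.

Lemma nodal_linear_f : nodal_linear Om P (fun v => - f (interp P v)).
Proof.
split=> [v w vw|k v w v0 w0]; first by rewrite (interp_congr vw).
rewrite interp_lin (f_lin oO L0 OmL p11 q1 pq Wf k (interp_s0 q1 v0) (interp_s0 q1 w0)); ring.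
Qed.

Lemma galer_ex : exists w, galer w.
Proof.
have [w w0 h1] := discrete_ex M L0 OmL mA Lm0 AL Ac c0 nodal_linear_f.
by exists w.
Qed.

Lemma galer_uniq w w' : galer w -> galer w' -> veq P w w'.
Proof.
move=> [w0 hw] [w0' hw']; apply: (discrete_uniq M L0 OmL mA Lm0 AL Ac c0 w0 w0') => v v0.
by rewrite hw ?hw'.
Qed.

(** Used twice: with [K] from the functional [f] for the uniform bound, and with [K] from an
    approximation error for convergence. *)
Lemma stability w K : 0 <= K -> bdry0 Om P w ->
  (forall phi, bdry0 Om P phi -> bf (Dg P w) (Dg P phi) <=
     K * (\sum_j tau P j * gnorm P phi j `^ q) `^ q^-1) ->
  (\sum_j tau P j * gnorm P w j `^ p) `^ p^-1 <= S * K.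
Proof.
move=> K0 w0 hK; apply: le_trans (discrete_stability M L0 OmL mA Lm0 AL Ac c0 d01 K0 w0 _ d_small) _.
  by move=> phi phi0; have := hK phi phi0; rewrite invf_div.
by rewrite ler_wpM2r// /stabC ler_norm.
Qed.

Lemma galer_bound w : galer w -> (\sum_j tau P j * gnorm P w j `^ p) `^ p^-1 <= S * (D * CE L).
Proof.
move=> [w0 hw]; have C0 := CE_gt0 L0.
apply: stability => //; first by rewrite mulr_ge0// ltW.
move=> phi phi0; rewrite hw//.
have si := interp_s0 q1 phi0; have [fi fD] := sob_in si.1.
apply: le_trans (ler_norm _) _; rewrite normrN.
apply: le_trans (dual_bound oO L0 OmL p11 q1 pq Wf si) _.
rewrite -mulrA ler_wpM2l// -lee_fin -(snE q0 fi fD).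
exact: (sn_interp_le M L0 OmL q32 phi0).
Qed.

Lemma galer_gn w : galer w -> gn Om p (Dg P w) <= 2 * (S * (D * CE L)).
Proof.
move=> gw; have [w0 _] := gw; apply: le_trans (gn_Dg M L0 OmL p1 w0) _.
by rewrite ler_wpM2l// galer_bound.
Qed.

Lemma galer_sn w : galer w ->
  (sn Om p (interp P w) (Dg P w) <= (CE L * (S * CE L) * D)%:E)%E.
Proof.
move=> gw; have [w0 _] := gw; apply: le_trans (sn_interp_le M L0 OmL p32 w0) _.
rewrite lee_fin -/(CE L) -mulrA ler_wpM2l ?(ltW (CE_gt0 L0))//.
apply: le_trans (galer_bound gw) _; rewrite le_eqVlt; apply/orP; left; apply/eqP; ring.
Qed.

Lemma Q_Dg w : bdry0 Om P w -> Q Om p (Dg P w) <= 2 * \sum_j tau P j * gnorm P w j `^ p.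
Proof.
move=> w0; have b i : ipr Om p (Dg P w i) <= \sum_j tau P j * gnorm P w j `^ p.
  have fi := Gin_Dg M L0 OmL p1 w0 i.
  rewrite -lee_fin; apply: le_trans (Ip_Dg_le M w i (ltW p0)).
  by rewrite /ipr /Rintegral fineK// -/(Ip _ _ _ _) ge0_fin_numE ?Ip_ge0//; case: fi.
exact: sum2_le b.
Qed.

End one_mesh.

Lemma dphi_in q' phi : 1 <= q' -> test_function Om phi -> Gin Om q' (dphi phi).
Proof. by move=> h1 tp; exact: (sob_in (test_sob oO L0 OmL h1 tp)).2. Qed.

(** Testing with [phi] in place of its interpolant costs the interpolation error, of order [H],
    times the uniform bounds of the discrete gradient and of [f]. *)
Lemma galer_residual phi : test_function Om phi -> exists2 C : R, 0 <= C &
  forall n (P : 'I_n -> 'I_3 -> R * R) h, is_mesh Om P s h ->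
  forall H, (forall j, h j <= H) -> forall w, galer P w ->
  `|bf (Dg P w) (dphi phi) + f phi| <= C * H.
Proof.
move=> tp; have [C C0 hC] := nodal_test oO L0 OmL s O0 q1 tp.
pose B := 2 * Lm * (2 * (S * (D * CE L))) + D.
have CE0 := CE_gt0 L0.
have B0 : 0 <= B.
  rewrite addr_ge0// mulr_ge0 ?mulr_ge0 ?(ltW Lm0)//; last exact: ltW.
exists (B * C); first exact: mulr_ge0.
move=> n P h M H hH w gw; have [w0 hw] := gw.
have phi0 := test_bdry0 (p := P) tp.
have si := interp_s0 M q1 phi0; have st := test_sob0 oO L0 OmL q1 tp.
have fw := Gin_Dg M L0 OmL p1 w0; have [fi fD] := sob_in si.1; have fP := dphi_in q1 tp.
have [ft _] := sob_in st.1.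
have fB : Gin Om q (fun i x => Dg P phi i x - partial i phi x) by move=> i; exact: (inLpB oO q1 (fD i) (fP i)).
have sB := sob0B oO L0 OmL q1 si st.
have := hC n P h M H hH; rewrite (snE q0 (inLpB oO q1 fi ft) fB) lee_fin => hb.
have g0 := gn_ge0 Om q (fun i x => Dg P phi i x - partial i phi x).
have rn0 := rn_ge0 Om q (fun x => interp P phi x - phi x).
have e1 : bf (Dg P w) (fun i x => Dg P phi i x - partial i phi x) =
    bf (Dg P w) (Dg P phi) - bf (Dg P w) (dphi phi).
  have := bf_linr oO mA (ltW Lm0) AL (-1) p1 q1 pq fw fP fD.
  rewrite mulN1r addrC => <-; congr (bf _ _); apply/funext => i; apply/funext => x; ring.
have e2 : f (fun x => interp P phi x - phi x) = f (interp P phi) - f phi.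
  have := f_lin oO L0 OmL p11 q1 pq Wf (-1) st si.
  rewrite mulN1r addrC => <-; congr f; apply/funext => x; ring.
have -> : bf (Dg P w) (dphi phi) + f phi =
    - (bf (Dg P w) (fun i x => Dg P phi i x - partial i phi x) + f (fun x => interp P phi x - phi x)).
  by rewrite e1 e2 hw//; ring.
rewrite normrN; apply: le_trans (ler_normD _ _) _.
have b1 := bf_le oO mA (ltW Lm0) AL p1 q0 pq fw fB.
have b2 := dual_bound oO L0 OmL p11 q1 pq Wf sB.
have b3 : 2 * Lm * gn Om p (Dg P w) * gn Om q (fun i x => Dg P phi i x - partial i phi x) <=
    2 * Lm * (2 * (S * (D * CE L))) * (C * H).
  apply: ler_pM => //.
  - by rewrite mulr_ge0 ?gn_ge0// mulr_ge0// ltW.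
  - by rewrite ler_wpM2l ?mulr_ge0 ?(ltW Lm0)//; exact: (galer_gn M gw).
  - by apply: le_trans hb; rewrite lerDr.
have b4 : D * (rn Om q (fun x => interp P phi x - phi x) + gn Om q (fun i x => Dg P phi i x - partial i phi x)) <= D * (C * H).
  by rewrite ler_wpM2l.
apply: le_trans (lerD (le_trans b1 b3) (le_trans b2 b4)) _.
by rewrite /B -[X in _ <= X]mulrA [X in _ <= X]mulrDl.
Qed.

(** Galerkin solutions on meshes of size [1 / (k + 1)] are bounded in W^{1,p}_0, and their residual
    against each test function tends to 0, as [weak_limit] requires. The higher integrability of the
    gradient of [u] is thus inherited from the discrete estimate. *)
Lemma weak_solution_ex : exists u G, sob0 Om p u G /\
  forall phi, test_function Om phi -> bf G (dphi phi) = - f phi.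
Proof.
have CE0 := CE_gt0 L0.
pose good k (t : (plane R -> R) * field) := exists n (P : 'I_n -> 'I_3 -> R * R) h w,
  [/\ is_mesh Om P s h, forall j, h j <= k.+1%:R^-1, galer P w & t = (interp P w, Dg P w)].
have /choice[t ht] : forall k, exists t, good k t.
  move=> k; have k0 : 0 < k.+1%:R^-1 :> R by [].
  have [n [P [h [M hH]]]] := fam k0; have [w gw] := galer_ex M.
  by exists (interp P w, Dg P w), n, P, h, w.
pose I := {phi : R * R -> R | test_function Om phi}.
pose ell (i : I) (G : field) := bf G (dphi (sval i)) + f (sval i).
have poinc u G : sob0 Om p u G -> rn Om p u <= CE L * gn Om p G.
  exact: (poincare_p oO L0 OmL fam O0 p32).
pose B := 2 * (S * (D * CE L)) `^ p.
have fp (i : I) := dphi_in q1 (svalP i).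
have [|||||u [G [su hG]]] := @weak_limit R L Om oO L0 OmL p (CE L) p2 (ltW CE0) poinc I ell (fun k => (t k).1) (fun k => (t k).2) B.
- move=> i G H fG fH; rewrite /ell.
  have e1 := bf_linl oO mA (ltW Lm0) AL (2^-1 - 1) p1 q0 pq fH fH (fp i).
  have := bf_linl oO mA (ltW Lm0) AL 2^-1 p1 q0 pq fG (Gin_lin oO (2^-1 - 1) p1 fH fH) (fp i).
  rewrite e1; set X := bf G _; set Y := bf H _ => e2.
  have -> : bf (fun k x => 2^-1 * (G k x + H k x)) (dphi (sval i)) = 2^-1 * X + ((2^-1 - 1) * Y + Y).
    rewrite -[RHS]e2; congr (bf _ _); apply/funext => k; apply/funext => x; ring.
  by field.
- move=> i; exists (2 * Lm * gn Om q (dphi (sval i))).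
    by rewrite mulr_ge0 ?gn_ge0// mulr_ge0// ltW.
  move=> G H fG fH; rewrite /ell opprD addrACA subrr addr0.
  have e1 := bf_linl oO mA (ltW Lm0) AL (-1) p1 q0 pq fH fG (fp i).
  have -> : bf G (dphi (sval i)) - bf H (dphi (sval i)) = bf (gsub G H) (dphi (sval i)).
    rewrite addrC -mulN1r -e1; congr (bf _ _); apply/funext => k; apply/funext => x; rewrite /gsub; ring.
  by rewrite mulrAC; apply: (bf_le oO mA (ltW Lm0) AL p1 q0 pq _ (fp i)); exact: Gin_sub.
- move=> k; have [n [P [h [w [M hH gw ->]]]]] := ht k; exact: (interp_s0 M p1 gw.1).
- move=> k; have [n [P [h [w [M hH gw ->]]]]] := ht k.
  apply: le_trans (Q_Dg M gw.1) _; rewrite ler_wpM2l//.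
  rewrite -[leLHS](powRVK (lt0r_neq0 p0) (gnormS_ge0 M w p)).
  apply: powR_mono; rewrite ?powR_ge0 ?(ltW p0)//; exact: (galer_bound M gw).
- move=> i e e0'; have [C C0 hC] := galer_residual (svalP i).
  have C1 : 0 < C + 1 by rewrite ltr_wpDl.
  have [N _ hN] := near_infty_natSinv_lt (PosNum (divr_gt0 e0' C1)).
  exists N => k Nk; have [n [P [h [w [M hH gw ->]]]]] := ht k.
  apply: le_trans (hC n P h M _ hH w gw) _.
  have := hN k Nk => /= /ltW; rewrite ler_pdivlMr// mulrDr mulr1 [C * _]mulrC.
  have ki : 0 <= k.+1%:R^-1 :> R by [].
  by apply: le_trans; rewrite lerDl.
exists u, G; split => // phi tp.
by have := hG (exist _ phi tp); rewrite /ell /= => /eqP; rewrite addr_eq0 => /eqP.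
Qed.

Section solution.
Variables (u : plane R -> R) (G : field).
Hypothesis su : sob0 Om p u G.
Hypothesis hu : forall phi, test_function Om phi -> bf G (dphi phi) = - f phi.

Let fG : Gin Om p G. Proof. by case: (sob_in su.1). Qed.

(** Test functions are dense in W^{1,q}_0, and both sides are continuous there because [q] is
    conjugate to [p]. *)
Lemma solution_extends v H : sob0 Om q v H -> bf G H = - f v.
Proof.
move=> sv; have [fv fH] := sob_in sv.1.
pose B := 2 * Lm * gn Om p G + D.
have gG := gn_ge0 Om p G.
have B0 : 0 <= B by rewrite addr_ge0// mulr_ge0// mulr_ge0// ltW.
apply/eqP; rewrite -subr_eq0 opprK -normr_le0; apply/ler_addgt0Pr => e e0'; rewrite add0r.
have B1 : 0 < B + 1 by rewrite ltr_wpDl.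
have [phi tp] := sv.2 _ (divr_gt0 e0' B1).
have fP := dphi_in q1 tp; have st := test_sob0 oO L0 OmL q1 tp; have [ft _] := sob_in st.1.
have fB : Gin Om q (fun i x => H i x - partial i phi x) by move=> i; exact: (inLpB oO q1 (fH i) (fP i)).
have sB := sob0B oO L0 OmL q1 sv st.
rewrite (snE q0 (inLpB oO q1 fv ft) fB) lte_fin => hb.
have g0 := gn_ge0 Om q (fun i x => H i x - partial i phi x).
have rn0 := rn_ge0 Om q (fun x => v x - phi x).
have e1 : bf G (fun i x => H i x - partial i phi x) = bf G H - bf G (dphi phi).
  have := bf_linr oO mA (ltW Lm0) AL (-1) p1 q1 pq fG fP fH.
  rewrite mulN1r addrC => <-; congr (bf _ _); apply/funext => i; apply/funext => x; ring.
have e2 : f (fun x => v x - phi x) = f v - f phi.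
  have := f_lin oO L0 OmL p11 q1 pq Wf (-1) st sv.
  rewrite mulN1r addrC => <-; congr f; apply/funext => x; ring.
have -> : bf G H + f v = bf G (fun i x => H i x - partial i phi x) + f (fun x => v x - phi x).
  by rewrite e1 e2 (hu tp); ring.
apply: le_trans (ler_normD _ _) _.
have b1 := bf_le oO mA (ltW Lm0) AL p1 q0 pq fG fB.
have b2 := dual_bound oO L0 OmL p11 q1 pq Wf sB.
apply: le_trans (lerD b1 b2) _.
move: hb g0 rn0 b1 b2; move: (gn Om q _) (rn Om q _) => a b hb a0 b0 _ _.
have hb' : a + b <= e / (B + 1) by lra.
apply: (@le_trans _ _ (B * (a + b))).
  rewrite /B [X in _ <= X]mulrDl; apply: lerD; last by rewrite [b + a]addrC.
  by rewrite ler_wpM2l ?lerDl// mulr_ge0// mulr_ge0// ltW.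
apply: (@le_trans _ _ (B * (e / (B + 1)))); first by rewrite ler_wpM2l.
by rewrite mulrCA ger_pMr// ler_pdivrMr// mul1r lerDl.
Qed.

(** The discrete function [z], equal to [w] minus the interpolant of a test function [phi] close to
    [u], solves a discrete problem with the flux of [F] as right-hand side, where [F] is the
    gradient error of that interpolant; [stability] applies to it. *)
Lemma galer_cvg (e : R) : 0 < e -> exists2 del : R, 0 < del &
  forall n (P : 'I_n -> 'I_3 -> R * R) h, is_mesh Om P s h -> (forall j, h j <= del) ->
  forall w, galer P w ->
    (sn Om p (fun x => (interp P w x - u x)%R) (fun i x => (Dg P w i x - G i x)%R) <= e%:E)%E.
Proof.
move=> e0'; have CE0 := CE_gt0 L0.
(* [8 = 2 * 2 * 2]: [gn_Dg] for [z], [bf_le], and [gn_Dg] for the test function; [CE L + 1] passes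
   from the gradient to the full norm. *)
pose B := (CE L + 1) * (8 * S * Lm + 1).
have B0 : 0 < B.
  apply: mulr_gt0; first by rewrite addr_gt0.
  by rewrite ltr_wpDl// mulr_ge0 ?(ltW Lm0)// mulr_ge0.
have e2 : 0 < e / (2 * B) by rewrite divr_gt0// mulr_gt0.
have [phi tp] := su.2 _ e2.
have [fu _] := sob_in su.1.
have fP := dphi_in p1 tp; have st := test_sob0 oO L0 OmL p1 tp; have [ft _] := sob_in st.1.
have fB : Gin Om p (fun i x => G i x - partial i phi x) by move=> i; exact: (inLpB oO p1 (fG i) (fP i)).
rewrite (snE p0 (inLpB oO p1 fu ft) fB) lte_fin.
have := rn_ge0 Om p (fun x => u x - phi x); move: (rn Om p (fun x => u x - phi x)) => a a0 hb.
have {}hb : gn Om p (fun i x => G i x - partial i phi x) <= e / (2 * B) by lra.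
have [C C0 hC] := nodal_test oO L0 OmL s O0 p1 tp.
have C1 : 0 < C + 1 by rewrite ltr_wpDl.
exists (e / (2 * B) / (C + 1)); first exact: divr_gt0.
move=> n P h M hH w [w0 hw].
have phi0 := test_bdry0 (p := P) tp.
have [fi fD] := sob_in (sob_interp M L0 OmL p1 phi0).
have fB2 : Gin Om p (fun i x => Dg P phi i x - partial i phi x) by move=> i; exact: (inLpB oO p1 (fD i) (fP i)).
have := hC n P h M _ hH; rewrite (snE p0 (inLpB oO p1 fi ft) fB2) lee_fin.
have := rn_ge0 Om p (fun x => interp P phi x - phi x); move: (rn Om p _) => b b0 hb2.
have {}hb2 : gn Om p (fun i x => Dg P phi i x - partial i phi x) <= e / (2 * B).
  apply: (@le_trans _ _ (C * (e / (2 * B) / (C + 1)))); first by move: hb2; lra.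
  by rewrite mulrCA ger_pMr// ler_pdivrMr// mul1r lerDl.
pose F : field := fun i x => G i x - Dg P phi i x.
have fF : Gin Om p F by move=> i; exact: (inLpB oO p1 (fG i) (fD i)).
have hF : gn Om p F <= e / B.
  have := gn_lin oO (-1) p1 fB2 fB; rewrite normrN1 mul1r.
  have -> : (fun i x => -1 * (Dg P phi i x - partial i phi x) + (G i x - partial i phi x)) = F.
    by apply/funext => i; apply/funext => x; rewrite /F; ring.
  have -> : e / B = e / (2 * B) + e / (2 * B) by field; rewrite gt_eqF.
  by lra.
pose z (x : R * R) := -1 * phi x + w x.
have z0 : bdry0 Om P z by exact: bdry0_lin.
have gF := gn_ge0 Om p F.
have fz := Gin_Dg M L0 OmL p1 z0; have fw := Gin_Dg M L0 OmL p1 w0.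
have hz : gn Om p (Dg P z) <= 2 * (S * (2 * Lm * gn Om p F * 2)).
  apply: le_trans (gn_Dg M L0 OmL p1 z0) _; rewrite ler_wpM2l//.
  apply: (stability M) => //; first by rewrite mulr_ge0// mulr_ge0// mulr_ge0// ltW.
  move=> psi psi0; have fpsi := Gin_Dg M L0 OmL q1 psi0.
  (* Galerkin orthogonality: the gradients of [w] and [u] have the same form against a discrete
     [psi]. *)
  have -> : bf (Dg P z) (Dg P psi) = bf F (Dg P psi).
    rewrite Dg_linE (bf_linl oO mA (ltW Lm0) AL (-1) p1 q0 pq fD fw fpsi) hw//.
    rewrite -(solution_extends (interp_s0 M q1 psi0)).
    rewrite -(bf_linl oO mA (ltW Lm0) AL (-1) p1 q0 pq fD fG fpsi); congr (bf _ _).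
    by apply/funext => i; apply/funext => x; rewrite /F; ring.
  apply: le_trans (ler_norm _) _; apply: le_trans (bf_le oO mA (ltW Lm0) AL p1 q0 pq fF fpsi) _.
  rewrite -[X in _ <= X]mulrA ler_wpM2l ?(gn_Dg M L0 OmL q1 psi0)//.
  by rewrite mulr_ge0// mulr_ge0// ltW.
have sw := interp_s0 M p1 w0; have sB := sob0B oO L0 OmL p1 sw su.
have [f1 f2] := sob_in sB.1.
rewrite (snE p0 f1 f2) lee_fin.
have h1 := poincare_p oO L0 OmL fam O0 p32 sB.
have h2 : gn Om p (fun i x => Dg P w i x - G i x) <= gn Om p (Dg P z) + gn Om p F.
  have := gn_lin oO (-1) p1 fF fz; rewrite normrN1 mul1r [gn Om p F + _]addrC.
  congr (gn _ _ _ <= _); apply/funext => i; apply/funext => x.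
  by rewrite /z Dg_linE /F; ring.
have h3 : gn Om p (Dg P z) + gn Om p F <= (8 * S * Lm + 1) * (e / B).
  apply: (@le_trans _ _ ((8 * S * Lm + 1) * gn Om p F)).
    by move: hz; set t := gn Om p F; move: t (gn _ _ _) S Lm => t t' S' L' hz; lra.
  by rewrite ler_wpM2l// addr_ge0// mulr_ge0 ?(ltW Lm0)// mulr_ge0.
apply: (@le_trans _ _ ((CE L + 1) * ((8 * S * Lm + 1) * (e / B)))).
  apply: (@le_trans _ _ ((CE L + 1) * gn Om p (fun i x => Dg P w i x - G i x))).
    by rewrite mulrDl mul1r lerD2r.
  by apply: ler_wpM2l; [rewrite addr_ge0// ltW|exact: (le_trans h2 h3)].
by rewrite mulrA -/B mulrCA mulfV ?mulr1// gt_eqF.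
Qed.

End solution.
End galerkin_convergence.

(** * Meshes from triangulations *)

Section triangles.
Context {R : realType}.
Implicit Types (a b x y : R * R) (p q : 'I_3 -> R * R).

Definition vtx a b x (i : 'I_3) : R * R := match val i with 0%N => a | 1%N => b | _ => x end.

Lemma nondegenerate_area2 a b x : Defs.nondegenerate a b x -> area2 (vtx a b x) != 0.
Proof. by rewrite /Defs.nondegenerate /area2 /cross /= subr_eq0. Qed.

Lemma triangleE a b x : Defs.nondegenerate a b x -> triangle a b x = tri (vtx a b x).
Proof.
move=> /nondegenerate_area2 pn; apply/seteqP; split => y.
  move=> [r [s [t [r0 s0 t0 e ->]]]] i.
  pose rr (k : 'I_3) := match val k with 0%N => r | 1%N => s | _ => t end.
  have -> : r *: a + s *: b + t *: x = \sum_k rr k *: vtx a b x k by rewrite sum3.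
  apply: tri_conv => [||k]; [by rewrite sum3|by move=> k; rewrite /rr; case: (val k) => [|[|?]]|].
  exact: (tri_vertex pn).
move=> yt; exists (bary (vtx a b x) o0 y), (bary (vtx a b x) o1 y), (bary (vtx a b x) o2 y).
split; [exact: yt|exact: yt|exact: yt|by have := sum_bary pn y; rewrite sum3|].
rewrite -[LHS](sum_bary_vertex pn y); exact: sum3.
Qed.

Lemma bary_le1 p i y : area2 p != 0 -> tri p y -> bary p i y <= 1.
Proof.
move=> pn yp; rewrite -(sum_bary pn y) (bigD1 i)//= lerDl sumr_ge0// => k _; exact: yp.
Qed.

Lemma bary_eq1 p i y : area2 p != 0 -> tri p y -> bary p i y = 1 -> y = p i.
Proof.
move=> pn yp b1; have := sum_bary pn y; rewrite (bigD1 i)//= b1 => e.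
have /eqP : \sum_(k < 3 | k != i) bary p k y = 0 by move: e; move: (\sum_(k < 3 | _) _) => S; lra.
rewrite psumr_eq0 => [/allP h|k _]; last exact: yp.
rewrite -[LHS](sum_bary_vertex pn y) (bigD1 i)//= b1 scale1r big1 ?addr0// => k ki.
by have := h k (mem_index_enum _); rewrite ki /= => /eqP ->; rewrite scale0r.
Qed.

(** The coordinate [i] is affine, at most 1 on the triangle, and equal to 1 only at [p i]. *)
Lemma vertex_extreme p i y z (t : R) : area2 p != 0 -> 0 <= t <= 1 -> tri p y -> tri p z ->
  p i = (1 - t) *: y + t *: z -> y = p i \/ z = p i.
Proof.
move=> pn /andP[t0 t1] yp zp e.
have b : 1 = (1 - t) * bary p i y + t * bary p i z.
  transitivity (bary p i (p i)); first by rewrite (bary_vertex pn) eqxx.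
  rewrite {1}e (baryE p i _ 0) (baryE p i y 0) (baryE p i z 0) /dotp /= /GRing.scale /= !subr0; ring.
have by1 := bary_le1 i pn yp; have bz1 := bary_le1 i pn zp.
have [t1'|t1'] := eqVneq t 1.
  by right; apply: (bary_eq1 pn zp); rewrite t1' in b; lra.
left; apply: (bary_eq1 pn yp); apply/eqP; rewrite eq_le by1 /=.
have t1s : 0 < 1 - t by rewrite subr_gt0 lt_neqAle t1' t1.
have : t * bary p i z <= t by rewrite ler_piMr.
have -> : (1 <= bary p i y) = ((1 - t) * 1 <= (1 - t) * bary p i y) by rewrite ler_pM2l.
lra.
Qed.

(** If no vertex of [q] were [p i], the coordinate [bary p i] would be below 1 at all three of them,
    hence also at their convex combination [p i]. *)
Lemma vertex_of_set p q i : area2 p != 0 -> area2 q != 0 -> tri p = tri q -> exists l, q l = p i.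
Proof.
move=> pn qn e; have pq : tri q (p i) by rewrite -e; exact: (tri_vertex pn).
apply: contrapT => no.
have b1 l : bary p i (q l) < 1.
  rewrite lt_neqAle bary_le1 ?andbT//; last by rewrite e; exact: (tri_vertex qn).
  apply/eqP => h; apply: no; exists l; apply: (bary_eq1 pn) => //.
  by rewrite e; exact: (tri_vertex qn).
have := @bary_affine _ p i 3 _ q (sum_bary qn (p i)); rewrite (sum_bary_vertex qn) (bary_vertex pn) eqxx => h.
have : \sum_l bary q l (p i) * (1 - bary p i (q l)) = 0.
  under eq_bigr do rewrite mulrBr mulr1.
  by rewrite sumrB (sum_bary qn) -h subrr.
move/eqP; rewrite psumr_eq0 => [/allP z|l _]; last by rewrite mulr_ge0 ?subr_ge0 ?(ltW (b1 l)).
have z0 l : bary q l (p i) = 0.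
  have := z l (mem_index_enum _); rewrite /= mulf_eq0 subr_eq0 eq_sym => /orP[/eqP//|].
  by rewrite eq_sym (lt_eqF (b1 l)).
have := sum_bary qn (p i); rewrite big1// => /eqP; by rewrite eq_sym oner_eq0.
Qed.

Lemma is_triangleP T : is_triangle T -> exists p, area2 p != 0 /\ T = tri p.
Proof.
move=> [a [b [x [nd ->]]]]; exists (vtx a b x); split; first exact: nondegenerate_area2.
exact: triangleE.
Qed.

Lemma is_vertexP p x : area2 p != 0 -> is_vertex (tri p) x -> exists i, p i = x.
Proof.
move=> pn [b [c [nd e]]]; have qn := nondegenerate_area2 nd; rewrite (triangleE nd) in e.
by have [l hl] := @vertex_of_set (vtx x b c) p o0 qn pn (esym e); exists l.
Qed.

Lemma is_sideP p S : area2 p != 0 -> is_side (tri p) S -> exists i j, S = segment (p i) (p j).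
Proof.
move=> pn [a [b [c [nd e ->]]]]; have qn := nondegenerate_area2 nd; rewrite (triangleE nd) in e.
have [i hi] := @vertex_of_set (vtx a b c) p o0 qn pn (esym e).
have [j hj] := @vertex_of_set (vtx a b c) p o1 qn pn (esym e).
by exists i, j; rewrite hi hj.
Qed.

Lemma segmentl a b : segment a b a.
Proof. by exists 0; split => //; rewrite subr0 scale1r scale0r addr0. Qed.

Lemma segmentr a b : segment a b b.
Proof. by exists 1; split => //; rewrite subrr scale1r scale0r add0r. Qed.

(** If the triangles share a vertex only, [x] is that vertex. On a common side only the coordinates
    of its two ends can be nonzero, and an end, being extreme in [tri p], coincides with an end of
    the same side described by vertices of [q]. *)
Lemma conform_of_admissible Th p q x i : admissible Th -> Th (tri p) -> Th (tri q) ->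
  area2 p != 0 -> area2 q != 0 -> tri p x -> tri q x -> bary p i x != 0 -> exists l, q l = p i.
Proof.
move=> adm Tp Tq pn qn xp xq bi.
have [e|ne] := pselect (tri p = tri q); first exact: vertex_of_set.
have [E|[y [vy vy' E]]|[sp sq]] := adm _ _ Tp Tq ne.
- by have : (tri p `&` tri q) x by []; rewrite E.
- have xy : x = y by have : (tri p `&` tri q) x by []; rewrite E.
  subst y; have [i0 e0] := is_vertexP pn vy; have [l0 e1] := is_vertexP qn vy'.
  exists l0; rewrite e1 -e0; congr p.
  by move: bi; rewrite -e0 (bary_vertex pn); have [->//|_] := eqVneq i i0; rewrite eqxx.
have [i1 [i2 E]] := is_sideP pn sp; have [l1 [l2 E']] := is_sideP qn sq.
have vin k : segment (p i1) (p i2) (p k) -> exists l, q l = p k.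
  rewrite -E E' => -[t [t0 t1 e]].
  have inp l : segment (q l1) (q l2) (q l) -> tri p (q l) by rewrite -E' => -[].
  have t01 : 0 <= t <= 1 by rewrite t0 t1.
  have [h|h] := vertex_extreme pn t01 (inp _ (segmentl _ _)) (inp _ (segmentr _ _)) e.
  - by exists l1.
  - by exists l2.
have [t [t0 t1 ex]] : segment (p i1) (p i2) x by rewrite -E.
have : bary p i x = (1 - t) * (i == i1)%:R + t * (i == i2)%:R.
  rewrite -!(bary_vertex pn) ex.
  rewrite (baryE p i _ 0) (baryE p i (p i1) 0) (baryE p i (p i2) 0) /dotp /= /GRing.scale /= !subr0; ring.
move=> bE; have [h|h] : i = i1 \/ i = i2.
  move: bi; rewrite bE; have [|_] := eqVneq i i1; first by left.
  have [|_] := eqVneq i i2; first by right.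
  by rewrite !mulr0 addr0 eqxx.
- by apply: vin; rewrite h; exact: segmentl.
- by apply: vin; rewrite h; exact: segmentr.
Qed.

Lemma edist_ge_norm x y : `|x - y| <= Defs.edist x y.
Proof.
have h (u v : R) : `|u| <= Num.sqrt (u ^+ 2 + v ^+ 2).
  by rewrite -sqrtr_sqr ler_wsqrtr// lerDl sqr_ge0.
rewrite norm_pair ge_max /Defs.edist /= h /= [X in Num.sqrt X]addrC; exact: h.
Qed.

Lemma edist_le_norm x y : Defs.edist x y <= 2 * `|x - y|.
Proof.
have n0 : 0 <= 2 * `|x - y| by rewrite mulr_ge0.
rewrite -[leRHS](ger0_norm n0) -sqrtr_sqr ler_wsqrtr//.
have a1 : (x.1 - y.1) ^+ 2 <= `|x - y| ^+ 2.
  by rewrite -[leLHS]real_normK ?num_real// ler_sqr ?nnegrE//; exact: (norm1_le (x - y)).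
have a2 : (x.2 - y.2) ^+ 2 <= `|x - y| ^+ 2.
  by rewrite -[leLHS]real_normK ?num_real// ler_sqr ?nnegrE//; exact: (norm2_le (x - y)).
rewrite exprMn; have := sqr_ge0 `|x - y|; lra.
Qed.

Section one_triangle.
Variable p : 'I_3 -> R * R.
Hypothesis pn : area2 p != 0.

Lemma tri_bounded x y : tri p x -> tri p y -> `|x - y| <= 2 * (`|p o0| + `|p o1| + `|p o2|).
Proof.
have h z : tri p z -> `|z| <= `|p o0| + `|p o1| + `|p o2|.
  move=> zp; rewrite -(sum_bary_vertex pn z) sum3.
  have b i : `|bary p i z *: p i| <= `|p i|.
    by rewrite normrZ ger0_norm ?zp// ler_piMl// bary_le1.
  apply: le_trans (ler_normD _ _) _; apply: lerD => //; apply: le_trans (ler_normD _ _) _.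
  exact: lerD.
by move=> /h hx /h hy; apply: le_trans (ler_normB _ _) _; lra.
Qed.

Lemma diam_has_sup : has_sup [set Defs.edist x y | x in tri p & y in tri p].
Proof.
split; first by exists (Defs.edist (p o0) (p o0)); exists (p o0); [exact: tri_vertex|exists (p o0) => //; exact: tri_vertex].
exists (2 * (2 * (`|p o0| + `|p o1| + `|p o2|))) => _ [x xp [y yp <-]].
by apply: le_trans (edist_le_norm x y) _; rewrite ler_wpM2l// tri_bounded.
Qed.

Lemma diam_ge x y : tri p x -> tri p y -> Defs.edist x y <= diam (tri p).
Proof. by move=> xp yp; apply: (sup_upper_bound diam_has_sup); exists x => //; exists y. Qed.

Lemma diam_gt0 : 0 < diam (tri p).
Proof.
apply: lt_le_trans (diam_ge (tri_vertex pn o0) (tri_vertex pn o1)).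
apply: lt_le_trans (edist_ge_norm _ _); rewrite normr_gt0 subr_eq0.
by apply/eqP => /(vertex_inj pn).
Qed.

Lemma inball_has_sup : has_sup [set 2 * r | r in [set r : R | 0 <= r /\ exists x, [set y | Defs.edist x y <= r] `<=` tri p]].
Proof.
have e0 x : Defs.edist x x = 0 by rewrite /Defs.edist !subrr expr0n /= addr0 sqrtr0.
split.
  exists (2 * 0); exists 0 => //; split => //; exists (p o0) => y /= h.
  have := le_trans (edist_ge_norm (p o0) y) h; rewrite normr_le0 subr_eq0 => /eqP <-.
  exact: tri_vertex.
exists (2 * diam (tri p)) => _ [r [r0 [x hx]] <-]; rewrite ler_wpM2l//.
have xr : Defs.edist x (x.1 + r, x.2) = r.
  by rewrite /Defs.edist /= subrr expr0n /= addr0 opprD addrA subrr sub0r sqrrN sqrtr_sqr ger0_norm.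
rewrite -xr; apply: diam_ge; apply: hx; rewrite /= ?xr//.
by rewrite e0.
Qed.

(** A ball around the barycentre, where all coordinates are [1 / 3], so small that no coordinate
    loses more than that. *)
Lemma inball_gt0 : 0 < inball_diam (tri p).
Proof.
pose g := \sum_(i < 3) (3^-1 : R) *: p i.
have s1 : \sum_(i < 3) (3^-1 : R) = 1 by rewrite sum3; field.
have bg i : bary p i g = 3^-1.
  rewrite (@bary_affine _ p i 3 _ p s1) (bigD1 i)//= big1 ?addr0 => [|k ki].
    by rewrite (bary_vertex pn) eqxx mulr1.
  by rewrite (bary_vertex pn) eq_sym (negbTE ki) mulr0.
pose B := \sum_i n1 (bgrad p i) + 1.
have nB i : n1 (bgrad p i) <= B.
  by rewrite /B (bigD1 i)//= -addrA lerDl addr_ge0// sumr_ge0// => k _; exact: n1_ge0.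
have B0 : 0 < B by rewrite ltr_wpDl// sumr_ge0// => k _; exact: n1_ge0.
pose r := (3 * B)^-1; have r0 : 0 < r by rewrite invr_gt0 mulr_gt0.
apply: (@lt_le_trans _ _ (2 * r)); first by rewrite mulr_gt0.
apply: (sup_upper_bound inball_has_sup); exists r => //; split; first exact: ltW.
exists g => y /= gy i.
have yr : `|y - g| <= r by rewrite distrC; exact: le_trans (edist_ge_norm _ _) gy.
rewrite (baryE p i y g) bg.
have := dotp_le (bgrad p i) (y - g).
have : n1 (bgrad p i) * `|y - g| <= B * r by apply: ler_pM => //; exact: n1_ge0.
have -> : B * r = 3^-1 by rewrite /r; field; rewrite gt_eqF.
by move=> h1 h2; have := le_trans h2 h1; rewrite ler_norml => /andP[]; lra.
Qed.

(** [8 = 2 * 2 * 2]: diameter against radius of the inscribed ball, one half given up to have a ball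
    near the supremum, and the factor 2 of [edist_le_norm]. *)
Lemma shape_of_regular (sigma : R) : 0 < sigma -> diam (tri p) / inball_diam (tri p) <= sigma ->
  shape p (8 * sigma) (diam (tri p)).
Proof.
move=> s0; rewrite ler_pdivrMr ?inball_gt0// => hs; have d0 := diam_gt0.
split => //; first by move=> x y xp yp; apply: le_trans (edist_ge_norm x y) (diam_ge xp yp).
have rho0 := inball_gt0.
have e0 : 0 < inball_diam (tri p) / 2 by rewrite divr_gt0.
have [_ [r [r0 [x hx]] <-]] := sup_adherent e0 inball_has_sup.
rewrite -/(inball_diam _) => hr; exists x => y yx; apply: hx => /=.
apply: le_trans (edist_le_norm x y) _; rewrite distrC.
have : diam (tri p) / (8 * sigma) <= inball_diam (tri p) / 8.
  rewrite ler_pdivrMr ?mulr_gt0//; apply: le_trans hs _; rewrite le_eqVlt; apply/orP; left; apply/eqP.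
  by field.
by move: yx hr; move: (inball_diam _) => w; lra.
Qed.

End one_triangle.

Lemma mesh_of_triangulation Om Th (sigma h : R) : open Om -> cvx Om -> 0 < sigma ->
  triangulation Om Th -> admissible Th ->
  (forall T, Th T -> diam T / inball_diam T <= sigma) ->
  (forall T, Th T -> diam T <= h) ->
  exists n (p : 'I_n -> 'I_3 -> R * R) hh, [/\ is_mesh Om p (8 * sigma) hh,
    forall j, hh j <= h & forall T, Th T <-> exists j, T = tri (p j)].
Proof.
move=> oO cO s0 [/finite_seqP[l0 El0] tT cov] adm reg hT.
(* Repetitions are removed because distinct indices must carry distinct triangles ([mesh_inj]). *)
pose l := undup l0; have El : Th = [set` l] by rewrite El0; apply/seteqP; split => T /=; rewrite mem_undup.
pose n := size l; pose T (j : 'I_n) := nth set0 l j.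
have TT j : Th (T j) by rewrite El /= mem_nth.
have [p hp] := fin_all_exists (fun j => is_triangleP (tT _ (TT j))).
have pn j : area2 (p j) != 0 by case: (hp j).
have pT j : T j = tri (p j) by case: (hp j).
have ThP S : Th S <-> exists j, S = tri (p j).
  split => [|[j ->]]; last by rewrite -pT.
  rewrite El /= => Sl; have lt : (index S l < n)%N by rewrite index_mem.
  by exists (Ordinal lt); rewrite -pT /T nth_index.
exists n, p, (fun j => diam (tri (p j))); split => //; last by move=> j; rewrite -pT; exact: hT.
split => //.
- by rewrite mulr_gt0.
- rewrite cov; apply/seteqP; split => x [S]; first by move=> /ThP[j ->] xj; exists j.
  by move=> _ xS; exists (tri (p S)) => //; rewrite -pT.
- move=> j k; rewrite -!pT => e; apply: val_inj.
  by apply/eqP; rewrite -(nth_uniq set0 (ltn_ord j) (ltn_ord k) (undup_uniq l0)); apply/eqP.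
- move=> j k x xj xk i bi; apply: (conform_of_admissible adm _ _ (pn j) (pn k) xj xk bi); by rewrite -pT.
- by move=> j; apply: shape_of_regular => //; rewrite -pT; exact: reg.
Qed.

End triangles.

(** * Galerkin and weak solutions *)

Section galerkin_solutions.
Context {R : realType}.
Local Notation lam := (@lam R).
Variables (L : R) (Om : set (R * R)).
Hypothesis (oO : open Om) (L0 : 0 < L) (OmL : forall x, Om x -> `|x| <= L).
Local Notation O := (Om : set (plane R)).
Variables (o : R * R) (r : R).
Hypothesis (r0 : 0 < r) (hr : forall y, `|y - o| < r -> Om y).
Variable s : R.
Hypothesis fam : forall H : R, 0 < H ->
  exists n (p : 'I_n -> 'I_3 -> R * R) h, is_mesh Om p s h /\ forall j, h j <= H.
Variables (A : R * R -> 'M[R]_2) (c Lm : R).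
Hypothesis mA : forall i k, measurable_fun O (fun x : plane R => A x i k).
Hypothesis Lm0 : 0 < Lm.
Hypothesis AL : {ae lam, forall x : plane R, O x -> forall i k, `|A x i k| <= Lm}.
Hypothesis Ac : {ae lam, forall x : plane R, O x -> forall a : 'I_2 -> R,
  c * \sum_i a i ^+ 2 <= \sum_i (\sum_k A x i k * a k) * a i}.
Hypothesis c0 : 0 < c.
Let mo := mO oO.
Local Notation field := ('I_2 -> plane R -> R).
Local Notation bf := (bf Om A).
Local Notation dphi phi := (fun i => partial i phi).

Let O0 : Om !=set0. Proof. by exists o; apply: hr; rewrite subrr normr0. Qed.
Let t1 : 1 <= 2 :> R. Proof. by lra. Qed.
Let t0 : 0 < 2 :> R. Proof. by []. Qed.
Let h2 : (2 : R)^-1 + 2^-1 = 1. Proof. by lra. Qed.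

Lemma sob0_congr q (u v : plane R -> R) (G : field) : (forall x, Om x -> u x = v x) ->
  sob0 Om q u G -> sob0 Om q v G.
Proof.
move=> uv [[[mu fu] su] ap].
have L_ : forall w : plane R -> R, Lnr lam O q (fun x => v x - w x) = Lnr lam O q (fun x => u x - w x).
  move=> w; rewrite /Lnr; congr Lnorm; apply/funext => x; rewrite /= !patchE.
  by case: ifPn => //; rewrite inE => Ox; rewrite uv.
split; last first.
  move=> e e0; have [phi tp h] := ap e e0; exists phi => //.
  by move: h; rewrite /sn L_.
split.
  split; first by apply: eq_measurable_fun mu => x; rewrite inE => Ox; rewrite uv.
  have -> : Ip lam O q v = Ip lam O q u by apply: eq_integral => x; rewrite inE => Ox; rewrite uv.
  exact: fu.
move=> i; have [[iu iG h] fG] := su i; split => //; split => //.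
  have uvE : {in (O : set (plane R)), EFin \o u =1 EFin \o v} by move=> x; rewrite inE => Ox; rewrite /= uv.
  by apply: eq_integrable iu; [exact: mo|exact: uvE].
move=> phi tp; rewrite -h//; apply: eq_Rintegral => x; rewrite inE => Ox.
by rewrite uv.
Qed.

Lemma int_dot (W V G H : field) : (forall i, measurable_fun O (W i)) -> (forall i, measurable_fun O (V i)) ->
  (forall i, measurable_fun O (G i)) -> (forall i, measurable_fun O (H i)) ->
  (forall i, {ae lam, forall x : plane R, O x -> W i x = G i x}) ->
  (forall i, {ae lam, forall x : plane R, O x -> V i x = H i x}) ->
  \int[leb2 R]_(x in Om) dot (A x *m \col_i W i x) (\col_i V i x) = bf G H.
Proof.
move=> mW mV mG mH WG VH; rewrite Rint_lam /bf /pair.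
have E (X Y : field) x : dot (A x *m \col_i X i x) (\col_i Y i x) = \sum_i flux A X i x * Y i x.
  rewrite /dot; apply: eq_bigr => i _; rewrite !mxE; congr (_ * _).
  by apply: eq_bigr => k _; rewrite mxE.
have m (X Y : field) : (forall i, measurable_fun O (X i)) -> (forall i, measurable_fun O (Y i)) ->
    measurable_fun O (fun x => \sum_i flux A X i x * Y i x).
  move=> mX mY; apply: measurable_sum => i; apply: measurable_funM; last exact: mY.
  by apply: measurable_sum => k; apply: measurable_funM; [exact: mA|exact: mX].
transitivity (\int[lam]_(x in O) \sum_i flux A W i x * V i x).
  by apply: eq_Rintegral => x _; rewrite E.
apply: (eq_rint_ae oO (m _ _ mW mV) (m _ _ mG mH)).
have a : {ae lam, forall x : plane R, O x -> forall i, W i x = G i x /\ V i x = H i x}.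
  move: (WG 0) (WG (lift ord0 ord0)) => w0 w1; move: (VH 0) (VH (lift ord0 ord0)) => v0 v1.
  have h : {ae lam, forall x : plane R, O x -> W 0 x = G 0 x /\ V 0 x = H 0 x} by apply: filterS2 w0 v0 => x a b Ox; split; [exact: a|exact: b].
  apply: filterS3 h w1 v1 => x a b d Ox i.
  have [->|->] : i = 0 \/ i = lift ord0 ord0.
    by case: i => -[|[|//]] hi; [left|right]; apply: val_inj.
  - exact: a.
  - by split; [exact: b|exact: d].
apply: filterS a => x h Ox; apply: eq_bigr => i _; rewrite (h Ox i).2; congr (_ * _).
by apply: eq_bigr => k _; rewrite (h Ox k).1.
Qed.

Let mwp u (G : field) (wu : forall i, wp Om i u (G i)) i : measurable_fun O (G i).
Proof. by have [_ iG _] := wu i; exact: L1_measurable iG. Qed.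

Lemma int_wp u v (G H : field) : (forall i, wp Om i u (G i)) -> (forall i, wp Om i v (H i)) ->
  \int[leb2 R]_(x in Om) dot (A x *m weak_grad Om u x) (weak_grad Om v x) = bf G H.
Proof.
move=> wu wv; apply: int_dot.
- by move=> i; exact: (wp_weak_partial oO (wu i)).1.
- by move=> i; exact: (wp_weak_partial oO (wv i)).1.
- exact: mwp wu.
- exact: mwp wv.
- by move=> i; exact: (wp_weak_partial oO (wu i)).2.
- by move=> i; exact: (wp_weak_partial oO (wv i)).2.
Qed.

Lemma int_wp_test u phi (G : field) : (forall i, wp Om i u (G i)) -> test_function Om phi ->
  \int[leb2 R]_(x in Om) dot (A x *m weak_grad Om u x) (grad phi x) = bf G (dphi phi).
Proof.
move=> wu tp.
have mp i : measurable_fun O (partial i phi : plane R -> R) by exact: measurable_test (test_partial i tp).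
apply: int_dot => //.
- by move=> i; exact: (wp_weak_partial oO (wu i)).1.
- exact: mwp wu.
- by move=> i; exact: (wp_weak_partial oO (wu i)).2.
- by move=> i; apply: aeW.
Qed.

Section mesh.
Variables (n : nat) (P : 'I_n -> 'I_3 -> R * R) (h : 'I_n -> R) (Th : set (set (R * R))).
Hypothesis M : is_mesh Om P s h.
Hypothesis ThP : forall T, Th T <-> exists j, T = tri (P j).

Lemma V1_0_interp w : bdry0 Om P w -> V1_0 Om Th (interp P w).
Proof.
move=> w0; split; last by move=> x [_ nx]; apply: (interp_out M w0) => Ox; apply: nx; rewrite (interior_id _).1.
split; first exact/continuous_subspaceT/(v_continuous M w0).
by move=> T /ThP[j ->]; exact: (interp_affine M w j).
Qed.

Lemma V1_0_nodal v : V1_0 Om Th v -> bdry0 Om P v /\ forall x, closure Om x -> v x = interp P v x.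
Proof.
move=> [[_ hv] v0]; split; last by apply: (affine_interp M) => j; apply: hv; apply/ThP; exists j.
move=> j i nO; apply: v0; split; last by move/interior_subset.
by rewrite (mesh_cover M); exists j => //; apply: tri_vertex; exact: (mesh_nondeg M).
Qed.

Let wpi w : bdry0 Om P w -> forall i, wp Om i (interp P w) (Dg P w i).
Proof. by move=> w0 i; exact: (wp_interp M L0 OmL i w0). Qed.

Lemma int_nodal w v : V1_0 Om Th w -> V1_0 Om Th v ->
  \int[leb2 R]_(x in Om) dot (A x *m weak_grad Om w x) (weak_grad Om v x) = bf (Dg P w) (Dg P v).
Proof.
move=> /V1_0_nodal[w0 hw] /V1_0_nodal[v0 hv].
have E u : (forall x, closure Om x -> u x = interp P u x) -> weak_grad Om u = weak_grad Om (interp P u).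
  move=> hu; apply/funext => x; apply/colP => i; rewrite !mxE (@weak_partial_congr _ Om i u (interp P u))//.
  by move=> y Oy; apply: hu; exact: subset_closure.
by rewrite (E _ hw) (E _ hv); exact: (int_wp (wpi w0) (wpi v0)).
Qed.

Section functional.
Variables (p q : R) (f : (R * R -> R) -> R).
Hypothesis (p1 : 1 < p) (q1 : 1 <= q) (pq : p^-1 + q^-1 = 1).
Hypothesis Wf : Wm1 Om p%:E f.

(** The difference is 0 on the domain, so it has norm 0 and [dual_bound] applies: the functional
    does not see values outside the domain. *)
Lemma f_congr u v (G : field) : (forall x, Om x -> u x = v x) -> sob0 Om q u G -> f u = f v.
Proof.
move=> uv su; have sv := sob0_congr uv su; have q0 : 0 < q by move: q1 => ?; lra.
have e := f_lin oO L0 OmL p1 q1 pq Wf (-1) su sv.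
have b := dual_bound oO L0 OmL p1 q1 pq Wf (sob0_lin oO L0 OmL (-1) q1 su sv).
have g0 : gn Om q (fun i x => -1 * G i x + G i x) = 0.
  rewrite /gn big1// => i _; have z : (fun x => -1 * G i x + G i x) = fun=> 0.
    by apply/funext => x; rewrite mulN1r addNr.
  by rewrite z /rn Lnr0.
have r0' : rn Om q (fun x => -1 * u x + v x) = 0.
  have z : (fun x => -1 * u x + v x) \_ Om = (fun=> 0) \_ Om.
    by apply/funext => x; rewrite !patchE; case: ifPn => //; rewrite inE => Ox; rewrite uv// mulN1r addNr.
  by rewrite /rn /Lnr z -/(Lnr lam O q (fun=> 0)) Lnr0.
move: b; rewrite e g0 r0' addr0 mulr0 normr_le0 mulN1r.
by rewrite addrC subr_eq0 => /eqP.
Qed.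

(** On the closure an element of [V1_0] is its own interpolant, and neither [f] nor [weak_grad]
    depends on more than the values in the domain. *)
Lemma galerkin_solutionP v : galerkin_solution Om Th A f v <-> V1_0 Om Th v /\ galer Om A f P v.
Proof.
have fE w : V1_0 Om Th w -> f w = f (interp P w).
  move=> /V1_0_nodal[w0 hw]; apply/esym; apply: (@f_congr (interp P w) w (Dg P w)).
    by move=> x Ox; rewrite hw//; exact: subset_closure.
  exact: (interp_sob0 M L0 OmL r0 hr w0 q1).
split => [[Vv hv]|[Vv [v0 hv]]]; split => //.
  split; first by case: (V1_0_nodal Vv).
  move=> w w0; have Vw := V1_0_interp w0.
  have vw : veq P (interp P w) w by move=> j i; exact: (interp_vertex M).
  rewrite -(hv _ Vw) (int_nodal Vv Vw); congr (bf _ _).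
  apply/funext => i; apply/funext => x; apply: eq_bigr => j _; case: ifP => // _.
  by rewrite (@igrad_congr _ _ P w (interp P w) j)// => k; rewrite vw.
move=> w Vw; have [w0 _] := V1_0_nodal Vw.
by rewrite (int_nodal Vv Vw) (hv _ w0) (fE _ Vw).
Qed.

End functional.
End mesh.

(** The form of the difference vanishes against test functions, which approximate the difference
    itself; coercivity forces its gradient to be 0, and Poincare's inequality the function. *)
Lemma weak_solution_uniq f u w (G : field) : sob0 Om 2 u G ->
  (forall phi, test_function Om phi -> bf G (dphi phi) = - f phi) ->
  weak_solution Om A f w -> {ae leb2 R, forall x, Om x -> w x = u x}.
Proof.
move=> su hu [W0 hw]; have [H sw] := W1_sob oO L0 OmL t1 W0.1.
have sw0 := W1_0_sob0 oO L0 OmL t1 sw W0; have sd := sob0B oO L0 OmL t1 sw0 su.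
have [_ fH] := sob_in sw; have [_ fG] := sob_in su.1; have [fd fD] := sob_in sd.1.
set d := fun x => w x - u x; set K := fun i x => H i x - G i x.
have KE : K = fun i x => -1 * G i x + H i x by apply/funext => i; apply/funext => x; rewrite /K; ring.
have Kt phi : test_function Om phi -> bf K (dphi phi) = 0.
  move=> tp; have [_ ft] := sob_in (test_sob oO L0 OmL t1 tp).
  rewrite KE (bf_linl oO mA (ltW Lm0) AL (-1) t1 t0 h2 fG fH ft) (hu _ tp) -(@int_wp_test w phi H)// ?(hw _ tp); first by ring.
  by move=> i; case: (sw.2 i).
pose g := gn Om 2 K; have g0 : 0 <= g := gn_ge0 Om 2 K.
have gK : g = 0.
  apply/eqP; rewrite eq_le g0 andbT leNgt; apply/negP => gp.
  (* With this accuracy coercivity yields [c * g ^+ 2 <= c * g ^+ 2 / 2]. *)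
  have e0 : 0 < c * g / (8 * Lm) by rewrite divr_gt0 ?mulr_gt0.
  have [phi tp hphi] := sd.2 _ e0.
  have st := test_sob oO L0 OmL t1 tp; have [ft fT] := sob_in st.
  have fdt := inLpB oO t1 fd ft.
  have fKt : Gin Om 2 (fun i x => K i x - partial i phi x) by move=> i; exact: (inLpB oO t1 (fD i) (fT i)).
  move: hphi; rewrite (snE t0 fdt fKt) lte_fin => hphi.
  have rr := rn_ge0 Om 2 (fun x => d x - phi x).
  have bK : bf K K = bf K (fun i x => K i x - partial i phi x).
    have := bf_linr oO mA (ltW Lm0) AL (-1) t1 t1 h2 fD fT fD; rewrite (Kt _ tp) mulr0 add0r => <-.
    by congr (bf _ _); apply/funext => i; apply/funext => x; rewrite /K mulN1r addrC.
  have b1 := bf_le oO mA (ltW Lm0) AL t1 t0 h2 fD fKt; rewrite -bK in b1.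
  have b2 := bf_coercive oO mA (ltW Lm0) AL Ac c0 fD.
  have b3 : bf K K <= 2 * Lm * g * (c * g / (8 * Lm)).
    apply: le_trans (ler_norm _) _; apply: le_trans b1 _.
    by rewrite ler_wpM2l ?mulr_ge0 ?(ltW Lm0)//; lra.
  have : c * g ^+ 2 <= c * g ^+ 2 / 2.
    apply: le_trans b2 _; have -> : c * g ^+ 2 / 2 = 2 * (2 * Lm * g * (c * g / (8 * Lm))) by field; rewrite gt_eqF.
    by rewrite ler_wpM2l.
  have : 0 < c * g ^+ 2 by rewrite mulr_gt0// exprn_gt0.
  lra.
have h32 : 3 / 2 <= (2 : R) <= 3 by apply/andP; split; lra.
have := poincare_p oO L0 OmL fam O0 h32 sd; rewrite -/K -/g gK mulr0 => rn0.
have Ln0 : Lnr lam O 2 d = 0%E by rewrite (rnE t0 fd); congr EFin; apply/eqP; rewrite eq_le rn0 rn_ge0.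
have md : measurable_fun [set: plane R] (EFin \o (d \_ O)).
  by apply/measurable_EFinP; apply/(measurable_restrictT _ mo); case: fd.
have p20 : (0 < 2%:E :> \bar R)%E by rewrite lte_fin.
rewrite (lam_ae (fun x : plane R => Om x -> w x = u x)).
have := Lnorm_eq0_eq0 md p20 Ln0; apply: filterS => x /= hx Ox.
by move: (hx I); rewrite patchE mem_set// => -[] /eqP; rewrite subr_eq0 => /eqP.
Qed.

End galerkin_solutions.

(** * The theorem *)

Section hypotheses.
Context {R : realType}.
Local Notation lam := (@lam R).
Variable Om : set (R * R).
Hypothesis oO : open Om.
Local Notation O := (Om : set (plane R)).

Lemma cvx_of_convex_set : convex_set Om -> cvx Om.
Proof.
move=> cO x y t Ox Oy /andP[t0 t1]; have := cO y x (Itv01 t0 t1); rewrite !inE => /(_ Oy Ox).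
rewrite [X in Om X -> _](_ : _ = t *: y + (1 - t) *: x)//.
by rewrite scalerBl scale1r scalerBr addrCA.
Qed.

Lemma bounded_set_le : bounded_set Om -> exists2 L : R, 0 < L & forall x, Om x -> `|x| <= L.
Proof.
move=> [K [_ hK]]; exists (`|K| + 1); first by rewrite ltr_wpDl.
by apply: hK; rewrite ltr_pwDr// ler_norm.
Qed.

Lemma Linfty_mx_le (A : R * R -> 'M[R]_2) : Linfty_mx Om A ->
  (forall i k, measurable_fun O (fun x : plane R => A x i k)) /\
  exists2 Lm : R, 0 < Lm & {ae lam, forall x : plane R, O x -> forall i k, `|A x i k| <= Lm}.
Proof.
move=> hA; have mO := open_measurable2 oO.
have h i k : measurable_fun O (fun x : plane R => A x i k) /\
    exists2 K : R, 0 <= K & {ae lam, forall x : plane R, O x -> `|A x i k| <= K}.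
  have := hA i k; rewrite lam_Lp inE => /andP[]; rewrite !inE /= => mu fu.
  split; first exact/(measurable_restrictT _ mO).
  (* The norm of exponent [+oo] is an essential supremum once the whole space has positive
     measure. *)
  have T0 : (0 < lam [set: plane R])%E.
    pose B : set (R * R) := ball (0 : R * R) 1.
    have mB : measurable (B : set (plane R)) by apply: open_measurable2; exact: ball_open.
    apply: (@lt_le_trans _ _ (lam B)); first by rewrite lam_ball// lte_fin exprn_gt0// mulr_gt0.
    by apply: le_measure; rewrite ?inE//; exact: mB.
  move: fu; rewrite /finite_norm unlock /= T0.
  set S := ess_sup_inf.ess_sup _ _ => Sf.
  have S0 : (0 <= S)%E by apply: ess_sup_inf.ess_sup_gee => //; apply: aeW => x; exact: abse_ge0.
  have fS : S \is a fin_num by rewrite ge0_fin_numE.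
  exists (fine S); first exact: fine_ge0.
  have := @ess_sup_inf.ess_sup_ge _ _ _ lam (abse \o (EFin \o ((fun x => A x i k) \_ Om))).
  by apply: filterS => x /=; rewrite -/S -(fineK fS) lee_fin patchE => + Ox; rewrite mem_set.
split; first by move=> i k; case: (h i k).
have [K K0 hK] : exists2 K : 'I_2 -> 'I_2 -> R, (forall i k, 0 <= K i k) &
    forall i k, {ae lam, forall x : plane R, O x -> `|A x i k| <= K i k}.
  have /choice[K hK] : forall ik : 'I_2 * 'I_2, exists K : R, 0 <= K /\
      {ae lam, forall x : plane R, O x -> `|A x ik.1 ik.2| <= K}.
    by move=> [i k]; have [_ [K K0 hK]] := h i k; exists K.
  by exists (fun i k => K (i, k)) => i k; have [] := hK (i, k).
pose j : 'I_2 := lift ord0 ord0.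
have two (i : 'I_2) : i = 0 \/ i = j by case: i => -[|[|//]] hi; [left|right]; apply: val_inj.
exists (K 0 0 + K 0 j + K j 0 + K j j + 1); first by rewrite ltr_wpDl// !addr_ge0.
have a1 : {ae lam, forall x : plane R, O x -> `|A x 0 0| <= K 0 0 /\ `|A x 0 j| <= K 0 j}.
  by apply: filterS2 (hK 0 0) (hK 0 j) => x a b Ox; split; [exact: a|exact: b].
have a2 : {ae lam, forall x : plane R, O x -> `|A x j 0| <= K j 0 /\ `|A x j j| <= K j j}.
  by apply: filterS2 (hK j 0) (hK j j) => x a b Ox; split; [exact: a|exact: b].
have k1 := K0 0 0; have k2 := K0 0 j; have k3 := K0 j 0; have k4 := K0 j j.
apply: filterS2 a1 a2 => x + + Ox i k => /(_ Ox)[b1 b2] /(_ Ox)[b3 b4].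
by have [->|->] := two i; have [->|->] := two k; lra.
Qed.

Lemma elliptic_forms (A : R * R -> 'M[R]_2) : uniformly_elliptic Om A ->
  exists2 c : R, 0 < c & {ae lam, forall x : plane R, O x -> forall a : 'I_2 -> R,
  c * \sum_i a i ^+ 2 <= \sum_i (\sum_k A x i k * a k) * a i}.
Proof.
move=> [c c0 hc]; exists c => //.
have hc' : {ae lam, forall x : plane R, O x -> forall xi : 'cV[R]_2, c * dot xi xi <= dot (A x *m xi) xi} by rewrite -lam_ae.
apply: filterS hc' => x h Ox a; have := h Ox (\col_i a i); rewrite /dot.
rewrite (_ : \sum_i _ = \sum_i a i ^+ 2); last by apply: eq_bigr => i _; rewrite !mxE expr2.
rewrite (_ : (\sum_(i < 2) (A x *m _) _ _ * _) = \sum_i (\sum_k A x i k * a k) * a i)//.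
apply: eq_bigr => i _; rewrite !mxE; congr (_ * _); apply: eq_bigr => k _; by rewrite mxE.
Qed.

Lemma regular_family_mesh h0 Th : cvx Om -> regular_family Om h0 Th ->
  exists2 sigma : R, 0 < sigma & forall h, 0 < h <= h0 ->
  exists n (p : 'I_n -> 'I_3 -> R * R) hh, [/\ is_mesh Om p (8 * sigma) hh,
    forall j, hh j <= h & forall T, Th h T <-> exists j, T = tri (p j)].
Proof.
move=> cO [hT [sigma s0 hs]]; exists sigma => // h hh; have [tr adm sh] := hT h hh.
apply: mesh_of_triangulation => //; first exact: hs.
have [/finite_seqP[l El] _ _] := tr.
move=> T TT; rewrite -[leRHS]sh; apply: ub_le_sup; last by exists T.
exists (\sum_(S <- l) `|diam S|) => _ [S SS <-].
apply: le_trans (ler_norm _) _.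
have Sl : S \in l by move: SS; rewrite El.
by rewrite (big_rem S Sl)/= lerDl sumr_ge0.
Qed.

End hypotheses.

Unset Implicit Arguments.

Theorem theorem1p1 (R : realType) (Om : set (R * R))
  (Om_polygonal : polygonal_domain Om) (Om_convex : convex_set Om)
  (h0 : R) (h0_gt0 : 0 < h0) (Th : R -> set (set (R * R)))
  (Th_regular : regular_family Om h0 Th)
  (A : R * R -> 'M[R]_2) (A_bounded : Linfty_mx Om A)
  (A_elliptic : uniformly_elliptic Om A) :
  exists eps C : R, [/\ 0 < eps, 0 < C &
    forall p : R, 2 < p < 2 + eps ->
    forall f : (R * R -> R) -> R, Wm1 Om p%:E f ->
    exists (u : R * R -> R) (uh : R -> R * R -> R),
      [/\ weak_solution Om A f u /\
          (forall w, weak_solution Om A f w ->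
             {ae leb2 R, forall x, Om x -> w x = u x}),
          forall h, 0 < h <= h0 ->
            galerkin_solution Om (Th h) A f (uh h) /\
            (forall w, galerkin_solution Om (Th h) A f w ->
               {in closure Om, w =1 uh h}),
          forall h, 0 < h <= h0 ->
            W1 Om p%:E (uh h) /\
            (W1_norm Om p%:E (uh h) <= C%:E * dual_norm Om p%:E f)%E &
          W1_norm Om p%:E (uh h \- u) @[h --> 0^'+] --> 0%E]].
Proof.
have [oO [z Oz] _ bO _] := Om_polygonal.
have cO := cvx_of_convex_set Om_convex.
have [L L0 OmL] := bounded_set_le bO.
have [r r0 hr] : exists2 r : R, 0 < r & forall y, `|y - z| < r -> Om y.
  have := open_ex oO Oz; move=> [r r0 hr]; exists r => // y; exact: hr.
have [mA [Lm Lm0 AL]] := Linfty_mx_le oO A_bounded.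
have [c c0 Ac] := elliptic_forms A_elliptic.
have [sigma s0 hmesh] := regular_family_mesh oO cO Th_regular.
pose s := 8 * sigma.
have fam H : 0 < H -> exists n (p : 'I_n -> 'I_3 -> R * R) h, is_mesh Om p s h /\ forall j, h j <= H.
  move=> H0; have hH : 0 < Num.min h0 H <= h0 by rewrite lt_min h0_gt0 H0 ge_min lexx.
  have [n [p [h [M hh _]]]] := hmesh _ hH; exists n, p, h; split => // j.
  by apply: le_trans (hh j) _; rewrite ge_min lexx orbT.
(* The added 1 keeps the divisor positive; every [d] below [min 1 (c / 2 / E)] satisfies the
   smallness condition of the stability estimate. *)
pose E := `|16 * Lm * truncC s * maxC s| + 1.
have E0 : 0 < E by rewrite ltr_wpDl.
pose S := stabC s c.
have CE0 := CE_gt0 L0.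
have S0 : 0 <= S by exact: normr_ge0.
have K0 : 0 <= CE L * (S * CE L) by rewrite !mulr_ge0// ltW.
exists (Num.min 1 (c / 2 / E)), (CE L * (S * CE L) + 1); split.
- by rewrite lt_min ltr01 !divr_gt0.
- by rewrite ltr_wpDl.
move=> p hp f.
have [d [pE d0 dm]] : exists d, [/\ p = 2 + d, 0 < d & d < Num.min 1 (c / 2 / E)].
  by exists (p - 2); case/andP: hp => ? ?; split; lra.
rewrite pE => {hp pE p} Wf; move: dm; rewrite lt_min => /andP[d1 dE].
have d01 : 0 < d <= 1 by rewrite d0 ltW.
have d_small : d * (16 * Lm * truncC s * maxC s) <= c / 2.
  apply: (@le_trans _ _ (d * E)).
    by rewrite ler_wpM2l ?(ltW d0)// (le_trans (ler_norm _))// lerDl.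
  by rewrite -ler_pdivlMr// ltW.
pose p := 2 + d; pose q := (2 + d) / (1 + d).
have e0 : 0 < 1 + d by lra.
have p1 : 1 <= p by rewrite /p; lra.
have p11 : 1 < p by rewrite /p; lra.
have p2 : 2 <= p by rewrite /p; lra.
have t1 : 1 <= 2 :> R by lra.
have q1 : 1 <= q by rewrite /q ler_pdivlMr//; lra.
have pq : p^-1 + q^-1 = 1 by rewrite /p /q; field; apply/andP; split; rewrite gt_eqF//; lra.
have D0 := dn_ge0 oO L0 OmL p11 q1 pq Wf.
have [u [G [su hu]]] := weak_solution_ex oO L0 OmL r0 hr fam mA Lm0 AL Ac c0 d01 d_small Wf.
(* [u] is found in W^{1,p}_0; the weak formulation and uniqueness live in W^{1,2}_0. *)
have su2 := sob0_embed oO L0 OmL t1 p2 su.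
(* One Galerkin solution per mesh size; 0 is a default outside []0, h0]]. *)
have /choice[uh huh] : forall h, exists v, 0 < h <= h0 -> exists n (P : 'I_n -> 'I_3 -> R * R) hh w,
    [/\ is_mesh Om P s hh, forall j, hh j <= h, forall T, Th h T <-> exists j, T = tri (P j),
    galer Om A f P w & v = interp P w].
  move=> h; have [hh|nh] := pselect (0 < h <= h0); last by exists (fun=> 0).
  have [n [P [hs [M hj hT]]]] := hmesh _ hh.
  have [w gw] := galer_ex oO L0 OmL r0 hr mA Lm0 AL Ac c0 d01 Wf M.
  by exists (interp P w) => _; exists n, P, hs, w.
exists u, uh; split.
- split.
    split; first exact: (sob0_W1_0 oO L0 OmL t1 su2).
    move=> phi tp; rewrite -(hu _ tp); apply: (int_wp_test oO mA _ tp).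
    by move=> i; case: (su2.1.2 i).
  by move=> w; exact: (weak_solution_uniq oO L0 OmL r0 hr fam mA Lm0 AL Ac c0 su2 hu).
- move=> h hh; have [n [P [hs [w [M hj hT gw ->]]]]] := huh h hh.
  have gP := galerkin_solutionP oO L0 OmL r0 hr mA M hT p11 q1 pq Wf.
  split.
    apply: (gP _).2; split; first exact: (V1_0_interp oO M hT gw.1).
    have wv : veq P (interp P w) w by move=> j i; exact: (interp_vertex M).
    split; first by move=> j i nO; rewrite wv; exact: gw.1.
    have eD : Dg P (interp P w) = Dg P w by exact: Dg_congr wv.
    by move=> phi phi0; rewrite eD; exact: gw.2.
  move=> v /gP[Vv gv] x; rewrite inE => cx.
  rewrite ((V1_0_nodal M hT Vv).2 _ cx); congr (_ x); apply: interp_congr.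
  exact: (galer_uniq L0 OmL mA Lm0 AL Ac c0 M gv gw).
- move=> h hh; have [n [P [hs [w [M hj hT gw ->]]]]] := huh h hh.
  have si := interp_sob0 M L0 OmL r0 hr gw.1 p1.
  split; first exact: (sob_W1 oO p1 si.1).
  rewrite (sob_normE oO p1 si.1) (dualE oO L0 OmL p11 q1 pq Wf).
  apply: le_trans (galer_sn oO L0 OmL r0 hr mA Lm0 AL Ac c0 d01 d_small Wf M gw) _.
  by rewrite -EFinM lee_fin ler_wpM2r// lerDl.
have cv (e : R) : 0 < e -> \forall h \near 0^'+, (W1_norm Om p%:E (uh h \- u)%R <= e%:E)%E.
  move=> ep; have [del del0 hdel] := galer_cvg oO L0 OmL r0 hr fam mA Lm0 AL Ac c0 d01 d_small Wf su hu ep.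
  near=> h.
  have h0' : 0 < h by near: h; exact: nbhs_right_gt.
  have hh : 0 < h <= h0 by rewrite h0'/=; near: h; exact: nbhs_right_le.
  have hd : h <= del by near: h; exact: nbhs_right_le.
  have [n [P [hs [w [M hj hT gw ->]]]]] := huh h hh.
  have si := interp_sob0 M L0 OmL r0 hr gw.1 p1.
  rewrite (sob_normE oO p1 (sobB oO p1 si.1 su.1)).
  exact: (hdel _ _ _ M (fun j => le_trans (hj j) hd) _ gw).
have W0 h : (0 <= W1_norm Om p%:E (uh h \- u)%R)%E.
  by rewrite /W1_norm adde_ge0 ?sume_ge0// => *; exact: Lnorm_ge0.
apply/fine_cvgP; split.
  near=> h; rewrite ge0_fin_numE//; apply: le_lt_trans (ltry 1); near: h; exact: cv.
apply/cvgr0Pnorm_le => e ep; near=> h.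
have he : (W1_norm Om p%:E (uh h \- u)%R <= e%:E)%E by near: h; exact: cv.
rewrite /= ger0_norm ?fine_ge0// -lee_fin fineK// ge0_fin_numE//.
exact: le_lt_trans he (ltry e).
Unshelve. all: by end_near.
Qed.
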